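(* Let $K$ be a field, let $\mathbf{u}=\{x_1,\ldots,x_p\}$ and $\mathbf{v}=\{y_1,\ldots,y_q\}$ be finite subsets of $\mathbb{A}^1=\mathbb{C}$ of cardinalities $p$ and $q$ such that $\mathbf{u}\ast\mathbf{v}$ is generic, and let $U_1=\mathbb{A}^1\setminus\mathbf{u}$, $U_2=\mathbb{A}^1\setminus\mathbf{v}$, $S=\mathbb{A}^1\setminus\mathbf{u}\ast\mathbf{v}$. Let $\mathcal{V}_1\in\mathcal{T}_K(U_1)$ with monodromy tuple $(A_1,\ldots,A_{p+1})\in\mathrm{GL}(V)^{p+1}$, $n=\dim_K V$, and let $\mathcal{V}_2\in\mathrm{LS}_K(U_2)$ be a rank-one local system with monodromy tuple $(\lambda_1,\ldots,\lambda_{q+1})\in\mathrm{GL}_1(K)^{q+1}$ such that $\lambda_i\neq 1$ for $i=1,\ldots,q$. Then the local system $\mathcal{V}_1\ast\mathcal{V}_2\in\mathrm{LS}_K(S)$ is irreducible if $$(p-2)n-\sum_{i=1}^p\dim_K(\ker(A_i-1))>0.$$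
   Context: Spaces carry the complex analytic topology. $\mathrm{LS}_K(X)$ is the category of local systems of finite-dimensional $K$-vector spaces on $X$. For $\mathbb{A}^1\setminus\{w_1,\ldots,w_r\}$ choose generators $\alpha_1,\ldots,\alpha_{r+1}$ of the fundamental group which are homotopy classes of simple (counterclockwise) loops around $w_1,\ldots,w_r,\infty$ with $\alpha_1\cdots\alpha_{r+1}=1$; the monodromy tuple of a local system with monodromy representation $\rho$ is $(\rho(\alpha_1),\ldots,\rho(\alpha_{r+1}))$. $\mathcal{T}_K(U_1)$ is the category of local systems in $\mathrm{LS}_K(U_1)$ which are irreducible and for which at least two of $A_1,\ldots,A_p$ are not the identity. $\mathbf{u}\ast\mathbf{v}=\{x_i+y_j\}$ is generic if it has exactly $pq$ elements. Put $U=\{(x,y)\in\mathbb{A}^2: x\notin\mathbf{u},\ y-x\notin\mathbf{v},\ y\notin\mathbf{u}\ast\mathbf{v}\}$, $\mathrm{pr}_1:U\to U_1,(x,y)\mapsto x$; $\mathrm{d}:U\to U_2,(x,y)\mapsto y-x$; $j:U\to\mathbb{P}^1\times S$ the inclusion; $\overline{\mathrm{pr}}_2:\mathbb{P}^1\times S\to S$ the projection. The middle convolution is $\mathcal{V}_1\ast\mathcal{V}_2:=R^1(\overline{\mathrm{pr}}_2)_*\big(j_*(\mathrm{pr}_1^*\mathcal{V}_1\otimes\mathrm{d}^*\mathcal{V}_2)\big)$, a local system on $S$. *)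

(* Defs.v *)
From HB Require Import structures.
From mathcomp Require Import all_boot all_order all_algebra.
From mathcomp Require Import complex.
From mathcomp Require Import all_classical all_reals all_analysis.
Import Order.TTheory GRing.Theory Num.Theory.
Import numFieldNormedType.Exports.

Set Implicit Arguments.
Unset Strict Implicit.
Unset Printing Implicit Defensive.

Local Open Scope classical_set_scope.
Local Open Scope ring_scope.
Local Open Scope quotient_scope.

#[local] Obligation Tactic := idtac.

Record prelmod (K : fieldType) := PreLmod {
  pcar :> choiceType;
  peq : pcar -> pcar -> Prop;
  pzero : pcar;
  padd : pcar -> pcar -> pcar;
  pscale : K -> pcar -> pcar;
  peq_refl : forall x, peq x x;
  peq_sym : forall x y, peq x y -> peq y x;
  peq_trans : forall x y z, peq x y -> peq y z -> peq x z;
  padd_eq : forall x x' y y',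
    peq x x' -> peq y y' -> peq (padd x y) (padd x' y');
  pscale_eq : forall a x x', peq x x' -> peq (pscale a x) (pscale a x');
  paddA : forall x y z, peq (padd x (padd y z)) (padd (padd x y) z);
  paddC : forall x y, peq (padd x y) (padd y x);
  padd0 : forall x, peq (padd pzero x) x;
  paddN : forall x, peq (padd (pscale (- 1) x) x) pzero;
  pscaleA : forall a b x, peq (pscale a (pscale b x)) (pscale (a * b) x);
  pscale1 : forall x, peq (pscale 1 x) x;
  pscaleDr : forall a x y,
    peq (pscale a (padd x y)) (padd (pscale a x) (pscale a y));
  pscaleDl : forall x a b,
    peq (pscale (a + b) x) (padd (pscale a x) (pscale b x))
}.

Section Quotient.
Variables (K : fieldType) (P : prelmod K).

Definition eqb (x y : P) : bool := `[< peq x y >].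

Let eqb_equiv : equiv_class_of eqb.
Proof.
split=> [x|x y|y x z]; rewrite /eqb.
- exact/asboolP/peq_refl.
- by apply/asboolP/asboolP => /peq_sym.
- by move=> /asboolP xy /asboolP yz; apply/asboolP/(peq_trans xy).
Qed.

Canonical peq_equiv := EquivRelPack eqb_equiv.

Definition lquot : Type := {eq_quot peq_equiv}.

HB.instance Definition _ := Choice.on lquot.

Definition lcls (x : P) : lquot := \pi_{eq_quot peq_equiv} x.

Lemma lclsP (x y : P) : lcls x = lcls y <-> peq x y.
Proof.
split=> [/eqmodP/asboolP//|xy]; apply/eqmodP; exact/asboolP.
Qed.

Definition lrepr (q : lquot) : P := repr (q : {eq_quot peq_equiv}).

Lemma lreprK (q : lquot) : lcls (lrepr q) = q.
Proof. exact: reprK. Qed.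

Lemma lcls_surj (q : lquot) : exists x, q = lcls x.
Proof. by exists (lrepr q); rewrite lreprK. Qed.

Lemma lrepr_cls (x : P) : peq (lrepr (lcls x)) x.
Proof. by apply/lclsP; rewrite lreprK. Qed.

Definition ladd (q r : lquot) : lquot := lcls (padd (lrepr q) (lrepr r)).
Definition lscale (a : K) (q : lquot) : lquot := lcls (pscale a (lrepr q)).

Let laddE x y : ladd (lcls x) (lcls y) = lcls (padd x y).
Proof. by apply/lclsP/padd_eq; exact: lrepr_cls. Qed.

Let lscaleE a x : lscale a (lcls x) = lcls (pscale a x).
Proof. by apply/lclsP/pscale_eq; exact: lrepr_cls. Qed.

Let laddA : associative ladd.
Proof.
move=> q r s; have [x ->] := lcls_surj q; have [y ->] := lcls_surj r.
by have [z ->] := lcls_surj s; rewrite !laddE; apply/lclsP/paddA.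
Qed.

Let laddC : commutative ladd.
Proof.
move=> q r; have [x ->] := lcls_surj q; have [y ->] := lcls_surj r.
by rewrite !laddE; apply/lclsP/paddC.
Qed.

Let ladd0 : left_id (lcls (pzero P)) ladd.
Proof.
by move=> q; have [x ->] := lcls_surj q; rewrite laddE; apply/lclsP/padd0.
Qed.

Let laddN : left_inverse (lcls (pzero P)) (lscale (- 1)) ladd.
Proof.
move=> q; have [x ->] := lcls_surj q; rewrite lscaleE laddE.
exact/lclsP/paddN.
Qed.

HB.instance Definition _ := GRing.isZmodule.Build lquot laddA laddC ladd0 laddN.

Let lscaleA a b q : lscale a (lscale b q) = lscale (a * b) q.
Proof.
by have [x ->] := lcls_surj q; rewrite !lscaleE; apply/lclsP/pscaleA.
Qed.

Let lscale1 : left_id 1 lscale.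
Proof.
by move=> q; have [x ->] := lcls_surj q; rewrite lscaleE; apply/lclsP/pscale1.
Qed.

Let lscaleDr : right_distributive lscale +%R.
Proof.
move=> a q r; have [x ->] := lcls_surj q; have [y ->] := lcls_surj r.
rewrite [X in lscale a X]laddE !lscaleE [RHS]laddE.
exact/lclsP/pscaleDr.
Qed.

Let lscaleDl q : {morph lscale^~ q : a b / a + b}.
Proof.
move=> a b; have [x ->] := lcls_surj q.
by rewrite !lscaleE [RHS]laddE; apply/lclsP/pscaleDl.
Qed.

HB.instance Definition _ := GRing.Zmodule_isLmodule.Build K lquot
  lscaleA lscale1 lscaleDr lscaleDl.

Lemma lclsD x y : lcls x + lcls y = lcls (padd x y).
Proof. exact: laddE. Qed.

Lemma lclsZ a x : a *: lcls x = lcls (pscale a x).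
Proof. exact: lscaleE. Qed.

Lemma lcls0 : lcls (pzero P) = 0.
Proof. by []. Qed.

End Quotient.

Definition submod (K : fieldType) (M : lmodType K) (G : set M) : Prop :=
  G 0 /\ forall (a : K) u v, G u -> G v -> G (a *: u + v).

Section Subquotient.
Variables (K : fieldType) (M : lmodType K) (G T : set M).
Hypotheses (sG : submod G) (sT : submod T).

Let T0 : T 0. Proof. by case: sT. Qed.
Let TD u v : T u -> T v -> T (u + v).
Proof. by move=> Tu Tv; rewrite -[u]scale1r; apply: sT.2. Qed.
Let TZ a u : T u -> T (a *: u).
Proof. by move=> Tu; rewrite -[_ *: _]addr0; apply: sT.2. Qed.
Let TN u : T u -> T (- u).
Proof. by move=> Tu; rewrite -scaleN1r; apply: TZ. Qed.

Let G0 : 0 \in G. Proof. by rewrite inE; case: sG. Qed.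
Let GD u v : u \in G -> v \in G -> u + v \in G.
Proof. by rewrite !inE => Gu Gv; rewrite -[u]scale1r; apply: sG.2. Qed.
Let GZ a u : u \in G -> a *: u \in G.
Proof.
by rewrite !inE => Gu; rewrite -[_ *: _]addr0; apply: sG.2 => //; case: sG.
Qed.

Program Definition subquot_pre : prelmod K := @PreLmod K (set_type G)
  (fun x y => T (val x - val y))
  (exist _ 0 G0)
  (fun x y => exist _ (val x + val y) (GD (valP x) (valP y)))
  (fun a x => exist _ (a *: val x) (GZ a (valP x)))
  _ _ _ _ _ _ _ _ _ _ _ _ _.
Next Obligation. by move=> x /=; rewrite subrr. Qed.
Next Obligation. by move=> x y /= /TN; rewrite opprB. Qed.
Next Obligation. by move=> x y z /= /TD/[apply]; rewrite addrA subrK. Qed.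
Next Obligation. by move=> x x' y y' /= /TD/[apply]; rewrite opprD addrACA. Qed.
Next Obligation. by move=> a x x' /= /(TZ a); rewrite scalerBr. Qed.
Next Obligation. by move=> x y z /=; rewrite addrA subrr. Qed.
Next Obligation. by move=> x y /=; rewrite [X in _ - X]addrC subrr. Qed.
Next Obligation. by move=> x /=; rewrite add0r subrr. Qed.
Next Obligation. by move=> x /=; rewrite scaleN1r addNr subrr. Qed.
Next Obligation. by move=> a b x /=; rewrite scalerA subrr. Qed.
Next Obligation. by move=> x /=; rewrite scale1r subrr. Qed.
Next Obligation. by move=> a x y /=; rewrite scalerDr subrr. Qed.
Next Obligation. by move=> x a b /=; rewrite scalerDl subrr. Qed.

(* G / (G `&` T) *)
Definition subquot : lmodType K := lquot subquot_pre.

Definition is_class (m : M) (q : subquot) : Prop :=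
  exists g : subquot_pre, val (g : set_type G) = m /\ q = lcls g.

Lemma is_class_ex m : G m -> exists q, is_class m q.
Proof.
move=> /mem_set Gm; pose g : subquot_pre := exist _ m Gm.
by exists (lcls g), g.
Qed.

Lemma is_class_surj q : exists2 m, G m & is_class m q.
Proof.
have [g ->] := lcls_surj q; exists (val (g : set_type G)); last by exists g.
by have := valP (g : set_type G); rewrite inE.
Qed.

Lemma is_class_eq m m' q q' :
  is_class m q -> is_class m' q' -> (q = q' <-> T (m - m')).
Proof. by move=> [g [<- ->]] [g' [<- ->]]; rewrite lclsP. Qed.

Lemma is_classD a m m' q q' :
  is_class m q -> is_class m' q' -> is_class (a *: m + m') (a *: q + q').
Proof.
move=> [g [<- ->]] [g' [<- ->]]; exists (padd (pscale a g) g'); split=> //.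
by rewrite lclsZ lclsD.
Qed.

End Subquotient.

Section Tensor.
Variables (K : fieldType) (M N : lmodType K).

(* [:: (m1, n1); ...] stands for the formal sum of the mi (x) ni. *)
Inductive teq : seq (M * N) -> seq (M * N) -> Prop :=
| teq_refl l : teq l l
| teq_sym l l' : teq l l' -> teq l' l
| teq_trans l l' l'' : teq l l' -> teq l' l'' -> teq l l''
| teq_cat l1 l1' l2 l2' :
    teq l1 l1' -> teq l2 l2' -> teq (l1 ++ l2) (l1' ++ l2')
| teq_comm l l' : teq (l ++ l') (l' ++ l)
| teq_0l n : teq [:: (0, n)] [::]
| teq_addl m m' n : teq [:: (m + m', n)] [:: (m, n); (m', n)]
| teq_addr m n n' : teq [:: (m, n + n')] [:: (m, n); (m, n')]
| teq_scale a m n : teq [:: (a *: m, n)] [:: (m, a *: n)].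

Definition tscale (a : K) (l : seq (M * N)) := [seq (a *: p.1, p.2) | p <- l].

Let tscale_eq a l l' : teq l l' -> teq (tscale a l) (tscale a l').
Proof.
elim=> {l l'}
  [l|l l' _|l l' l'' _ IH _|l1 l1' l2 l2' _ IH1 _ IH2|l l'
  |n|m m' n|m n n'|b m n].
- exact: teq_refl.
- exact: teq_sym.
- exact: teq_trans.
- by rewrite /tscale !map_cat; apply: teq_cat.
- by rewrite /tscale !map_cat; apply: teq_comm.
- by rewrite /= scaler0; apply: teq_0l.
- by rewrite /= scalerDr; apply: teq_addl.
- exact: teq_addr.
- by rewrite /= scalerA mulrC -scalerA; apply: teq_scale.
Qed.

Let tscale_pt (f : M * N -> seq (M * N)) (g : M * N -> M * N) l :
  (forall p, teq [:: g p] (f p)) -> teq (map g l) (flatten (map f l)).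
Proof.
move=> fg; elim: l => [|p l IH]; first exact: teq_refl.
by rewrite /= -cat1s; apply: teq_cat.
Qed.

Let teq_split (f g : M * N -> M * N) l :
  teq (flatten [seq [:: f p; g p] | p <- l]) (map f l ++ map g l).
Proof.
elim: l => [|p l IH]; first exact: teq_refl.
rewrite /= -[f p :: (g p :: _)]/([:: f p] ++ ([:: g p] ++ _)).
rewrite -[f p :: _ ++ _]/([:: f p] ++ _).
apply: teq_cat; first exact: teq_refl.
apply: teq_trans (teq_cat (teq_refl _) IH) _.
rewrite catA -[g p :: map g l]cat1s catA.
by apply: teq_cat; [exact: teq_comm|exact: teq_refl].
Qed.

Let tscaleDl l a b : teq (tscale (a + b) l) (tscale a l ++ tscale b l).
Proof.
apply: teq_trans (teq_split _ _ _); apply: tscale_pt => p.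
by rewrite scalerDl; apply: teq_addl.
Qed.

Let tscale0 l : teq (tscale 0 l) [::].
Proof.
elim: l => [|p l IH] /=; first exact: teq_refl.
rewrite -cat1s -[X in teq _ X]/([::] ++ [::]); apply: teq_cat => //.
by rewrite scale0r; apply: teq_0l.
Qed.

Let tscale1 l : tscale 1 l = l.
Proof. by rewrite -[RHS]map_id; apply: eq_map => -[m n] /=; rewrite scale1r. Qed.

Program Definition tensor_pre : prelmod K := @PreLmod K (seq (M * N)) teq
  [::] cat tscale teq_refl teq_sym teq_trans teq_cat tscale_eq
  _ teq_comm _ _ _ _ _ tscaleDl.
Next Obligation. by move=> x y z; rewrite catA; apply: teq_refl. Qed.
Next Obligation. by move=> x; apply: teq_refl. Qed.
Next Obligation.
move=> l; rewrite -[X in _ ++ X]tscale1; apply: teq_trans (teq_sym (tscaleDl _ _ _)) _.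
by rewrite addNr; apply: tscale0.
Qed.
Next Obligation.
move=> a b l; rewrite /tscale -map_comp.
have -> : map ((fun p : M * N => (a *: p.1, p.2)) \o (fun p => (b *: p.1, p.2))) l
    = [seq ((a * b) *: p.1, p.2) | p <- l].
  by apply: eq_map => p /=; rewrite scalerA.
exact: teq_refl.
Qed.
Next Obligation. by move=> l; rewrite tscale1; apply: teq_refl. Qed.
Next Obligation. by move=> a l l'; rewrite /tscale map_cat; apply: teq_refl. Qed.

Definition tensor : lmodType K := lquot tensor_pre.

Definition tsum (l : seq (M * N)) : tensor := lcls (l : tensor_pre).

End Tensor.

(* A sheaf is given by its etale space: its stalks, together with the
   predicate [sect s x], meaning that the possibly discontinuous family [s]
   restricts to a section of the sheaf on some neighbourhood of [x]. The
   sections over an open [V] are the restrictions to [V] of the families [s]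
   such that [sect s x] for all [x] in [V]. *)
Record sheaf (K : fieldType) (X : topologicalType) := Sheaf {
  stalk :> X -> lmodType K;
  sect : (forall x, stalk x) -> X -> Prop;
  sect_local : forall s t x,
    sect s x -> (\forall y \near x, s y = t y) -> sect t x;
  sect_open : forall s x, sect s x -> \forall y \near x, sect s y;
  sect_ex : forall x (e : stalk x), exists2 s, sect s x & s x = e;
  sect_inj : forall s t x,
    sect s x -> sect t x -> s x = t x -> \forall y \near x, s y = t y;
  sect_lin : forall (a : K) s t x,
    sect s x -> sect t x -> sect (fun y => a *: s y + t y) x
}.

Lemma sect_zero (K : fieldType) (X : topologicalType) (F : sheaf K X) x :
  sect (fun y => 0 : F y) x.
Proof.
have [s ss _] := sect_ex (0 : F x).
apply: sect_local (sect_lin (-1) ss ss) _.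
by apply: nearW => y; rewrite scaleN1r addNr.
Qed.

Record sheaf_hom (K : fieldType) (X : topologicalType) (F G : sheaf K X) :=
  SheafHom {
  hom_stalk :> forall x, {linear F x -> G x};
  hom_sect : forall s x, sect s x -> sect (fun y => hom_stalk y (s y)) x
}.

Definition sheaf_mono K X (F G : sheaf K X) (f : sheaf_hom F G) : Prop :=
  forall x, injective (f x).

Definition sheaf_epi K X (F G : sheaf K X) (f : sheaf_hom F G) : Prop :=
  forall x (e : G x), exists e', f x e' = e.

Definition sheaf_iso K X (F G : sheaf K X) (f : sheaf_hom F G) : Prop :=
  sheaf_mono f /\ sheaf_epi f.

Section Constant.
Variables (K : fieldType) (X : topologicalType) (M : lmodType K).

Program Definition constant_sheaf : sheaf K X := @Sheaf K X (fun=> M)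
  (fun s x => \forall y \near x, s y = s x) _ _ _ _ _.
Next Obligation.
move=> s t x sx st; have <- := nbhs_singleton st.
by near=> y; rewrite -(near st y)//; near: y.
Unshelve. all: by end_near. Qed.
Next Obligation.
move=> s x /near_join sx; near=> y.
have syx : s y = s x by apply: (nbhs_singleton (near sx y _)).
by rewrite syx; near: y.
Unshelve. all: by end_near. Qed.
Next Obligation. by move=> x e; exists (fun=> e) => //; apply: nearW. Qed.
Next Obligation.
move=> s t x sx tx st; near=> y.
by rewrite (near sx y)// (near tx y).
Unshelve. all: by end_near. Qed.
Next Obligation.
move=> a s t x sx tx; near=> y.
by rewrite (near sx y)// (near tx y).
Unshelve. all: by end_near. Qed.

End Constant.

Section Pullback.
Variables (K : fieldType) (X Y : topologicalType) (f : X -> Y).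
Hypothesis cf : continuous f.
Variable F : sheaf K Y.

(* The inverse image sheaf: its sections are locally of the form t \o f. *)
Program Definition pullback : sheaf K X := @Sheaf K X (fun x => F (f x))
  (fun s x => exists2 t : forall y, F y,
     sect t (f x) & \forall z \near x, s z = t (f z)) _ _ _ _ _.
Next Obligation.
move=> s s' x [t ts st] ss'; exists t => //; near=> z.
by rewrite -(near ss' z)// (near st z).
Unshelve. all: by end_near. Qed.
Next Obligation.
move=> s x [t ts /near_join st]; near=> z.
exists t; last by near: z.
by near: z; apply: cf (sect_open ts).
Unshelve. all: by end_near. Qed.
Next Obligation.
move=> x e; have [t ts <-] := sect_ex e.
by exists (fun z => t (f z)) => //; exists t => //; apply: nearW.
Qed.
Next Obligation.
move=> s s' x [t ts st] [t' ts' st'] ss'.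
have /= : \forall y \near f x, t y = t' y.
  apply: sect_inj => //.
  by rewrite -(nbhs_singleton st) -(nbhs_singleton st').
move=> /cf tt'; near=> z.
by rewrite (near st z)// (near st' z)//; near: z.
Unshelve. all: by end_near. Qed.
Next Obligation.
move=> a s s' x [t ts st] [t' ts' st'].
exists (fun y => a *: t y + t' y); first exact: sect_lin.
by near=> z; rewrite (near st z)// (near st' z).
Unshelve. all: by end_near. Qed.

End Pullback.

Section TensorSheaf.
Variables (K : fieldType) (X : topologicalType) (F G : sheaf K X).

Definition sections : Type := seq ((forall x, F x) * (forall x, G x)).

Definition sects (l : sections) x : Prop :=
  foldr (fun p Q => sect p.1 x /\ sect p.2 x /\ Q) True l.

Definition ev (l : sections) x : seq (F x * G x) :=
  [seq (p.1 x, p.2 x) | p <- l].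

Let sects_cat l l' x : sects (l ++ l') x <-> sects l x /\ sects l' x.
Proof.
elim: l => [|p l IH] /=; first by split=> [|[]].
by split=> [[? [? /IH[]]]|[[? [? ?]] ?]]; do ?split => //; apply/IH.
Qed.

Let sects_open l x : sects l x -> \forall y \near x, sects l y.
Proof.
elim: l => [|p l IH] /=; first by move=> _; apply: nearW.
move=> [p1 [p2 /IH pl]]; near=> y; split; last split.
- by near: y; apply: sect_open.
- by near: y; apply: sect_open.
- by near: y.
Unshelve. all: by end_near. Qed.

Let sects_ex x (l : seq (F x * G x)) : exists2 L, sects L x & ev L x = l.
Proof.
elim: l => [|[m n] l [L sL eL]]; first by exists [::].
have [s ss sm] := sect_ex m; have [t st tn] := sect_ex n.
by exists ((s, t) :: L) => //=; rewrite sm tn -eL.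
Qed.

Let ev_inj L L' x : sects L x -> sects L' x -> ev L x = ev L' x ->
  \forall y \near x, ev L y = ev L' y.
Proof.
elim: L L' => [|p L IH] [|p' L'] //=; first by move=> *; apply: nearW.
move=> [p1 [p2 pL]] [p1' [p2' pL']] [e1 e2 eL].
have h1 := sect_inj p1 p1' e1; have h2 := sect_inj p2 p2' e2.
have hL := IH _ pL pL' eL.
by near=> y; rewrite (near h1 y)// (near h2 y)// (near hL y).
Unshelve. all: by end_near. Qed.

Let ev_cat L L' x : ev (L ++ L') x = ev L x ++ ev L' x.
Proof. exact: map_cat. Qed.

Let teq_lift0 x (l l' : seq (F x * G x)) : teq l l' -> 
  exists L L', [/\ sects L x, sects L' x, ev L x = l, ev L' x = l' &
    \forall y \near x, teq (ev L y) (ev L' y)].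
Proof.
elim=> {l l'}.
- move=> l; have [L sL eL] := sects_ex l; exists L, L; split=> //.
  by apply: nearW => y; apply: teq_refl.
- move=> l l' _ [L [L' [sL sL' eL eL' LL']]]; exists L', L; split=> //.
  by near=> y; apply: teq_sym; near: y.
- move=> l l' l'' _ [L [L' [sL sL' eL eL' LL']]] _ [M [M' [sM sM' eM eM' MM']]].
  exists L, M'; split=> //.
  have h : \forall y \near x, ev L' y = ev M y by apply: ev_inj; rewrite ?eL'.
  near=> y; apply: (@teq_trans _ _ _ _ (ev L' y)); first by near: y.
  by rewrite (near h y)//; near: y.
- move=> l1 l1' l2 l2' _ [L [L' [sL sL' eL eL' LL']]] _ [M [M' [sM sM' eM eM' MM']]].
  exists (L ++ M), (L' ++ M'); split; rewrite ?ev_cat ?eL ?eL' ?eM ?eM' //.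
  + exact/sects_cat.
  + exact/sects_cat.
  + by near=> y; rewrite !ev_cat; apply: teq_cat; near: y.
- move=> l l'; have [L sL eL] := sects_ex l; have [L' sL' eL'] := sects_ex l'.
  exists (L ++ L'), (L' ++ L); split; rewrite ?ev_cat ?eL ?eL' //.
  + exact/sects_cat.
  + exact/sects_cat.
  + by apply: nearW => y; rewrite !ev_cat; apply: teq_comm.
- move=> n; have [t st tn] := sect_ex n.
  exists [:: (fun=> 0, t)], [::]; split=> //=; first by do !split=> //; exact: sect_zero.
  + by rewrite tn.
  + by apply: nearW => y; apply: teq_0l.
- move=> m m' n; have [t st tn] := sect_ex n.
  have [s ss sm] := sect_ex m; have [s' ss' sm'] := sect_ex m'.
  exists [:: (fun y => s y + s' y, t)], [:: (s, t); (s', t)]; split=> //=.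
  + do !split=> //; apply: sect_local (sect_lin 1 ss ss') _.
    by apply: nearW => y; rewrite scale1r.
  + by rewrite sm sm' tn.
  + by rewrite sm sm' tn.
  + by apply: nearW => y; apply: teq_addl.
- move=> m n n'; have [s ss sm] := sect_ex m.
  have [t st tn] := sect_ex n; have [t' st' tn'] := sect_ex n'.
  exists [:: (s, fun y => t y + t' y)], [:: (s, t); (s, t')]; split=> //=.
  + do !split=> //; apply: sect_local (sect_lin 1 st st') _.
    by apply: nearW => y; rewrite scale1r.
  + by rewrite sm tn tn'.
  + by rewrite sm tn tn'.
  + by apply: nearW => y; apply: teq_addr.
- move=> a m n; have [s ss sm] := sect_ex m; have [t st tn] := sect_ex n.
  exists [:: (fun y => a *: s y, t)], [:: (s, fun y => a *: t y)]; split=> //=.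
  + do !split=> //; apply: sect_local (sect_lin a ss (sect_zero _ x)) _.
    by apply: nearW => y; rewrite addr0.
  + do !split=> //; apply: sect_local (sect_lin a st (sect_zero _ x)) _.
    by apply: nearW => y; rewrite addr0.
  + by rewrite sm tn.
  + by rewrite sm tn.
  + by apply: nearW => y; apply: teq_scale.
Unshelve. all: by end_near. Qed.

Let teq_lift L L' x : sects L x -> sects L' x -> teq (ev L x) (ev L' x) ->
  \forall y \near x, teq (ev L y) (ev L' y).
Proof.
move=> sL sL' /teq_lift0[M [M' [sM sM' eM eM' MM']]].
have h := ev_inj sM sL eM; have h' := ev_inj sM' sL' eM'.
by near=> y; rewrite -(near h y)// -(near h' y)//; near: y.
Unshelve. all: by end_near. Qed.

(* Sections are locally finite sums of s (x) t, for sections s of F, t of G. *)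
Program Definition tensor_sheaf : sheaf K X := @Sheaf K X
  (fun x => tensor (F x) (G x))
  (fun s x => exists l : sections,
     sects l x /\ \forall y \near x, s y = tsum (ev l y)) _ _ _ _ _.
Next Obligation.
move=> s s' x [l [sl h]] ss'; exists l; split=> //.
by near=> y; rewrite -(near ss' y)// (near h y).
Unshelve. all: by end_near. Qed.
Next Obligation.
move=> s x [l [sl /near_join h]]; near=> y; exists l; split; last by near: y.
by near: y; apply: sects_open.
Unshelve. all: by end_near. Qed.
Next Obligation.
move=> x e; have [l ->] := lcls_surj e; have [L sL eL] := sects_ex (l : seq (F x * G x)).
exists (fun y => tsum (ev L y)); last by rewrite eL.
by exists L; split=> //; apply: nearW.
Qed.
Next Obligation.
move=> s s' x [l [sl h]] [l' [sl' h']] ss'.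
have /lclsP e : tsum (ev l x) = tsum (ev l' x).
  by rewrite -(nbhs_singleton h) -(nbhs_singleton h').
have ee := teq_lift sl sl' e.
near=> y; rewrite (near h y)// (near h' y)//; apply/lclsP.
by near: y.
Unshelve. all: by end_near. Qed.
Next Obligation.
move=> a s s' x [l [sl h]] [l' [sl' h']].
exists ([seq (fun y => a *: p.1 y, p.2) | p <- l] ++ l'); split.
  apply/sects_cat; split=> //; elim: l sl {h} => //= p l IH [p1 [p2 pl]].
  do !split=> //; last exact: IH.
  apply: sect_local (sect_lin a p1 (sect_zero _ x)) _.
  by apply: nearW => y; rewrite addr0.
near=> y; rewrite (near h y)// (near h' y)// lclsZ lclsD /ev map_cat /=.
by rewrite -map_comp /tscale -map_comp.
Unshelve. all: by end_near. Qed.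

End TensorSheaf.

Definition dprod (K : fieldType) (X : Type) (F : X -> lmodType K) : Type :=
  forall x, F x.

Section Dprod.
Variables (K : fieldType) (X : Type) (F : X -> lmodType K).

HB.instance Definition _ := gen_eqMixin (dprod F).
HB.instance Definition _ := gen_choiceMixin (dprod F).

Definition dadd (s t : dprod F) : dprod F := fun x => s x + t x.
Definition dopp (s : dprod F) : dprod F := fun x => - s x.
Definition dzero : dprod F := fun x => 0.
Definition dscale (a : K) (s : dprod F) : dprod F := fun x => a *: s x.

Let daddA : associative dadd.
Proof. by move=> s t u; apply: functional_extensionality_dep => x; apply: addrA. Qed.
Let daddC : commutative dadd.
Proof. by move=> s t; apply: functional_extensionality_dep => x; apply: addrC. Qed.
Let dadd0 : left_id dzero dadd.
Proof. by move=> s; apply: functional_extensionality_dep => x; apply: add0r. Qed.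
Let daddN : left_inverse dzero dopp dadd.
Proof. by move=> s; apply: functional_extensionality_dep => x; apply: addNr. Qed.

HB.instance Definition _ := GRing.isZmodule.Build (dprod F) daddA daddC dadd0 daddN.

Let dscaleA a b s : dscale a (dscale b s) = dscale (a * b) s.
Proof. by apply: functional_extensionality_dep => x; apply: scalerA. Qed.
Let dscale1 : left_id 1 dscale.
Proof. by move=> s; apply: functional_extensionality_dep => x; apply: scale1r. Qed.
Let dscaleDr : right_distributive dscale +%R.
Proof. by move=> a s t; apply: functional_extensionality_dep => x; apply: scalerDr. Qed.
Let dscaleDl s : {morph dscale^~ s : a b / a + b}.
Proof. by move=> a b; apply: functional_extensionality_dep => x; apply: scalerDl. Qed.

HB.instance Definition _ := GRing.Zmodule_isLmodule.Build K (dprod F)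
  dscaleA dscale1 dscaleDr dscaleDl.

End Dprod.

(* The presheaf V |-> num V / (num V `&` den V), all of whose values are
   subquotients of one vector space amb, with restrictions induced by the
   identity of amb. *)
Record presheaf (K : fieldType) (Y : topologicalType) := Presheaf {
  amb : lmodType K;
  num : set Y -> set amb;
  den : set Y -> set amb;
  num_submod : forall V, submod (num V);
  den_submod : forall V, submod (den V);
  num_res : forall V W, W `<=` V -> num V `<=` num W;
  den_res : forall V W, W `<=` V -> den V `<=` den W
}.

Section Sheafify.
Variables (K : fieldType) (Y : topologicalType) (P : presheaf K Y).

Definition germs (D : set Y -> set (amb P)) (y : Y) : set (amb P) :=
  [set m | exists V, [/\ open V, V y & D V m]].

Let germs_submod D y : (forall V, submod (D V)) ->
  (forall V W, W `<=` V -> D V `<=` D W) -> submod (germs D y).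
Proof.
move=> sD rD; split; first by exists setT; split=> //; [exact: openT|apply: (sD _).1].
move=> a u v [V [oV Vy Du]] [W [oW Wy Dv]]; exists (V `&` W); split=> //.
  exact: openI.
by apply: (sD _).2; [apply: rD Du|apply: rD Dv] => z [].
Qed.

Lemma germs_num y : submod (germs (@num _ _ P) y).
Proof. exact: germs_submod (@num_submod _ _ P) (@num_res _ _ P). Qed.

Lemma germs_den y : submod (germs (@den _ _ P) y).
Proof. exact: germs_submod (@den_submod _ _ P) (@den_res _ _ P). Qed.

(* As filtered colimits are exact, colim_V (num V / den V) is the quotient
   of the union of the num V by the union of the den V. *)
Definition pstalk (y : Y) : lmodType K := subquot (germs_num y) (germs_den y).

Definition pgerm (y : Y) (m : amb P) (e : pstalk y) : Prop := is_class m e.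

Let ext (m : amb P) : exists s : forall y, pstalk y,
  forall y, germs (@num _ _ P) y m -> pgerm m (s y).
Proof.
suff h y : exists e : pstalk y, germs (@num _ _ P) y m -> pgerm m e.
  by exists (fun y => projT1 (cid (h y))) => y; apply: (projT2 (cid (h y))).
have [nm|n] := pselect (germs (@num _ _ P) y m); last by exists 0.
have [e he] := is_class_ex (germs_num y) (germs_den y) nm.
by exists e.
Qed.

Program Definition sheafify : sheaf K Y := @Sheaf K Y pstalk
  (fun s y => exists V m, [/\ open V, V y, num V m &
     forall z, V z -> pgerm m (s z)]) _ _ _ _ _.
Next Obligation.
move=> s t y [V [m [oV Vy nm h]]]; rewrite /prop_near1 nbhsE => -[W [oW Wy st]].
exists (V `&` W), m; split=> //; first exact: openI.
  by apply: num_res nm => z [].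
by move=> z [Vz Wz]; rewrite -st//; apply: h.
Qed.
Next Obligation.
move=> s y [V [m [oV Vy nm h]]]; rewrite /prop_near1 nbhsE; exists V => //.
by move=> z Vz; exists V, m.
Qed.
Next Obligation.
move=> y e; have [m [V [oV Vy nm]] hm] := is_class_surj e.
have [s hs] := ext m; exists s.
  by exists V, m; split=> // z Vz; apply: hs; exists V.
apply/(is_class_eq (hs y _) hm); first by exists V.
by rewrite subrr; apply: (germs_den y).1.
Qed.
Next Obligation.
move=> s t y [V [m [oV Vy nm h]]] [W [m' [oW Wy nm' h']]].
move=> /(is_class_eq (h _ Vy) (h' _ Wy))[Z [oZ Zy dZ]].
rewrite /prop_near1 nbhsE; exists (V `&` W `&` Z); first by do 2?[split=> //]; do 2?apply: openI.
move=> z [[Vz Wz] Zz]; apply/(is_class_eq (h _ Vz) (h' _ Wz)).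
by exists Z.
Qed.
Next Obligation.
move=> a s t y [V [m [oV Vy nm h]]] [W [m' [oW Wy nm' h']]].
exists (V `&` W), (a *: m + m'); split=> //; first exact: openI.
  by apply: (num_submod _ _).2; [apply: num_res nm|apply: num_res nm'] => z [].
by move=> z [Vz Wz]; apply: is_classD; [apply: h|apply: h'].
Qed.

End Sheafify.

Section DirectImage.
Variables (K : fieldType) (X Y : topologicalType) (f : X -> Y) (F : sheaf K X).

(* V |-> F (f^-1 V); a section over f^-1 V is a family on X up to its values
   off f^-1 V. *)
Program Definition pushforward_pre : presheaf K Y := @Presheaf K Y (dprod F)
  (fun V => [set s | forall x, V (f x) -> sect s x])
  (fun V => [set s | forall x, V (f x) -> s x = 0]) _ _ _ _.
Next Obligation.
move=> V; split=> [x _|a s t hs ht x Vx]; first exact: sect_zero.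
by apply: sect_lin; [apply: hs|apply: ht].
Qed.
Next Obligation.
move=> V; split=> [//|a s t hs ht x Vx].
change (a *: s x + t x = 0).
by rewrite hs// ht// scaler0 addr0.
Qed.
Next Obligation. by move=> V W WV s hs x /WV; apply: hs. Qed.
Next Obligation. by move=> V W WV s hs x /WV; apply: hs. Qed.

Definition pushforward : sheaf K Y := sheafify pushforward_pre.

(* Godement resolution: C0 F is the flasque sheaf of all families of germs of
   F; godement_coker is C0 F / F. *)
Program Definition godement_coker_pre : presheaf K X := @Presheaf K X (dprod F)
  (fun V => setT) (fun V => [set s | forall x, V x -> sect s x]) _ _ _ _.
Next Obligation. by []. Qed.
Next Obligation.
move=> V; split=> [x _|a s t hs ht x Vx]; first exact: sect_zero.
by apply: sect_lin; [apply: hs|apply: ht].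
Qed.
Next Obligation. by []. Qed.
Next Obligation. by move=> V W WV s hs x /WV; apply: hs. Qed.

Definition godement_coker : sheaf K X := sheafify godement_coker_pre.

Lemma godement_class (c : dprod F) x : exists q : godement_coker x,
  @pgerm _ _ godement_coker_pre x c q.
Proof. by apply: is_class_ex; exists setT; split=> //; exact: openT. Qed.

(* V |-> H^1 (f^-1 V, F) = coker (C0 F (f^-1 V) -> (C0 F / F) (f^-1 V)). *)
Program Definition R1_pre : presheaf K Y := @Presheaf K Y (dprod godement_coker)
  (fun V => [set q | forall x, V (f x) -> sect q x])
  (fun V => [set q | exists c : dprod F, forall x, V (f x) ->
     @pgerm _ _ godement_coker_pre x c (q x)]) _ _ _ _.
Next Obligation.
move=> V; split=> [x _|a s t hs ht x Vx]; first exact: sect_zero.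
by apply: sect_lin; [apply: hs|apply: ht].
Qed.
Next Obligation.
move=> V; split=> [|a s t [c hc] [c' hc']].
  exists 0 => x _; have [q hq] := godement_class 0 x.
  suff -> : (0 : dprod godement_coker) x = -1 *: q + q.
    have -> : 0 = -1 *: 0 + 0 :> dprod F by rewrite scaler0 addr0.
    exact: is_classD.
  by rewrite scaleN1r addNr.
by exists (a *: c + c') => x Vx; apply: is_classD; [apply: hc|apply: hc'].
Qed.
Next Obligation. by move=> V W WV s hs x /WV; apply: hs. Qed.
Next Obligation. by move=> V W WV s [c hc]; exists c => x /WV; apply: hc. Qed.

(* The first higher direct image R^1 f_* F. *)
Definition R1 : sheaf K Y := sheafify R1_pre.

End DirectImage.

Lemma set_val_cts (X : topologicalType) (A : set X) :
  continuous (set_val : A -> X).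
Proof. exact: initial_continuous. Qed.

Definition local_system (K : fieldType) (X : topologicalType) (F : sheaf K X)
  : Prop :=
  forall x, exists U : set X, [/\ open U, U x &
    exists (n : nat) (f : sheaf_hom (constant_sheaf U 'rV[K]_n)
                                    (pullback (@set_val_cts X U) F)),
      sheaf_iso f].

(* F is a simple object of the category of local systems. *)
Definition irreducible_local_system (K : fieldType) (X : topologicalType)
    (F : sheaf K X) : Prop :=
  [/\ local_system F,
      exists x, exists e : F x, e <> 0 &
      forall N : sheaf K X, local_system N ->
      forall f : sheaf_hom N F, sheaf_mono f ->
        (forall x (e : N x), e = 0) \/ sheaf_iso f].

Definition Cplx (R : realType) : numFieldType := R[i].

Section Loops.
Variables (R : realType) (X : topologicalType).
Local Notation I := (`[0, 1]%classic : set R).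

Definition loop_at (x0 : X) (g : R -> X) : Prop :=
  [/\ {within I, continuous g}, g 0 = x0 & g 1 = x0].

Definition loop_homotopic (x0 : X) (g h : R -> X) : Prop :=
  exists H : R * R -> X, [/\ {within I `*` I, continuous H},
    forall t, I t -> H (0, t) = g t /\ H (1, t) = h t &
    forall s, I s -> H (s, 0) = x0 /\ H (s, 1) = x0].

(* First g, then h. *)
Definition loop_mul (g h : R -> X) : R -> X :=
  fun t => if t <= 2^-1 then g (2 * t) else h (2 * t - 1).

Definition loop_inv (g : R -> X) : R -> X := fun t => g (1 - t).

(* A continuous lift of the path g to the etale space of F. *)
Definition lifts (K : fieldType) (F : sheaf K X) (g : R -> X)
    (s : R -> {x : X & F x}) : Prop :=
  forall t, I t -> tag (s t) = g t /\
    exists2 u : forall x, F x, sect u (g t) &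
      \forall t' \near within I (nbhs t), s t' = existT _ (g t') (u (g t')).

Definition transport (K : fieldType) (F : sheaf K X) (g : R -> X) (x y : X)
    (e : F x) (e' : F y) : Prop :=
  exists2 s, lifts g s & s 0 = existT _ x e /\ s 1 = existT _ y e'.

End Loops.

Section Monodromy.
Variable R : realType.
Local Notation C := (Cplx R).
Local Notation I := (`[0, 1]%classic : set R).

Definition winding_number (g : R -> C) (w : C) (k : int) : Prop :=
  exists r th : R -> R, [/\ {within I, continuous r}, {within I, continuous th},
    forall t, I t -> 0 < r t /\
      g t = w + ((r t * cos (th t)) +i* (r t * sin (th t)))%C &
    th 1 - th 0 = k%:~R * (2 * pi)].

Variables (r : nat) (w : 'I_r -> C).

Definition punctured : set C := ~` range w.

Definition simple_loop (g : R -> punctured) : Prop :=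
  forall t t', 0 <= t < 1 -> 0 <= t' < 1 -> g t = g t' -> t = t'.

Definition fin_idx (i : 'I_r) : 'I_r.+1 := widen_ord (leqnSn r) i.

(* alpha (fin_idx i) is a simple counterclockwise loop around w i and
   alpha ord_max one around infinity, that is, a clockwise simple loop
   enclosing all the w i. *)
Record standard_generators (x0 : punctured) (alpha : 'I_r.+1 -> R -> punctured)
  : Prop := StandardGenerators {
  gen_loop : forall i, loop_at x0 (alpha i);
  gen_simple : forall i, simple_loop (alpha i);
  gen_around : forall i j : 'I_r,
    winding_number (set_val \o alpha (fin_idx i)) (w j) (i == j)%:Z;
  gen_infty : forall j : 'I_r,
    winding_number (set_val \o alpha ord_max) (w j) (- 1);
  gen_prod : loop_homotopic x0
    (\big[@loop_mul R punctured/cst x0]_(i < r.+1) alpha i) (cst x0);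
  gen_generate : forall g : R -> punctured, loop_at x0 g ->
    exists l : seq ('I_r.+1 * bool), loop_homotopic x0 g
      (\big[@loop_mul R punctured/cst x0]_(e <- l)
         if e.2 then loop_inv (alpha e.1) else alpha e.1)
}.

(* In a basis b of the stalk at x0. Row vectors are used, so that the
   monodromy representation turns products of loops into products of
   matrices in the same order. *)
Definition monodromy_tuple (K : fieldType) (F : sheaf K punctured)
    (x0 : punctured) (alpha : 'I_r.+1 -> R -> punctured) (n : nat)
    (A : 'I_r.+1 -> 'M[K]_n) : Prop :=
  (forall i, A i \in unitmx) /\
  exists b : {linear 'rV[K]_n -> F x0}, bijective b /\
    forall i v, transport (alpha i) (b v) (b (v *m A i)).

(* Membership in the category T_K of a sheaf F with monodromy tuple A; the
   component of A at infinity is not taken into account. *)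
Definition in_T (K : fieldType) (F : sheaf K punctured) (n : nat)
    (A : 'I_r.+1 -> 'M[K]_n) : Prop :=
  irreducible_local_system F /\
  exists i j : 'I_r, [/\ i != j, A (fin_idx i) <> 1%:M & A (fin_idx j) <> 1%:M].

End Monodromy.

Section MiddleConvolution.
Variables (R : realType) (p q : nat).
Local Notation C := (Cplx R).
Variables (x : 'I_p -> C) (y : 'I_q -> C).

Definition conv_points : set C := [set a + b | a in range x & b in range y].

Definition generic_conv : Prop := (conv_points #= `I_(p * q))%card.

Definition conv_base : set C := ~` conv_points.

Definition conv_total : set (C * C) := [set z |
  [/\ ~ range x z.1, ~ range y (z.2 - z.1) & ~ conv_points z.2]].

(* The Riemann sphere. *)
Definition P1 : topologicalType := one_point_compactification C.

Lemma pr1_in (z : conv_total) : (set_val z).1 \in punctured x.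
Proof. by rewrite inE; case: (set_valP z). Qed.
Lemma dif_in (z : conv_total) : (set_val z).2 - (set_val z).1 \in punctured y.
Proof. by rewrite inE; case: (set_valP z). Qed.
Lemma conv_base_in (z : conv_total) : (set_val z).2 \in conv_base.
Proof. by rewrite inE; case: (set_valP z). Qed.

Definition pr1 (z : conv_total) : punctured x :=
  exist _ (set_val z).1 (pr1_in z).

Definition dif (z : conv_total) : punctured y :=
  exist _ ((set_val z).2 - (set_val z).1) (dif_in z).

Definition incl_j (z : conv_total) : P1 * conv_base :=
  (Some (set_val z).1, exist _ (set_val z).2 (conv_base_in z)).

Definition pr2bar (z : P1 * conv_base) : conv_base := z.2.

Lemma pr1_cts : continuous pr1.
Proof.
apply: continuous_comp_initial => z.
apply: (@continuous_comp _ _ _ set_val fst); first exact: set_val_cts.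
exact: cvg_fst.
Qed.

Lemma dif_cts : continuous dif.
Proof.
apply: continuous_comp_initial => z.
apply: (@continuousB C C conv_total (fun z => (set_val z).2) (fun z => (set_val z).1)).
  apply: (@continuous_comp _ _ _ set_val snd); first exact: set_val_cts.
  exact: cvg_snd.
apply: (@continuous_comp _ _ _ set_val fst); first exact: set_val_cts.
exact: cvg_fst.
Qed.

Definition middle_convolution (K : fieldType) (V1 : sheaf K (punctured x))
    (V2 : sheaf K (punctured y)) : sheaf K conv_base :=
  R1 pr2bar
    (pushforward incl_j
      (tensor_sheaf (pullback pr1_cts V1) (pullback dif_cts V2))).

End MiddleConvolution.

(* Main.v *)
(* For a generic direction, cut the plane along parallel slits issuing from the
   punctures: local systems become matrices, one for each slit. Over [s], the
   slits of [pr1^* V1] issue from the [x i] and those of [d^* V2] from the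
   [s - y j], and a class in the stalk of [V1 * V2] at [s] is recorded by a
   vector [v] indexed by the punctures and infinity, subject to one parabolic
   relation and taken modulo trivial vectors. When [s] crosses the line of
   height [hgt (x i + y j)], one puncture slides across the slit of another,
   and [v] changes by the corresponding braid move, from either side of
   [x i + y j]. A subsheaf thus gives a family of subspaces, indexed by the
   height of [s] and stable under all the braid moves. As the [lambda j] differ
   from 1, the commutators of these moves propagate any nontrivial vector along
   the irreducible monodromy of [V1] to all parabolic vectors. The scalars
   attached to the slits of a rank one local system are compared with its
   monodromy through winding numbers. *)
Require Import Defs.
From HB Require Import structures.
From mathcomp Require Import all_boot all_order all_algebra.
From mathcomp Require Import complex.
From mathcomp Require Import all_classical all_reals all_analysis.
Import Order.TTheory GRing.Theory Num.Theory.
Import numFieldNormedType.Exports.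

From mathcomp Require Import ring lra.
Import Defs.

Set Implicit Arguments.
Unset Strict Implicit.
Unset Printing Implicit Defensive.

Local Open Scope classical_set_scope.
Local Open Scope ring_scope.

(** * Coordinates of the plane along a direction *)

(** A class of [R^1] at [s] is a section, over [P^1] and near [s], of arbitrary functions modulo
    sections of the direct image. The slit plane is contractible, so this section lifts there to one
    function [c], unique up to a constant. The entry of [v] at a puncture [a] compares [c] with a
    lift near [a], the entry at [None] with a lift near infinity. Another constant shifts all of
    [v], another lift at [a] adds a vector fixed by [B a]: this accounts for the trivial vectors,
    and a path around infinity for the parabolic relation. Fundamental groups are avoided:
    coordinates are locally constant in [s] off finitely many lines, and only the moves across these
    lines remain. One turn around [x i + y j], minus the identity, yields a vector that depends only
    on the difference [d] of the entries at [x i] and [y j]; its entry at [x i] is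
    [(mu j - 1) *: d], which is where [mu j != 1] enters. For fixed [j], the images of these
    differences under the [1 - Y i] span a space stable under every [Y i], so it is zero or
    everything. If it is zero for every [j], all the vectors at hand are trivial. *)

Module Plane.

Section Plane.
Variables (R : realType) (th : R).
Local Notation C := (Cplx R).

Definition rho (z : C) : R := complex.Re z * cos th + complex.Im z * sin th.
Definition hgt (z : C) : R := complex.Im z * cos th - complex.Re z * sin th.
Definition pt (a b : R) : C := ((a * cos th - b * sin th) +i* (a * sin th + b * cos th))%C.

Lemma rhoD z w : rho (z + w) = rho z + rho w.
Proof. by case: z w => [a b] [c d]; rewrite /rho /=; ring. Qed.
Lemma hgtD z w : hgt (z + w) = hgt z + hgt w.
Proof. by case: z w => [a b] [c d]; rewrite /hgt /=; ring. Qed.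
Lemma rhoN z : rho (- z) = - rho z.
Proof. by case: z => [a b]; rewrite /rho /=; ring. Qed.
Lemma hgtN z : hgt (- z) = - hgt z.
Proof. by case: z => [a b]; rewrite /hgt /=; ring. Qed.
Lemma rhoB z w : rho (z - w) = rho z - rho w.
Proof. by rewrite rhoD rhoN. Qed.
Lemma hgtB z w : hgt (z - w) = hgt z - hgt w.
Proof. by rewrite hgtD hgtN. Qed.
Lemma rho0 : rho 0 = 0. Proof. by rewrite /rho /= !mul0r addr0. Qed.
Lemma hgt0 : hgt 0 = 0. Proof. by rewrite /hgt /= !mul0r subr0. Qed.
Lemma rhoZ (t : R) z : rho (t%:C%C * z) = t * rho z.
Proof. by case: z => [a b]; rewrite /rho /=; ring. Qed.
Lemma hgtZ (t : R) z : hgt (t%:C%C * z) = t * hgt z.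
Proof. by case: z => [a b]; rewrite /hgt /=; ring. Qed.

Lemma rho_pt a b : rho (pt a b) = a.
Proof.
rewrite /rho /pt /= -[RHS]mulr1 -(cos2Dsin2 th); ring.
Qed.
Lemma hgt_pt a b : hgt (pt a b) = b.
Proof.
rewrite /hgt /pt /= -[RHS]mulr1 -(cos2Dsin2 th); ring.
Qed.
Lemma pt_rho_hgt z : pt (rho z) (hgt z) = z.
Proof.
case: z => [a b]; rewrite /pt /rho /hgt /=; congr (_ +i* _)%C.
  by rewrite -[RHS]mulr1 -(cos2Dsin2 th); ring.
by rewrite -[RHS]mulr1 -(cos2Dsin2 th); ring.
Qed.
Lemma plane_eq z w : rho z = rho w -> hgt z = hgt w -> z = w.
Proof. by move=> e1 e2; rewrite -[z]pt_rho_hgt e1 e2 pt_rho_hgt. Qed.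

Lemma normC_le (z : C) (e : R) :
  `|complex.Re z| < e / 2 -> `|complex.Im z| < e / 2 -> `|z| < e%:C%C.
Proof.
move=> h1 h2; have e0 : 0 < e by have := normr_ge0 (complex.Re z); lra.
rewrite normc_def ltcR -[ltRHS]gtr0_norm// -sqrtr_sqr ltr_sqrt ?exprn_gt0//.
have /ler_pM h : 0 <= `|complex.Re z| by [].
rewrite -(real_normK (num_real (complex.Re z))) -(real_normK (num_real (complex.Im z))).
have p1 := normr_ge0 (complex.Re z); have p2 := normr_ge0 (complex.Im z).
nra.
Qed.

Lemma normC_Im (z : C) : `|complex.Im z|%:C%C <= `|z|.
Proof.
have := normc_ge_Re (z * (0 +i* 1)%C); rewrite normrM.
have -> : `|(0 +i* 1)%C : R[i]| = 1.
  by rewrite normc_def /= expr0n expr1n add0r sqrtr1.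
rewrite mulr1; suff -> : complex.Re (z * (0 +i* 1)%C) = - complex.Im z by rewrite normrN.
by case: z => a b /=; rewrite mulr0 mulr1 sub0r.
Qed.

Lemma sin_le1' : `|sin th| <= 1.
Proof. by rewrite ler_norml sin_geN1 sin_le1. Qed.
Lemma cos_le1' : `|cos th| <= 1.
Proof. by rewrite ler_norml cos_geN1 cos_le1. Qed.

Lemma comb_lt (a b c d e : R) : `|a| < e / 2 -> `|b| < e / 2 ->
  `|c| <= 1 -> `|d| <= 1 -> `|a * c + b * d| < e.
Proof.
move=> ha hb hc hd; apply: (le_lt_trans (ler_normD _ _)); rewrite !normrM.
have := normr_ge0 a; have := normr_ge0 b; have := normr_ge0 c; have := normr_ge0 d.
nra.
Qed.

Definition box (z : C) (e : R) (z' : C) : Prop :=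
  `|rho z' - rho z| < e /\ `|hgt z' - hgt z| < e.

Lemma nbhs_box (z : C) (P : set C) :
  nbhs z P <-> exists2 e : R, 0 < e & forall z', box z e z' -> P z'.
Proof.
split.
  move=> /nbhs_ballP[/= e e0 eP].
  (* A positive element of [C] is real, since the order of [C] only compares numbers with the same
     imaginary part. *)
  have er : e = (complex.Re e)%:C%C.
    by move: e0; case: (e) => a b; rewrite ltcE /= => /andP[/eqP -> _].
  have Re0 : 0 < complex.Re e by rewrite er ltcR in e0.
  (* A cartesian coordinate combines two rotated ones, and the norm combines two cartesian ones:
     each combination costs a factor 2. *)
  exists (complex.Re e / 4); first by rewrite divr_gt0.
  move=> z' [h1 h2]; apply: eP.
  rewrite /ball /= er -normrN opprB; set w := (_ - _).
  have -> : w = pt (rho w) (hgt w) by rewrite pt_rho_hgt.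
  move: h1 h2; rewrite -rhoB -hgtB -/w => h1 h2.
  have e4 (a : R) : `|a| < complex.Re e / 4 -> `|a| < complex.Re e / 2 / 2 by lra.
  apply: normC_le => /=.
    rewrite -mulrN; apply: comb_lt; [exact: e4|exact: e4|exact: cos_le1'|].
    by rewrite normrN; exact: sin_le1'.
  by apply: comb_lt; [exact: e4|exact: e4|exact: sin_le1'|exact: cos_le1'].
move=> [e e0 eP]; apply/nbhs_ballP; exists (e / 2)%:C%C => /=.
  by rewrite ltcR divr_gt0.
move=> z'; rewrite /ball /= -normrN opprB => h; apply: eP.
have h1 : `|complex.Re (z' - z)| < e / 2.
  by rewrite -ltcR; apply: le_lt_trans h; exact: normc_ge_Re.
have h2 : `|complex.Im (z' - z)| < e / 2.
  by rewrite -ltcR; apply: le_lt_trans h; exact: normC_Im.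
rewrite /box -rhoB -hgtB; split.
  by apply: comb_lt => //; [exact: cos_le1'|exact: sin_le1'].
rewrite /hgt -mulrN; apply: comb_lt => //; first exact: cos_le1'.
by rewrite normrN; exact: sin_le1'.
Qed.

Lemma box_nbhs (z : C) (e : R) : 0 < e -> \forall z' \near z, box z e z'.
Proof. by move=> e0; apply/nbhs_box; exists e. Qed.

Lemma rho_cts : continuous rho.
Proof.
move=> z P /nbhs_ballP[e /= e0 eP]; apply/nbhs_box; exists e => // w [h1 h2].
by apply: eP; rewrite /ball /= distrC.
Qed.

Lemma hgt_cts : continuous hgt.
Proof.
move=> z P /nbhs_ballP[e /= e0 eP]; apply/nbhs_box; exists e => // w [h1 h2].
by apply: eP; rewrite /ball /= distrC.
Qed.

Lemma cvg_plane (T : Type) (F : set_system T) {FF : Filter F} (f : T -> C) (z : C) :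
  rho (f x) @[x --> F] --> rho z -> hgt (f x) @[x --> F] --> hgt z -> f x @[x --> F] --> z.
Proof.
move=> h1 h2; move=> P /nbhs_box[e e0 eP].
move/cvgrPdist_lt: h1 => /(_ e e0) h1; move/cvgrPdist_lt: h2 => /(_ e e0) h2.
apply: filterS2 h1 h2 => x hx1 hx2; apply: eP.
by split; rewrite distrC.
Qed.

Lemma pt_cts2 : continuous (fun ab : R * R => pt ab.1 ab.2).
Proof.
move=> [a b]; apply: cvg_plane; under eq_fun do rewrite ?rho_pt ?hgt_pt.
  by rewrite rho_pt; exact: cvg_fst.
by rewrite hgt_pt; exact: cvg_snd.
Qed.

Lemma nbhs_box2 (u : C * C) (P : set (C * C)) :
  nbhs u P <-> exists2 e : R, 0 < e &
    forall u' : C * C, box u.1 e u'.1 -> box u.2 e u'.2 -> P u'.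
Proof.
split.
  move=> [[/= A B] [/nbhs_box[e1 e10 h1] /nbhs_box[e2 e20 h2]] AB].
  exists (Num.min e1 e2); first by rewrite lt_min e10.
  move=> u' [a1 a2] [b1 b2]; apply: AB; split.
    by apply: h1; split; [move: a1|move: a2]; rewrite lt_min => /andP[].
  by apply: h2; split; [move: b1|move: b2]; rewrite lt_min => /andP[].
move=> [e e0 eP]; exists (box u.1 e, box u.2 e).
  by split; exact: box_nbhs.
by move=> u' [/= h1 h2]; exact: eP.
Qed.

End Plane.

End Plane.
Export Plane.

(** * Connectedness of segments and of convex sets *)

(** [P] and its complement are both relatively open, so the connectedness of the segment applies.
    Nearly every continuation argument goes through this lemma, with [P] comparing the value at [t]
    with a fixed one. *)
Lemma segment_const (R : realType) (a b : R) (P : R -> Prop) : a <= b ->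
  (forall t, a <= t <= b -> \forall t' \near t, a <= t' <= b -> P t' <-> P t) ->
  P a -> P b.
Proof.
move=> ab loc Pa.
pose A := `[a, b]%classic.
have inA t : A t <-> a <= t <= b by rewrite /A /= in_itv.
have key (Q : R -> Prop) : open [set t | \forall t' \near t, A t' -> Q t'].
  by rewrite openE => t /= /near_join; apply: filterS.
have loc' (Q : R -> Prop) : (forall t, a <= t <= b -> \forall t' \near t, a <= t' <= b -> Q t' <-> Q t) ->
    A `&` Q = A `&` [set t | \forall t' \near t, A t' -> Q t'].
  move=> h; apply/seteqP; split=> t [At Qt]; split=> //=.
    by have := h t ((inA t).1 At); apply: filterS => t' h' /inA /h' ->.
  exact: (nbhs_singleton Qt).
suff e : A `&` P = A.
  have : (A `&` P) b by rewrite e; apply/inA; rewrite ab lexx.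
  by case.
have := @segment_connected R a b; apply.
- by exists a; split=> //; apply/inA; rewrite lexx ab.
- by exists [set t | \forall t' \near t, A t' -> P t'] => //; exact: loc'.
- exists (~` [set t | \forall t' \near t, A t' -> ~ P t']).
    by apply: open_closedC; exact: key.
  have := loc' (fun t => ~ P t); move=> h.
  have {}h : A `&` (fun t => ~ P t) = A `&` [set t | \forall t' \near t, A t' -> ~ P t'].
    apply: h => t /loc; apply: filterS => t' h' /h' [h1 h2].
    by split=> n m; apply: n; auto.
  apply/seteqP; split=> t [At Pt]; split=> //=.
    move=> nP; have : (A `&` (fun t => ~ P t)) t by rewrite h.
    by case.
  apply: contrapT => nP; apply: Pt.
  have : (A `&` (fun t => ~ P t)) t by [].
  by rewrite h => -[].
Qed.

Lemma nearI (T : topologicalType) (x : T) (P Q : T -> Prop) :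
  (\forall y \near x, P y) -> (\forall y \near x, Q y) -> \forall y \near x, P y /\ Q y.
Proof. exact: filterI. Qed.

Section Convex.
Variable R : realType.
Local Notation C := (Cplx R).

Definition sg (u v : C * C) (t : R) : C * C :=
  (u.1 + t%:C%C * (v.1 - u.1), u.2 + t%:C%C * (v.2 - u.2)).

Lemma sg0 u v : sg u v 0 = u.
Proof. by case: u => a b; rewrite /sg /= !mul0r !addr0. Qed.
Lemma sg1 u v : sg u v 1 = v.
Proof. by case: u v => a b [c d]; rewrite /sg /= !mul1r ![_ + (_ - _)]addrC !subrK. Qed.

Lemma realC_cts : continuous ((fun t => t%:C%C) : R -> C).
Proof.
move=> t; apply: (@cvg_plane R 0 R (nbhs t) (nbhs_filter t)).
- have -> : (fun t : R => rho 0 (t%:C%C : C)) = id.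
    by apply/funext => s; rewrite /rho /= cos0 sin0 !mulr1 mul0r addr0.
  by rewrite /rho /= cos0 sin0 mulr1 mul0r addr0; exact: cvg_id.
- have -> : (fun t : R => hgt 0 (t%:C%C : C)) = cst 0.
    by apply/funext => s; rewrite /hgt /= cos0 sin0 mulr0 mul0r subr0.
  by rewrite /hgt /= cos0 sin0 mulr0 mul0r subr0; exact: cvg_cst.
Qed.

Lemma sg_cts u v : continuous (sg u v).
Proof.
have cvgR (a b : C) (t : R) : (fun t' : R => a + t'%:C%C * b : C) @ t --> (a + t%:C%C * b : C).
  apply: (@cvgD _ C R (nbhs t) (nbhs_filter t)); first exact: cvg_cst.
  by apply: (@cvgM C R (nbhs t) (nbhs_filter t) (fun t : R => t%:C%C : C)); [exact: realC_cts|exact: cvg_cst].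
move=> t; apply: (@cvg_pair _ _ _ (nbhs t) (nbhs _) (nbhs _)); exact: cvgR.
Qed.

Definition segconvex (A : set (C * C)) := forall u v, A u -> A v ->
  forall t : R, 0 <= t <= 1 -> A (sg u v t).

Lemma segconvexI A B : segconvex A -> segconvex B -> segconvex (A `&` B).
Proof. by move=> cA cB u v [Au Bu] [Av Bv] t t01; split; [apply: cA|apply: cB]. Qed.

Lemma locconst_segconvex T (A : set (C * C)) (c : C * C -> T) : segconvex A ->
  (forall u, A u -> \forall u' \near u, c u' = c u) ->
  forall u v, A u -> A v -> c u = c v.
Proof.
move=> cA lc u v Au Av.
rewrite -[u](sg0 u v) -[in RHS](sg1 u v).
apply: (@segment_const R 0 1 (fun t => c (sg u v 0) = c (sg u v t))) => //.
move=> t t01; have : \forall t' \near t, c (sg u v t') = c (sg u v t).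
  exact: (sg_cts (lc _ (cA _ _ Au Av _ t01))).
by apply: filterS => t' /= -> _; split=> ->.
Qed.

Lemma box_convex th (u : C * C) (e : R) :
  segconvex (fun u' => box th u.1 e u'.1 /\ box th u.2 e u'.2).
Proof.
have aux (x y z t : R) : `|x - z| < e -> `|y - z| < e -> 0 <= t <= 1 ->
    `|x + t * (y - x) - z| < e.
  rewrite !ltr_norml => /andP[h1 h2] /andP[h3 h4] /andP[h5 h6].
  have [xy|/ltW xy] := leP x y.
    have := mulr_ge0 h5 (_ : 0 <= y - x); rewrite subr_ge0 => /(_ xy) k1.
    have := mulr_ge0 (_ : 0 <= 1 - t) (_ : 0 <= y - x).
    by rewrite !subr_ge0 => /(_ h6 xy) k2; apply/andP; split; lra.
  have := mulr_ge0 h5 (_ : 0 <= x - y); rewrite subr_ge0 => /(_ xy) k1.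
  have := mulr_ge0 (_ : 0 <= 1 - t) (_ : 0 <= x - y).
  by rewrite !subr_ge0 => /(_ h6 xy) k2; apply/andP; split; lra.
move=> v w [[h1 h2] [h3 h4]] [[h5 h6] [h7 h8]] t t01.
by rewrite /sg /box /=; do !split; rewrite ?rhoD ?hgtD ?rhoZ ?hgtZ ?rhoB ?hgtB; exact: aux.
Qed.

(** The point [u] may lie on the boundary of [A], for instance on the edge of a half plane. A small
    box around [u] meets [A] in a convex set, where local constancy gives constancy. The argument of
    type [T] is the value taken when this intersection is empty. *)
Lemma near_const T (A : set (C * C)) (c : C * C -> T) (u : C * C) : segconvex A ->
  (\forall u' \near u, A u' -> \forall u'' \near u', c u'' = c u') ->
  T -> exists k, \forall u' \near u, A u' -> c u' = k.
Proof.
move=> cA /(@nbhs_box2 R 0)[e e0 h] k0.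
pose D u' := A u' /\ (box 0 u.1 e u'.1 /\ box 0 u.2 e u'.2).
have cD : segconvex D by by apply: segconvexI cA _; exact: box_convex.
have [[w Dw]|nD] := pselect (exists w, D w).
  exists (c w); apply/(@nbhs_box2 R 0); exists e => // u' h1 h2 Au'.
  apply: (@locconst_segconvex T D c cD) => //.
  by move=> v [Av [b1 b2]]; apply: h.
exists k0; apply/(@nbhs_box2 R 0); exists e => // u' h1 h2 Au'.
by exfalso; apply: nD; exists u'.
Qed.

End Convex.

(** * Extending germs along a contraction *)

Section Extension.
Variables (R : realType) (Z : topologicalType) (G : Type).
Variables (eqat : G -> G -> Z -> Prop) (good : G -> Z -> Prop) (D : set Z).
Hypothesis eqat_refl : forall g z, eqat g g z.
Hypothesis eqat_sym : forall g g' z, eqat g g' z -> eqat g' g z.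
Hypothesis eqat_trans : forall g g' g'' z, eqat g g' z -> eqat g' g'' z -> eqat g g'' z.
Hypothesis eqat_open : forall g g' z, D z -> good g z -> good g' z -> eqat g g' z ->
  \forall z' \near z, eqat g g' z'.
Hypothesis neqat_open : forall g g' z, D z -> good g z -> good g' z -> ~ eqat g g' z ->
  \forall z' \near z, ~ eqat g g' z'.
Hypothesis good_open : forall g z, D z -> good g z -> \forall z' \near z, good g z'.
Hypothesis good_ext : forall z, D z -> exists2 O, nbhs z O &
  forall z' g, O z' -> good g z' -> exists2 g', eqat g' g z' & forall z'', O z'' -> good g' z''.
Hypothesis glue : forall h : Z -> G,
  (forall z, D z -> good (h z) z) ->
  (forall z, D z -> \forall z' \near z, D z' -> eqat (h z) (h z') z') ->
  exists g, forall z, D z -> good g z.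
Variables (p : Z -> R -> Z) (u0 : Z).
Hypothesis pD : forall u t, D u -> 0 <= t <= 1 -> D (p u t).
Hypothesis p0 : forall u, D u -> p u 0 = u0.
Hypothesis p1 : forall u, D u -> p u 1 = u.
Hypothesis p_cts : forall u t, D u -> 0 <= t <= 1 ->
  forall O, nbhs (p u t) O -> exists A (e : R), [/\ nbhs u A, 0 < e &
    forall u' t', A u' -> `|t' - t| < e -> O (p u' t')].

Let near_t u t O : D u -> 0 <= t <= 1 -> nbhs (p u t) O -> \forall t' \near t, O (p u t').
Proof.
move=> Du t01 /(p_cts Du t01)[A [e [nA e0 h]]].
have := nbhsx_ballx t e e0; apply: filterS => t' tt'; apply: h; first exact: nbhs_singleton.
by rewrite distrC.
Qed.

Let near_u u t O : D u -> 0 <= t <= 1 -> nbhs (p u t) O -> \forall u' \near u, O (p u' t).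
Proof.
move=> Du t01 /(p_cts Du t01)[A [e [nA e0 h]]].
by apply: filterS nA => u' Au'; apply: h => //; rewrite subrr normr0.
Qed.

Let near_refl g u a b (t : R) : \forall t' \near t, a <= t' <= b -> eqat g g (p u t').
Proof. by near=> t' => _; exact: eqat_refl. Unshelve. all: by end_near. Qed.

(** A continuation along the path of [u]: germs at neighbouring times agree. Equality of germs is
    tested at single points of the path only, which suffices since it is an open condition among
    good germs. *)
Let lift u (a b : R) (y : R -> G) := forall t, a <= t <= b -> good (y t) (p u t) /\
  \forall t' \near t, a <= t' <= b -> eqat (y t) (y t') (p u t').

(** Agreement and disagreement of two continuations are both open conditions along the path. *)
Let lift_uniq u a b y y' : D u -> 0 <= a -> a <= b -> b <= 1 -> lift u a b y -> lift u a b y' ->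
  eqat (y a) (y' a) (p u a) <-> eqat (y b) (y' b) (p u b).
Proof.
move=> Du a0 ab b1 ly ly'.
have loc t : a <= t <= b -> \forall t' \near t, a <= t' <= b ->
    eqat (y t') (y' t') (p u t') <-> eqat (y t) (y' t) (p u t).
  move=> tab; have [gy hy] := ly _ tab; have [gy' hy'] := ly' _ tab.
  have t01 : 0 <= t <= 1 by lra.
  have [e|ne] := pselect (eqat (y t) (y' t) (p u t)).
    have ho := near_t Du t01 (eqat_open (pD Du t01) gy gy' e).
    near=> t' => tab'; split=> // _.
    apply: eqat_trans (eqat_sym (near hy t' _ tab')) _ => //.
    by apply: eqat_trans (near hy' t' _ tab') => //; near: t'.
  have ho := near_t Du t01 (neqat_open (pD Du t01) gy gy' ne).
  near=> t' => tab'; split=> // e; exfalso; have : ~ eqat (y t) (y' t) (p u t') by near: t'.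
  apply; apply: eqat_trans (near hy t' _ tab') _ => //.
  by apply: eqat_trans e _; apply: eqat_sym; apply: (near hy' t' _ tab').
split; first by apply: (segment_const (P := fun t => eqat (y t) (y' t) (p u t))).
move=> eb; apply: contrapT => na; suff : ~ eqat (y b) (y' b) (p u b) by [].
apply: (segment_const (P := fun t => ~ eqat (y t) (y' t) (p u t)) ab) => // t /loc.
by apply: filterS => t' h /h [h1 h2]; split=> n m; apply: n; auto.
Unshelve. all: by end_near. Qed.

Let lift_const u a b g : D u -> 0 <= a -> b <= 1 ->
  (forall t, a <= t <= b -> good g (p u t)) -> lift u a b (fun=> g).
Proof. by move=> Du a0 b1 h t tab; split; [exact: h|exact: near_refl]. Qed.

Variable g0 : G.
Hypothesis g0_good : good g0 u0.

(** The germ [g] is what the continuation of [g0] along the path of [u] reaches at time [t]. *)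
Let cont u t g := exists y, [/\ lift u 0 t y, eqat (y 0) g0 u0,
  eqat (y t) g (p u t) & good g (p u t)].

Let cont_fwd u t t' g : D u -> 0 <= t -> t <= t' -> t' <= 1 ->
  (forall s, t <= s <= t' -> good g (p u s)) -> cont u t g -> cont u t' g.
Proof.
move=> Du t0 tt' t1 gg [y [ly y0 yt yg]].
exists (fun s => if s <= t then y s else g); split.
- move=> s st; have s01 : 0 <= s <= 1 by lra.
  case: (ltgtP s t) => [lt|gt|->].
  + have [|gy hy] := ly s; first lra.
    split=> //; near=> s' => s't'.
    have lt' : s' < t by near: s'; exact: lt_nbhsl.
    by rewrite (ltW lt'); apply: (near hy s') => //; lra.
  + split; first by apply: gg; lra.
    near=> s' => _; have lt' : t < s' by near: s'; exact: lt_nbhsr.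
    by rewrite leNgt lt' /=; exact: eqat_refl.
  + have [|gy hy] := ly t; first lra.
    split=> //.
    have t01 : 0 <= t <= 1 by lra.
    have ho := near_t Du t01 (eqat_open (pD Du t01) gy yg yt).
    near=> s' => s't'; case: ifP => // st'; last by near: s'.
    by apply: (near hy s') => //; lra.
- by rewrite t0.
- case: ifP => [t't|_]; last exact: eqat_refl.
  by have <- : t = t' by lra.
- by apply: gg; rewrite tt' lexx.
Unshelve. all: by end_near. Qed.

Let cont_bwd u t t' g : D u -> 0 <= t -> t <= t' -> t' <= 1 ->
  (forall s, t <= s <= t' -> good g (p u s)) -> cont u t' g -> cont u t g.
Proof.
move=> Du t0 tt' t1 gg [y [ly y0 yt yg]]; exists y; split=> //.
- move=> s st; have [|gy hy] := ly s; first lra.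
  by split=> //; apply: filterS hy => s' h s't; apply: h; lra.
- have lt' : lift u t t' y.
    move=> s st; have [|gy hy] := ly s; first lra.
    by split=> //; apply: filterS hy => s' h s't; apply: h; lra.
  by apply/(lift_uniq Du t0 tt' t1 lt' (lift_const Du t0 t1 gg)).
- by apply: gg; rewrite tt' lexx.
Qed.

Let cont_move u t t' g : D u -> 0 <= t <= 1 -> 0 <= t' <= 1 ->
  (forall s, (t <= s <= t') || (t' <= s <= t) -> good g (p u s)) -> cont u t g -> cont u t' g.
Proof.
move=> Du t01 t01' gg.
have [tt'|/ltW tt'] := leP t t'.
  by apply: cont_fwd => //; [lra|lra|move=> s st; apply: gg; rewrite st].
by apply: cont_bwd => //; [lra|lra|move=> s st; apply: gg; rewrite st orbT].
Qed.

Let cont_eq u t g g' : cont u t g -> eqat g g' (p u t) -> good g' (p u t) -> cont u t g'.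
Proof. by move=> [y [ly y0 yt yg]] e h; exists y; split=> //; exact: eqat_trans e. Qed.

Let cont_uniq u t g g' : D u -> 0 <= t <= 1 -> cont u t g -> cont u t g' -> eqat g g' (p u t).
Proof.
move=> Du /andP[t0 t1] [y [ly y0 yt yg]] [y' [ly' y0' yt' yg']].
apply: eqat_trans (eqat_sym yt) _; apply: eqat_trans yt'.
apply/(lift_uniq Du (lexx 0) t0 t1 ly ly'); rewrite p0//.
exact: eqat_trans y0 (eqat_sym y0').
Qed.

Let local_ext u t : D u -> 0 <= t <= 1 -> exists O A (e : R), [/\ nbhs u A, 0 < e,
    forall u' t', A u' -> `|t' - t| < e -> O (p u' t') &
    forall z' g, O z' -> good g z' -> exists2 g', eqat g' g z' & forall z'', O z'' -> good g' z''].
Proof.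
move=> Du t01; have [W nO hO] := good_ext (pD Du t01).
have [A [e [nA e0 h]]] := p_cts Du t01 nO.
by exists W, A, e; split.
Qed.

Let near_dist (t e : R) : 0 < e -> \forall t' \near t, `|t' - t| < e.
Proof. by move=> e0; apply: filterS (nbhsx_ballx t e e0) => t'; rewrite /ball /= distrC. Qed.

Let between (t t' s c e : R) : `|t - c| < e -> `|t' - c| < e ->
  (t <= s <= t') || (t' <= s <= t) -> `|s - c| < e.
Proof. rewrite !ltr_norml; lra. Qed.

Let cont_ex u t : D u -> 0 <= t <= 1 -> exists g, cont u t g.
Proof.
move=> Du /andP[t0 t1]; apply: (segment_const (P := fun t => exists g, cont u t g) t0).
  move=> s st; have s01 : 0 <= s <= 1 by lra.
  have [W [A [e [nA e0 hO ext]]]] := local_ext Du s01.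
  have key r r' : 0 <= r <= 1 -> 0 <= r' <= 1 -> `|r - s| < e -> `|r' - s| < e ->
      (exists g, cont u r g) -> exists g, cont u r' g.
    move=> r01 r01' rs rs' [g cg].
    have [||g' e' gg'] := ext (p u r) g; first by apply: hO => //; exact: nbhs_singleton.
      by case: cg => y [].
    have pO r'' : `|r'' - s| < e -> good g' (p u r'').
      by move=> h; apply: gg'; apply: hO => //; exact: nbhs_singleton.
    exists g'; apply: (cont_move Du r01 r01'); last first.
      by apply: cont_eq cg (eqat_sym e') _; exact: pO.
    by move=> s' s'b; apply: pO; exact: between s'b.
  have ss : `|s - s| < e by rewrite subrr normr0.
  near=> r => r01; have rs : `|r - s| < e by near: r; exact: near_dist.
  by split; apply: key => //; lra.
exists g0; exists (fun=> g0); rewrite p0//; split=> //.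
move=> s /andP[s0 s0']; have -> : s = 0 by lra.
by rewrite p0//; split=> //; exact: near_refl.
Unshelve. all: by end_near. Qed.

Let cont_open u t g : D u -> 0 <= t <= 1 -> cont u t g ->
  \forall u' \near u, D u' -> cont u' t g.
Proof.
move=> Du /andP[t0 t1].
(* Openness in [u] is itself propagated along the path, starting at time 0, where all the paths are
   at [u0]. *)
pose Q t := forall g, cont u t g -> \forall u' \near u, D u' -> cont u' t g.
suff : Q t by apply.
apply: (segment_const (P := Q) t0).
  move=> s st; have s01 : 0 <= s <= 1 by lra.
  have [W [A [e [nA e0 hO ext]]]] := local_ext Du s01.
  have key r r' : 0 <= r <= 1 -> 0 <= r' <= 1 -> `|r - s| < e -> `|r' - s| < e -> Q r -> Q r'.
    move=> r01 r01' rs rs' Qr h ch.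
    have gh : good h (p u r') by case: ch => y [].
    have [|g' e' gg'] := ext (p u r') h _ gh.
      by apply: hO => //; exact: nbhs_singleton.
    have pO u' r'' : A u' -> `|r'' - s| < e -> good g' (p u' r'').
      by move=> ? ?; apply: gg'; apply: hO.
    have Au : A u by exact: nbhs_singleton.
    have mv u' r1 r2 : A u' -> D u' -> 0 <= r1 <= 1 -> 0 <= r2 <= 1 ->
        `|r1 - s| < e -> `|r2 - s| < e -> cont u' r1 g' -> cont u' r2 g'.
      move=> Au' Du' r10 r20 r1s r2s; apply: (cont_move Du' r10 r20) => s' s'b.
      by apply: pO => //; exact: between s'b.
    have c1 : cont u r' g' by apply: cont_eq ch (eqat_sym e') _; exact: pO.
    have c2 : cont u r g' by apply: mv c1.
    have c3 := Qr _ c2.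
    have n1 := near_u Du r01' (eqat_open (pD Du r01') (pO _ _ Au rs') gh e').
    have n2 := near_u Du r01' (good_open (pD Du r01') gh).
    near=> u' => Du'.
    have Au' : A u' by near: u'.
    apply: (@cont_eq _ _ g').
    - by apply: (mv u' r r') => //; apply: (near c3 u').
    - by near: u'.
    - by near: u'.
  have ss : `|s - s| < e by rewrite subrr normr0.
  near=> r => r01; have rs : `|r - s| < e by near: r; exact: near_dist.
  by split; apply: key => //; lra.
move=> h [y [ly y0 yt yg]]; rewrite p0// in yg yt.
apply: nearW => u' Du'; exists (fun=> h); rewrite p0//; split=> //.
  move=> s /andP[s0 s0']; have -> : s = 0 by lra.
  by rewrite p0//; split=> //; exact: near_refl.
exact: eqat_trans (eqat_sym yt) y0.
Unshelve. all: by end_near. Qed.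

(** Each [u] is joined to [u0] by its own path [p u], and the germ chosen at [u] is the continuation
    of [g0] at time 1. Joint continuity of [p] makes neighbouring choices compatible, so no homotopy
    of paths is involved. The setting is abstract because it is applied both to primitives of
    cocycles and to frames of local systems. *)
Lemma contraction_section : exists g, forall z, D z -> good g z.
Proof.
have i01 : 0 <= (1 : R) <= 1 by rewrite ler01 lexx.
have hE u : exists g, D u -> cont u 1 g.
  have [Du|nD] := pselect (D u); last by exists g0.
  by have [g] := cont_ex Du i01; exists g.
pose h u := projT1 (cid (hE u)).
have hh u : D u -> cont u 1 (h u) by exact: (projT2 (cid (hE u))).
apply: (glue (h := h)) => [z Dz|z Dz].
  by have [y [_ _ _]] := hh _ Dz; rewrite p1.
have co := cont_open Dz i01 (hh _ Dz).
near=> z' => Dz'; have := cont_uniq Dz' i01 (near co z' _ Dz') (hh _ Dz').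
by rewrite p1//; apply.
Unshelve. all: by end_near. Qed.

End Extension.

(** * Slits *)

Module Slits.

Section RealContinuity.
Variables (R : realType) (T : topologicalType).
Implicit Types f g : T -> R.

Lemma ctsD f g : continuous f -> continuous g -> continuous (fun x => f x + g x).
Proof. by move=> cf cg x; exact: (@continuousD R R T f g x (cf x) (cg x)). Qed.
Lemma ctsN f : continuous f -> continuous (fun x => - f x).
Proof. by move=> cf x; exact: (@continuousN R R T f x (cf x)). Qed.
Lemma ctsB f g : continuous f -> continuous g -> continuous (fun x => f x - g x).
Proof. by move=> cf cg; apply: ctsD => //; exact: ctsN. Qed.
Lemma ctsM f g : continuous f -> continuous g -> continuous (fun x => f x * g x).
Proof. by move=> cf cg x; exact: (@continuousM R T f g x (cf x) (cg x)). Qed.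
Lemma cts_min f g : continuous f -> continuous g -> continuous (fun x => Num.min (f x) (g x)).
Proof. by move=> cf cg x; exact: (@continuous_min R T f g x (cf x) (cg x)). Qed.
Lemma cts_norm f : continuous f -> continuous (fun x => `|f x|).
Proof.
move=> cf x; exact: (@continuous_comp _ _ _ f (fun y : R => `|y|) x (cf x) (@norm_continuous R R (f x))).
Qed.
Lemma cts_cst (c : R) : continuous (fun _ : T => c).
Proof. by move=> x; exact: cvg_cst. Qed.
Lemma cts_plane th (f : T -> Cplx R) :
  continuous (fun x => rho th (f x)) -> continuous (fun x => hgt th (f x)) -> continuous f.
Proof. by move=> c1 c2 x; apply: (@cvg_plane R th T (nbhs x) (nbhs_filter x)); [exact: c1|exact: c2]. Qed.
Lemma cts_pos f x : continuous f -> 0 < f x -> \forall y \near x, 0 < f y.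
Proof. by move=> cf f0; exact: (cf x _ (lt_nbhsr f0)). Qed.
Lemma cts_neg f x : continuous f -> f x < 0 -> \forall y \near x, f y < 0.
Proof. by move=> cf f0; exact: (cf x _ (lt_nbhsl f0)). Qed.
Lemma cts_comp (S : topologicalType) (h : T -> S) (f : S -> R) :
  continuous h -> continuous f -> continuous (fun x => f (h x)).
Proof. by move=> ch cf x; exact: (@continuous_comp _ _ _ h f x (ch x) (cf (h x))). Qed.
End RealContinuity.

Lemma near_forall (T : topologicalType) (I : finType) (P : I -> T -> Prop) (x : T) :
  (forall i, \forall y \near x, P i y) -> \forall y \near x, forall i, P i y.
Proof.
move=> h; suff : \forall y \near x, forall i, i \in enum I -> P i y.
  by apply: filterS => y hy i; apply: hy; rewrite mem_enum.
elim: (enum I) => [|a l IH]; first by apply: nearW.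
apply: filterS2 (h a) IH => y ha hl i; rewrite in_cons => /orP[/eqP->//|]; exact: hl.
Qed.

Section Slits.
Variables (R : realType) (th : R) (I : finType).
Local Notation C := (Cplx R).
Variables (pa : I -> C) (ea : I -> bool).

Definition pos (a : I) (s : C) : C := pa a + (if ea a then s else 0).

Definition hh (a : I) (u : C * C) : R := hgt th (u.1 - pos a u.2).
Definition rr (a : I) (u : C * C) : R := rho th (u.1 - pos a u.2).

Lemma fst_cts : continuous (fst : C * C -> C).
Proof. by move=> u; exact: cvg_fst. Qed.
Lemma snd_cts : continuous (snd : C * C -> C).
Proof. by move=> u; exact: cvg_snd. Qed.

Lemma hh_cts a : continuous (hh a).
Proof.
have -> : hh a = fun u => hgt th u.1 - (hgt th (pa a) + if ea a then hgt th u.2 else 0).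
  by apply/funext => u; rewrite /hh /pos hgtB hgtD; case: (ea a); rewrite ?hgt0.
apply: ctsB; first by apply: cts_comp; [exact: fst_cts|exact: hgt_cts].
apply: ctsD; first exact: cts_cst.
case: (ea a); last exact: cts_cst.
by apply: cts_comp; [exact: snd_cts|exact: hgt_cts].
Qed.

Lemma rr_cts a : continuous (rr a).
Proof.
have -> : rr a = fun u => rho th u.1 - (rho th (pa a) + if ea a then rho th u.2 else 0).
  by apply/funext => u; rewrite /rr /pos rhoB rhoD; case: (ea a); rewrite ?rho0.
apply: ctsB; first by apply: cts_comp; [exact: fst_cts|exact: rho_cts].
apply: ctsD; first exact: cts_cst.
case: (ea a); last exact: cts_cst.
by apply: cts_comp; [exact: snd_cts|exact: rho_cts].
Qed.

Lemma hh_sg a u v t : hh a (sg u v t) = hh a u + t * (hh a v - hh a u).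
Proof.
rewrite /hh /pos /sg /=; case: (ea a); rewrite !(hgtD, hgtN, hgtZ) ?hgt0; ring.
Qed.
Lemma rr_sg a u v t : rr a (sg u v t) = rr a u + t * (rr a v - rr a u).
Proof.
rewrite /rr /pos /sg /=; case: (ea a); rewrite !(rhoD, rhoN, rhoZ) ?rho0; ring.
Qed.

(** The slit plane: the complement of the closed half-lines that issue from the punctures in the
    direction of increasing [rho]. *)
Definition omega (u : C * C) : Prop := forall a, hh a u = 0 -> rr a u < 0.

Lemma omega_near u : omega u -> \forall u' \near u, omega u'.
Proof.
move=> ou; apply: near_forall => a.
have [h0|h0] := eqVneq (hh a u) 0.
  by have := cts_neg (@rr_cts a) (ou _ h0); apply: filterS => v hv _.
have : `|hh a u| > 0 by rewrite normr_gt0.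
move=> /(cts_pos (cts_norm (@hh_cts a))); apply: filterS => v.
by rewrite normr_gt0 => /eqP.
Qed.

Definition half (P : R -> Prop) := forall x y t : R, P x -> P y -> 0 <= t <= 1 -> P (x + t * (y - x)).

Lemma half_pos : half (fun x => 0 < x).
Proof.
move=> x y t x0 y0 /andP[t0 t1].
have [xy|/ltW xy] := leP x y.
  have k := mulr_ge0 t0 (_ : 0 <= y - x); rewrite subr_ge0 in k; have := k xy; lra.
have k := mulr_ge0 (_ : 0 <= 1 - t) (_ : 0 <= x - y); rewrite !subr_ge0 in k; have := k t1 xy; lra.
Qed.
Lemma half_neg : half (fun x => x < 0).
Proof.
move=> x y t x0 y0 t01; have := half_pos (x := - x) (y := - y) (t := t); lra.
Qed.
Lemma hh_half a P : half P -> segconvex (fun u => P (hh a u)).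
Proof. by move=> hP u v hu hv t t01; rewrite hh_sg; exact: hP. Qed.
Lemma rr_half a P : half P -> segconvex (fun u => P (rr a u)).
Proof. by move=> hP u v hu hv t t01; rewrite rr_sg; exact: hP. Qed.

End Slits.

End Slits.
Export Slits.

(** * Contraction of the slit plane over a box of parameters *)

Section Contraction.
Variables (R : realType) (th : R) (I : finType).
Local Notation C := (Cplx R).
Variables (pa : I -> C) (ea : I -> bool).
Local Notation rho := (rho th).
Local Notation hgt := (hgt th).
Local Notation omega := (omega th pa ea).
Variables (s0 : C) (e : R).

Definition omega_over (u : C * C) : Prop := box th s0 e u.2 /\ omega u.

Definition left_bound : R := \sum_a `|rho (pa a)| + `|rho s0| + `|e| + 1.

Lemma left_boundP a s x : box th s0 e s -> rho x <= - left_bound -> rr th pa ea a (x, s) < 0.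
Proof.
move=> [bs _] hx; rewrite /rr /pos /= rhoB rhoD.
have le : `|rho (pa a)| <= \sum_a `|rho (pa a)|.
  by rewrite (bigD1 a)//= lerDl; apply: sumr_ge0.
have h1 := ler_norm (- rho (pa a)); rewrite normrN in h1.
have h2 := ler_norm (- rho s0); rewrite normrN in h2.
have h3 := ler_norm e; have h5 := normr_ge0 (rho s0); have h6 := normr_ge0 e.
move: bs; rewrite ltr_norml => /andP[b1 b2].
by move: hx; rewrite /left_bound; case: (ea a); rewrite ?rho0; lra.
Qed.

Definition base : C * C := (pt th (- left_bound) 0, s0).

(** Read from [t = 1] down to [t = 0]. Until [t = 1/2] the point moves to the left with [s] fixed,
    until it is to the left of all punctures; as the slits extend to the right, it meets none of
    them. Then everything shrinks linearly to [base], inside a region to the left of all slits. *)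
Definition ctr (u : C * C) (t : R) : C * C :=
  let m := Num.min 1 (2 * t) in
  let s := (`|rho u.1| + left_bound) * Num.min 1 (2 - 2 * t) in
  (pt th (- left_bound + m * (rho u.1 - s - - left_bound)) (m * hgt u.1),
   pt th (rho s0 + m * (rho u.2 - rho s0)) (hgt s0 + m * (hgt u.2 - hgt s0))).

Lemma left_bound_gt0 : 0 < left_bound.
Proof.
rewrite /left_bound; have : 0 <= \sum_a `|rho (pa a)| by apply: sumr_ge0.
have := normr_ge0 (rho s0); have := normr_ge0 e; lra.
Qed.

Lemma ctr0 u : ctr u 0 = base.
Proof.
rewrite /ctr /base mulr0; have -> : Num.min 1 (0 : R) = 0 by rewrite minElt ltr10.
by rewrite !mul0r !addr0 pt_rho_hgt.
Qed.

Let addrBK' (a b : R) : a + (b - a) = b.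
Proof. by rewrite addrC subrK. Qed.

Lemma ctr1 u : ctr u 1 = u.
Proof.
case: u => x s; rewrite /ctr !mulr1 subrr; have -> : Num.min 1 (0 : R) = 0 by rewrite minElt ltr10.
have -> : Num.min 1 (2 : R) = 1 by rewrite minElt ltr1n.
by rewrite !mul1r mulr0 subr0 !addrBK' !pt_rho_hgt.
Qed.

Lemma ctr_over u t : 0 < e -> omega_over u -> 0 <= t <= 1 -> omega_over (ctr u t).
Proof.
move=> e0 [[w1 w2] ou] t01; have L0 := left_bound_gt0.
have Wc : box th s0 e (ctr u t).2.
  rewrite /ctr /=; set m := Num.min _ _.
  have m01 : 0 <= m <= 1 by rewrite /m minElt; case: ifP => h; lra.
  have sc (a : R) : `|a| < e -> `|m * a| < e.
    rewrite normrM ger0_norm; last lra.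
    have := normr_ge0 a; nra.
  by split; rewrite ?rho_pt ?hgt_pt [_ + _ - _]addrC addKr; apply: sc.
split=> //.
have [t2|t2] := leP (2 * t) 1.
  move=> a _; rewrite [ctr u t]surjective_pairing; apply: left_boundP => //.
  rewrite /ctr /= rho_pt.
  have -> : Num.min 1 (2 * t) = 2 * t by apply/min_idPr.
  have -> : Num.min 1 (2 - 2 * t) = 1 by apply/min_idPl; lra.
  rewrite mulr1; have := ler_norm (rho u.1).
  have : 0 <= 2 * t by lra.
  nra.
have e1 : Num.min 1 (2 * t) = 1 by apply/min_idPl; lra.
have s0' : 0 <= Num.min 1 (2 - 2 * t) by rewrite minElt; case: ifP => h; lra.
have k : 0 <= (`|rho u.1| + left_bound) * Num.min 1 (2 - 2 * t).
  by apply: mulr_ge0 => //; have := normr_ge0 (rho u.1); lra.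
move=> a; have := ou a; rewrite /hh /rr /ctr e1 !mul1r /= !addrBK'.
by rewrite !pt_rho_hgt !hgtB !rhoB rho_pt hgt_pt => h /h; lra.
Qed.

Lemma ctr_cts : continuous (fun v : (C * C) * R => ctr v.1 v.2).
Proof.
have c1 : continuous (fun v : (C * C) * R => v.1) by move=> u; exact: cvg_fst.
have c2 : continuous (fun v : (C * C) * R => v.2) by move=> u; exact: cvg_snd.
have c11 (f : C -> R) : continuous f -> continuous (fun v : (C * C) * R => f v.1.1).
  move=> cf; apply: cts_comp cf; move=> u.
  by apply: (@continuous_comp _ _ _ fst fst u (c1 u)); exact: fst_cts.
have c12 (f : C -> R) : continuous f -> continuous (fun v : (C * C) * R => f v.1.2).
  move=> cf; apply: cts_comp cf; move=> u.
  by apply: (@continuous_comp _ _ _ fst snd u (c1 u)); exact: snd_cts.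
have cm : continuous (fun v : (C * C) * R => Num.min 1 (2 * v.2)).
  by apply: cts_min; [exact: cts_cst|apply: ctsM; [exact: cts_cst|exact: c2]].
have cs : continuous (fun v : (C * C) * R => Num.min 1 (2 - 2 * v.2)).
  apply: cts_min; first exact: cts_cst.
  by apply: ctsB; [exact: cts_cst|apply: ctsM; [exact: cts_cst|exact: c2]].
have cr := c11 _ (@rho_cts R th); have ch := c11 _ (@hgt_cts R th).
have cr2 := c12 _ (@rho_cts R th); have ch2 := c12 _ (@hgt_cts R th).
pose m (v : (C * C) * R) := Num.min 1 (2 * v.2).
have f1 : continuous (fun v : (C * C) * R => (ctr v.1 v.2).1).
  apply: (@cts_plane _ _ th).
    rewrite (_ : (fun v => _) = fun v => - left_bound + m v * (rho v.1.1 -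
      (`|rho v.1.1| + left_bound) * Num.min 1 (2 - 2 * v.2) - - left_bound)); last first.
      by apply/funext => v; rewrite /ctr /= rho_pt.
    apply: ctsD; first exact: cts_cst.
    apply: ctsM => //; apply: ctsB; last exact: cts_cst.
    apply: ctsB => //; apply: ctsM => //; apply: ctsD; last exact: cts_cst.
    exact: cts_norm.
  rewrite (_ : (fun v => _) = fun v => m v * hgt v.1.1); last first.
    by apply/funext => v; rewrite /ctr /= hgt_pt.
  exact: ctsM.
have f2 : continuous (fun v : (C * C) * R => (ctr v.1 v.2).2).
  apply: (@cts_plane _ _ th).
    rewrite (_ : (fun v => _) = fun v => rho s0 + m v * (rho v.1.2 - rho s0)); last first.
      by apply/funext => v; rewrite /ctr /= rho_pt.
    apply: ctsD; first exact: cts_cst.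
    by apply: ctsM => //; apply: ctsB => //; exact: cts_cst.
  rewrite (_ : (fun v => _) = fun v => hgt s0 + m v * (hgt v.1.2 - hgt s0)); last first.
    by apply/funext => v; rewrite /ctr /= hgt_pt.
  apply: ctsD; first exact: cts_cst.
  by apply: ctsM => //; apply: ctsB => //; exact: cts_cst.
move=> v; exact: (@cvg_pair _ _ _ (nbhs v) _ _ _ _ _ _ _ (f1 v) (f2 v)).
Qed.

Lemma ctr_near u t (Q : set (C * C)) : nbhs (ctr u t) Q ->
  exists A (d : R), [/\ nbhs u A, 0 < d &
    forall u' t', A u' -> `|t' - t| < d -> Q (ctr u' t')].
Proof.
move=> nQ; have [[/= A B] [nA /nbhs_ballP[d /= d0 dB]] AB] := @ctr_cts (u, t) _ nQ.
exists A, d; split=> // u' t' Au' tt'; apply: (AB (u', t')); split=> //=.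
by apply: dB; rewrite /ball /= distrC.
Qed.

Lemma omega_const T (c : C * C -> T) : 0 < e ->
  (forall u, omega_over u -> \forall u' \near u, c u' = c u) ->
  forall u v, omega_over u -> omega_over v -> c u = c v.
Proof.
move=> e0 lc u v.
suff h w : omega_over w -> c base = c w by move=> /h <- /h.
move=> ow; rewrite -[w in RHS]ctr1 -(ctr0 w).
apply: (@segment_const R 0 1 (fun t => c (ctr w 0) = c (ctr w t))) => //.
move=> t t01; have [A [d [nA d0 h]]] := ctr_near (lc _ (ctr_over e0 ow t01)).
have := nbhsx_ballx t d d0; apply: filterS => t' tt' _.
have -> : c (ctr w t') = c (ctr w t) by apply: h; [exact: nbhs_singleton|rewrite distrC].
by split=> ->.
Qed.

Lemma omega_over_near u : omega_over u -> \forall u' \near u, omega_over u'.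
Proof.
move=> [[w1 w2] ou]; have n1 := omega_near ou.
have cr2 : continuous (fun v : C * C => e - `|rho v.2 - rho s0|).
  apply: ctsB; first exact: cts_cst.
  apply: cts_norm; apply: ctsB; last exact: cts_cst.
  by apply: cts_comp; [exact: snd_cts|exact: rho_cts].
have ch2 : continuous (fun v : C * C => e - `|hgt v.2 - hgt s0|).
  apply: ctsB; first exact: cts_cst.
  apply: cts_norm; apply: ctsB; last exact: cts_cst.
  by apply: cts_comp; [exact: snd_cts|exact: hgt_cts].
have n2 := @cts_pos _ _ _ u cr2 _; have n3 := @cts_pos _ _ _ u ch2 _.
rewrite subr_gt0 in n2; rewrite subr_gt0 in n3.
near=> v; split; last by near: v.
split; rewrite -subr_gt0; first by near: v; exact: n2.
by near: v; exact: n3.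
Unshelve. all: by end_near. Qed.

Lemma base_over : 0 < e -> omega_over base.
Proof.
move=> e0; split; first by split; rewrite subrr normr0.
by move=> a _; apply: left_boundP; rewrite ?rho_pt//; split; rewrite subrr normr0.
Qed.

End Contraction.

Section LocallyConstant.
Variables (R : realType).
Local Notation C := (Cplx R).

Definition lc (V : Type) (c : C * C -> V) u := \forall u' \near u, c u' = c u.

Lemma lc_near (V : Type) (c : C * C -> V) u : lc c u -> \forall u' \near u, lc c u'.
Proof.
move=> h; have /near_join hh := h; near=> v.
have e : c v = c u by near: v.
have : \forall w \near v, c w = c u by near: v.
by apply: filterS => w ->.
Unshelve. all: by end_near. Qed.

Variable V : zmodType.
Implicit Types c d : C * C -> V.

Lemma lcD c d u : lc c u -> lc d u -> lc (c + d) u.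
Proof. by apply: filterS2 => v; rewrite !fctE => -> ->. Qed.
Lemma lcN c u : lc c u -> lc (- c) u.
Proof. by apply: filterS => v; rewrite !fctE => ->. Qed.
Lemma lcB c d u : lc c u -> lc d u -> lc (c - d) u.
Proof. by move=> h1 h2; apply: lcD => //; exact: lcN. Qed.
Lemma lc_cst (a : V) u : lc (fun=> a) u.
Proof. by rewrite /lc; near=> v. Unshelve. all: by end_near. Qed.
Lemma lc_eq (W : Type) (c d : C * C -> W) u : lc c u -> (\forall v \near u, c v = d v) -> lc d u.
Proof.
move=> h1 h2; have e := nbhs_singleton h2.
by apply: filterS2 h1 h2 => v h <-; rewrite h e.
Qed.

(** The first cohomology of the slit plane with constant coefficients vanishes: [t] is a cocycle of
    functions modulo locally constant ones, and continuation along the contraction provides a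
    primitive. *)
Lemma omega_lift th (I : finType) (pa : I -> C) (ea : I -> bool) (s0 : C) (e : R)
    (t : C * C -> C * C -> V) : 0 < e ->
  (forall u, omega_over th pa ea s0 e u ->
     \forall u' \near u, omega_over th pa ea s0 e u' -> lc (t u' - t u) u') ->
  exists c, forall u, omega_over th pa ea s0 e u -> lc (c - t u) u.
Proof.
move=> e0 ht; pose D := omega_over th pa ea s0 e.
have oD u : D u -> \forall u' \near u, D u' by exact: omega_over_near.
have ht' u : D u -> \forall u' \near u, lc (t u' - t u) u'.
  move=> Du; apply: filterS2 (oD _ Du) (ht _ Du) => u' Du'; exact.
have diff g g' z : lc (g - t z) z -> lc (g' - t z) z -> lc (g - g') z.
  move=> h1 h2; have -> : g - g' = (g - t z) - (g' - t z) by rewrite opprB addrA subrK.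
  exact: lcB.
apply: (@contraction_section R _ _ (fun g g' z => g z = g' z) (fun g z => lc (g - t z) z) D
  _ _ _ _ _ _ _ _ (ctr th pa s0 e) (base th pa s0 e) _ _ _ _ (t (base th pa s0 e))).
- by [].
- by [].
- by move=> g g' g'' z -> ->.
- move=> g g' z Dz h1 h2 E; apply: filterS (diff _ _ _ h1 h2) => v.
  by rewrite !fctE E subrr => /subr0_eq.
- move=> g g' z Dz h1 h2 E; apply: filterS (diff _ _ _ h1 h2) => v.
  by rewrite !fctE => h /eqP; rewrite -subr_eq0 h subr_eq0 => /eqP.
- move=> g z Dz h; apply: filterS2 (ht' _ Dz) (lc_near h) => v h1 h2.
  have -> : g - t v = (g - t z) - (t v - t z) by rewrite opprB addrA subrK.
  exact: lcB.
- move=> z Dz; exists [set v | lc (t v - t z) v]; first exact: ht'.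
  (* A primitive near [z] with a prescribed value at [z'] is [t z] corrected by a constant. *)
  move=> z' g h1 h2; exists (t z + (fun=> g z' - t z z')).
    by rewrite !fctE addrC subrK.
  move=> v hv; have -> : t z + (fun=> g z' - t z z') - t v = (fun=> g z' - t z z') - (t v - t z).
    apply/funext => w; rewrite !fctE; move: (g z' - t z z') => k.
    by rewrite opprB addrA (addrC (t z w)).
  by apply: lcB => //; exact: lc_cst.
(* The glued primitive takes at [z] the value there of the germ chosen at [z]. *)
- move=> h h1 h2; exists (fun z => h z z) => z Dz.
  apply: (lc_eq (h1 _ Dz)); apply: filterS2 (h2 _ Dz) (oD _ Dz) => v hv Dv.
  by rewrite !fctE hv.
- by move=> u r Du r01; exact: ctr_over.
- by move=> u Du; exact: ctr0.
- by move=> u Du; exact: ctr1.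
- by move=> u r Du r01 Q; exact: ctr_near.
- by rewrite subrr; exact: lc_cst.
Qed.

End LocallyConstant.

(** * Cochains on the slit plane and their coordinates *)

Module Cochains.

Section Data.
Variables (R : realType) (th : R) (I : finType) (K : fieldType) (n : nat).
Local Notation C := (Cplx R).
Local Notation V := 'rV[K]_n.
Variables (pa : I -> C) (ea : I -> bool) (B : I -> 'M[K]_n) (S : set C).
Variable sec : (C * C -> V) -> C * C -> Prop.
Local Notation rho := (rho th).
Local Notation hgt := (hgt th).
Local Notation pos := (pos pa ea).
Local Notation hh := (hh th pa ea).
Local Notation rr := (rr th pa ea).
Local Notation omega := (omega th pa ea).

Definition only_slit (a : I) (u : C * C) : Prop :=
  [/\ hh a u = 0, 0 < rr a u & forall b, b != a -> hh b u = 0 -> rr b u < 0].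

(** What is retained of a local system written in a trivialization off the slits: [sec c u] means
    that the coordinate function [c] is a section at [u]. By convention the points of a slit belong
    to its upper side, as [js_slit] tests [hh a u' < 0]. *)
Record jump_system : Prop := JumpSystem {
  js_open : forall s, S s -> \forall s' \near s, S s';
  js_inj : forall s, S s -> injective (pos^~ s);
  js_omega : forall c u, S u.2 -> omega u -> sec c u <-> lc c u;
  js_slit : forall c u a, S u.2 -> only_slit a u -> sec c u <->
    \forall u' \near u, c u' = if hh a u' < 0 then c u *m B a else c u;
  js_0 : forall u, sec 0 u;
  js_D : forall c d u, sec c u -> sec d u -> sec (c + d) u;
  js_Z : forall (k : K) c u, sec c u -> sec (k *: c) u
}.

Definition regular (u : C * C) : Prop := S u.2 /\ forall a, u.1 <> pos a u.2.

(** Complements of boxes, which form a basis of neighbourhoods of infinity. *)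
Definition far (b : R) (x : C) : Prop := b < `|rho x| \/ b < `|hgt x|.

(** Being a section, near the point [(b, s)] of [P^1 * S], of the direct image of the local system;
    [None] is the point at infinity. Only regular points are tested, because a direct image imposes
    no condition at the punctures. *)
Definition near_sec (m : C * C -> V) (b : option C) (s : C) : Prop :=
  match b with
  | Some x => \forall u \near (x, s), regular u -> sec m u
  | None => exists b : R, \forall s' \near s, forall x, far b x -> regular (x, s') -> sec m (x, s')
  end.

(** A cocycle in the style of the Godement resolution: [t b s] is an arbitrary function, considered
    modulo sections near [(b, s)], and its class varies continuously with the point. Such a family
    around a fibre represents a class of [R^1]. *)
Definition datum_at (t : option C -> C -> C * C -> V) (s : C) : Prop :=
  (forall x, \forall u \near (x, s), near_sec (t (Some u.1) u.2 - t (Some x) s) (Some u.1) u.2) /\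
  exists b : R, \forall s' \near s,
    (forall x, far b x -> near_sec (t (Some x) s' - t None s) (Some x) s') /\
    near_sec (t None s' - t None s) None s'.

Definition trivial_near (t : option C -> C -> C * C -> V) (s : C) : Prop :=
  exists m, \forall s' \near s, forall b, near_sec (m - t b s') b s'.

(** The affine map with linear part [B a] that fixes the entry of [v] at [a]. It tells how the
    difference between the datum and its lift changes from above to below the slit of [a]. *)
Definition afix (v : option I -> V) (a : I) (x : V) : V := v (Some a) + (x - v (Some a)) *m B a.

Definition off (s : C) : Prop := forall a b, hgt (pos a s) = hgt (pos b s) -> a = b.

(** Here [c] lifts the datum over the slit plane and each [g] lifts it near a puncture or near
    infinity. There [g - c] is constant off the slits, and these constants are the coordinates. *)
Definition coord_with (c : C * C -> V) (t : option C -> C -> C * C -> V) (s : C)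
    (v : option I -> V) : Prop :=
  exists e, [/\ 0 < e, forall s', box th s e s' -> S s' /\ datum_at t s',
    forall u, omega_over th pa ea s e u -> lc (c - t (Some u.1) u.2) u,
    forall a, exists2 g, near_sec (g - t (Some (pos a s)) s) (Some (pos a s)) s &
      \forall u \near (pos a s, s), omega u -> g u - c u = v (Some a) &
    exists2 g, near_sec (g - t None s) None s &
      exists b, \forall s' \near s, forall x, rho x < - b -> g (x, s') - c (x, s') = v None].

Definition coord t s v : Prop := exists c, coord_with c t s v.

Hypothesis J : jump_system.

Lemma near_sec0 b s : near_sec 0 b s.
Proof.
case: b => [x|] /=; first by near=> u => _; exact: (js_0 J).
by exists 0; near=> s' => x _ _; exact: (js_0 J).
Unshelve. all: by end_near. Qed.

Lemma near_secD m m' b s : near_sec m b s -> near_sec m' b s -> near_sec (m + m') b s.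
Proof.
case: b => [x|] /=.
  by apply: filterS2 => u h1 h2 tu; apply: (js_D J); [exact: h1|exact: h2].
move=> [b1 h1] [b2 h2]; exists (Num.max b1 b2).
apply: filterS2 h1 h2 => s' h1 h2 x fx tx; apply: (js_D J).
  by apply: h1 => //; case: fx; rewrite gt_max => /andP[] *; [left|right].
by apply: h2 => //; case: fx; rewrite gt_max => /andP[] *; [left|right].
Qed.

Lemma near_secZ k m b s : near_sec m b s -> near_sec (k *: m) b s.
Proof.
case: b => [x|] /=; first by apply: filterS => u h tu; apply: (js_Z J); exact: h.
by move=> [b h]; exists b; apply: filterS h => s' h x fx tx; apply: (js_Z J); exact: h.
Qed.

Lemma near_secB m m' b s : near_sec m b s -> near_sec m' b s -> near_sec (m - m') b s.
Proof. by move=> h1 h2; apply: near_secD => //; rewrite -scaleN1r; exact: near_secZ. Qed.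

Lemma near_sec_at m x s : near_sec m (Some x) s -> regular (x, s) -> sec m (x, s).
Proof. by move=> /nbhs_singleton. Qed.

Lemma near_sec_open m x s : near_sec m (Some x) s ->
  \forall u \near (x, s), near_sec m (Some u.1) u.2.
Proof. by move=> /near_join; apply: filterS => -[]. Qed.

Lemma near_sec_open_oo m s : near_sec m None s -> \forall s' \near s, near_sec m None s'.
Proof. by move=> [b /near_join h]; apply: filterS h => s' h; exists b. Qed.

Lemma regular_omega u : S u.2 -> omega u -> regular u.
Proof.
move=> Su ou; split=> // a e.
have := ou a; rewrite /hh /rr e subrr hgt0 rho0 => /(_ erefl); rewrite ltxx //.
Qed.

Lemma regular_slit a u : S u.2 -> only_slit a u -> regular u.
Proof.
move=> Su [h r ob]; split=> // b e.
have [ba|ba] := eqVneq b a.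
  by move: r; rewrite /rr -ba e subrr rho0 ltxx.
by have := ob b ba; rewrite /hh /rr e subrr hgt0 rho0 => /(_ erefl); rewrite ltxx.
Qed.

Lemma near_sec_lc m u : near_sec m (Some u.1) u.2 -> S u.2 -> omega u -> lc m u.
Proof.
case: u => x s ns Ss ou; apply/(js_omega J) => //; apply: near_sec_at ns _.
exact: regular_omega.
Qed.

Lemma near_sec_slit m u a : near_sec m (Some u.1) u.2 -> S u.2 -> only_slit a u ->
  \forall u' \near u, m u' = if hh a u' < 0 then m u *m B a else m u.
Proof.
case: u => x s ns Ss ou; apply/(js_slit J) => //; apply: near_sec_at ns _.
exact: regular_slit ou.
Qed.

Lemma near_sec_pointwise t s b m : S s -> datum_at t s ->
  (\forall s' \near s, forall x, regular (x, s') -> sec (m - t (Some x) s') (x, s')) ->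
  near_sec (m - t b s) b s.
Proof.
move=> Ss [d1 [bd d2]] h; case: b => [x|] /=.
  have h' : \forall u \near (x, s), forall x', regular (x', u.2) -> sec (m - t (Some x') u.2) (x', u.2).
    exact: (cvg_snd h).
  apply: filterS2 h' (d1 x) => -[x' s'] /= h1 h2 tu.
  have -> : m - t (Some x) s = (m - t (Some x') s') + (t (Some x') s' - t (Some x) s) by rewrite addrA subrK.
  by apply: (js_D J); [exact: h1|exact: near_sec_at h2 tu].
exists bd; apply: filterS2 h d2 => s' h1 [h2 _] x fx tu.
have -> : m - t None s = (m - t (Some x) s') + (t (Some x) s' - t None s) by rewrite addrA subrK.
by apply: (js_D J); [exact: h1|exact: near_sec_at (h2 _ fx) tu].
Qed.

Lemma datum_lift t s0 : S s0 -> (\forall s \near s0, datum_at t s) ->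
  exists e c, [/\ 0 < e, forall s', box th s0 e s' -> S s' /\ datum_at t s' &
    forall u, omega_over th pa ea s0 e u -> lc (c - t (Some u.1) u.2) u].
Proof.
move=> Ss0 dt; have [e e0 he] : exists2 e : R, 0 < e & forall s', box th s0 e s' -> S s' /\ datum_at t s'.
  by apply/nbhs_box; apply: filterS2 (js_open J Ss0) dt => s'.
suff /(omega_lift e0)[c hc] : forall u, omega_over th pa ea s0 e u -> \forall u' \near u,
    omega_over th pa ea s0 e u' -> lc (t (Some u'.1) u'.2 - t (Some u.1) u.2) u'.
  by exists e, c; split.
move=> [x s] [/= bs ou]; have [_ [d1 _]] := he _ bs.
apply: filterS (d1 x) => u' ns [bs' ou']; apply: near_sec_lc => //.
by have [] := he _ bs'.
Qed.

Lemma pos_cts a : continuous (pos a).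
Proof.
rewrite /pos; case: (ea a) => s; last exact: (@cst_continuous C C).
by apply: (@cvgD _ C C (nbhs s) (nbhs_filter s)); [exact: cvg_cst|exact: cvg_id].
Qed.

Lemma cvg_pos a s (P : set (C * C)) : (\forall u \near (pos a s, s), P u) ->
  \forall s' \near s, P (pos a s', s').
Proof.
by move=> nP; apply: (@cvg_pair _ _ _ (nbhs s) (nbhs (pos a s)) (nbhs s) _ _ _ _ id _ _ _ nP); [exact: pos_cts|exact: cvg_id].
Qed.

Lemma box_box s e s' : box th s e s' -> exists2 e' : R, 0 < e' & forall s'', box th s' e' s'' -> box th s e s''.
Proof.
move=> [h1 h2]; exists (Num.min (e - `|rho s' - rho s|) (e - `|hgt s' - hgt s|)).
  by rewrite lt_min !subr_gt0 h1 h2.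
move=> s'' [k1 k2]; move: k1 k2; rewrite !lt_min => /andP[k1 _] /andP[_ k2].
split; first by have := ler_distD (rho s') (rho s'') (rho s); lra.
by have := ler_distD (hgt s') (hgt s'') (hgt s); lra.
Qed.

(** The same [c] and the same local lifts serve for all nearby [s], so the coordinates are locally
    constant in [s]. *)
Lemma coord_with_near c t s v : coord_with c t s v -> \forall s' \near s, coord_with c t s' v.
Proof.
move=> [e [e0 hS hc ha [goo ns [b hb]]]].
have [Ss [d1 [bd d2]]] : S s /\ datum_at t s by apply: hS; split; rewrite subrr normr0.
have hA : \forall s' \near s, forall a, exists2 g,
    near_sec (g - t (Some (pos a s')) s') (Some (pos a s')) s' &
    \forall u \near (pos a s', s'), omega u -> g u - c u = v (Some a).
  apply: near_forall => a; have [g ng hg] := ha a.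
  have n1 := cvg_pos (near_sec_open ng).
  have n2 := cvg_pos (near_join hg).
  have n3 := cvg_pos (d1 (pos a s)).
  near=> s'; exists g; last by near: s'.
  have -> : g - t (Some (pos a s')) s' = (g - t (Some (pos a s)) s) - (t (Some (pos a s')) s' - t (Some (pos a s)) s).
    by rewrite opprB addrA subrK.
  by apply: near_secB; [exact: (near n1 s')|exact: (near n3 s')].
have nb := box_nbhs th s e0.
have noo := near_sec_open_oo ns; have hb' := near_join hb.
near=> s'; have bs' : box th s e s' by near: s'.
have [e' e'0 he'] := box_box bs'.
exists e'; split=> //.
- by move=> s'' /he' /hS.
- by move=> u [/he' ? ?]; apply: hc; split.
- by near: s'.
exists goo; last by exists b; near: s'.
have -> : goo - t None s' = (goo - t None s) - (t None s' - t None s) by rewrite opprB addrA subrK.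
apply: near_secB; first by near: s'.
by have [] := near d2 s'.
Unshelve. all: by end_near. Qed.

Lemma coord_near t s v : coord t s v -> \forall s' \near s, coord t s' v.
Proof. by move=> [c /coord_with_near]; apply: filterS => s' h; exists c. Qed.

Lemma coord_lin k t t' s v v' : coord t s v -> coord t' s v' ->
  coord (fun b s => k *: t b s + t' b s) s (fun a => k *: v a + v' a).
Proof.
have lin (f f' g g' : C * C -> V) : k *: f + f' - (k *: g + g') = k *: (f - g) + (f' - g').
  by rewrite scalerBr opprD addrACA.
move=> [c [e [e0 hS hc ha [goo ns [b hb]]]]] [c' [e' [e'0 hS' hc' ha' [goo' ns' [b' hb']]]]].
exists (k *: c + c'), (Num.min e e').
have sub s' : box th s (Num.min e e') s' -> box th s e s' /\ box th s e' s'.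
  by move=> [k1 k2]; move: k1 k2; rewrite !lt_min => /andP[? ?] /andP[? ?]; split.
split.
- by rewrite lt_min e0.
- move=> s' /sub[/hS[Ss [d1 [bd d2]]] /hS'[_ [d1' [bd' d2']]]]; split=> //; split.
    move=> x; apply: filterS2 (d1 x) (d1' x) => u h1 h2.
    by rewrite lin; apply: near_secD => //; exact: near_secZ.
  exists (Num.max bd bd'); apply: filterS2 d2 d2' => s'' [h1 h2] [h1' h2']; split.
    move=> x fx; rewrite lin; apply: near_secD.
      apply: near_secZ; apply: h1; case: fx; rewrite gt_max => /andP[] *; [left|right] => //.
    by apply: h1'; case: fx; rewrite gt_max => /andP[] *; [left|right].
  by rewrite lin; apply: near_secD => //; exact: near_secZ.
- move=> u [/sub[b1 b2] ou]; rewrite lin; apply: lcD.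
    have := hc u (conj b1 ou); apply: filterS => w h.
    by rewrite !fctE in h *; rewrite h.
  by apply: hc'; split.
- move=> a; have [g ng hg] := ha a; have [g' ng' hg'] := ha' a.
  exists (k *: g + g'); first by rewrite lin; apply: near_secD => //; exact: near_secZ.
  apply: filterS2 hg hg' => u h1 h2 ou.
  by rewrite -(h1 ou) -(h2 ou) !fctE scalerBr opprD addrACA.
exists (k *: goo + goo').
  by rewrite lin; apply: near_secD => //; exact: near_secZ.
exists (Num.max b b'); apply: filterS2 hb hb' => s' h1 h2 x hx.
have x1 : rho x < - b by apply: lt_le_trans hx _; rewrite lerN2 le_max lexx.
have x2 : rho x < - b' by apply: lt_le_trans hx _; rewrite lerN2 le_max lexx orbT.
by rewrite -(h1 x x1) -(h2 x x2) !fctE scalerBr opprD addrACA.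
Qed.

End Data.

End Cochains.
Export Cochains.

Lemma subr_subl (V : zmodType) (x y z : V) : (x - z) - (x - y) = y - z.
Proof. by rewrite opprB addrC addrA subrK. Qed.

(** * Jumps of a lift across a slit *)

Section Cross.
Variables (R : realType) (th : R) (I : finType) (K : fieldType) (n : nat).
Local Notation C := (Cplx R).
Local Notation V := 'rV[K]_n.
Variables (pa : I -> C) (ea : I -> bool) (B : I -> 'M[K]_n) (S : set C).
Variable sec : (C * C -> V) -> C * C -> Prop.
Local Notation rho := (rho th).
Local Notation hgt := (hgt th).
Local Notation pos := (pos pa ea).
Local Notation hh := (hh th pa ea).
Local Notation rr := (rr th pa ea).
Local Notation omega := (omega th pa ea).
Local Notation only_slit := (only_slit th pa ea).
Local Notation near_sec := (near_sec th pa ea S sec).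
Local Notation datum_at := (datum_at th pa ea S sec).

Definition away (a : I) (u : C * C) : Prop := forall b, b != a -> hh b u = 0 -> rr b u < 0.

Lemma away_near a u : away a u -> \forall u' \near u, away a u'.
Proof.
move=> h; apply: near_forall => b; have [->|ba] := eqVneq b a.
  by near=> u' => /eqP.
have [h0|h0] := eqVneq (hh b u) 0.
  by have := cts_neg (@rr_cts R th I pa ea b) (h _ ba h0); apply: filterS => w hw _.
have : `|hh b u| > 0 by rewrite normr_gt0.
move=> /(cts_pos (cts_norm (@hh_cts R th I pa ea b))); apply: filterS => w.
by rewrite normr_gt0 => /eqP.
Unshelve. all: by end_near. Qed.

Lemma away_omega a u : away a u -> omega u <-> (hh a u <> 0 \/ rr a u < 0).
Proof.
move=> h; split=> [ou|hr b hb].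
  by have [h0|/eqP] := eqVneq (hh a u) 0; [right; exact: ou|left].
by have [ba|] := eqVneq b a; [subst b; case: hr|move/h; exact].
Qed.

Definition shiftl (u : C * C) (r : R) : C * C := (u.1 - pt th r 0, u.2).

Lemma hh_shiftl a u r : hh a (shiftl u r) = hh a u.
Proof. by rewrite /hh /shiftl /= !hgtB hgt_pt subr0. Qed.
Lemma rr_shiftl a u r : rr a (shiftl u r) = rr a u - r.
Proof. by rewrite /rr /shiftl /= !rhoB rho_pt; lra. Qed.

Lemma shiftl_near (a : I) (b0 : C * C) (Q : set (C * C)) : rr a b0 = 0 -> nbhs b0 Q ->
  \forall u \near b0, exists r, [/\ 0 <= r, rr a (shiftl u r) < 0 & Q (shiftl u r)].
Proof.
move=> r0 /(nbhs_box2 th)[e e0 eQ].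
have n1 : \forall u \near b0, box th b0.1 (e / 2) u.1 /\ box th b0.2 (e / 2) u.2.
  by apply/(nbhs_box2 th); exists (e / 2); rewrite ?divr_gt0.
have n2 : \forall u \near b0, 0 < e / 4 - rr a u.
  apply: cts_pos; last by rewrite r0 subr0 divr_gt0.
  by apply: ctsB; [exact: cts_cst|exact: rr_cts].
apply: filterS2 n1 n2 => u [[h1 h2] [h3 h4]] h5; exists (e / 4); split; first lra.
  by rewrite rr_shiftl; lra.
apply: eQ; split=> /=; rewrite ?rhoB ?hgtB ?rho_pt ?hgt_pt; move: h1 h2 h3 h4; rewrite !ltr_norml => /andP[? ?] /andP[? ?] /andP[? ?] /andP[? ?]; apply/andP; split; lra.
Qed.

(** Near its tip, the complement of a slit is covered by three half planes: above, below and to the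
    left. [f] is constant on each of them, and a shift to the left links the first two with the
    third; this is why [A] has to be stable under such shifts. *)
Lemma tip_const T (A : set (C * C)) (f : C * C -> T) a (b0 : C * C) : rr a b0 = 0 -> segconvex A ->
  (forall u r, 0 <= r -> A u -> A (shiftl u r)) ->
  (\forall u \near b0, A u -> (hh a u <> 0 \/ rr a u < 0) -> lc f u) ->
  exists k, \forall u \near b0, A u -> (hh a u <> 0 \/ rr a u < 0) -> f u = k.
Proof.
move=> r0 cA sA h.
have sub (A' : set (C * C)) : segconvex A' -> (forall u, A' u -> hh a u <> 0 \/ rr a u < 0) ->
    exists k, \forall u \near b0, (A `&` A') u -> f u = k.
  move=> cA' hA'; apply: near_const (segconvexI cA cA') _ (f b0).
  by apply: filterS h => u hu [Au A'u]; apply: hu => //; exact: hA'.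
have [|k1 n1] := sub _ (@hh_half R th I pa ea a _ (@half_pos R)).
  by move=> u /= hu; left => e; rewrite e ltxx in hu.
have [|k2 n2] := sub _ (@hh_half R th I pa ea a _ (@half_neg R)).
  by move=> u /= hu; left => e; rewrite e ltxx in hu.
have [|k3 n3] := sub _ (@rr_half R th I pa ea a _ (@half_neg R)); first by move=> u /= hu; right.
have nn : \forall u \near b0, [/\ A u -> 0 < hh a u -> f u = k1,
    A u -> hh a u < 0 -> f u = k2 & A u -> rr a u < 0 -> f u = k3].
  by apply: filterS3 n1 n2 n3 => u h1 h2 h3; split=> ? ?; [apply: h1|apply: h2|apply: h3].
have ns := shiftl_near r0 nn.
exists k3; apply: filterS2 nn ns => u [m1 m2 m3] [r [r_ge0 rl [q1 q2 q3]]] Au hu.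
have As := sA _ _ r_ge0 Au.
have [hr|hr] := ltP (rr a u) 0; first exact: m3.
case: hu => [/eqP|]; last by rewrite ltNge hr.
rewrite neq_lt => /orP[hn|hp].
  by rewrite m2// -q2 ?q3// hh_shiftl.
by rewrite m1// -q1 ?q3// hh_shiftl.
Qed.

Lemma up_ex (a : I) (u : C * C) (Q : set (C * C)) : hh a u = 0 -> nbhs u Q -> exists2 u', Q u' & 0 < hh a u'.
Proof.
move=> h0 /(nbhs_box2 th)[e e0 eQ]; exists (u.1 + pt th 0 (e / 2), u.2).
  apply: eQ; rewrite /box /=; last by rewrite !subrr normr0.
  by rewrite rhoD hgtD rho_pt hgt_pt addr0 subrr normr0 addrC addKr gtr0_norm ?divr_gt0//; split=> //; lra.
by move: h0; rewrite /hh /= !hgtB hgtD hgt_pt; lra.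
Qed.
Lemma down_ex (a : I) (u : C * C) (Q : set (C * C)) : hh a u = 0 -> nbhs u Q -> exists2 u', Q u' & hh a u' < 0.
Proof.
move=> h0 /(nbhs_box2 th)[e e0 eQ]; exists (u.1 + pt th 0 (- (e / 2)), u.2).
  apply: eQ; rewrite /box /=; last by rewrite !subrr normr0.
  rewrite rhoD hgtD rho_pt hgt_pt addr0 subrr normr0 addrC addKr normrN gtr0_norm ?divr_gt0//; split=> //; lra.
by move: h0; rewrite /hh /= !hgtB hgtD hgt_pt; lra.
Qed.

Definition jump a (k l : V) (f : C * C -> V) (u : C * C) :=
  \forall u' \near u, (0 < hh a u' -> f u' = k) /\ (hh a u' < 0 -> f u' = l).

Lemma jump_uniq a k l k' l' f (u : C * C) : hh a u = 0 -> jump a k l f u -> jump a k' l' f u -> k = k' /\ l = l'.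
Proof.
move=> h0 j j'; split.
  by have [w [[h1 _] [h2 _]] hw] := up_ex h0 (filterI j j'); rewrite -h1// -h2.
by have [w [[_ h1] [_ h2]] hw] := down_ex h0 (filterI j j'); rewrite -h1// -h2.
Qed.

Lemma jump_open a k l f u : jump a k l f u -> \forall u' \near u, jump a k l f u'.
Proof. exact: near_join. Qed.

Lemma jumpD a k l k' l' f f' u : jump a k l f u -> jump a k' l' f' u -> jump a (k + k') (l + l') (f + f') u.
Proof.
apply: filterS2 => w [h1 h2] [h1' h2']; split=> hw; rewrite !fctE.
  by rewrite h1// h1'.
by rewrite h2// h2'.
Qed.

Lemma jump_ex a f (u : C * C) : (\forall u' \near u, hh a u' <> 0 -> lc f u') -> exists k l, jump a k l f u.
Proof.
move=> h.
have [k nk] : exists k, \forall u' \near u, [set u | 0 < hh a u] u' -> f u' = k.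
  apply: near_const (@hh_half R th I pa ea a _ (@half_pos R)) _ (f u).
  by apply: filterS h => w hw /= h0; apply: hw => e; rewrite e ltxx in h0.
have [l nl] : exists k, \forall u' \near u, [set u | hh a u < 0] u' -> f u' = k.
  apply: near_const (@hh_half R th I pa ea a _ (@half_neg R)) _ (f u).
  by apply: filterS h => w hw /= h0; apply: hw => e; rewrite e ltxx in h0.
by exists k, l; apply: filterS2 nk nl => w.
Qed.

Hypothesis J : jump_system th pa ea B S sec.

Lemma near_sec_jump m u a : near_sec m (Some u.1) u.2 -> S u.2 -> only_slit a u ->
  jump a (m u) (m u *m B a) m u.
Proof.
move=> ns Su os; have := near_sec_slit J ns Su os; apply: filterS => w ->.
by split=> [h|->//]; rewrite ltNge ltW.
Qed.

Variables (t : option C -> C -> C * C -> V) (s0 : C) (e : R) (c : C * C -> V).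
Hypothesis e_gt0 : 0 < e.
Hypothesis tS : forall s', box th s0 e s' -> S s' /\ datum_at t s'.
Hypothesis c_lift : forall u, omega_over th pa ea s0 e u -> lc (c - t (Some u.1) u.2) u.

Let box_open (x s : C) : box th s0 e s -> \forall u \near (x, s), box th s0 e u.2.
Proof.
move=> bs; have [e' e'0 he'] := box_box bs.
by apply/(nbhs_box2 th); exists e' => // u _ /he'.
Qed.

Lemma lift_sec g (x s : C) : box th s0 e s -> near_sec (g - t (Some x) s) (Some x) s ->
  \forall u \near (x, s), near_sec (g - t (Some u.1) u.2) (Some u.1) u.2.
Proof.
move=> bs ns; have [_ [d1 _]] := tS bs.
apply: filterS2 (near_sec_open ns) (d1 x) => u h1 h2.
have -> : g - t (Some u.1) u.2 = (g - t (Some x) s) - (t (Some u.1) u.2 - t (Some x) s).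
  by rewrite opprB addrA subrK.
exact: (near_secB J).
Qed.

Lemma lift_lc g (x s : C) : box th s0 e s -> near_sec (g - t (Some x) s) (Some x) s ->
  \forall u \near (x, s), omega u -> lc (g - c) u.
Proof.
move=> bs ns; apply: filterS2 (lift_sec bs ns) (box_open x bs) => -[x' s'] h1 h2 /= ou.
have -> : g - c = (g - t (Some x') s') - (c - t (Some x') s') by rewrite opprB addrA subrK.
apply: lcB; last by apply: (@c_lift (x', s')).
by apply: (near_sec_lc J (u := (x', s'))) => //; have [] := tS h2.
Qed.

Lemma near_sec_self (x s : C) : near_sec (t (Some x) s - t (Some x) s) (Some x) s.
Proof. by rewrite subrr; exact: (near_sec0 J). Qed.

Lemma only_slit_near a u : only_slit a u ->
  \forall u' \near u, (hh a u' <> 0 -> omega u') /\ (hh a u' = 0 -> only_slit a u').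
Proof.
move=> [h r aw]; apply: filterS2 (away_near aw) (cts_pos (@rr_cts R th I pa ea a) r) => w aw' r'.
by split=> [h'|h']; [apply/(away_omega aw'); left|split].
Qed.

Section Along.
Variables (s : C) (a : I) (va : V) (g : C * C -> V).
Hypothesis bs : box th s0 e s.
Hypothesis ng : near_sec (g - t (Some (pos a s)) s) (Some (pos a s)) s.
Hypothesis hg : \forall u \near (pos a s, s), omega u -> g u - c u = va.

Let bp (y : R) : C * C := (pt th y (hgt (pos a s)), s).

Let bp_near y (Q : set (C * C)) : nbhs (bp y) Q -> \forall y' \near y, Q (bp y').
Proof.
move=> /(nbhs_box2 th)[d d0 dQ]; have := nbhsx_ballx y d d0.
apply: filterS => y' hy; apply: dQ; last by split; rewrite subrr normr0.
by split; rewrite /= ?rho_pt ?hgt_pt ?subrr ?normr0// distrC.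
Qed.

Let P y := exists k, jump a k (va + (k - va) *m B a) (t (Some (bp y).1) s - c) (bp y).

(** Near the tip, [t - c] equals [(g - c) - (g - t)], where [g - c] is the constant [va] and [g - t]
    is a section, multiplied by [B a] below the slit; the affine rule follows. Farther along the
    slit the data at neighbouring points differ by a section, which respects the rule. *)
Lemma cross x : only_slit a (x, s) ->
  exists k, jump a k (va + (k - va) *m B a) (t (Some x) s - c) (x, s).
Proof.
move=> [h0 r0 aw].
have hx : hgt x = hgt (pos a s) by move: h0; rewrite /hh hgtB => /subr0_eq.
have bX : bp (rho x) = (x, s) by rewrite /bp -hx pt_rho_hgt.
have Ss : S s by have [] := tS bs.
have rx : rho (pos a s) < rho x by move: r0; rewrite /rr rhoB; lra.
have osl y : rho (pos a s) < y -> y <= rho x -> only_slit a (bp y).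
  move=> y1 y2; split.
  - by rewrite /hh hgtB hgt_pt subrr.
  - by rewrite /rr rhoB rho_pt; lra.
  move=> b ba hb; have := aw b ba; rewrite /hh /rr /= hgtB hx rhoB => h.
  have := h _; rewrite /hh hgtB hgt_pt in hb; move/(_ hb); rewrite rhoB rho_pt; lra.
suff : P (rho x) by rewrite /P bX.
have loc y : rho (pos a s) < y <= rho x -> \forall y' \near y, rho (pos a s) < y' <= rho x -> P y' <-> P y.
  move=> /andP[y1 y2]; have oy := osl _ y1 y2.
  have nl := lift_lc bs (near_sec_self (bp y).1 s).
  have [|k [l jkl]] := @jump_ex a (t (Some (bp y).1) s - c) (bp y).
    apply: filterS2 nl (only_slit_near oy) => w h1 [h2 _] /h2; exact: h1.
  have ns := lift_sec bs (near_sec_self (bp y).1 s).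
  have n1 := bp_near ns; have n2 := bp_near (jump_open jkl).
  near=> y' => /andP[y1' y2'].
  have j1 : jump a k l (t (Some (bp y).1) s - c) (bp y') by near: y'.
  have ns' : near_sec (t (Some (bp y).1) s - t (Some (bp y').1) s) (Some (bp y').1) s by near: y'.
  have j2 := near_sec_jump (u := bp y') ns' Ss (osl _ y1' y2').
  set d := (_ - _) in j2.
  have j3 : jump a (k - d (bp y')) (l - d (bp y') *m B a) (t (Some (bp y').1) s - c) (bp y').
    apply: filterS2 j1 j2 => w [h1 h2] [h3 h4].
    have e1 : (t (Some (bp y').1) s - c) w = (t (Some (bp y).1) s - c) w - d w.
      by rewrite /d !fctE subr_subl.
    by split=> hw; rewrite e1; [rewrite h1// h3|rewrite h2// h4].
  have hPy : P y <-> l = va + (k - va) *m B a.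
    split=> [[k' jk]|e1]; last by exists k; rewrite -e1.
    have h0y : hh a (bp y) = 0 by case: oy.
    by have [-> ->] := jump_uniq h0y jkl jk.
  have h0y' : hh a (bp y') = 0 by have [] := osl _ y1' y2'.
  rewrite hPy; split=> [[k' jk]|e1].
    have [<- /eqP] := jump_uniq h0y' j3 jk.
    by rewrite subr_eq => /eqP ->; rewrite -addrA -mulmxDl addrAC subrK.
  exists (k - d (bp y')).
  suff <- : l - d (bp y') *m B a = va + (k - d (bp y') - va) *m B a by [].
  by rewrite e1 (addrAC k (- d (bp y'))) (mulmxBl (k - va)) addrA.
have start : \forall y \near rho (pos a s), rho (pos a s) < y <= rho x -> P y.
  have b0 : bp (rho (pos a s)) = (pos a s, s) by rewrite /bp pt_rho_hgt.
  have := lift_sec bs ng; rewrite -b0 => /bp_near n1.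
  have := near_join hg; rewrite -b0 => /bp_near n2.
  near=> y => /andP[y1 y2].
  have oy := osl _ y1 y2.
  have ns : near_sec (g - t (Some (bp y).1) s) (Some (bp y).1) s by near: y.
  have j1 := near_sec_jump (u := bp y) ns Ss oy.
  set d := (_ - _) in j1.
  have hgy : \forall u \near bp y, omega u -> g u - c u = va by near: y.
  exists (va - d (bp y)).
  apply: filterS2 (filterI hgy j1) (only_slit_near oy) => w [h1 [h2 h3]] [h4 _].
  have e1 : (t (Some (bp y).1) s - c) w = (g w - c w) - d w.
    by rewrite /d !fctE subr_subl.
  split=> hw; have ow : omega w by apply: h4 => e'; rewrite e' ltxx in hw.
    by rewrite e1 h1// h2.
  by rewrite e1 h1// h3// addrAC subrr add0r mulNmx.
(* The rule makes sense only strictly to the right of the tip, so the propagation starts from a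
   point close to it. *)
have [y [y1 y2 Py]] : exists y, [/\ rho (pos a s) < y, y <= rho x & P y].
  have /nbhs_ballP[d /= d0 hd] := start.
  exists (Num.min (rho x) (rho (pos a s) + d / 2)).
  have h1 : rho (pos a s) < Num.min (rho x) (rho (pos a s) + d / 2) by rewrite lt_min rx; lra.
  have h2 : Num.min (rho x) (rho (pos a s) + d / 2) <= rho x by rewrite ge_min lexx.
  split=> //; apply: hd; last by rewrite h1.
  rewrite /ball /= distrC ger0_norm ?subr_ge0 ?(ltW h1)//.
  have : Num.min (rho x) (rho (pos a s) + d / 2) <= rho (pos a s) + d / 2 by rewrite ge_min lexx orbT.
  lra.
apply: (segment_const y2 _ Py) => y' y'b.
have := loc y' _; have -> : rho (pos a s) < y' <= rho x by lra.
move=> /(_ isT); apply: filterS => y'' h y''b; apply: h; lra.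
Unshelve. all: by end_near. Qed.

End Along.

End Cross.

(** * Existence of coordinates and recognition of trivial classes *)

Section Coordinates.
Variables (R : realType) (th : R) (I : finType) (K : fieldType) (n : nat).
Local Notation C := (Cplx R).
Local Notation V := 'rV[K]_n.
Variables (pa : I -> C) (ea : I -> bool) (B : I -> 'M[K]_n) (S : set C).
Variable sec : (C * C -> V) -> C * C -> Prop.
Local Notation rho := (rho th).
Local Notation hgt := (hgt th).
Local Notation pos := (pos pa ea).
Local Notation hh := (hh th pa ea).
Local Notation rr := (rr th pa ea).
Local Notation omega := (omega th pa ea).
Local Notation only_slit := (only_slit th pa ea).
Local Notation near_sec := (near_sec th pa ea S sec).
Local Notation datum_at := (datum_at th pa ea S sec).
Local Notation coord := (coord th pa ea S sec).
Local Notation coord_with := (coord_with th pa ea S sec).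
Local Notation off := (off th pa ea).
Local Notation away := (away th pa ea).
Local Notation regular := (regular pa ea S).
Local Notation jump := (jump th pa ea).
Hypothesis J : jump_system th pa ea B S sec.

Lemma off_away a s : off s -> away a (pos a s, s).
Proof.
move=> os b ba; rewrite /hh /= hgtB => /subr0_eq h.
by move: ba; rewrite (os a b h) eqxx.
Qed.

Lemma off_only_slit a x s : off s -> hh a (x, s) = 0 -> 0 < rr a (x, s) -> only_slit a (x, s).
Proof.
move=> os h r; split=> // b ba hb; move: h hb; rewrite /hh /= !hgtB => /subr0_eq h /subr0_eq hb.
by move: ba; rewrite (os a b) ?eqxx// -h.
Qed.

Lemma off_regular x s : off s -> regular (x, s) -> omega (x, s) \/ exists a, only_slit a (x, s).
Proof.
move=> os [Ss ne]; have [ou|nou] := pselect (omega (x, s)); [by left|right].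
have [a ha] : exists a, ~ (hh a (x, s) = 0 -> rr a (x, s) < 0) by apply/existsNP.
move/not_implyP: ha => [h0 /negP]; rewrite -leNgt le_eqVlt => /orP[/eqP r0|r0].
  exfalso; apply: (ne a); apply: (plane_eq (th := th)).
    by move: r0; rewrite /rr rhoB => /esym/subr0_eq.
  by move: h0; rewrite /hh hgtB => /subr0_eq.
by exists a; exact: off_only_slit.
Qed.

Lemma off_near s : off s -> \forall s' \near s, off s'.
Proof.
move=> os; suff : \forall s' \near s, forall a b, a != b -> hgt (pos a s') <> hgt (pos b s').
  by apply: filterS => s' h a b e; apply: contrapT => /eqP /h.
apply: near_forall => a; apply: near_forall => b.
have [->|ab] := eqVneq a b; first by near=> s' => /eqP.
have cab : continuous (fun s' => `|hgt (pos a s') - hgt (pos b s')|).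
  by apply: cts_norm; apply: ctsB; apply: cts_comp; [exact: pos_cts|exact: hgt_cts|exact: pos_cts|exact: hgt_cts].
have h : 0 < `|hgt (pos a s) - hgt (pos b s)|.
  by rewrite normr_gt0 subr_eq0; apply: contra ab => /eqP/os ->.
have := cts_pos cab h; apply: filterS => s' + _ e.
by rewrite e subrr normr0 ltxx.
Unshelve. all: by end_near. Qed.

Lemma only_slit_uniq a b u : only_slit a u -> only_slit b u -> a = b.
Proof.
move=> [ha ra aa] [hb rb ab]; apply/eqP; apply: contraT => ne.
by have := ab _ ne ha; rewrite ltNge ltW.
Qed.

Section Lift.
Variables (t : option C -> C -> C * C -> V) (s0 : C) (e : R) (c : C * C -> V).
Hypothesis e_gt0 : 0 < e.
Hypothesis tS : forall s', box th s0 e s' -> S s' /\ datum_at t s'.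
Hypothesis c_lift : forall u, omega_over th pa ea s0 e u -> lc (c - t (Some u.1) u.2) u.

Let b0 : box th s0 e s0. Proof. by split; rewrite subrr normr0. Qed.

Lemma rr_tip a s : rr a (pos a s, s) = 0.
Proof. by rewrite /rr subrr rho0. Qed.
Lemma hh_tip a s : hh a (pos a s, s) = 0.
Proof. by rewrite /hh subrr hgt0. Qed.

Lemma tip_value a : away a (pos a s0, s0) -> exists k,
  \forall u \near (pos a s0, s0), omega u -> t (Some (pos a s0)) s0 u - c u = k.
Proof.
move=> aw; have nl := lift_lc J tS c_lift b0 (near_sec_self J t (pos a s0) s0).
have na := away_near aw.
have [k hk] : exists k, \forall u \near (pos a s0, s0), setT u -> (hh a u <> 0 \/ rr a u < 0) ->
    (t (Some (pos a s0)) s0 - c) u = k.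
  apply: tip_const => //; first exact: rr_tip.
  by apply: filterS2 nl na => u h aw' _ /(away_omega aw'); exact: h.
exists k; apply: filterS2 hk na => u h aw' /(away_omega aw'); exact: h.
Qed.

Lemma far_near (b : R) (x : C) : far th b x -> \forall x' \near x, far th b x'.
Proof.
move=> [h|h].
  have := cts_pos (f := fun x => `|rho x| - b) (x := x) _ _; rewrite subr_gt0 => /(_ _ h).
  have cf : continuous (fun x => `|rho x| - b).
    by apply: ctsB; [apply: cts_norm; exact: rho_cts|exact: cts_cst].
  by move=> /(_ cf); apply: filterS => x'; rewrite subr_gt0; left.
have := cts_pos (f := fun x => `|hgt x| - b) (x := x) _ _; rewrite subr_gt0 => /(_ _ h).
have cf : continuous (fun x => `|hgt x| - b).
  by apply: ctsB; [apply: cts_norm; exact: hgt_cts|exact: cts_cst].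
by move=> /(_ cf); apply: filterS => x'; rewrite subr_gt0; right.
Qed.

Lemma lift_oo g : near_sec (g - t None s0) None s0 -> exists b, 0 <= b /\
  \forall s' \near s0, forall x, far th b x -> near_sec (g - t (Some x) s') (Some x) s'.
Proof.
move=> [b1 h1]; have [_ [_ [b2 h2]]] := tS b0.
exists (Num.max 0 (Num.max b1 b2)); split; first by rewrite le_max lexx.
have h1' := near_join h1; apply: filterS2 h1' h2 => s' hs' [h2' _] x fx.
have f1 : far th b1 x by case: fx; rewrite !gt_max => /and3P[_ ? _]; [left|right].
have f2 : far th b2 x by case: fx; rewrite !gt_max => /and3P[_ _ ?]; [left|right].
have -> : g - t (Some x) s' = (g - t None s0) - (t (Some x) s' - t None s0).
  by rewrite opprB addrA subrK.
apply: (near_secB J); last exact: h2'.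
have n1 : \forall u \near (x, s'), far th b1 u.1 by exact: (cvg_fst (far_near f1)).
have n2 : \forall u \near (x, s'), forall x, far th b1 x -> regular (x, u.2) -> sec (g - t None s0) (x, u.2).
  exact: (cvg_snd hs').
by apply: filterS2 n1 n2 => -[x' s''] /= hf h tu; exact: h.
Qed.

Lemma half_lt (b : R) : half (fun x => x < b).
Proof.
move=> x y r xb yb r01; have := @half_neg R (x - b) (y - b) r; lra.
Qed.

Lemma half_gt (b : R) : half (fun x => b < x).
Proof.
move=> x y r xb yb r01; have := @half_pos R (x - b) (y - b) r; lra.
Qed.

Lemma rho_half P : half P -> segconvex (fun u : C * C => P (rho u.1)).
Proof. by move=> hP u v hu hv r r01; rewrite /sg /= rhoD rhoZ rhoB; exact: hP. Qed.
Lemma hgt_half P : half P -> segconvex (fun u : C * C => P (hgt u.1)).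
Proof. by move=> hP u v hu hv r r01; rewrite /sg /= hgtD hgtZ hgtB; exact: hP. Qed.

Lemma box2_convex s1 d : segconvex (fun u : C * C => box th s1 d u.2).
Proof.
move=> u v bu bv r r01.
by have [] := @box_convex R th (s1, s1) d (u.2, u.2) (v.2, v.2) (conj bu bu) (conj bv bv) r r01.
Qed.

Lemma far_left (b : R) x : 0 <= b -> rho x < - b -> far th b x.
Proof. by move=> b_ge0 h; left; have := ler_norm (- rho x); rewrite normrN; lra. Qed.

Lemma oo_value : exists k b, \forall s' \near s0, forall x, rho x < - b -> t None s0 (x, s') - c (x, s') = k.
Proof.
have [|b [b_ge0 hb]] := @lift_oo (t None s0); first by rewrite subrr; exact: (near_sec0 J).
have [d d0 hd] : exists2 d : R, 0 < d & forall s', box th s0 d s' -> box th s0 e s' /\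
    forall x, far th b x -> near_sec (t None s0 - t (Some x) s') (Some x) s'.
  by apply/nbhs_box; apply: filterS2 (box_nbhs th s0 e_gt0) hb.
(* To the left of [- b'] a point is at once close to infinity and to the left of all punctures: the
   region is convex and meets no slit. *)
pose b' := Num.max b (left_bound th pa s0 e).
pose A (u : C * C) := box th s0 d u.2 /\ rho u.1 < - b'.
have bb' : b <= b' by rewrite le_max lexx.
have lb' : left_bound th pa s0 e <= b' by rewrite le_max lexx orbT.
have cA : segconvex A.
  apply: segconvexI; first exact: box2_convex.
  exact: (rho_half (half_lt (b := - b'))).
have lA u : A u -> lc (t None s0 - c) u.
  case: u => x s [/= bs hx]; have [bs' h] := hd _ bs.
  have ou : omega (x, s) by move=> a _; apply: (@left_boundP R th I pa ea s0 e a s x bs'); apply: ltW; apply: lt_le_trans hx _; rewrite lerN2.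
  have -> : t None s0 - c = (t None s0 - t (Some x) s) - (c - t (Some x) s).
    by rewrite opprB addrA subrK.
  apply: lcB; last by apply: (c_lift (u := (x, s))); split.
  apply: (near_sec_lc J (u := (x, s))) => //; last by have [] := tS bs'.
  by apply: h; apply: far_left => //; lra.
pose u1 := (pt th (- b' - 1) 0, s0).
have Au1 : A u1 by split; [split; rewrite subrr normr0|rewrite rho_pt; lra].
exists ((t None s0 - c) u1), b'; apply/(nbhs_box th); exists d => // s' bs x hx.
by have := locconst_segconvex cA lA (conj bs hx : A (x, s')) Au1.
Qed.

End Lift.

(** By [off], no tip lies on the slit of another puncture, so [t - c] has a single value around each
    tip, which becomes its coordinate. *)
Lemma coord_ex t s0 : S s0 -> off s0 -> (\forall s \near s0, datum_at t s) -> exists v, coord t s0 v.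
Proof.
move=> Ss0 os dt; have [e [c [e0 hS hc]]] := datum_lift J Ss0 dt.
have hv a := tip_value e0 hS hc (@off_away a _ os).
have [k [b hk]] := oo_value e0 hS hc.
exists (fun o => if o is Some a then projT1 (cid (hv a)) else k), c, e; split=> //.
  move=> a; exists (t (Some (pos a s0)) s0); first exact: (near_sec_self J).
  exact: (projT2 (cid (hv a))).
exists (t None s0); first by rewrite subrr; exact: (near_sec0 J).
by exists b.
Qed.

Lemma slit_point a s : S s -> off s -> (forall Q, nbhs (pos a s, s) Q ->
  exists x, only_slit a (x, s) /\ Q (x, s)).
Proof.
move=> Ss os Q /(nbhs_box2 th)[e e0 eQ]; exists (pos a s + pt th (e / 2) 0); split.
  apply: off_only_slit => //; first by rewrite /hh /= [_ + pt _ _ _]addrC addrK hgt_pt.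
  by rewrite /rr /= [_ + pt _ _ _]addrC addrK rho_pt divr_gt0.
apply: eQ; last by split; rewrite subrr normr0.
by rewrite /box /= rhoD hgtD rho_pt hgt_pt addr0 subrr normr0 addrC addKr gtr0_norm ?divr_gt0//; split=> //; lra.
Qed.

(** A primitive [m] of the datum differs from [c] by a single constant [w] on the slit plane, which
    is connected. Near the tip of [a], [m - g] is a section equal to [w - v (Some a)] on both sides
    of the slit, hence fixed by [B a]. *)
Lemma coord_trivial t s0 v : off s0 -> coord t s0 v -> trivial_near th pa ea S sec t s0 ->
  exists w, forall a, (v (Some a) - w) *m B a = v (Some a) - w.
Proof.
move=> os [c [e [e0 hS hc ha _]]] [m hm].
have [Ss0 _] : S s0 /\ datum_at t s0 by apply: hS; split; rewrite subrr normr0.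
have [d d0 hd] : exists2 d : R, 0 < d & forall s', box th s0 d s' -> box th s0 e s' /\
    forall b, near_sec (m - t b s') b s'.
  by apply/nbhs_box; apply: filterS2 (box_nbhs th s0 e0) hm.
have lmc u : omega_over th pa ea s0 d u -> lc (m - c) u.
  case: u => x s [/= bs ou]; have [bs' h] := hd _ bs.
  have -> : m - c = (m - t (Some x) s) - (c - t (Some x) s) by rewrite opprB addrA subrK.
  apply: lcB; last by apply: (hc (x, s)).
  by apply: (near_sec_lc J (u := (x, s))) => //; have [] := hS _ bs'.
have cst := omega_const d0 lmc.
exists ((m - c) (base th pa s0 d)) => a; set w := (m - c) _.
have [g ng hg] := ha a.
have bs0 : box th s0 d s0 by split; rewrite subrr normr0.
have nmg : near_sec (m - g) (Some (pos a s0)) s0.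
  have -> : m - g = (m - t (Some (pos a s0)) s0) - (g - t (Some (pos a s0)) s0).
    by rewrite opprB addrA subrK.
  by apply: (near_secB J) => //; have [_ h] := hd _ bs0.
have nb : \forall u \near (pos a s0, s0), box th s0 d u.2 by exact: (cvg_snd (box_nbhs th s0 d0)).
have nval : \forall u \near (pos a s0, s0), omega u -> (m - g) u = w - v (Some a).
  apply: filterS2 nb hg => u bu hgu ou; rewrite -(hgu ou).
  have -> : w = (m - c) u by apply: cst; [exact: base_over|].
  by rewrite !fctE opprB addrA subrK.
have nn := nearI (near_sec_open nmg) (near_join nval).
have [x [osl [/= h1 h2]]] := slit_point Ss0 os nn.
have j1 := near_sec_jump J (u := (x, s0)) h1 Ss0 osl.
have j2 : jump a (w - v (Some a)) (w - v (Some a)) (m - g) (x, s0).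
  apply: filterS2 h2 (only_slit_near osl) => u h3 [h4 _].
  by split=> hu; apply: h3; apply: h4 => e1; rewrite e1 ltxx in hu.
have [|e1 e2] := jump_uniq _ j1 j2; first by case: osl.
by rewrite -opprB mulNmx -e1 e2 e1.
Qed.

(** Off the slits the primitive is [c + w]. On a slit its value is forced by the convention that a
    section takes there its upper value; [kk u] is the upper value of [t - c] at [u]. Since
    [v (Some a) - w] is fixed by [B a], the jump across the slit of [a] is the one of a section. *)
Lemma coord_trivialP t s0 v w : off s0 -> coord t s0 v ->
  (forall a, (v (Some a) - w) *m B a = v (Some a) - w) -> trivial_near th pa ea S sec t s0.
Proof.
move=> os [c cv] hw.
have ncv := coord_with_near J cv; have nos := off_near os.
pose isk u k := exists a, only_slit a u /\
  jump a k (v (Some a) + (k - v (Some a)) *m B a) (t (Some u.1) u.2 - c) u.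
have hk u : exists k, (exists k', isk u k') -> isk u k.
  by have [[k h]|n0] := pselect (exists k', isk u k'); [exists k|exists 0 => h].
pose kk u := projT1 (cid (hk u)).
pose m u := if `[< omega u >] then c u + w else t (Some u.1) u.2 u - kk u + w.
have kkP x s a : coord_with c t s v -> off s -> only_slit a (x, s) ->
    jump a (kk (x, s)) (v (Some a) + (kk (x, s) - v (Some a)) *m B a) (t (Some x) s - c) (x, s).
  move=> [e [e0 hS hc ha _]] oss osl; have [g ng hg] := ha a.
  have bs : box th s e s by split; rewrite subrr normr0.
  have [k jk] := cross J hS hc bs ng hg osl.
  have [|b [oslb]] := projT2 (cid (hk (x, s))); first by exists k, a.
  by rewrite -/(kk (x, s)) (only_slit_uniq oslb osl).
exists m.
suff key : \forall s \near s0, forall x, regular (x, s) -> sec (m - t (Some x) s) (x, s).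
  have nk := near_join key; apply: filterS2 ncv nk => s [e [e0 hS _ _ _]] h b.
  have [Ss ds] : S s /\ datum_at t s by apply: hS; split; rewrite subrr normr0.
  by have := @near_sec_pointwise _ _ _ _ _ _ _ _ _ _ J t s b m Ss ds h.
have ncv' := near_join ncv; have nos' := near_join nos.
apply: filterS2 (nearI ncv' nos') ncv => s [nc no] cs x rx.
have oss : off s := nbhs_singleton no.
have [e [e0 hS hc ha _]] := cs.
have bs : box th s e s by split; rewrite subrr normr0.
have [Ss ds] := hS _ bs.
have [ou|[a osl]] := off_regular oss rx.
  apply/(js_omega J) => //.
  apply: (lc_eq (c := c - t (Some x) s + (fun=> w))).
    by apply: lcD; [exact: (hc (x, s))|exact: lc_cst].
  have := omega_near ou; apply: filterS => u /asboolT ou'.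
  by rewrite !fctE /m ou' addrAC.
apply/(@js_slit _ _ _ _ _ _ _ _ _ _ J _ (x, s) a Ss osl).
have nou : `[< omega (x, s) >] = false.
  apply/asboolPn => ou; case: osl => h0 r0 _.
  by have := ou a h0; rewrite ltNge ltW.
have jx := kkP _ _ _ cs oss osl.
set k := kk (x, s) in jx.
have mx : (m - t (Some x) s) (x, s) = w - k.
  by rewrite !fctE /m nou /= -/k addrAC [X in X + w]addrAC subrr add0r addrC.
have eqB : (w - k) *m B a = w - (v (Some a) + (k - v (Some a)) *m B a).
  have -> : w - k = (w - v (Some a)) - (k - v (Some a)) by rewrite opprB addrA subrK.
  by rewrite mulmxBl -(opprB (v _) w) mulNmx hw opprB opprD addrA.
have n1 : \forall u \near (x, s), coord_with c t u.2 v by exact: (cvg_snd nc).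
have n2 : \forall u \near (x, s), off u.2 by exact: (cvg_snd no).
have n3 := lift_sec J hS bs (near_sec_self J t x s).
have n4 := jump_open jx; have n5 := only_slit_near osl.
rewrite mx; near=> u.
have [j1 j2] : (0 < hh a u -> (t (Some x) s - c) u = k) /\
  (hh a u < 0 -> (t (Some x) s - c) u = v (Some a) + (k - v (Some a)) *m B a) by near: u.
have [q1 q2] : (hh a u <> 0 -> omega u) /\ (hh a u = 0 -> only_slit a u) by near: u.
case: (ltgtP (hh a u) 0) => [hn|hp|h0].
- rewrite eqB -j2//.
  have /asboolT ou : omega u by apply: q1 => e1; rewrite e1 ltxx in hn.
  by rewrite !fctE /m ou opprB addrA (addrC w).
- rewrite -(j1 hp).
  have /asboolT ou : omega u by apply: q1 => e1; rewrite e1 ltxx in hp.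
  by rewrite !fctE /m ou opprB addrA (addrC w).
have oslu := q2 h0.
have nouu : `[< omega u >] = false.
  apply/asboolPn => ou; case: oslu => h0' r0 _.
  by have := ou a h0'; rewrite ltNge ltW.
have nsu : near_sec (t (Some x) s - t (Some u.1) u.2) (Some u.1) u.2 by near: u.
have cu : coord_with c t u.2 v by near: u.
have ou2 : off u.2 by near: u.
have jxu : jump a k (v (Some a) + (k - v (Some a)) *m B a) (t (Some x) s - c) u by near: u.
have ju : jump a (kk u) (v (Some a) + (kk u - v (Some a)) *m B a) (t (Some u.1) u.2 - c) u.
  by move: cu ou2 oslu; case: (u) => x' s' /=; exact: kkP.
have Su : S u.2 by have [e' [e'0 hS' _ _ _]] := cu; have [] : S u.2 /\ datum_at t u.2 by apply: hS'; split; rewrite subrr normr0.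
have jd := near_sec_jump J nsu Su oslu.
have ju' := jumpD ju jd.
have eqf : (t (Some u.1) u.2 - c) + (t (Some x) s - t (Some u.1) u.2) = t (Some x) s - c.
  by rewrite addrC addrA subrK.
rewrite eqf in ju'; have [e1 _] := jump_uniq h0 jxu ju'.
rewrite e1 /m; change ((if `[< omega u >] then c u + w else t (Some u.1) u.2 u - kk u + w) - t (Some x) s u =
  w - (kk u + (t (Some x) s u - t (Some u.1) u.2 u))).
rewrite nouu; move: (kk u) (t (Some x) s u) (t (Some u.1) u.2 u) => k1 t1 t2.
by rewrite opprD opprB !addrA; congr (_ - t1); rewrite addrC addrA addrAC.
Unshelve. all: by end_near. Qed.

End Coordinates.

(** * Change of coordinates when a puncture crosses a slit *)

Section Crossing.
Variables (R : realType) (th : R) (I : finType) (K : fieldType) (n : nat).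
Local Notation C := (Cplx R).
Local Notation V := 'rV[K]_n.
Variables (pa : I -> C) (ea : I -> bool) (B : I -> 'M[K]_n) (S : set C).
Variable sec : (C * C -> V) -> C * C -> Prop.
Local Notation rho := (rho th).
Local Notation hgt := (hgt th).
Local Notation pos := (pos pa ea).
Local Notation hh := (hh th pa ea).
Local Notation rr := (rr th pa ea).
Local Notation omega := (omega th pa ea).
Local Notation only_slit := (only_slit th pa ea).
Local Notation near_sec := (near_sec th pa ea S sec).
Local Notation datum_at := (datum_at th pa ea S sec).
Local Notation coord := (coord th pa ea S sec).
Local Notation coord_with := (coord_with th pa ea S sec).
Local Notation off := (off th pa ea).
Local Notation away := (away th pa ea).
Local Notation regular := (regular pa ea S).
Local Notation jump := (jump th pa ea).
Hypothesis J : jump_system th pa ea B S sec.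


Lemma near_sec_sym (f g : C * C -> V) b s : near_sec (f - g) b s -> near_sec (g - f) b s.
Proof. by move=> h; rewrite -opprB -scaleN1r; exact: (near_secZ J). Qed.

Lemma coord_of_lifts t c s0 v : S s0 -> (\forall s \near s0, datum_at t s) ->
  (\forall u \near s0, forall x, omega (x, u) -> lc (c - t (Some x) u) (x, u)) ->
  (forall a, exists2 g, near_sec (g - t (Some (pos a s0)) s0) (Some (pos a s0)) s0 &
      \forall u \near (pos a s0, s0), omega u -> g u - c u = v (Some a)) ->
  (exists2 g, near_sec (g - t None s0) None s0 &
      exists b, \forall s' \near s0, forall x, rho x < - b -> g (x, s') - c (x, s') = v None) ->
  coord_with c t s0 v.
Proof.
move=> Ss dt hc h1 h2.
have [e e0 he] : exists2 e : R, 0 < e & forall s', box th s0 e s' -> (S s' /\ datum_at t s') /\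
    forall x, omega (x, s') -> lc (c - t (Some x) s') (x, s').
  by apply/nbhs_box; apply: nearI hc; apply: nearI dt; exact: (js_open J).
exists e; split=> //; first by move=> s' /he[].
by move=> [x s] [/= /he[_ h] ou]; exact: h.
Qed.

(** At [s0] the tip of [b] lies on the slit of [a], and one lift [c] over a box around [s0] serves
    both sides. Near this tip [t - c] has the value [kp] above the slit of [a] and [km] below it,
    related by the affine map of [a]. As [s] moves, the tip of [b] falls on one side or the other,
    and reads [kp] or [km]. *)
Lemma coord_cross t s0 a b : S s0 -> (\forall s \near s0, datum_at t s) ->
  hgt (pos a s0) = hgt (pos b s0) -> rho (pos a s0) < rho (pos b s0) ->
  (forall c d, c != d -> hgt (pos c s0) = hgt (pos d s0) ->
     c = a /\ d = b \/ c = b /\ d = a) ->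
  exists v, \forall s \near s0,
    (hgt (pos a s) < hgt (pos b s) -> coord t s v) /\
    (hgt (pos b s) < hgt (pos a s) ->
       coord t s (fun o => if o == Some b then afix B v a (v (Some b)) else v o)).
Proof.
move=> Ss0 dt hab rab only.
have ab : a != b by apply: contraTN rab => /eqP ->; rewrite ltxx.
have [e [c [e0 hS hc]]] := datum_lift J Ss0 dt.
have bs0 : box th s0 e s0 by split; rewrite subrr normr0.
have dist d x : d != x -> hh d (pos x s0, s0) = 0 -> d = a /\ x = b \/ d = b /\ x = a.
  move=> dx; rewrite /hh /= hgtB => /subr0_eq h.
  by have [[-> ->]|[-> ->]] := only _ _ dx (esym h); [left|right].
(* At [b] the value 0 is a placeholder: its tip lies on a slit, so [t - c] need not have a single
   value there. *)
have hv x : exists k, x != b -> \forall u \near (pos x s0, s0), omega u -> t (Some (pos x s0)) s0 u - c u = k.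
  have [->|xb] := eqVneq x b; first by exists 0.
  have [|k hk] := @tip_value _ _ _ _ _ _ _ _ _ _ J t s0 e c e0 hS hc x; last by exists k.
  move=> d dx /(dist _ _ dx)[[_ e1]|[-> ->]]; first by rewrite e1 eqxx in xb.
  by rewrite /rr rhoB; lra.
pose kv x := projT1 (cid (hv x)).
have hkv x : x != b -> \forall u \near (pos x s0, s0), omega u -> t (Some (pos x s0)) s0 u - c u = kv x.
  exact: (projT2 (cid (hv x))).
have [koo [boo hoo]] := oo_value J e0 hS hc.
pose f := t (Some (pos b s0)) s0 - c.
have nl := lift_lc J hS hc bs0 (near_sec_self J t (pos b s0) s0).
have nom : \forall u \near (pos b s0, s0), hh a u <> 0 -> (hh b u <> 0 \/ rr b u < 0) -> omega u.
  have : \forall u \near (pos b s0, s0), forall d, d != a -> d != b -> hh d u = 0 -> rr d u < 0.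
    apply: near_forall => d; have [->|da] := eqVneq d a; first by near=> u.
    have [->|db] := eqVneq d b; first by near=> u.
    have hd : hh d (pos b s0, s0) != 0.
      by apply/eqP => /(dist _ _ db)[[e1 _]|[e1 _]]; [rewrite e1 eqxx in da|rewrite e1 eqxx in db].
    have : 0 < `|hh d (pos b s0, s0)| by rewrite normr_gt0.
    move=> /(cts_pos (cts_norm (@hh_cts R th I pa ea d))); apply: filterS => u + _ _ /eqP.
    by rewrite normr_gt0 => /negPf ->.
  apply: filterS => u h ha hb d hd.
  have [da|da] := eqVneq d a; first by rewrite da in hd.
  by have [db|db] := eqVneq d b; [subst d; case: hb|exact: h].
have side (A : set (C * C)) : segconvex A -> (forall u r, 0 <= r -> A u -> A (shiftl th u r)) ->
    (forall u, A u -> hh a u <> 0) ->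
    exists k, \forall u \near (pos b s0, s0), A u -> (hh b u <> 0 \/ rr b u < 0) -> f u = k.
  move=> cA sA hA; apply: tip_const => //; first exact: rr_tip.
  by apply: filterS2 nl nom => u h1 h2 Au hu; apply: h1; apply: h2 => //; exact: hA.
have [| |kp hkp] := side _ (@hh_half R th I pa ea a _ (@half_pos R)).
- by move=> u r _ /=; rewrite hh_shiftl.
- by move=> u /= hu e1; rewrite e1 ltxx in hu.
have [| |km hkm] := side _ (@hh_half R th I pa ea a _ (@half_neg R)).
- by move=> u r _ /=; rewrite hh_shiftl.
- by move=> u /= hu e1; rewrite e1 ltxx in hu.
(* The two values are compared at a point of the slit of [a] just to the left of the tip of [b],
   where no other slit passes. *)
have [x [osl rb nx np nm]] : exists x, [/\ only_slit a (x, s0), rr b (x, s0) < 0,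
    near_sec (t (Some (pos b s0)) s0 - t (Some x) s0) (Some x) s0,
    \forall u \near (x, s0), 0 < hh a u -> (hh b u <> 0 \/ rr b u < 0) -> f u = kp &
    \forall u \near (x, s0), hh a u < 0 -> (hh b u <> 0 \/ rr b u < 0) -> f u = km].
  have n1 := lift_sec J hS bs0 (near_sec_self J t (pos b s0) s0).
  have nn := nearI n1 (nearI (near_join hkp) (near_join hkm)).
  have [d d0 dQ] := (nbhs_box2 th _ _).1 nn.
  pose y := Num.min (d / 2) ((rho (pos b s0) - rho (pos a s0)) / 2).
  have y0 : 0 < y by rewrite /y lt_min; apply/andP; split; lra.
  have yd : y <= d / 2 by rewrite ge_min lexx.
  have ya : y <= (rho (pos b s0) - rho (pos a s0)) / 2 by rewrite ge_min lexx orbT.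
  exists (pos b s0 - pt th y 0).
  have [||h1 [h2 h3]] := dQ (pos b s0 - pt th y 0, s0).
  - by rewrite /box /= rhoB hgtB rho_pt hgt_pt subr0 subrr normr0 addrC addKr normrN gtr0_norm//; split=> //; lra.
  - by split; rewrite subrr normr0.
  have rrb : rr b (pos b s0 - pt th y 0, s0) < 0 by rewrite /rr /= !rhoB rho_pt; lra.
  split=> //; split.
  - by rewrite /hh /= !hgtB hgt_pt hab; lra.
  - by rewrite /rr /= !rhoB rho_pt; lra.
  move=> d' d'a hd'; have [->//|d'b] := eqVneq d' b.
  have : hh d' (pos b s0, s0) = 0 by move: hd'; rewrite /hh /= !hgtB hgt_pt subr0.
  by move=> /(dist _ _ d'b)[[e1 _]|[e1 _]]; [rewrite e1 eqxx in d'a|rewrite e1 eqxx in d'b].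
have rel : km = kv a + (kp - kv a) *m B a.
  have [k jk] := cross J hS hc bs0 (near_sec_self J t (pos a s0) s0) (hkv a ab) osl.
  have jd := near_sec_jump J (u := (x, s0)) nx Ss0 osl.
  have jf := jumpD jk jd.
  have ef : t (Some x) s0 - c + (t (Some (pos b s0)) s0 - t (Some x) s0) = f.
    by rewrite addrC addrA subrK.
  rewrite ef in jf.
  have jf' : jump a kp km f (x, s0).
    have nr := cts_neg (@rr_cts R th I pa ea b) rb.
    apply: filterS3 np nm nr => u h1 h2 h3; split=> hu; first by apply: h1 => //; right.
    by apply: h2 => //; right.
  have [|-> ->] := jump_uniq _ jf' jf; first by case: osl.
  by rewrite -addrA -mulmxDl [k - _ + _]addrAC.
pose v o := if o is Some x then if x == b then kp else kv x else koo.
have nlift x' : \forall s \near s0, near_sec (t (Some (pos x' s0)) s0 - t (Some (pos x' s)) s) (Some (pos x' s)) s.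
  exact: cvg_pos (lift_sec J hS bs0 (near_sec_self J t (pos x' s0) s0)).
have nS := js_open J Ss0.
have nD := near_join dt.
have nB := box_nbhs th s0 e0.
have noo : \forall s \near s0, exists2 g, near_sec (g - t None s) None s &
      exists b, \forall s' \near s, forall x, rho x < - b -> g (x, s') - c (x, s') = koo.
  have [_ [_ [bd hbd]]] := hS _ bs0.
  apply: filterS2 (near_join hoo) hbd => s h1 [_ h2]; exists (t None s0); last by exists boo.
  exact: near_sec_sym.
have nkv x' : x' != b -> \forall s \near s0, \forall u \near (pos x' s, s),
    omega u -> t (Some (pos x' s0)) s0 u - c u = kv x'.
  by move=> x'b; exact: cvg_pos (near_join (hkv _ x'b)).
have nkv' : \forall s \near s0, forall x', x' != b -> \forall u \near (pos x' s, s),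
    omega u -> t (Some (pos x' s0)) s0 u - c u = kv x'.
  apply: near_forall => x'; have [->|x'b] := eqVneq x' b; first by near=> s.
  by apply: filterS (nkv _ x'b).
have nlift' := near_forall nlift.
have np' := cvg_pos (near_join hkp); have nm' := cvg_pos (near_join hkm).
have omb u : omega u -> hh b u <> 0 \/ rr b u < 0.
  by move=> ou; have [h0|/eqP] := eqVneq (hh b u) 0; [right; exact: ou|left].
have cl s : box th s0 e s -> \forall u \near s, forall x, omega (x, u) -> lc (c - t (Some x) u) (x, u).
  move=> bs; have [e' e'0 he'] := box_box bs.
  by apply/(nbhs_box th); exists e' => // s' /he' bs' x' ox; apply: (hc (x', s')).
exists v; near=> s.
have Ss : S s by near: s.
have bs : box th s0 e s by near: s.
have ds : \forall s' \near s, datum_at t s' by near: s.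
have nkvs : forall x', x' != b -> \forall u \near (pos x' s, s),
    omega u -> t (Some (pos x' s0)) s0 u - c u = kv x' by near: s.
have nls : forall x', near_sec (t (Some (pos x' s0)) s0 - t (Some (pos x' s)) s) (Some (pos x' s)) s by near: s.
have nos : exists2 g, near_sec (g - t None s) None s &
      exists b, \forall s' \near s, forall x, rho x < - b -> g (x, s') - c (x, s') = koo by near: s.
have nps : \forall u \near (pos b s, s), 0 < hh a u -> (hh b u <> 0 \/ rr b u < 0) -> f u = kp by near: s.
have nms : \forall u \near (pos b s, s), hh a u < 0 -> (hh b u <> 0 \/ rr b u < 0) -> f u = km by near: s.
split=> hs; exists c; apply: coord_of_lifts => //; try exact: cl.
  move=> x'; exists (t (Some (pos x' s0)) s0); first exact: nls.
  have [->|x'b] := eqVneq x' b; last by rewrite /v /= (negPf x'b); exact: nkvs.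
  have hp : 0 < hh a (pos b s, s) by rewrite /hh hgtB subr_gt0.
  apply: filterS2 nps (cts_pos (@hh_cts R th I pa ea a) hp) => u h1 h2 /omb h3.
  by rewrite /v /= eqxx; exact: h1.
move=> x'; exists (t (Some (pos x' s0)) s0); first exact: nls.
have [[->]|x'b] := eqVneq (Some x') (Some b).
  have hp : hh a (pos b s, s) < 0 by rewrite /hh hgtB subr_lt0.
  apply: filterS2 nms (cts_neg (@hh_cts R th I pa ea a) hp) => u h1 h2 /omb h3.
  by rewrite /afix /v (negPf ab) eqxx -rel; exact: h1.
have {}x'b : x' != b by apply: contra x'b => /eqP ->.
by rewrite /v /= (negPf x'b); exact: nkvs.
Unshelve. all: by end_near. Qed.

End Crossing.

(** * The relation at infinity *)

Module Parabolic.

(** Meant for a locally constant function restricted to a vertical line that cuts all the slits: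
    read downwards, each slit applies its map [f a]. The induction removes the highest jump, the
    head of [L]. *)
Lemma fold_jumps (R : realType) (T : Type) (A : eqType) (h : A -> R) (f : A -> T -> T)
    (D : R -> T) (L : seq A) (y z : R) : z <= y ->
  sorted (fun a b => h b < h a) L -> (forall a, a \in L -> z < h a < y) ->
  (forall x, z <= x <= y -> (forall a, a \in L -> h a != x) -> \forall x' \near x, D x' = D x) ->
  (forall a, a \in L -> exists k, \forall x \near h a,
     (h a < x -> D x = k) /\ (x < h a -> D x = f a k)) ->
  D z = foldl (fun x a => f a x) (D y) L.
Proof.
elim: L y => [|a L IH] y zy so hL hc hj /=.
  apply: (segment_const (P := fun x => D z = D x) zy) => // x xzy.
  have [] := hc x xzy => // e e0 he; exists e => // x' hx' _.
  by rewrite (he _ hx').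
have la b : b \in L -> h b < h a.
  move=> bL; have := so; rewrite /= path_sortedE; last by move=> ? ? ? h1 h2; exact: lt_trans h2 h1.
  by move=> /andP[/allP /(_ _ bL)].
have /andP[za ay] := hL a (mem_head _ _).
have [k hk] := hj a (mem_head _ _).
have Dy : D y = k.
  have [x [x1 x2 Dx]] : exists x, [/\ h a < x, x <= y & D x = k].
    have /nbhs_ballP[d /= d0 hd] := hk.
    pose x := Num.min y (h a + d / 2).
    have h1 : h a < x by rewrite lt_min ay; lra.
    have h3 : x <= h a + d / 2 by rewrite ge_min lexx orbT.
    exists x; split=> //; first by rewrite ge_min lexx.
    have [|h2 _] := hd x _; last exact: h2.
    by rewrite /ball /= distrC ger0_norm ?subr_ge0 ?(ltW h1)//; lra.
  rewrite -Dx; apply/esym; apply: (segment_const (P := fun x' => D x = D x') x2) => // x' xx'.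
  have [||e e0 he] := hc x' _ _; first lra.
    move=> b; rewrite in_cons => /orP[/eqP->|/la hb]; apply/eqP; lra.
  by exists e => // x'' hx'' _; rewrite (he _ hx'').
have [z' [zz' z'a hb Dz']] : exists z', [/\ z <= z', z' < h a, forall b, b \in L -> h b < z' & D z' = f a k].
  have n1 : \forall x \near h a, forall b, b \in L -> h b < x.
    have : forall b, b \in L -> h b < h a := la.
    elim: (L) => [_|b l IHl hl]; first by near=> x.
    have h1 : \forall x \near h a, forall b, b \in l -> h b < x.
      by apply: IHl => b' b'l; apply: hl; rewrite in_cons b'l orbT.
    have h2 := lt_nbhsr (hl b (mem_head _ _)).
    near=> x => b'; rewrite in_cons => /orP[/eqP->|b'l]; first by near: x.
    by move: b' b'l; near: x.
  have n2 := lt_nbhsr za.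
  have /nbhs_ballP[d /= d0 hd] := nearI n1 (nearI n2 hk).
  have [|h1 [h2 [_ h3]]] := hd (h a - d / 2).
    by rewrite /ball /= opprB addrC subrK gtr0_norm; lra.
  by exists (h a - d / 2); split=> //; [exact: ltW|lra|apply: h3; lra].
rewrite Dy -Dz'; apply: IH => //.
- by move: so => /=; exact: path_sorted.
- move=> b bL; rewrite hb// andbT; have := hL b; rewrite in_cons bL orbT => /(_ isT); lra.
- move=> x xz hx; apply: hc; first lra.
  move=> b; rewrite in_cons => /orP[/eqP->|/hx//]; apply/eqP; lra.
- by move=> b bL; apply: hj; rewrite in_cons bL orbT.
Unshelve. all: by end_near. Qed.

Section AtInfinity.
Variables (R : realType) (th : R) (I : finType) (K : fieldType) (n : nat).
Local Notation C := (Cplx R).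
Local Notation V := 'rV[K]_n.
Variables (pa : I -> C) (ea : I -> bool) (B : I -> 'M[K]_n) (S : set C).
Variable sec : (C * C -> V) -> C * C -> Prop.
Local Notation rho := (rho th).
Local Notation hgt := (hgt th).
Local Notation pos := (pos pa ea).
Local Notation hh := (hh th pa ea).
Local Notation rr := (rr th pa ea).
Local Notation omega := (omega th pa ea).
Local Notation only_slit := (only_slit th pa ea).
Local Notation near_sec := (near_sec th pa ea S sec).
Local Notation datum_at := (datum_at th pa ea S sec).
Local Notation coord := (coord th pa ea S sec).
Local Notation coord_with := (coord_with th pa ea S sec).
Local Notation off := (off th pa ea).
Local Notation away := (away th pa ea).
Local Notation regular := (regular pa ea S).
Local Notation jump := (jump th pa ea).
Hypothesis J : jump_system th pa ea B S sec.


Definition descending (s : C) : seq I := sort (fun a b => hgt (pos b s) <= hgt (pos a s)) (enum I).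

Lemma mem_descending s a : a \in descending s.
Proof. by rewrite mem_sort mem_enum. Qed.

Lemma descending_sorted s : off s -> sorted (fun a b => hgt (pos b s) < hgt (pos a s)) (descending s).
Proof.
move=> os; have tot : total (fun a b : I => hgt (pos b s) <= hgt (pos a s)).
  by move=> a b; exact: le_total.
have uq : uniq (descending s) by rewrite sort_uniq enum_uniq.
have := sort_sorted tot (enum I); rewrite -/(descending s) => so.
have tr : transitive (fun a b : I => hgt (pos b s) <= hgt (pos a s)).
  by move=> a b c h1 h2; exact: le_trans h2 h1.
move: so uq; case: (descending s) => //= a l; elim: l a => //= b l IH a /andP[h1 h2] /andP[h3 h4].
rewrite IH// andbT.
rewrite lt_neqAle h1 andbT; apply: contraNneq h3 => /os ->.
by rewrite in_cons eqxx.
Qed.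

Definition parabolic (v : option I -> V) (s : C) : Prop :=
  foldl (fun x a => afix B v a x) (v None) (descending s) = v None.

(** Far out, the lift at infinity and [c] differ by [v None] above, below and to the left of all
    slits. A vertical line far to the right leads from the upper region to the lower one and crosses
    each slit once, the highest first. *)
Lemma coord_parabolic t s0 v : off s0 -> coord t s0 v -> parabolic v s0.
Proof.
move=> os [c [e [e0 hS hc ha [g ng [b1 hb1]]]]].
have bs0 : box th s0 e s0 by split; rewrite subrr normr0.
have [Ss0 ds0] := hS _ bs0.
have [b2 [b2_ge0 hb2]] := lift_oo J e0 hS ng.
have hfar : forall x, far th b2 x -> near_sec (g - t (Some x) s0) (Some x) s0 := nbhs_singleton hb2.
have hleft : forall x, rho x < - b1 -> g (x, s0) - c (x, s0) = v None := nbhs_singleton hb1.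
(* [X] exceeds the radius [b2] beyond which [g] is a lift, the bound [b1] of the left region, and
   the coordinates of all punctures. *)
pose X := b2 + `|b1| + \sum_a `|rho (pos a s0)| + \sum_a `|hgt (pos a s0)| + 1.
have sr0 : 0 <= \sum_a `|rho (pos a s0)| by apply: sumr_ge0.
have sh0 : 0 <= \sum_a `|hgt (pos a s0)| by apply: sumr_ge0.
have nb1 := normr_ge0 b1.
have rX a : `|rho (pos a s0)| < X.
  rewrite /X (bigD1 a)//=.
  have : 0 <= \sum_(i | i != a) `|rho (pos i s0)| by apply: sumr_ge0.
  lra.
have hX a : `|hgt (pos a s0)| < X.
  rewrite /X [X in _ + X + 1](bigD1 a)//=.
  have : 0 <= \sum_(i | i != a) `|hgt (pos i s0)| by apply: sumr_ge0.
  lra.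
have b2X : b2 < X by rewrite /X; lra.
have X0 : 0 < X by rewrite /X; lra.
have glc x : far th b2 x -> omega (x, s0) -> lc (g - c) (x, s0).
  move=> fx ox; have -> : g - c = (g - t (Some x) s0) - (c - t (Some x) s0) by rewrite opprB addrA subrK.
  apply: lcB; first by apply: (near_sec_lc J (u := (x, s0))) => //; exact: hfar.
  by apply: (hc (x, s0)); split.
pose bp (y : R) : C * C := (pt th X y, s0).
have bp_near y (Q : set (C * C)) : nbhs (bp y) Q -> \forall y' \near y, Q (bp y').
  move=> /(nbhs_box2 th)[d d0 dQ]; have := nbhsx_ballx y d d0.
  apply: filterS => y' hy; apply: dQ; last by split; rewrite subrr normr0.
  by split; rewrite /= ?rho_pt ?hgt_pt ?subrr ?normr0// distrC.
have bpfar y : far th b2 (bp y).1 by left; rewrite rho_pt gtr0_norm.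
pose D y := (g - c) (bp y).
have cs0 : segconvex (fun u : C * C => u.2 = s0).
  by move=> u w hu hw r _; rewrite /sg /= hu hw subrr mulr0 addr0.
have edge (A : set (C * C)) y : segconvex A -> A (bp y) -> A (pt th (- X) y, s0) ->
    (forall u, A u -> [/\ u.2 = s0, far th b2 u.1 & omega u]) -> D y = v None.
  move=> cA A1 A2 hA; have lA u : A u -> lc (g - c) u.
    by move: u => [x s] /hA[/= -> ? ?]; exact: glc.
  rewrite /D (locconst_segconvex cA lA A1 A2); apply: hleft.
  by rewrite rho_pt ltrN2 /X; have := ler_norm b1; lra.
have Dtop y : X < y -> D y = v None.
  move=> Xy; apply: (edge (fun u => u.2 = s0 /\ X < hgt u.1)).
  - apply: segconvexI => //; exact: (hgt_half (half_gt (b := X))).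
  - by rewrite /bp /= hgt_pt.
  - by rewrite /= hgt_pt.
  - move=> [x s] [/= -> hx]; split=> //; first by right; have := ler_norm (hgt x); lra.
    by move=> a; have := hX a; rewrite ltr_norml /hh hgtB => /andP[_ h1] h2; exfalso; lra.
have Dbot y : y < - X -> D y = v None.
  move=> Xy; apply: (edge (fun u => u.2 = s0 /\ hgt u.1 < - X)).
  - apply: segconvexI => //; exact: (hgt_half (half_lt (b := - X))).
  - by rewrite /bp /= hgt_pt.
  - by rewrite /= hgt_pt.
  - move=> [x s] [/= -> hx]; split=> //.
      by right; have := ler_norm (- hgt x); rewrite normrN; lra.
    by move=> a; have := hX a; rewrite ltr_norml /hh hgtB => /andP[h1 _] h2; exfalso; lra.
rewrite /parabolic.
have e1 : D (X + 1) = v None by apply: Dtop; lra.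
have e2 : D (- X - 1) = v None by apply: Dbot; lra.
rewrite -{2}e2 -e1; apply/esym.
apply: (@fold_jumps R V I (fun a => hgt (pos a s0)) (afix B v) D (descending s0)).
- lra.
- exact: descending_sorted.
- by move=> a _; have := hX a; rewrite ltr_norml; lra.
- move=> y _ hy; have oy : omega (bp y).
    move=> a; rewrite /hh /bp /= hgtB hgt_pt => /subr0_eq e3.
    by have := hy a (mem_descending _ _); rewrite -e3 eqxx.
  exact: bp_near (glc _ (bpfar y) oy).
move=> a _.
pose y := hgt (pos a s0).
have osl : only_slit a (bp y).
  apply: off_only_slit => //; first by rewrite /hh /= hgtB hgt_pt subrr.
  by rewrite /rr /= rhoB rho_pt subr_gt0; have := ler_norm (rho (pos a s0)); have := rX a; lra.
have [ga nga hga] := ha a.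
have [k jk] := cross J hS hc bs0 nga hga osl.
have jd := near_sec_jump J (u := bp y) (hfar _ (bpfar y)) Ss0 osl.
have jf := jumpD jk jd.
have ef : t (Some (bp y).1) s0 - c + (g - t (Some (bp y).1) s0) = g - c by rewrite addrC addrA subrK.
rewrite [X in jump _ _ _ X]ef in jf.
set d := (_ - _) in jf.
exists (k + d (bp y)); have := bp_near _ _ jf; apply: filterS => y' [h1 h2].
have hy' : hh a (bp y') = y' - y by rewrite /hh /bp /= hgtB hgt_pt.
split=> hyy; first by rewrite /D h1// hy' subr_gt0.
rewrite /D h2; last by rewrite hy' subr_lt0.
by rewrite /afix -addrA -mulmxDl addrAC.
Qed.

End AtInfinity.

End Parabolic.
Export Parabolic.

(** * Every parabolic vector is the coordinate vector of a datum *)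

Section Realization.
Variables (R : realType) (th : R) (I : finType) (K : fieldType) (n : nat).
Local Notation C := (Cplx R).
Local Notation V := 'rV[K]_n.
Variables (pa : I -> C) (ea : I -> bool) (B : I -> 'M[K]_n) (S : set C).
Variable sec : (C * C -> V) -> C * C -> Prop.
Local Notation rho := (rho th).
Local Notation hgt := (hgt th).
Local Notation pos := (pos pa ea).
Local Notation hh := (hh th pa ea).
Local Notation rr := (rr th pa ea).
Local Notation omega := (omega th pa ea).
Local Notation only_slit := (only_slit th pa ea).
Local Notation near_sec := (near_sec th pa ea S sec).
Local Notation datum_at := (datum_at th pa ea S sec).
Local Notation coord := (coord th pa ea S sec).
Local Notation coord_with := (coord_with th pa ea S sec).
Local Notation off := (off th pa ea).
Local Notation away := (away th pa ea).
Local Notation regular := (regular pa ea S).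
Local Notation jump := (jump th pa ea).
Hypothesis J : jump_system th pa ea B S sec.


Lemma near_sec_of_lc m u : lc m u -> S u.2 -> omega u -> near_sec m (Some u.1) u.2.
Proof.
case: u => x s lm Ss ou /=.
have nS : \forall w \near (x, s), S w.2 by exact: (cvg_snd (js_open J Ss)).
apply: filterS3 (lc_near lm) (omega_near ou) nS => w lw ow Sw _.
exact/(js_omega J).
Qed.

Lemma near_sec_of_jump m u a k : S u.2 -> only_slit a u ->
  (\forall w \near u, m w = if hh a w < 0 then k *m B a else k) ->
  near_sec m (Some u.1) u.2.
Proof.
case: u => x s Ss osl hm /=.
have nS : \forall w \near (x, s), S w.2 by exact: (cvg_snd (js_open J Ss)).
apply: filterS3 (near_join hm) (only_slit_near osl) nS => w hw [h1 h2] Sw _.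
have [h0|/eqP h0] := eqVneq (hh a w) 0.
  have oslw := h2 h0; apply/(@js_slit _ _ _ _ _ _ _ _ _ _ J m w a Sw oslw).
  by have := nbhs_singleton hw; rewrite h0 ltxx => ->.
apply/(@js_omega _ _ _ _ _ _ _ _ _ _ J m w Sw (h1 h0)).
rewrite /lc (nbhs_singleton hw).
case: (ltgtP (hh a w) 0) => [hn|hp|//].
  by apply: filterS2 hw (cts_neg (@hh_cts R th I pa ea a) hn) => w' -> ->.
apply: filterS2 hw (cts_pos (@hh_cts R th I pa ea a) hp) => w' -> h.
by rewrite ltNge ltW.
Qed.

Variables (v : option I -> V) (s0 : C).
Hypothesis Ss0 : S s0.
Hypothesis os0 : off s0.
Hypothesis pv : parabolic th pa ea B v s0.

Let L := descending th pa ea s0.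
Let X : R := left_bound th pa s0 1.

(** The value at infinity, carried from the top down through those slits that pass above [u]. *)
Definition strip_value (u : C * C) : V :=
  foldl (fun x a => if hh a u < 0 then afix B v a x else x) (v None) L.

(** Built so that the zero function is the lift over the slit plane. The datum is then constant at a
    tip; across the slit of [a] it is normalized to 0 above, so the affine rule leaves
    [afix B v a 0] below. To the right, near infinity, it accumulates these rules. *)
Definition model_datum (b : option C) (s : C) (u : C * C) : V :=
  match b with
  | Some x =>
    if [pick a | x == pos a s] is Some a then v (Some a) else
    if [pick a | (hh a (x, s) == 0) && (0 < rr a (x, s))] is Some a then
      if hh a u < 0 then afix B v a 0 else 0
    else 0
  | None => if X < rho u.1 then strip_value u else v None
  end.

Let md_omega x s : omega (x, s) -> model_datum (Some x) s = 0.
Proof.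
move=> ou; apply/funext => u /=; case: pickP => [a /eqP e|_].
  have := ou a; rewrite e hh_tip rr_tip => /(_ erefl); by rewrite ltxx.
case: pickP => // a /andP[/eqP h0 r0]; have := ou a h0.
by rewrite ltNge ltW.
Qed.

Let md_slit x s a : only_slit a (x, s) ->
  model_datum (Some x) s = fun u => if hh a u < 0 then afix B v a 0 else 0.
Proof.
move=> osl; have [h0 r0 aw] := osl; apply/funext => u /=; case: pickP => [b /eqP e|_].
  have [ba|ba] := eqVneq b a; first by move: r0; rewrite e ba rr_tip ltxx.
  by have := aw b ba; rewrite e hh_tip rr_tip ltxx => /(_ erefl).
case: pickP => [b /andP[/eqP hb rb]|/(_ a)]; last by rewrite h0 eqxx r0.
have [->//|ba] := eqVneq b a.
by have := aw b ba hb; rewrite ltNge ltW.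
Qed.

Let md_tip a s : S s -> model_datum (Some (pos a s)) s = fun=> v (Some a).
Proof.
move=> Ss; apply/funext => u /=; case: pickP => [b /eqP e|/(_ a)]; last by rewrite eqxx.
by rewrite ((js_inj J Ss) _ _ e).
Qed.

Let md_diff_omega (m : C * C -> V) x s : S s -> omega (x, s) -> lc m (x, s) ->
  near_sec (model_datum (Some x) s - m) (Some x) s.
Proof.
move=> Ss ou lm; apply: (near_sec_of_lc (u := (x, s))) => //.
by rewrite md_omega//; apply: lcB => //; exact: lc_cst.
Qed.

Let tips_or s x : S s -> off s -> [\/ omega (x, s), exists a, only_slit a (x, s) |
  exists a, x = pos a s].
Proof.
move=> Ss os; have [[a e]|ne] := pselect (exists a, x = pos a s); first by apply: Or33; exists a.
have rx : regular (x, s) by split=> // a e; apply: ne; exists a.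
by have [h|h] := off_regular os rx; [apply: Or31|apply: Or32].
Qed.

(** [strip_value] follows the order of the slits over [s0]; it can be used over every nearby [s]
    because this order persists. *)
Let order s := forall a b : I, hgt (pos a s0) < hgt (pos b s0) -> hgt (pos a s) < hgt (pos b s).

Let order_near : \forall s \near s0, order s.
Proof.
apply: near_forall => a; apply: near_forall => b.
have [h|h] := ltP (hgt (pos a s0)) (hgt (pos b s0)); last first.
  by near=> s.
have cab : continuous (fun s' => hgt (pos b s') - hgt (pos a s')).
  by apply: ctsB; apply: cts_comp; [exact: pos_cts|exact: hgt_cts|exact: pos_cts|exact: hgt_cts].
have h' : 0 < hgt (pos b s0) - hgt (pos a s0) by rewrite subr_gt0.
by have := cts_pos cab h'; apply: filterS => s'; rewrite subr_gt0.
Unshelve. all: by end_near. Qed.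

Let strip_top u : (forall a, 0 < hh a u) -> strip_value u = v None.
Proof.
move=> h; rewrite /strip_value; elim: L (v None) => //= a l IH x.
by rewrite ltNge (ltW (h a)) /= IH.
Qed.

Let strip_bottom u : (forall a, hh a u < 0) -> strip_value u = v None.
Proof.
move=> h; rewrite -[RHS]pv /strip_value -/L; elim: L (v None) => //= a l IH x.
by rewrite h IH.
Qed.

Let strip_eq u u' : (forall a, (hh a u < 0) = (hh a u' < 0)) -> strip_value u = strip_value u'.
Proof.
by move=> h; rewrite /strip_value; elim: L (v None) => //= a l IH x; rewrite h IH.
Qed.

Let sign_near u : \forall u' \near u, forall a, hh a u != 0 -> (hh a u' < 0) = (hh a u < 0).
Proof.
apply: near_forall => a; case: (ltgtP (hh a u) 0) => [hn|hp|_]; last by near=> u'.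
  by apply: filterS (cts_neg (@hh_cts R th I pa ea a) hn) => u' ->.
apply: filterS (cts_pos (@hh_cts R th I pa ea a) hp) => u' h _.
by apply/negbTE; rewrite -leNgt ltW.
Unshelve. all: by end_near. Qed.

(** On the slit of [a], the higher slits have all been applied and the lower ones have not, so near
    [u] only the step of [a] depends on the side. *)
Let strip_slit (a : I) u : S u.2 -> order u.2 -> only_slit a u -> exists k,
  \forall w \near u, strip_value w = if hh a w < 0 then afix B v a k else k.
Proof.
case: u => x s /= Ss os [h0 r0 aw].
have hx : hgt x = hgt (pos a s) by move: h0; rewrite /hh hgtB => /subr0_eq.
have aL : a \in L by exact: mem_descending.
have so : sorted (fun a b => hgt (pos b s0) < hgt (pos a s0)) L by exact: descending_sorted.
rewrite /strip_value; case/splitPr: aL so => l1 l2 so.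
have tr : transitive (fun a b : I => hgt (pos b s0) < hgt (pos a s0)).
  by move=> p q r h1 h2; exact: lt_trans h2 h1.
have [hl1 hl2] : (forall b, b \in l1 -> hgt (pos a s0) < hgt (pos b s0)) /\
    (forall b, b \in l2 -> hgt (pos b s0) < hgt (pos a s0)).
  move: so; rewrite (sorted_pairwise tr) pairwise_cat => /and3P[/allrelP ar _ /= /andP[/allP al _]].
  by split=> b bl; [apply: ar => //; exact: mem_head|exact: al].
pose N := foldl (fun x b => afix B v b x) (v None) l1.
exists N; have := sign_near (x, s); apply: filterS => w hw.
have f1 : foldl (fun x b => if hh b w < 0 then afix B v b x else x) (v None) l1 = N.
  have hs b : b \in l1 -> hh b w < 0.
    move=> /hl1 /os h; have hb : hh b (x, s) < 0 by rewrite /hh hgtB hx subr_lt0.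
    by rewrite hw// lt_eqF.
  rewrite /N; elim: (l1) (v None) hs => //= b l IH y hs.
  by rewrite hs ?mem_head// IH// => b' bl; apply: hs; rewrite in_cons bl orbT.
have f2 y : foldl (fun x b => if hh b w < 0 then afix B v b x else x) y l2 = y.
  have hs b : b \in l2 -> (hh b w < 0) = false.
    move=> /hl2 /os h; have hb : 0 < hh b (x, s) by rewrite /hh hgtB hx subr_gt0.
    by rewrite hw ?gt_eqF//; apply/negbTE; rewrite -leNgt ltW.
  elim: (l2) hs => //= b l IH hs.
  by rewrite hs ?mem_head// IH// => b' bl; apply: hs; rewrite in_cons bl orbT.
by rewrite foldl_cat /= f1 f2.
Qed.

Let posB a s : box th s0 1 s -> `|rho (pos a s)| < X /\ `|hgt (pos a s)| < X + \sum_a `|hgt (pa a)| + `|hgt s0|.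
Proof.
move=> [b1 b2].
have l1 : `|rho (pa a)| <= \sum_a `|rho (pa a)|.
  by rewrite (bigD1 a)//= lerDl; apply: sumr_ge0.
have l2 : `|hgt (pa a)| <= \sum_a `|hgt (pa a)|.
  by rewrite (bigD1 a)//= lerDl; apply: sumr_ge0.
have s1 : 0 <= \sum_a `|rho (pa a)| by apply: sumr_ge0.
have s2 : 0 <= \sum_a `|hgt (pa a)| by apply: sumr_ge0.
have n1 := normr_ge0 (rho s0); have n2 := normr_ge0 (hgt s0).
rewrite /X /left_bound normr1 /pos rhoD hgtD.
have k1 : `|rho (pa a) + rho (if ea a then s else 0)| <= `|rho (pa a)| + `|rho (if ea a then s else 0)| := ler_normD _ _.
have k2 : `|hgt (pa a) + hgt (if ea a then s else 0)| <= `|hgt (pa a)| + `|hgt (if ea a then s else 0)| := ler_normD _ _.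
have k3 : `|rho (if ea a then s else 0)| < `|rho s0| + 1.
  case: (ea a); last by rewrite rho0 normr0; lra.
  by have := ler_distD 0 (rho s) (rho s0); have := ler_normD (rho s - rho s0) (rho s0); rewrite subrK; lra.
have k4 : `|hgt (if ea a then s else 0)| < `|hgt s0| + 1.
  case: (ea a); last by rewrite hgt0 normr0; lra.
  by have := ler_normD (hgt s - hgt s0) (hgt s0); rewrite subrK; lra.
by split; lra.
Qed.

Let datum_ok s : S s -> off s -> order s -> box th s0 1 s ->
  (\forall s' \near s, S s' /\ off s' /\ order s' /\ box th s0 1 s') -> datum_at model_datum s.
Proof.
move=> Ss os ors bs nall; split.
  move=> x.
  have nall' : \forall u \near (x, s), S u.2 /\ off u.2 /\ order u.2 /\ box th s0 1 u.2 by exact: (cvg_snd nall).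
  have [ou|[a osl]|[a e]] := @tips_or _ x Ss os.
  - have := omega_near ou; apply: filterS2 nall' => -[x' s'] [Ss' _] ou' /=.
    by rewrite (md_omega ou); apply: md_diff_omega => //; exact: lc_cst.
  - rewrite (md_slit osl).
    apply: filterS2 nall' (only_slit_near osl) => -[x' s'] [Ss' [os' _]] [h1 h2].
    have [h0|/eqP h0] := eqVneq (hh a (x', s')) 0.
      by rewrite (md_slit (h2 h0)) subrr; exact: (near_sec0 J).
    apply: md_diff_omega => //; first exact: h1.
    have := sign_near (x', s'); apply: filterS => w hw.
    by rewrite hw//; apply/eqP.
  - subst x; rewrite md_tip//.
    have aw : away a (pos a s, s) by exact: off_away.
    apply: filterS2 nall' (away_near aw) => -[x' s'] [Ss' [os' _]] aw'.
    have [ou|[b osl]|[b e]] := @tips_or _ x' Ss' os'.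
    + by apply: md_diff_omega => //; exact: lc_cst.
    + have ba : b = a.
        apply/eqP; apply: contraT => ba; case: osl => hb rb _.
        by have := aw' b ba hb; rewrite ltNge ltW.
      subst b; apply: (near_sec_of_jump (u := (x', s')) Ss' osl (k := - v (Some a))).
      rewrite (md_slit osl); near=> w; rewrite !fctE /afix; case: ifP => _.
        by rewrite sub0r mulNmx addrC addKr.
      by rewrite sub0r.
    + have ba : b = a.
        apply/eqP; apply: contraT => ba.
        by have := aw' b ba; rewrite e hh_tip rr_tip ltxx => /(_ erefl).
      by rewrite e ba md_tip// subrr; exact: (near_sec0 J).
(* The datum at infinity breaks along the line [rho = X], but not beyond [bd]: above all slits
   [strip_value] is still [v None], and below them it is [v None] again by the parabolic
   relation. *)
pose bd := X + \sum_a `|hgt (pa a)| + `|hgt s0|.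
have X0 : 0 < X by exact: left_bound_gt0.
have Xbd : X <= bd.
  by rewrite /bd -addrA lerDl addr_ge0//; apply: sumr_ge0.
exists bd; apply: filterS nall => s' [Ss' [os' [ors' bs']]]; split; last first.
  have -> : model_datum None s' - model_datum None s = 0 by rewrite subrr.
  exact: (near_sec0 J).
move=> x fx; have pB a := posB a bs'.
have nov : lc (model_datum None s) (x, s') \/ X < rho x.
  case: fx => fx.
    have [rx|rx] := ltP X (rho x); [by right|left].
    have rx' : rho x < X.
      by rewrite lt_neqAle rx andbT; apply: contraTN fx => /eqP ->; rewrite gtr0_norm// -leNgt.
    have hX : 0 < X - rho (x, s').1 by rewrite subr_gt0.
    have n1 := cts_pos (f := fun u : C * C => X - rho u.1) _ hX.
    have {}n1 : \forall u \near (x, s'), 0 < X - rho u.1.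
      apply: n1; apply: ctsB; first exact: cts_cst.
      by apply: cts_comp; [exact: fst_cts|exact: rho_cts].
    apply: filterS n1 => u; rewrite subr_gt0 => hu /=.
    by rewrite !ltNge (ltW hu) (ltW rx').
  left; have hsgn : (forall a, 0 < hh a (x, s')) \/ (forall a, hh a (x, s') < 0).
    have [h|h] := leP 0 (hgt x); [left|right] => a.
      rewrite (ger0_norm h) in fx; rewrite /hh hgtB subr_gt0.
      by have [_] := pB a; have := ler_norm (hgt (pos a s')); rewrite -/bd; lra.
    rewrite (ltr0_norm h) in fx; rewrite /hh hgtB subr_lt0.
    by have [_] := pB a; have := ler_norm (- hgt (pos a s')); rewrite normrN -/bd; lra.
  have val u : (forall a, 0 < hh a u) \/ (forall a, hh a u < 0) -> model_datum None s u = v None.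
    by move=> hu /=; case: ifP => // _; case: hu; [exact: strip_top|exact: strip_bottom].
  have nn : \forall u \near (x, s'), (forall a, 0 < hh a u) \/ (forall a, hh a u < 0).
    case: hsgn => h.
      have : \forall u \near (x, s'), forall a, 0 < hh a u.
        by apply: near_forall => a; apply: cts_pos => //; exact: hh_cts.
      by apply: filterS => u; left.
    have : \forall u \near (x, s'), forall a, hh a u < 0.
      by apply: near_forall => a; apply: cts_neg => //; exact: hh_cts.
    by apply: filterS => u; right.
  by apply: filterS nn => u hu; rewrite !val.
have rXn : X < rho x -> \forall u \near (x, s'), X < rho u.1.
  rewrite -subr_gt0 => h; have := cts_pos (x := (x, s')) (f := fun u : C * C => rho u.1 - X) _ h.
  have cf : continuous (fun u : C * C => rho u.1 - X).
    apply: ctsB; last exact: cts_cst.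
    by apply: cts_comp; [exact: fst_cts|exact: rho_cts].
  by move=> /(_ cf); apply: filterS => u; rewrite subr_gt0.
have [ou|[a osl]|[a e]] := @tips_or _ x Ss' os'.
- apply: md_diff_omega => //; case: nov => // rx.
  have hne a : hh a (x, s') != 0.
    apply/eqP => /ou; rewrite /rr rhoB; have [+ _] := pB a.
    by have := ler_norm (rho (pos a s')); lra.
  apply: filterS2 (rXn rx) (sign_near (x, s')) => u h1 h2 /=.
  by rewrite h1 rx; apply: strip_eq => a; exact: h2.
- have rx : X < rho x.
    case: (osl) => h0 r0 _; have [p1 p2] := pB a.
    have hx : hgt x = hgt (pos a s') by move: h0; rewrite /hh hgtB => /subr0_eq.
    move: r0; rewrite /rr /= rhoB => r0.
    case: fx => fx; last by rewrite hx /bd in fx; lra.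
    have nb := ler_norm (- rho (pos a s')); rewrite normrN in nb.
    by have [h|h] := leP 0 (rho x); [rewrite ger0_norm// in fx|rewrite ltr0_norm// in fx]; lra.
  have [k hk] := @strip_slit a (x, s') Ss' ors' osl.
  apply: (near_sec_of_jump (u := (x, s')) Ss' osl (k := - k)).
  apply: filterS2 (rXn rx) hk => w h1 h2.
  rewrite (md_slit osl) !fctE /= h1 h2; case: ifP => _; last by rewrite sub0r.
  by rewrite /afix sub0r opprD addrACA subrr add0r -mulNmx -mulmxDl opprB addrA addNr add0r mulNmx.
- by exfalso; have [p1 p2] := pB a; rewrite e in fx; case: fx => fx; rewrite -/bd in p2; lra.
Unshelve. all: by end_near. Qed.

Lemma coord_model : (\forall s \near s0, datum_at model_datum s) /\ coord model_datum s0 v.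
Proof.
have dt : \forall s \near s0, datum_at model_datum s.
  have nS := js_open J Ss0; have nO := off_near os0; have nB := box_nbhs th s0 (@ltr01 R).
  have nall := nearI nS (nearI nO (nearI order_near nB)).
  have nall' := near_join nall; apply: filterS2 nall nall' => s [? [? [? ?]]] h.
  by apply: datum_ok => //; exact: h.
have l0 u : lc (0 : C * C -> V) u by exact: (lc_cst (0 : V)).
split=> //; exists 0; apply: (coord_of_lifts J) => //.
- by apply: filterS (js_open J Ss0) => s _ x ou; rewrite md_omega// subrr.
- move=> a; exists (model_datum (Some (pos a s0)) s0).
    by rewrite subrr; exact: (near_sec0 J).
  by near=> u => _; rewrite md_tip// subr0.
exists (model_datum None s0); first by rewrite subrr; exact: (near_sec0 J).
exists 0; apply: filterS (js_open J Ss0) => s _ x; rewrite oppr0 => hx /=.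
have X0 : 0 < X by exact: left_bound_gt0.
have -> : (X < rho x) = false by apply/negbTE; rewrite -leNgt; lra.
by rewrite subr0.
Unshelve. all: by end_near. Qed.

End Realization.

(** * Irreducibility of the braid action *)

Lemma foldl_eq (T S : Type) (f g : T -> S -> T) x l : f =2 g -> foldl f x l = foldl g x l.
Proof. by move=> fg; elim: l x => //= a l IH x; rewrite fg IH. Qed.

Section Algebra.
Variables (R : realType) (K : fieldType) (n p q : nat).
Local Notation V := 'rV[K]_n.
Local Notation I := ('I_p + 'I_q)%type.
Local Notation vec := (option I -> V).
Variables (Y : 'I_p -> 'M[K]_n) (mu : 'I_q -> K).
Hypothesis Yu : forall i, Y i \in unitmx.
Hypothesis mu0 : forall j, mu j != 0.
Hypothesis mu1 : forall j, mu j != 1.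

Definition irreducible_mx : Prop := forall U : set V, submod U ->
  (forall i v, U v -> U (v *m Y i)) -> (forall v, U v -> v = 0) \/ (forall v, U v).
Hypothesis irr : irreducible_mx.

Definition braid_mx (a : I) : 'M[K]_n :=
  match a with inl i => Y i | inr j => (mu j)%:M end.

Definition upd (v : vec) (a : I) (x : V) : vec := fun o => if o == Some a then x else v o.

(** With [D = B a], the change of coordinates when [b] passes from above to below the slit of [a];
    the way back has [D] inverted. *)
Definition slide (v : vec) (a b : I) (D : 'M[K]_n) : vec :=
  upd v b (v (Some a) + (v (Some b) - v (Some a)) *m D).

Variables (H : 'I_p -> 'I_q -> R).
Hypothesis Hinj : forall i j i' j', H i j = H i' j' -> i = i' /\ j = j'.

Definition offh (y : R) : Prop := forall i j, H i j != y.
Definition same_strip (y y' : R) : Prop := forall i j, (H i j < y) = (H i j < y').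
Definition only_between (y : R) (i : 'I_p) (j : 'I_q) (y' : R) : Prop :=
  y < H i j < y' /\ forall i' j', (i', j') != (i, j) -> (H i' j' < y) = (H i' j' < y').

(** [N y] stands for the coordinate vectors of a subsheaf at height [y]. The strips below and above
    [x i + y j] communicate on its right, where a puncture of [V2] crosses a slit of [V1], and on
    its left, where the roles are exchanged. *)
Variable N : R -> set vec.
Hypothesis N_lin : forall y, offh y -> forall (k : K) v v', N y v -> N y v' ->
  N y (fun o => k *: v o + v' o).
Hypothesis N_const : forall y, offh y -> forall w, N y (fun=> w).
Hypothesis N_same : forall y y', offh y -> offh y' -> same_strip y y' -> N y `<=` N y'.
Hypothesis N_right : forall y i j y', offh y -> offh y' -> only_between y i j y' ->
  (forall v, N y' v -> N y (slide v (inl i) (inr j) (Y i))) /\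
  (forall v, N y v -> N y' (slide v (inl i) (inr j) (invmx (Y i)))).
Hypothesis N_left : forall y i j y', offh y -> offh y' -> only_between y i j y' ->
  (forall v, N y v -> N y' (slide v (inr j) (inl i) (mu j)%:M)) /\
  (forall v, N y' v -> N y (slide v (inr j) (inl i) (mu j)^-1%:M)).

Let N0 y : offh y -> N y (fun=> 0). Proof. by move=> oy; exact: N_const. Qed.

Lemma isolated (t : R) : exists2 e : R, 0 < e & forall y, `|y - t| < e ->
  forall i j, H i j != t -> (H i j < y) = (H i j < t) /\ H i j != y.
Proof.
suff : \forall y \near t, forall i j, H i j != t -> (H i j < y) = (H i j < t) /\ H i j != y.
  move=> /nbhs_ballP[e /= e0 he]; exists e => // y hy; apply: he.
  by rewrite /ball /= distrC.
apply: near_forall => i; apply: near_forall => j.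
case: (ltgtP (H i j) t) => [h|h|_].
- by apply: filterS (lt_nbhsr h) => y hy _; rewrite hy lt_eqF.
- by apply: filterS (lt_nbhsl h) => y hy _; rewrite gt_eqF// ltNge ltW.
- by near=> y.
Unshelve. all: by end_near. Qed.

(** [P] is extended to all heights by requiring it at all nearby heights off the [H i j]; the
    extension [f] is locally constant on the whole line. *)
Lemma strip_connected (P : R -> Prop) :
  (forall y y', offh y -> offh y' -> same_strip y y' -> P y -> P y') ->
  (forall y i j y', offh y -> offh y' -> only_between y i j y' -> P y <-> P y') ->
  forall y y', offh y -> offh y' -> P y -> P y'.
Proof.
move=> Ps Pc.
pose f t := exists2 e : R, 0 < e & forall y, offh y -> `|y - t| < e -> P y.
have loc t : exists2 e : R, 0 < e & forall y y', offh y -> offh y' -> `|y - t| < e -> `|y' - t| < e -> P y -> P y'.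
  have [e e0 he] := isolated t; exists e => // y y' oy oy' hy hy' Py.
  have [[i [j hij]]|nH] := pselect (exists i j, H i j = t); last first.
    apply: Ps Py => // i j; have hne : H i j != t by apply/eqP => h; apply: nH; exists i, j.
    by rewrite (he _ hy _ _ hne).1 (he _ hy' _ _ hne).1.
  have oth i' j' : (i', j') != (i, j) -> H i' j' != t.
    by move=> ne; apply: contra ne => /eqP; rewrite -hij => /Hinj[-> ->].
  have [yt|yt] : (y < t) \/ (t < y) by case: (ltgtP y t) (oy i j) => // [||->]; [left|right|rewrite hij eqxx].
    have [yt'|yt'] : (y' < t) \/ (t < y') by case: (ltgtP y' t) (oy' i j) => // [||->]; [left|right|rewrite hij eqxx].
      apply: Ps Py => // i' j'; have [[-> ->]|ne] := eqVneq (i', j') (i, j).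
        by rewrite hij !ltNge !ltW.
      by rewrite (he _ hy _ _ (oth _ _ ne)).1 (he _ hy' _ _ (oth _ _ ne)).1.
    apply: (Pc y i j y' oy oy' _).1 => //; split; first by rewrite hij yt.
    by move=> i' j' ne; rewrite (he _ hy _ _ (oth _ _ ne)).1 (he _ hy' _ _ (oth _ _ ne)).1.
  have [yt'|yt'] : (y' < t) \/ (t < y') by case: (ltgtP y' t) (oy' i j) => // [||->]; [left|right|rewrite hij eqxx].
    apply: (Pc y' i j y oy' oy _).2 => //; split; first by rewrite hij yt'.
    by move=> i' j' ne; rewrite (he _ hy _ _ (oth _ _ ne)).1 (he _ hy' _ _ (oth _ _ ne)).1.
  apply: Ps Py => // i' j'; have [[-> ->]|ne] := eqVneq (i', j') (i, j).
    by rewrite hij yt yt'.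
  by rewrite (he _ hy _ _ (oth _ _ ne)).1 (he _ hy' _ _ (oth _ _ ne)).1.
have off_in t (e : R) : 0 < e -> exists y, offh y /\ `|y - t| < e.
  move=> e0; have [d d0 hd] := isolated t; pose y := t + Num.min e d / 2.
  have m0 : 0 < Num.min e d by rewrite lt_min e0.
  have me : Num.min e d <= e by rewrite ge_min lexx.
  have md : Num.min e d <= d by rewrite ge_min lexx orbT.
  have yt : `|y - t| = Num.min e d / 2 by rewrite /y addrC addKr gtr0_norm ?divr_gt0.
  exists y; split; last by rewrite yt; lra.
  move=> i j; have [->|hne] := eqVneq (H i j) t; first by rewrite lt_eqF// /y ltrDl divr_gt0.
  by have [|_] := hd y _ i j hne; first by rewrite yt; lra.
have fP y : offh y -> f y <-> P y.
  move=> oy; split; first by move=> [e e0 he]; apply: he => //; rewrite subrr normr0.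
  move=> Py; have [e e0 he] := loc y; exists e => // y' oy' hy'.
  by apply: he Py => //; rewrite subrr normr0.
have fl t : \forall t' \near t, f t' <-> f t.
  have [e e0 he] := loc t; have := nbhsx_ballx t e e0; apply: filterS => t'.
  rewrite /ball /= distrC => ht'; split=> -[d d0 hd].
    have m0 : 0 < Num.min d (e - `|t' - t|) by rewrite lt_min d0 subr_gt0.
    have [y [oy]] := off_in t' _ m0; rewrite lt_min => /andP[h1 h2].
    exists e => // y' oy' hy'; apply: he (hd _ oy h1) => //.
    by have := ler_distD t' y t; lra.
  have m0 : 0 < Num.min d e by rewrite lt_min d0.
  have [y [oy]] := off_in t _ m0; rewrite lt_min => /andP[h1 h2].
  exists (e - `|t' - t|); first by rewrite subr_gt0.
  move=> y' oy' hy'; apply: he (hd _ oy h1) => //.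
  by have := ler_distD t' y' t; lra.
have key y y' : y <= y' -> f y <-> f y'.
  move=> yy'; apply: (segment_const (P := fun x => f y <-> f x) yy') => // x _.
  by have := fl x; apply: filterS => x' h _; split=> h'; [rewrite -h|rewrite h].
move=> y y' oy oy' /(fP _ oy) fy; apply/(fP _ oy').
by have [/key|/ltW /key] := leP y y'; move=> [h1 h2]; auto.
Qed.

Let slideE v a b D c : slide v a b D (Some c) =
  if c == b then v (Some a) + (v (Some b) - v (Some a)) *m D else v (Some c).
Proof. by rewrite /slide /upd; congr (if _ then _ else _); apply/eqP/eqP => [[]|->]. Qed.

Let slide_oo v a b D : slide v a b D None = v None.
Proof. by []. Qed.

Let below i j : exists y y', [/\ offh y, offh y' & only_between y i j y'].
Proof.
have [e e0 he] := isolated (H i j).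
have h1 : `|H i j - e / 2 - H i j| < e by rewrite addrC addKr normrN gtr0_norm ?divr_gt0//; lra.
have h2 : `|H i j + e / 2 - H i j| < e by rewrite addrC addKr gtr0_norm ?divr_gt0//; lra.
have ne i' j' : (i', j') != (i, j) -> H i' j' != H i j.
  by move=> h; apply: contra h => /eqP /Hinj[-> ->].
exists (H i j - e / 2), (H i j + e / 2); split.
- move=> i' j'; have [[-> ->]|h] := eqVneq (i', j') (i, j); last by have [] := he _ h1 _ _ (ne _ _ h).
  by rewrite gt_eqF//; lra.
- move=> i' j'; have [[-> ->]|h] := eqVneq (i', j') (i, j); last by have [] := he _ h2 _ _ (ne _ _ h).
  by rewrite lt_eqF//; lra.
split; first lra.
by move=> i' j' h; have [-> _] := he _ h1 _ _ (ne _ _ h); have [-> _] := he _ h2 _ _ (ne _ _ h).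
Qed.

(* Moving past [z_j] on the left and past the other [z_l] on the right only
   rescales the differences [v_m - v_j]. *)
Let transport_diff j y y' v : offh y -> offh y' -> N y v -> exists2 v', N y' v' &
  forall m, exists2 c, c != 0 & v' (Some (inl m)) - v' (Some (inr j)) =
    c *: (v (Some (inl m)) - v (Some (inr j))).
Proof.
move=> oy oy' Nv.
pose P z := offh z -> exists2 v', N z v' & forall m, exists2 c, c != 0 &
  v' (Some (inl m)) - v' (Some (inr j)) = c *: (v (Some (inl m)) - v (Some (inr j))).
suff : P y' by apply.
apply: (strip_connected _ _ oy oy'); rewrite /P.
- move=> z z' oz oz' ss h _; have [v' Nv' hv'] := h oz.
  by exists v' => //; exact: N_same Nv'.
- move=> z i l z' oz oz' ob.
  have [r1 r2] := N_right oz oz' ob; have [l1 l2] := N_left oz oz' ob.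
  have step (z1 z2 : R) (c0 : K) (D : 'M[K]_n) : c0 != 0 -> offh z1 ->
      (forall w, N z1 w -> N z2 (slide w (inr l) (inl i) c0%:M)) ->
      (forall w, N z1 w -> N z2 (slide w (inl i) (inr l) D)) ->
      P z1 -> P z2.
    move=> c00 oz1 hl hr h _; have [w Nw hw] := h oz1.
    have [lj|lj] := eqVneq l j; last first.
      exists (slide w (inl i) (inr l) D); first exact: hr.
      move=> m; have [c c_neq0 hc] := hw m; exists c => //.
      rewrite !slideE /= -hc; congr (_ - _); case: eqP => // -[e1].
      by rewrite e1 eqxx in lj.
    subst l; exists (slide w (inr j) (inl i) c0%:M); first exact: hl.
    move=> m; have [c c_neq0 hc] := hw m.
    rewrite !slideE /=; case: eqP => [[e1]|_]; last by exists c.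
    subst m.
    by exists (c0 * c); [rewrite mulf_neq0|rewrite -scalerA -hc mul_mx_scalar addrC addKr].
  split; [apply: step l1 r2 => //|apply: step l2 r1 => //]; exact: invr_neq0.
- by move=> _; exists v => // m; exists 1; rewrite ?oner_neq0// scale1r.
Qed.

(** The difference between a vector after one turn around [x i + y j] and the vector itself; it
    depends only on the difference [d] of its entries at [x i] and at [y j]. *)
Let ev i j (d : V) : vec := fun o => match o with
  | Some (inl m) => if m == i then (mu j - 1) *: d else 0
  | Some (inr l) => if l == j then mu j *: (d *m (1%:M - Y i)) else 0
  | None => 0 end.

(* With the opposite choice, [ev i j d] keeps its other coordinates zero. *)
Let transport_ev i j y y' d : offh y -> offh y' -> N y (ev i j d) ->
  exists w, N y' (fun o => match o with
    | Some (inl m) => if m == i then d else 0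
    | Some (inr l) => if l == j then w else 0
    | None => 0 end).
Proof.
move=> oy oy' Nv.
pose sh (x w : V) : vec := fun o => match o with
    | Some (inl m) => if m == i then x else 0
    | Some (inr l) => if l == j then w else 0
    | None => 0 end.
pose P z := offh z -> exists c w, c != 0 /\ N z (sh (c *: d) w).
have : P y'.
  apply: (strip_connected _ _ oy oy'); rewrite /P.
  - move=> z z' oz oz' ss h _; have [c [w [c0 Nw]]] := h oz.
    by exists c, w; split=> //; exact: N_same Nw.
  - move=> z i' l z' oz oz' ob.
    have [r1 r2] := N_right oz oz' ob; have [l1 l2] := N_left oz oz' ob.
    have step (z1 z2 : R) (c0 : K) (D : 'M[K]_n) : c0 != 0 -> offh z1 ->
        (forall w, N z1 w -> N z2 (slide w (inr l) (inl i') c0%:M)) ->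
        (forall w, N z1 w -> N z2 (slide w (inl i') (inr l) D)) ->
        P z1 -> P z2.
      move=> c00 oz1 hl hr h _; have [c [w [c_neq0 Nw]]] := h oz1.
      have [lj|lj] := eqVneq l j.
        exists c, (slide (sh (c *: d) w) (inl i') (inr l) D (Some (inr l))); split=> //.
        suff -> : sh (c *: d) (slide (sh (c *: d) w) (inl i') (inr l) D (Some (inr l))) =
          slide (sh (c *: d) w) (inl i') (inr l) D by exact: hr.
        apply/funext => -[[m|m]|]; rewrite /= ?slideE//=.
        case: (eqVneq m j) => [->|mj]; first by rewrite lj !eqxx.
        by case: eqP => // -[e1]; rewrite e1 lj eqxx in mj.
      exists (if i' == i then c0 * c else c), w; split; first by case: ifP => // _; rewrite mulf_neq0.
      suff -> : sh ((if i' == i then c0 * c else c) *: d) w = slide (sh (c *: d) w) (inr l) (inl i') c0%:M.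
        exact: hl.
      apply/funext => -[[m|m]|]; rewrite /= ?slideE//=.
      rewrite (negPf lj) subr0 add0r mul_mx_scalar; case: (eqVneq m i) => [->|mi].
        by case: (eqVneq i' i) => [->|ii']; rewrite ?eqxx ?scalerA//; case: eqP => // -[e1]; rewrite e1 eqxx in ii'.
      by case: eqP => // -[<-]; rewrite (negPf mi) scaler0.
    split; [apply: step l1 r2 => //|apply: step l2 r1 => //]; exact: invr_neq0.
  - move=> _; exists (mu j - 1), (mu j *: (d *m (1%:M - Y i))); split; first by rewrite subr_eq0.
    by [].
move=> /(_ oy')[c [w [c0 Nw]]]; exists (c^-1 *: w).
have := N_lin oy' (c^-1) Nw (N0 oy'); congr (N _ _); apply/funext => -[[m|m]|] /=; rewrite addr0 ?scaler0//.
  by case: ifP => _; rewrite ?scaler0// scalerA mulVf// scale1r.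
by case: ifP => _; rewrite ?scaler0.
Qed.


Let ob_same y y' z z' i j : only_between y i j y' -> only_between z i j z' -> same_strip y z.
Proof.
have key a b : only_between a i j b -> forall i' j', (H i' j' < a) = (H i' j' < H i j).
  move=> [/andP[ab1 ab2] hab] i' j'; have [[-> ->]|ne] := eqVneq (i', j') (i, j).
    by rewrite ltxx; apply/negbTE; rewrite -leNgt ltW.
  apply/idP/idP => h; first by lra.
  by rewrite hab//; lra.
by move=> h1 h2 i' j'; rewrite (key _ _ h1) (key _ _ h2).
Qed.

Let dset i j (d : V) : Prop := exists y y', [/\ offh y, offh y', only_between y i j y' & N y (ev i j d)].

Let ev_lin i j (k : K) d d' : ev i j (k *: d + d') = fun o => k *: ev i j d o + ev i j d' o.
Proof.
apply/funext => -[[m|m]|] /=; last by rewrite scaler0 addr0.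
  by case: ifP => _; rewrite ?scaler0 ?addr0// scalerDr !scalerA mulrC.
by case: ifP => _; rewrite ?scaler0 ?addr0// mulmxDl scalerDr -scalemxAl !scalerA mulrC.
Qed.

Let dset_lin i j (k : K) d d' : dset i j d -> dset i j d' -> dset i j (k *: d + d').
Proof.
move=> [y [y' [oy oy' ob Ny]]] [z [z' [oz oz' ob' Nz]]]; exists y, y'; split=> //.
rewrite ev_lin; apply: N_lin => //.
exact: N_same (ob_same ob' ob) _ Nz.
Qed.

Let dset0 i j : dset i j 0.
Proof.
have [y [y' [oy oy' ob]]] := below i j; exists y, y'; split=> //.
suff -> : ev i j 0 = fun=> 0 by exact: N0.
by apply/funext => -[[m|m]|] //=; case: ifP; rewrite ?mul0mx ?scaler0.
Qed.

Let dsetZ i j k d : k != 0 -> dset i j (k *: d) -> dset i j d.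
Proof.
move=> k0 h; have := dset_lin k^-1 h (dset0 i j).
by rewrite addr0 scalerA mulVf// scale1r.
Qed.

(** The turn goes up on the left of [x i + y j] and comes back down on its right. Both moves
    preserve the family [N], so the commutator term lies in [N y]. *)
Let loop y i j y' v : offh y -> offh y' -> only_between y i j y' -> N y v ->
  dset i j (v (Some (inl i)) - v (Some (inr j))).
Proof.
move=> oy oy' ob Nv; have [r1 _] := N_right oy oy' ob; have [l1 _] := N_left oy oy' ob.
have N2 := r1 _ (l1 _ Nv); exists y, y'; split=> //.
have := N_lin oy (- 1) Nv N2; congr (N _ _); apply/funext => -[[m|m]|].
- rewrite !slideE /=; case: (eqVneq m i) => [->|mi]; last first.
    by case: eqP => [[e1]|_]; [rewrite e1 eqxx in mi|rewrite scaleN1r addNr].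
  by rewrite eqxx mul_mx_scalar scaleN1r scalerBl scale1r opprB [RHS]addrA [RHS]addrC (addrC (mu j *: _)).
- rewrite !slideE /=; case: (eqVneq m j) => [->|mj]; last first.
    by case: eqP => [[e1]|_]; [rewrite e1 eqxx in mj|rewrite scaleN1r addNr].
  rewrite !eqxx mul_mx_scalar scaleN1r scalemxAl.
  move: (v (Some (inr j))) (mu j *: (v (Some (inl i)) - v (Some (inr j)))) => w z.
  by rewrite opprD (addrA w (- w)) subrr sub0r mulNmx mulmxBr mulmx1 -addrA addKr.
- by rewrite !slide_oo scaleN1r addNr.
Qed.

(** The vector [ev i j d] itself belongs to [N]. Moved below [H m j], its difference between [m] and
    [j] is a nonzero multiple of [d *m (1%:M - Y i)], and a turn around [x m + y j] records it. For
    [m = i] the extra term [(mu j - 1) *: d] is first removed by linearity. *)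
Let dset_step i j d m : dset i j d -> dset m j (d *m (1%:M - Y i)).
Proof.
move=> hd; have [y [y' [oy oy' ob Ny]]] := hd.
have [->|mi] := eqVneq m i.
  have := loop oy oy' ob Ny; rewrite /= !eqxx => h.
  have := dset_lin (- 1) h (dset_lin (mu j - 1) hd (dset0 i j)).
  by rewrite addr0 scaleN1r opprB subrK; exact: dsetZ.
have [z [z' [oz oz' obz]]] := below m j.
have [v' Nv' hv'] := transport_diff j oy oz Ny.
have := loop oz oz' obz Nv'; have [c c0 ->] := hv' m; rewrite /= (negPf mi) eqxx sub0r => h.
by apply: (dsetZ (mu0 j)); apply: (dsetZ (k := - c)); rewrite ?oppr_eq0// scaleNr -scalerN.
Qed.

(** Contained in every [dset m j] by [dset_step], hence stable under every [Y i], as [x *m Y i] is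
    [x] minus [x *m (1%:M - Y i)]. The sets [dset i j] are not visibly stable themselves. *)
Let vset j (x : V) : Prop := exists2 d : 'I_p -> V, (forall i, dset i j (d i)) &
  x = \sum_i d i *m (1%:M - Y i).

Let vset_dset j x m : vset j x -> dset m j x.
Proof.
move=> [d hd ->]; elim/big_rec: _ => [|i z _ IH]; first exact: dset0.
by rewrite -[_ *m _]scale1r; apply: dset_lin IH; exact: dset_step.
Qed.

Let vset_submod j : submod (vset j).
Proof.
split; first by exists (fun=> 0); [move=> i; exact: dset0|rewrite big1// => i _; rewrite mul0mx].
move=> k u w [d hd ->] [d' hd' ->]; exists (fun i => k *: d i + d' i).
  by move=> i; exact: dset_lin.
rewrite scaler_sumr -big_split /=; apply: eq_bigr => i _.
by rewrite mulmxDl scalemxAl.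
Qed.

Let vset_single j m d : dset m j d -> vset j (d *m (1%:M - Y m)).
Proof.
move=> hd; exists (fun i => if i == m then d else 0).
  by move=> i; case: eqP => [->//|_]; exact: dset0.
rewrite (bigD1 m)//= eqxx big1 ?addr0// => i im.
by rewrite (negPf im) mul0mx.
Qed.

Let vset_dichotomy j : (forall x, vset j x -> x = 0) \/ (forall x, vset j x).
Proof.
apply: irr; first exact: vset_submod.
move=> i x hx; have h := vset_single (vset_dset i hx).
have := (vset_submod j).2 (- 1) _ _ h hx.
by rewrite mulmxBr mulmx1 scaleN1r opprB subrK.
Qed.

Let vset_zero j : (forall x, vset j x -> x = 0) -> forall y v, offh y -> N y v ->
  forall m, (v (Some (inl m)) - v (Some (inr j))) *m (1%:M - Y m) = 0.
Proof.
move=> h0 y v oy Nv m; have [z [z' [oz oz' obz]]] := below m j.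
have [v' Nv' hv'] := transport_diff j oy oz Nv.
have := loop oz oz' obz Nv'; have [c c0 ->] := hv' m => hd.
by apply: h0; apply: vset_single; exact: dsetZ hd.
Qed.

Hypothesis nontriv : exists i, Y i != 1%:M.
Hypothesis q_gt0 : (0 < q)%N.

Lemma fixed_zero (x : V) : (forall i, x *m Y i = x) -> x = 0.
Proof.
move=> hx; have [||h0|hV] := irr (U := fun x : V => forall i, x *m Y i = x).
- by split=> [i|k u w hu hw i]; [rewrite mul0mx|rewrite mulmxDl -scalemxAl hu hw].
- by move=> i v hv k; rewrite !hv.
- exact: h0.
have [i /eqP ne] := nontriv; exfalso; apply: ne; apply/row_matrixP => k.
by rewrite -[Y i]mul1mx row_mul hV.
Qed.

Definition trivial_vec (v : vec) : Prop := exists w, forall a, (v (Some a) - w) *m braid_mx a = v (Some a) - w.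

(** Otherwise the difference between the entries at [x m] and [y j] is always fixed by [Y m]. Then
    the entries at two punctures of [V2] differ by a vector fixed by all [Y i], which is 0, and [v]
    is trivial with [w] their common value. *)
Let vset_full_ex y v : offh y -> N y v -> ~ trivial_vec v -> exists j, forall x, vset j x.
Proof.
move=> oy Nv nt; apply: contrapT => hn; apply: nt.
have hz j m : (v (Some (inl m)) - v (Some (inr j))) *m Y m = v (Some (inl m)) - v (Some (inr j)).
  have [h0|hf] := vset_dichotomy j; last by exfalso; apply: hn; exists j.
  by have /eqP := vset_zero h0 oy Nv m; rewrite mulmxBr mulmx1 subr_eq0 => /eqP <-.
pose j0 := Ordinal q_gt0; exists (v (Some (inr j0))) => -[m|j] /=; first exact: hz.
suff -> : v (Some (inr j)) - v (Some (inr j0)) = 0 by rewrite mul0mx.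
apply: fixed_zero => i.
have -> : v (Some (inr j)) - v (Some (inr j0)) = (v (Some (inl i)) - v (Some (inr j0))) - (v (Some (inl i)) - v (Some (inr j))).
  by rewrite opprB [RHS]addrC addrA subrK.
by rewrite mulmxBl !hz.
Qed.

(** The transported vectors [ev i j d] prescribe one entry [u i] at a time, with an uncontrolled
    entry at [j] only. *)
Let full_family j y : offh y -> (forall x, vset j x) -> forall u : 'I_p -> V, exists w,
  N y (fun o => match o with
    | Some (inl m) => u m
    | Some (inr l) => if l == j then w else 0
    | None => 0 end).
Proof.
move=> oy hf u.
pose sh (u : 'I_p -> V) (w : V) : vec := fun o => match o with
    | Some (inl m) => u m
    | Some (inr l) => if l == j then w else 0
    | None => 0 end.
have one i : exists w, N y (sh (fun m => if m == i then u i else 0) w).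
  have [z [z' [oz oz' obz Nz]]] := vset_dset i (hf (u i)).
  exact: transport_ev Nz.
suff : exists w, N y (sh (fun m => \sum_(i <- index_enum 'I_p) if m == i then u i else 0) w).
  move=> [w Nw]; exists w; move: Nw; congr (N _ _); apply/funext => -[[m|m]|] //=.
  by rewrite (bigD1 m)//= eqxx big1 ?addr0// => i im; rewrite eq_sym (negPf im).
elim: (index_enum _) => [|i l [w Nw]].
  exists 0; have := N0 oy; congr (N _ _); apply/funext => -[[m|m]|] //=; first by rewrite big_nil.
  by case: ifP.
have [w' Nw'] := one i; exists (w' + w).
have := N_lin oy 1 Nw' Nw; congr (N _ _); apply/funext => -[[m|m]|] /=; rewrite scale1r.
- by rewrite big_cons.
- by case: ifP => _; rewrite ?addr0.
- by rewrite addr0.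
Qed.

(** Were [vset j'] zero, a member of [full_family j] with one common entry at all [x m] and 0 at
    [j'] would have this entry fixed by every [Y i]; with the rows of the identity as entries, every
    [Y i] would be 1. *)
Let vset_full_all j y v : offh y -> N y v -> (forall x, vset j x) -> forall j' x, vset j' x.
Proof.
move=> oy _ hf j' x; have [->|j'j] := eqVneq j' j; first exact: hf.
have [h0|//] := vset_dichotomy j'.
have [i /eqP ne] := nontriv; exfalso; apply: ne; apply/row_matrixP => k.
have [w Nw] := full_family oy hf (fun=> row k 1%:M).
have := vset_zero h0 oy Nw i; rewrite /= (negPf j'j) subr0 mulmxBr mulmx1 => /eqP.
by rewrite subr_eq0 -row_mul mul1mx => /eqP <-.
Qed.

Variables (lx : seq 'I_p) (lz : seq 'I_q).
Hypothesis lx_perm : perm_eq lx (enum 'I_p).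
Hypothesis lz_perm : perm_eq lz (enum 'I_q).

(** The passage around infinity at the lowest height, where all slits of [V1] lie above those of
    [V2]; the two families of affine maps are then applied one after the other. *)
Definition holonomy (v : vec) (x : V) : V :=
  foldl (fun x j => afix braid_mx v (inr j) x) (foldl (fun x i => afix braid_mx v (inl i) x) x lx) lz.

Let lx_uniq : uniq lx. Proof. by rewrite (perm_uniq lx_perm) enum_uniq. Qed.
Let lz_uniq : uniq lz. Proof. by rewrite (perm_uniq lz_perm) enum_uniq. Qed.
Let mem_lx i : i \in lx. Proof. by rewrite (perm_mem lx_perm) mem_enum. Qed.

(** Each [c j] is [1 - mu j] times a product of some [mu k], hence nonzero. The relation at infinity
    can therefore be solved for any single entry at a puncture of [V2]. *)
Let zfold : exists (al : K) (c : 'I_q -> K), [/\ al != 0, forall j, c j != 0 &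
  forall v x, foldl (fun x j => afix braid_mx v (inr j) x) x lz =
    al *: x + \sum_j c j *: v (Some (inr j))].
Proof.
suff [al [c [al0 c0 h]]] : exists (al : K) (c : 'I_q -> K), [/\ al != 0, forall j, c j != 0 &
    forall v x, foldl (fun x j => afix braid_mx v (inr j) x) x lz =
      al *: x + \sum_(j <- lz) c j *: v (Some (inr j))].
  exists al, c; split=> // v x; rewrite h; congr (_ + _).
  by rewrite (perm_big _ lz_perm) /= big_enum.
move: lz_uniq; elim: (lz) => [_|j l IH /= /andP[jl ul]].
  exists 1, (fun=> 1); split=> //; try by move=> *; exact: oner_neq0.
  by move=> v x; rewrite big_nil addr0 scale1r.
have [al [c [al0 c0 h]]] := IH ul.
exists (al * mu j), (fun k => if k == j then al * (1 - mu j) else c k); split.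
- by rewrite mulf_neq0.
- by move=> k; case: ifP => // _; rewrite mulf_neq0// subr_eq0 eq_sym.
move=> v x; rewrite h big_cons eqxx addrA; congr (_ + _).
  rewrite /afix /= mul_mx_scalar -!scalerA -scalerDr; congr (_ *: _).
  by rewrite scalerBr scalerBl scale1r addrCA addrA.
rewrite big_seq [RHS]big_seq; apply: eq_bigr => k kl.
by case: eqP kl => // ->; rewrite (negPf jl).
Qed.

Let im_sum : forall t : V, exists u : 'I_p -> V, t = \sum_i u i *m (1%:M - Y i).
Proof.
pose U (t : V) := exists u : 'I_p -> V, t = \sum_i u i *m (1%:M - Y i).
have one i x : U (x *m (1%:M - Y i)).
  exists (fun k => if k == i then x else 0); rewrite (bigD1 i)//= eqxx big1 ?addr0// => k ki.
  by rewrite (negPf ki) mul0mx.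
have sU : submod U.
  split; first by exists (fun=> 0); rewrite big1// => i _; rewrite mul0mx.
  move=> k _ _ [u ->] [u' ->]; exists (fun i => k *: u i + u' i).
  rewrite scaler_sumr -big_split /=; apply: eq_bigr => i _.
  by rewrite mulmxDl scalemxAl.
have [||h0|//] := irr (U := U) => //.
  move=> i v Uv; have := sU.2 (- 1) _ _ (one i v) Uv.
  by rewrite mulmxBr mulmx1 scaleN1r opprB subrK.
have [i /eqP ne] := nontriv; exfalso; apply: ne; apply/row_matrixP => k.
have := h0 _ (one i (row k 1%:M)); rewrite mulmxBr mulmx1 => /eqP.
by rewrite subr_eq0 -row_mul mul1mx => /eqP <-.
Qed.

Let xfold_onto (t : V) : exists u : 'I_p -> V, forall v : vec, (forall i, v (Some (inl i)) = u i) ->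
  foldl (fun x i => afix braid_mx v (inl i) x) 0 lx = t.
Proof.
have [u0 ->] := im_sum t.
suff [u hu] : exists u : 'I_p -> V, forall v : vec, (forall i, i \in lx -> v (Some (inl i)) = u i) ->
    foldl (fun x i => afix braid_mx v (inl i) x) 0 lx = \sum_(i <- lx) u0 i *m (1%:M - Y i).
  exists u => v hv; rewrite hu; last by move=> i _; exact: hv.
  by rewrite (perm_big _ lx_perm) /= big_enum.
move: lx_uniq; elim/last_ind: (lx) => [_|l a IH].
  by exists (fun=> 0) => v _; rewrite big_nil.
rewrite rcons_uniq => /andP[al ul]; have [u hu] := IH ul.
set s := \sum_(i <- l) _ in hu.
(* If [s] is the value reached before [a], the entry [u0 a + s] makes the affine map of [a] add
   exactly [u0 a *m (1%:M - Y a)] to it. *)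
exists (fun i => if i == a then u0 a + s else u i) => v hv.
rewrite -cats1 foldl_cat /= hu; last first.
  move=> i il; rewrite hv ?mem_rcons ?in_cons ?il ?orbT//.
  by case: eqP il => // ->; rewrite (negPf al).
rewrite big_cat big_seq1 /= -/s /afix hv ?mem_rcons ?mem_head// eqxx /=.
rewrite opprD addrCA subrr addr0 mulNmx mulmxBr mulmx1.
by rewrite [u0 a + s]addrC addrA.
Qed.

(** A constant is subtracted so that [v] vanishes at infinity. A member of [full_family] shares its
    entries at all [x i]; by the relation at infinity, the rest is supported on the punctures of
    [V2] and has weighted sum 0. Such vectors are sums of the [pr j t], differences of two members
    of [full_family] that agree at all [x i]. *)
Theorem braid_irreducible y0 v0 ys : offh y0 -> offh ys -> N y0 v0 -> ~ trivial_vec v0 ->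
  (forall v, N ys v -> holonomy v (v None) = v None) ->
  forall v, holonomy v (v None) = v None -> N ys v.
Proof.
move=> oy0 oys Nv0 nt hP v hv.
have [j1 f1] := vset_full_ex oy0 Nv0 nt.
have hf := vset_full_all oy0 Nv0 f1.
have [al [c [al0 c0 hz]]] := zfold.
have hol (u : vec) x : holonomy u x = al *: foldl (fun x i => afix braid_mx u (inl i) x) x lx +
    \sum_j c j *: u (Some (inr j)) by rewrite /holonomy hz.
have shift (u : vec) w : holonomy u (u None) = u None ->
    holonomy (fun o => u o - w) (u None - w) = u None - w.
  have sh1 (A : eqType) (g : A -> I) (l : seq A) x :
      foldl (fun x i => afix braid_mx (fun o => u o - w) (g i) x) (x - w) l =
      foldl (fun x i => afix braid_mx u (g i) x) x l - w.
    elim: l x => //= a l IH x; rewrite -IH; congr foldl.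
    by rewrite /afix opprB addrA subrK addrAC.
  by rewrite /holonomy !sh1 => ->.
pose v1 : vec := fun o => v o - v None.
suff Nv1 : N ys v1.
  have := N_lin oys 1 Nv1 (N_const oys (v None)); congr (N _ _).
  by apply/funext => o; rewrite /v1 scale1r subrK.
have hv1 : holonomy v1 0 = 0 by have := shift _ (v None) hv; rewrite subrr.
have v1oo : v1 None = 0 by rewrite /v1 subrr.
have [w1 Nw1] := full_family oys (hf j1) (fun i => v1 (Some (inl i))).
set n1 := (fun _ => _) in Nw1.
have hn1 : holonomy n1 0 = 0 := hP _ Nw1.
have eqx : foldl (fun x i => afix braid_mx n1 (inl i) x) 0 lx = foldl (fun x i => afix braid_mx v1 (inl i) x) 0 lx.
  by apply: foldl_eq => x i; rewrite /afix.
pose dl j := v1 (Some (inr j)) - n1 (Some (inr j)).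
have hdl : \sum_j c j *: dl j = 0.
  have /eqP : holonomy v1 0 - holonomy n1 0 = 0 by rewrite hv1 hn1 subr0.
  rewrite !hol eqx opprD addrACA subrr add0r -sumrB => /eqP h.
  by rewrite -[RHS]h; apply: eq_bigr => j _; rewrite scalerBr.
pose pr j t : vec := fun o => match o with
  | Some (inr l) => (if l == j then (c j)^-1 *: t else 0) - (if l == j1 then (c j1)^-1 *: t else 0)
  | _ => 0 end.
have Npr j t : N ys (pr j t).
  (* With this target the part of [V1] contributes [- t] to the relation at infinity, which then
     forces the free entry at [j'] to be [(c j')^-1 *: t]. *)
  have [u hu] := xfold_onto (- (al^-1 *: t)).
  have [a Na] := full_family oys (hf j) u; have [b Nb] := full_family oys (hf j1) u.
  have val j' w : N ys (fun o => match o with Some (inl m) => u m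
      | Some (inr l) => if l == j' then w else 0 | None => 0 end) -> w = (c j')^-1 *: t.
    move=> Nw; have := hP _ Nw; rewrite hol hu// scalerN scalerA mulfV// scale1r.
    rewrite (bigD1 j')//= eqxx big1 ?addr0; last by move=> k kj; rewrite (negPf kj) scaler0.
    by move=> /eqP; rewrite addrC subr_eq0 => /eqP <-; rewrite scalerA mulVf// scale1r.
  have := N_lin oys (- 1) Nb Na; congr (N _ _); apply/funext => -[[m|m]|] /=.
  - by rewrite scaleN1r addNr.
  - by rewrite scaleN1r addrC (val _ _ Na) (val _ _ Nb).
  - by rewrite scaler0 addr0.
have Nsum : N ys (fun o => \sum_j pr j (c j *: dl j) o).
  elim: (index_enum _) => [|j l IH].
    by have := N0 oys; congr (N _ _); apply/funext => o; rewrite big_nil.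
  have := N_lin oys 1 (Npr j (c j *: dl j)) IH; congr (N _ _).
  by apply/funext => o; rewrite scale1r big_cons.
have := N_lin oys 1 Nw1 Nsum; congr (N _ _); apply/funext => -[[m|m]|]; rewrite scale1r.
- by rewrite big1 ?addr0.
- rewrite /= sumrB; set s2 := \sum_j (if m == j1 then _ else 0).
  have -> : s2 = 0.
    rewrite /s2; case: (m == j1); last by rewrite big1.
    by rewrite -scaler_sumr hdl scaler0.
  rewrite subr0 (bigD1 m)//= eqxx scalerA mulVf// scale1r big1 ?addr0.
    by rewrite /dl /n1 /= addrC subrK.
  by move=> k km; rewrite eq_sym (negPf km).
- by rewrite big1 // addr0 v1oo.
Qed.

(** This will show that the middle convolution is not zero. Put [x] at one [i] with [Y i != 1], 0 at
    the other [x k], and solve for the entry at [j0]. As [mu j0 != 1], triviality forces [w] to be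
    this entry; then [r = x *m (1%:M - Y i)] is fixed by the other [Y k] and is a multiple of
    [r *m (1%:M - Y i)]. For [r != 0] its line is stable, hence the whole space. *)
Lemma holonomy_trivial : (forall v, holonomy v (v None) = v None -> trivial_vec v) ->
  n = 1%N /\ exists i0, forall k, k != i0 -> Y k = 1%:M.
Proof.
move=> ht; have [al [c [al0 c0 hz]]] := zfold.
pose j0 := Ordinal q_gt0.
have [i nei] := nontriv; have key (x : V) : exists r, [/\ r = x *m (1%:M - Y i),
    forall k, k != i -> r *m Y k = r & exists m : K, r = m *: (r *m (1%:M - Y i))].
  exists (x *m (1%:M - Y i)); set r := x *m _.
  pose u : vec := fun o => if o is Some (inl k) then if k == i then x else 0 else 0.
  pose T := foldl (fun x i => afix braid_mx u (inl i) x) 0 lx.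
  pose v : vec := fun o => if o is Some (inr l) then if l == j0 then - ((c j0)^-1 *: (al *: T)) else 0 else u o.
  have hT : foldl (fun x i => afix braid_mx v (inl i) x) 0 lx = T.
    by apply: foldl_eq => y k; rewrite /afix.
  have [|w hw] := ht v.
    rewrite /holonomy hz hT (bigD1 j0)//= ?eqxx big1 ?addr0; last by move=> k kj; rewrite (negPf kj) scaler0.
    by rewrite scalerN scalerA mulfV// scale1r subrr.
  have ew : w = - ((c j0)^-1 *: (al *: T)).
    have := hw (inr j0); rewrite /= ?eqxx mul_mx_scalar => /eqP.
    rewrite -subr_eq0 -[X in _ - X]scale1r -scalerBl scaler_eq0 subr_eq0 (negPf (mu1 j0)) subr_eq0.
    by move=> /eqP <-.
  pose m := - ((c j0)^-1 * al).
  have {}ew : w = m *: T by rewrite ew scalerA scaleNr.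
  have m0 : m != 0 by rewrite oppr_eq0 mulf_neq0// invr_neq0.
  have Tk k : k != i -> T *m Y k = T.
    move=> ki; have := hw (inl k); rewrite /= (negPf ki) sub0r mulNmx => /oppr_inj.
    by rewrite ew -scalemxAl => /(scalerI m0).
  have f1 (l : seq 'I_p) z : i \notin l -> foldl (fun x i => afix braid_mx u (inl i) x) z l =
      foldl (fun x i => x *m Y i) z l.
    elim: l z => // k l IH z; rewrite in_cons negb_or eq_sym => /andP[ki kl] /=.
    by rewrite /afix /= (negPf ki) subr0 add0r IH.
  have f2 (l : seq 'I_p) z : i \notin l -> foldl (fun x i => x *m Y i) z l = T -> z = T.
    elim/last_ind: l => [//|l k IH]; rewrite mem_rcons in_cons negb_or eq_sym => /andP[ki kl].
    rewrite -cats1 foldl_cat /= -{1}(Tk _ ki) => /(congr1 (mulmx^~ (invmx (Y k)))).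
    by rewrite !mulmxK//; exact: IH.
  have f0 (l : seq 'I_p) : foldl (fun (x : V) i => x *m Y i) 0 l = 0.
    by elim: l => //= k l IH; rewrite mul0mx.
  have eT : T = r.
    apply/esym; have := erefl T; rewrite {1}/T; case/splitPr: (mem_lx i) lx_uniq => l1 l2.
    rewrite cat_uniq /= => /and3P[_ hd /andP[il2 _]].
    have il1 : i \notin l1 by move: hd; rewrite negb_or => /andP[].
    rewrite foldl_cat (f1 l1)//= (f1 l2)//.
    rewrite f0.
    rewrite /afix /= eqxx sub0r mulNmx -{1}[x]mulmx1 -mulmxBr -/r.
    exact: f2.
  rewrite eT in Tk ew; split=> //; exists m.
  have := hw (inl i); rewrite /= eqxx ew mulmxBl => h.
  rewrite scalemxAl mulmxBr mulmx1 {1}/r mulmxBr mulmx1.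
  rewrite -{1}(subrK (m *: r) x) -h.
  move: (x *m Y i) (_ *m Y i) (m *: r) => a b d.
  by rewrite addrAC [b - _]addrC addrK addrC.
have [r hr] : exists r : V, r != 0 /\ exists x, r = x *m (1%:M - Y i).
  apply: contrapT => hn; move/eqP: nei; apply; apply/row_matrixP => k.
  have [//|/eqP ne] := eqVneq (row k (Y i)) (row k 1%:M); exfalso; apply: hn.
  exists (row k 1%:M *m (1%:M - Y i)); split; last by exists (row k 1%:M).
  by rewrite mulmxBr mulmx1 -row_mul mul1mx subr_eq0 eq_sym; apply/eqP.
have [r0 [x0 ex0]] := hr; have [r1 [e1 fx [m hm]]] := key x0.
rewrite -{}ex0 in e1; subst r1.
have m0 : m != 0 by apply: contra r0 => /eqP m0; rewrite hm m0 scale0r.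
have ri : r *m Y i = (1 - m^-1) *: r.
  have : r *m (1%:M - Y i) = m^-1 *: r by rewrite {2}hm scalerA mulVf// scale1r.
  by rewrite mulmxBr mulmx1 => h; rewrite scalerBl scale1r -h opprB addrC subrK.
have all v : exists k : K, v = k *: r.
  have [||h|h] := irr (U := [set v : V | exists k : K, v = k *: r]).
  - split; first by exists 0; rewrite scale0r.
    by move=> k _ _ [a ->] [b ->]; exists (k * a + b); rewrite scalerDl scalerA.
  - move=> k _ [a ->]; have [->|ki] := eqVneq k i.
      by exists (a * (1 - m^-1)); rewrite -scalemxAl ri scalerA.
    by exists a; rewrite -scalemxAl fx.
  - by move: r0; rewrite (h r) ?eqxx//; exists 1; rewrite scale1r.
  - exact: h.
have le1 : (1%:M <= r)%MS.
  by apply/row_subP => k; have [a ->] := all (row k 1%:M); exact: scalemx_sub.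
split.
  have := mxrankS le1; rewrite mxrank1 => /leq_trans/(_ (rank_leq_row _)).
  suff : n != 0%N by case: (n) => [|[]].
  apply/eqP => n0; move/eqP: r0; apply; apply/rowP => k.
  by have := ltn_ord k; rewrite [X in (_ < X)%N]n0.
exists i => k ki; apply/row_matrixP => l; have [a ea] := all (row l 1%:M).
by rewrite -[Y k]mul1mx row_mul ea -scalemxAl fx.
Qed.

End Algebra.

(** * Frames of local systems *)

Lemma near_val (X : topologicalType) (A : set X) (z : A) (P : set A) :
  (\forall y \near z, P y) <-> exists2 W, nbhs (set_val z) W & forall y : A, W (set_val y) -> P y.
Proof.
split; last by move=> [W nW WP]; apply: (@filterS _ (nbhs z) _ (set_val @^-1` W)); [move=> y; exact: WP|exact: (@set_val_cts X A z W nW)].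
rewrite /prop_near1 [nbhs z]nbhsE /= => -[B [[W oW WB] Bz] BP].
exists W; last by move=> y Wy; apply: BP; rewrite -WB.
by apply: (@open_nbhs_nbhs X); split=> //; move: Bz; rewrite -WB.
Qed.

Section Frames.
Variables (K : fieldType) (X : topologicalType) (F : sheaf K X).

(** No continuity is imposed: a frame may jump across slits, and [framed] tells near which points it
    is a trivialization. *)
Definition frame n := forall x, {linear 'rV[K]_n -> F x}.

Definition framed n (g : frame n) (x : X) :=
  \forall y \near x, bijective (g y) /\ forall v, @sect K X F (fun z => g z v) y.

Lemma framed_open n (g : frame n) x : framed g x -> \forall y \near x, framed g y.
Proof. exact: near_join. Qed.

Lemma framed_at n (g : frame n) x : framed g x -> bijective (g x) /\ forall v, @sect K X F (fun z => g z v) x.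
Proof. exact: nbhs_singleton. Qed.

Lemma framed_sect n (g : frame n) x s : framed g x ->
  @sect K X F s x <-> exists v, \forall y \near x, s y = g y v.
Proof.
move=> fg; have [[h hK Kh] gs] := framed_at fg; split.
  by move=> ss; exists (h (s x)); apply: sect_inj ss (gs _) _; rewrite Kh.
by move=> [v sv]; apply: sect_local (gs v) _; apply: filterS sv => y ->.
Qed.

Lemma framed_neq n (g : frame n) x s t : framed g x -> @sect K X F s x -> @sect K X F t x -> s x <> t x ->
  \forall y \near x, s y <> t y.
Proof.
move=> fg /(framed_sect _ fg)[v sv] /(framed_sect _ fg)[v' tv].
rewrite (nbhs_singleton sv) (nbhs_singleton tv) => ne.
apply: filterS3 fg sv tv => y [/bij_inj gi _] -> -> /gi e; apply: ne; by rewrite e.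
Qed.

Lemma linear_mx n m (V : lmodType K) (f : {linear 'rV[K]_n -> V}) (g : {linear 'rV[K]_m -> V}) :
  bijective g -> exists P, forall v, f v = g (v *m P).
Proof.
move=> [h hK Kh]; exists (\matrix_i h (f (delta_mx 0 i))) => v.
rewrite [in LHS](row_sum_delta v) mulmx_sum_row !linear_sum; apply: eq_bigr => i _.
by rewrite !linearZ rowK /= Kh.
Qed.

Lemma framed_dim n m (g : frame n) (g' : frame m) x : framed g x -> framed g' x -> n = m.
Proof.
have key k l (f : frame k) (f' : frame l) : framed f x -> framed f' x -> (k <= l)%N.
  move=> /framed_at[bf _] /framed_at[bf' _].
  have [P hP] := linear_mx (f x) bf'; have [Q hQ] := linear_mx (f' x) bf.
  have PQ : P *m Q = 1%:M.
    by apply/row_matrixP => i; rewrite !rowE mulmx1 mulmxA; apply: (bij_inj bf); rewrite -hQ -hP.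
  by have := mxrankM_maxl P Q; rewrite PQ mxrank1 => /leq_trans; apply; exact: rank_leq_col.
by move=> h h'; apply/eqP; rewrite eqn_leq (key _ _ _ _ h h') (key _ _ _ _ h' h).
Qed.

Lemma frame_eq_near n m (g : frame n) (g' : frame m) x P : framed g x -> framed g' x ->
  (forall v, g x v = g' x (v *m P)) -> \forall y \near x, forall v, g y v = g' y (v *m P).
Proof.
move=> /framed_at[_ gs] /framed_at[_ gs'] e.
have : \forall y \near x, forall i, g y (delta_mx 0 i) = g' y (delta_mx 0 i *m P).
  by apply: near_forall => i; apply: sect_inj; [exact: gs|exact: gs'|exact: e].
apply: filterS => y h v.
rewrite [in LHS](row_sum_delta v) mulmx_sum_row !linear_sum; apply: eq_bigr => i _.
by rewrite !linearZ h /= -rowE.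
Qed.

Lemma framed_mx n (g g' : frame n) x : framed g x -> framed g' x ->
  exists2 P, P \in unitmx & \forall y \near x, forall v, g y v = g' y (v *m P).
Proof.
move=> fg fg'; have [bg _] := framed_at fg; have [bg' _] := framed_at fg'.
have [P hP] := linear_mx (g x) bg'; have [Q hQ] := linear_mx (g' x) bg.
exists P; last exact: frame_eq_near.
suff PQ : P *m Q = 1%:M by have /mulmx1_unit[] := PQ.
by apply/row_matrixP => i; rewrite !rowE mulmx1 mulmxA; apply: (bij_inj bg); rewrite -hQ -hP.
Qed.

Definition frame_mul n (g : frame n) (P : 'M[K]_n) : frame n := fun x => g x \o mulmxr P.

Lemma framed_mul n (g : frame n) (P : 'M[K]_n) x : P \in unitmx -> framed g x -> framed (frame_mul g P) x.
Proof.
move=> Pu; apply: filterS => y [bg gs]; split; last by move=> v; exact: gs.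
apply: bij_comp => //; exists (mulmxr (invmx P)) => v /=; first by rewrite mulmxK.
by rewrite mulmxKV.
Qed.

Lemma local_system_frame x : local_system F -> exists n (g : frame n), framed g x.
Proof.
move=> /(_ x)[U [oU Ux [n [f [fm fe]]]]]; exists n.
(* Outside [U] the frame takes the junk value 0, invisible near [x]. *)
pose g : frame n := fun y => match pselect (U y) with
  | left h => f (exist _ y (mem_set h))
  | right _ => [the {linear 'rV[K]_n -> F y} of \0] end.
have gE (y : U) v : g (set_val y) v = f y v.
  rewrite /g; case: pselect => [h|[]]; last exact: set_valP.
  by case: y h => y yU h; congr (f (exist _ _ _) v); exact: bool_irrelevance.
exists g; have nU : nbhs x U by exact: open_nbhs_nbhs.
apply: filterS nU => y Uy; pose y' : U := exist _ y (mem_set Uy).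
split.
  have inj : injective (g y) by move=> a b; rewrite !(gE y') => e; exact: (fm y' _ _ e).
  have [h hK] := choice (fun e => fe y' e).
  by exists h => [v|e]; [apply: inj; rewrite (gE y') hK|rewrite (gE y')].
move=> v; have [|t st tv] := @hom_sect _ _ _ _ f (fun=> v) y' _.
  by change (\forall y0 \near y', v = v); near=> z.
apply: sect_local st _; move: tv => /near_val[W nW hW].
apply: filterS2 nW (open_nbhs_nbhs (conj oU Uy)) => z Wz Uz.
by have := hW (exist _ z (mem_set Uz)) Wz; rewrite -(gE (exist _ z (mem_set Uz))).
Unshelve. all: by end_near. Qed.

End Frames.

(** * Trivialization of a local system off the slits *)

Section SlitFrame.
Variables (R : realType) (K : fieldType) (th : R) (r : nat) (w : 'I_r -> Cplx R).
Local Notation C := (Cplx R).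
Local Notation rho := (rho th).
Local Notation hgt := (hgt th).
Variable F : sheaf K (punctured w).
Hypothesis lsF : local_system F.
Hypothesis hinj : forall i j, hgt (w i) = hgt (w j) -> i = j.

Definition om1 (z : C) : Prop := forall i, hgt z = hgt (w i) -> rho z < rho (w i).
Definition sl1 (i : 'I_r) (z : C) : Prop := hgt z = hgt (w i) /\ rho (w i) < rho z.

Lemma om1P z : om1 z <-> omega th w (fun=> false) (z, 0).
Proof.
split=> h a; have := h a; rewrite /hh /rr /pos /= addr0 hgtB rhoB subr_lt0.
  by move=> k /subr0_eq.
by move=> k e; apply: k; rewrite e subrr.
Qed.

Lemma om1_near z : om1 z -> \forall z' \near z, om1 z'.
Proof.
move=> /om1P/omega_near/nbhs_box2 -/(_ th)[e e0 h].
apply/(nbhs_box th); exists e => // z' bz; apply/om1P; apply: h => //=.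
by split; rewrite subrr normr0.
Qed.

Lemma om1_punctured z : om1 z -> z \in punctured w.
Proof. by move=> h; rewrite inE => -[i _ e]; have := h i; rewrite e ltxx => /(_ erefl). Qed.

Lemma sl1_punctured i z : sl1 i z -> z \in punctured w.
Proof.
move=> [h1 h2]; rewrite inE => -[j _ e]; move: h1 h2; rewrite -e => /hinj ->.
by rewrite ltxx.
Qed.

Lemma om1_or_sl1 (x : punctured w) : om1 (set_val x) \/ exists i, sl1 i (set_val x).
Proof.
have [|n] := pselect (exists i, sl1 i (set_val x)); [by right|left=> i e].
rewrite lt_neqAle leNgt; apply/andP; split; last by apply/negP => h; apply: n; exists i.
apply/eqP => e'; apply: (set_valP x); exists i => //; exact: plane_eq (esym e') (esym e).
Qed.

Lemma sl1_near i z : sl1 i z -> \forall z' \near z,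
  rho (w i) < rho z' /\ forall j, j != i -> hgt z' != hgt (w j).
Proof.
move=> [h1 h2]; apply: nearI; first exact: (@rho_cts R th z _ (lt_nbhsr h2)).
apply: near_forall => j; have [->|ji] := eqVneq j i; first by near=> z'.
have : hgt z != hgt (w j) by rewrite h1; apply: contra ji => /eqP /hinj ->.
case: ltgtP => // h _.
  have : \forall z' \near z, hgt z' < hgt (w j) by exact: (@hgt_cts R th z _ (lt_nbhsl h)).
  by apply: filterS => z' h' _; rewrite lt_eqF.
have : \forall z' \near z, hgt (w j) < hgt z' by exact: (@hgt_cts R th z _ (lt_nbhsr h)).
by apply: filterS => z' h' _; rewrite gt_eqF.
Unshelve. all: by end_near. Qed.

Lemma sl1_off i (z' : C) : rho (w i) < rho z' -> (forall j, j != i -> hgt z' != hgt (w j)) ->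
  [/\ hgt z' = hgt (w i) -> sl1 i z' & hgt z' != hgt (w i) -> om1 z'].
Proof.
move=> h1 h2; split=> [e|ne j e]; first by split.
by have [ji|/h2] := eqVneq j i; [rewrite -ji e eqxx in ne|rewrite e eqxx].
Qed.

Lemma above_near z (P : set C) : (\forall z' \near z, P z') -> exists2 z', P z' & hgt z < hgt z'.
Proof.
move=> /(nbhs_box th)[e e0 h]; exists (pt th (rho z) (hgt z + e / 2)); last by rewrite hgt_pt ltrDl divr_gt0.
apply: h; split; rewrite ?rho_pt ?hgt_pt ?subrr ?normr0//.
by rewrite addrC addKr gtr0_norm ?divr_gt0//; lra.
Qed.

Lemma below_near z (P : set C) : (\forall z' \near z, P z') -> exists2 z', P z' & hgt z' < hgt z.
Proof.
move=> /(nbhs_box th)[e e0 h]; exists (pt th (rho z) (hgt z - e / 2)); last by rewrite hgt_pt; lra.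
apply: h; split; rewrite ?rho_pt ?hgt_pt ?subrr ?normr0//.
by rewrite addrC addKr normrN gtr0_norm ?divr_gt0//; lra.
Qed.

(** The contraction of the slit plane is used here with fixed punctures and parameter 0; the germs
    continued along it are frames. *)
Lemma omega_frame : exists n (g : frame F n), forall x, om1 (set_val x) -> framed g x.
Proof.
pose D z := om1 z; pose p z t := (ctr th w 0 1 (z, 0) t).1.
pose u0 := (base th w 0 1).1.
have ov z : D z -> omega_over th w (fun=> false) 0 1 (z, 0).
  by move=> /om1P; split=> //; split; rewrite subrr normr0.
have pD z t : D z -> 0 <= t <= 1 -> D (p z t).
  move=> /ov Dz t01; have [_ h] := ctr_over ltr01 Dz t01.
  by apply/om1P => a; have := h a; rewrite /hh /rr /pos.
pose mk z (h : D z) : punctured w := exist _ z (om1_punctured h).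
have bD : D u0.
  have [_ h] := @base_over _ th _ w (fun=> false) 0 1 ltr01.
  by apply/om1P => a; have := h a; rewrite /hh /rr /pos.
have [n [g0 fg0]] := local_system_frame (mk _ bD) lsF.
exists n.
pose eqat (g g' : frame F n) z := forall x, set_val x = z -> forall v, g x v = g' x v.
pose good (g : frame F n) z := forall x, set_val x = z -> framed g x.
have toC (x : punctured w) (P : set (punctured w)) : (\forall y \near x, P y) ->
    \forall z \near (set_val x : C), forall y, set_val y = z -> P y.
  by move=> /near_val[W nW h]; apply: filterS nW => z Wz y e; apply: h; rewrite e.
have [g hg] : exists g, forall z, D z -> good g z.
  apply: (@contraction_section R C (frame F n) eqat good D _ _ _ _ _ _ _ _ p u0 pD _ _ _ g0).
  - by [].
  - by move=> g g' z h x e v; rewrite h.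
  - by move=> g g' g'' z h h' x e v; rewrite h// h'.
  - move=> g g' z Dz gg gg' h; pose x : punctured w := mk z Dz.
    apply: (toC x); have := @frame_eq_near _ _ _ _ _ g g' x 1%:M (gg x erefl) (gg' x erefl).
    by rewrite /prop_near1 => k; apply: filterS (k _) => [y hy v|v]; rewrite ?hy ?mulmx1// h.
  - move=> g g' z Dz gg gg' h; pose x : punctured w := mk z Dz.
    have [v hv] : exists v, g x v <> g' x v.
      apply: contrapT => hn; apply: h => y e v; have -> : y = x by apply: val_inj; rewrite /= -e.
      by apply: contrapT => hv; apply: hn; exists v.
    have [_ s1] := framed_at (gg x erefl); have [_ s2] := framed_at (gg' x erefl).
    have nn := framed_neq (gg x erefl) (s1 v) (s2 v) hv.
    have dn := om1_near Dz.
    apply: filterS2 dn (toC _ _ nn) => z' Dz' h1 h2.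
    by apply: (h1 (mk z' Dz') erefl); exact: h2.
  - move=> g z Dz gg; pose x : punctured w := mk z Dz.
    exact: (toC x _ (framed_open (gg x erefl))).
  - move=> z Dz; pose x : punctured w := mk z Dz.
    have [m [g fg]] := local_system_frame x lsF.
    have dn := om1_near Dz.
    exists [set z' | D z' /\ forall y, set_val y = z' -> framed g y].
      exact: nearI dn (toC _ _ (framed_open fg)).
    move=> z' h [Dz' h'] gh; pose x' : punctured w := mk z' Dz'.
    have mn := framed_dim (gh x' erefl) (h' x' erefl); subst m.
    have [P Pu hP] := framed_mx (gh x' erefl) (h' x' erefl).
    (* A frame around [z] is multiplied by a constant matrix so as to agree with the given one at
       [z']. *)
    exists (frame_mul g P); last by move=> z'' [_ h2] y e; apply: framed_mul => //; exact: h2.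
    move=> y e v; have -> : y = x' by apply: val_inj; rewrite /= -e.
    by rewrite (nbhs_singleton hP).
  - move=> h hg hc; exists (fun x => h (set_val x) x) => z Dz x e; subst z.
    have fx := hg _ Dz x erefl.
    have dn := om1_near Dz; have := hc _ Dz.
    have [W nW hW] := (near_val x _).1 fx.
    move=> cn; apply/near_val; exists [set z | W z /\ (D z -> eqat (h (set_val x)) (h z) z) /\ D z].
      exact: nearI nW (nearI cn dn).
    move=> y [Wy [ey Dy]]; have {}ey := ey Dy y erefl; have [by1 sy1] := hW y Wy.
    have := hg _ Dy y erefl; move=> /framed_at[by2 sy2]; split=> // v.
    apply: sect_local (sy2 v) _.
    have ny := hc _ Dy; have dny := om1_near Dy.
    apply/near_val; exists [set z | (D z -> eqat (h (set_val y)) (h z) z) /\ D z]; first exact: (nearI ny dny).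
    by move=> y' [h1 h2]; rewrite (h1 h2).
  - by move=> z _; rewrite /p ctr0.
  - by move=> z _; rewrite /p ctr1.
  - move=> z t Dz t01 W nW.
    have nW2 : nbhs (ctr th w 0 1 (z, 0) t) [set u | W u.1] by exact: (@fst_cts R _ _ nW).
    have [A [d [nA d0 h]]] := ctr_near nW2.
    exists [set z | A (z, 0)], d; split=> //; last by move=> z' t' Az tt; exact: h.
    move: nA => /nbhs_box2 -/(_ th)[e e0 h2]; apply/(nbhs_box th); exists e => // z' bz; apply: h2 => //=.
    by split; rewrite subrr normr0.
  - by move=> x e; have -> : x = mk _ bD by apply: val_inj; rewrite /= -e.
by exists g => x hx; exact: (hg _ hx x erefl).
Qed.

End SlitFrame.

Section SlitFrame2.
Variables (R : realType) (K : fieldType) (th : R) (r : nat) (w : 'I_r -> Cplx R).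
Local Notation C := (Cplx R).
Local Notation rho := (rho th).
Local Notation hgt := (hgt th).
Local Notation om1 := (om1 th w).
Local Notation sl1 := (sl1 th w).
Variable F : sheaf K (punctured w).
Hypothesis lsF : local_system F.
Hypothesis hinj : forall i j, hgt (w i) = hgt (w j) -> i = j.

Let near_pt (x : punctured w) (P : set (punctured w)) : (\forall y \near x, P y) ->
  \forall z \near (set_val x : C), forall y, set_val y = z -> P y.
Proof. by move=> /near_val[W nW h]; apply: filterS nW => z Wz y e; apply: h; rewrite e. Qed.

Let pt_near (x : punctured w) (P : C -> Prop) : (\forall z \near (set_val x : C), P z) ->
  \forall y \near x, P (set_val y).
Proof. by move=> nP; apply/near_val; exists P. Qed.

Lemma frame_mx_const n (g g' : frame F n) (i : 'I_r) (x : punctured w) (P : R -> Prop) :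
  half P -> (\forall z \near (set_val x : C), P (hgt (z - w i)) -> forall y, set_val y = z -> framed g y /\ framed g' y) ->
  (\forall z \near (set_val x : C), z \in punctured w) ->

  exists M, \forall z \near (set_val x : C), P (hgt (z - w i)) -> forall y, set_val y = z -> forall v, g y v = g' y (v *m M).
Proof.
move=> hP fr pu.
pose rel z M := forall y, set_val y = z -> forall v, g y v = g' y (v *m M).
pose c (u : C * C) := match pselect (exists M, rel u.1 M) with left h => projT1 (cid h) | right _ => 0 end.
pose A (u : C * C) := P (hh th w (fun=> false) i u).
have cE z M : (exists y : punctured w, set_val y = z) -> (forall y, set_val y = z -> framed g' y) -> rel z M -> forall s, c (z, s) = M.
  move=> [y ey] fg' rM s; rewrite /c; case: pselect => [h|[]]; last by exists M.
  case: cid => M' rM' /=; have [bg _] := framed_at (fg' y ey).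
  by apply/row_matrixP => k; rewrite !rowE; apply: (bij_inj bg); rewrite -(rM y)// -(rM' y).
have Ahh u : hh th w (fun=> false) i u = hgt (u.1 - w i) by rewrite /hh /pos addr0.
have key : \forall z \near (set_val x : C), P (hgt (z - w i)) -> exists2 M, rel z M &
    \forall z' \near z, forall s, c (z', s) = M.
  apply: filterS3 fr pu (near_join pu) => z fz zp zn Pz; pose y : punctured w := exist _ z zp.
  have [fg fg'] := fz Pz y erefl.
  have [M Mu hM] := framed_mx fg fg'; exists M.
    by move=> y' e v; have -> : y' = y by [apply: val_inj; rewrite /= -e]; rewrite (nbhs_singleton hM).
  apply: filterS3 zn (near_pt hM) (near_pt (framed_open fg')) => z' zp' h1 h2 s.
  by apply: cE => //; exists (exist _ z' zp').
have key2 : \forall u \near ((set_val x : C), 0 : C), A u -> exists2 M, rel u.1 M &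
    \forall u' \near u, c u' = M.
  have : \forall u \near ((set_val x : C), 0 : C), P (hgt (u.1 - w i)) -> exists2 M, rel u.1 M &
    \forall z' \near u.1, forall s, c (z', s) = M by exact: (@fst_cts R ((set_val x : C), 0 : C) _ key).
  apply: filterS => u h Au; rewrite /A Ahh in Au; have [M h1 h2] := h Au; exists M => //.
  have : \forall u' \near u, forall s, c (u'.1, s) = M by exact: (@fst_cts R u _ h2).
  by apply: filterS => -[z' s'] h'; exact: h'.
have [||M hM] := @near_const R _ A c ((set_val x : C), 0) _ _ 0; first exact: hh_half.
  apply: filterS key2 => u h Au; have [M _ h2] := h Au; have e := nbhs_singleton h2.
  by apply: filterS h2 => u' ->.
exists M; have hM' : \forall z \near (set_val x : C), A (z, 0) -> c (z, 0) = M.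
  move: hM => /nbhs_box2 -/(_ th)[e e0 h]; apply/(nbhs_box th); exists e => // z bz; apply: h => //=.
  by split; rewrite subrr normr0.
apply: filterS2 key hM' => z h1 h2 Pz; have [M0 h3 h4] := h1 Pz.
by rewrite -h2 ?/A ?Ahh// (nbhs_singleton h4).
Qed.

Let sl1_pos i x z : sl1 i x -> rho (w i) < rho z -> (forall j, j != i -> hgt z != hgt (w j)) ->
  [/\ 0 < hgt (z - w i) -> om1 z, hgt (z - w i) < 0 -> om1 z & z \in punctured w].
Proof.
move=> sx h1 h2; have [k1 k2] := sl1_off h1 h2; rewrite hgtB subr_gt0 subr_lt0; split.
- by move=> h; apply: k2; rewrite gt_eqF.
- by move=> h; apply: k2; rewrite lt_eqF.
- have [e|ne] := eqVneq (hgt z) (hgt (w i)); first by have := sl1_punctured hinj (k1 e).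
  exact: om1_punctured (k2 ne).
Qed.

Variables (n : nat) (g0 : frame F n).
Hypothesis fg0 : forall x, om1 (set_val x) -> framed g0 x.

(* [gM.1] extends [g0] from above across the slit. *)
Definition across i (x : punctured w) (gM : frame F n * 'M[K]_n) : Prop :=
  [/\ framed gM.1 x, gM.2 \in unitmx & \forall y \near x, forall v,
    (hgt (w i) < hgt (set_val y) -> gM.1 y v = g0 y v) /\
    (hgt (set_val y) < hgt (w i) -> gM.1 y v = g0 y (v *m gM.2))].

(** Any frame near a point of the slit differs from [g0] by one matrix above and one below.
    Normalizing the first to 1 turns the second into the jump. *)
Lemma across_ex i x : sl1 i (set_val x) -> exists gM, across i x gM.
Proof.
move=> sx; have [m [g fg]] := local_system_frame x lsF.
have sn := sl1_near hinj sx.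
have fgn := near_pt (framed_open fg).
have pn : \forall z \near (set_val x : C), z \in punctured w.
  by apply: filterS sn => z [h1 h2]; have [] := sl1_pos sx h1 h2.
have mn : n = m.
  have [z [h1 [h2 h3]]] := above_near th (nearI fgn sn); rewrite sx.1 => hz.
  have [k1 _ pz] := sl1_pos sx h2 h3; pose y : punctured w := exist _ z pz.
  apply: (framed_dim (fg0 (x := y) _) (h1 y erefl)); apply: k1; by rewrite hgtB subr_gt0.
subst m.
have both Q : (forall z, rho (w i) < rho z -> (forall j, j != i -> hgt z != hgt (w j)) -> Q (hgt (z - w i)) -> om1 z) -> \forall z \near (set_val x : C), Q (hgt (z - w i)) ->
    forall y, set_val y = z -> framed g y /\ framed g0 y.
  move=> hQ; apply: filterS2 fgn sn => z h1 [h2 h3] Qz y e; split; first exact: h1.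
  by apply: fg0; rewrite e; exact: hQ.
have [U hU] := frame_mx_const (@half_pos R) (both _ (fun z h1 h2 => let: And3 k _ _ := sl1_pos sx h1 h2 in k)) pn.
have [L hL] := frame_mx_const (@half_neg R) (both _ (fun z h1 h2 => let: And3 _ k _ := sl1_pos sx h1 h2 in k)) pn.
have unit1 M z (pz : z \in punctured w) (y : punctured w := exist _ z pz) : framed g y -> om1 z ->
    (forall y, set_val y = z -> forall v, g y v = g0 y (v *m M)) -> M \in unitmx.
  move=> fgz oz h; have [P Pu hP] := framed_mx fgz (fg0 (x := y) oz).
  suff -> : M = P by [].
  have [b0 _] := framed_at (fg0 (x := y) oz).
  apply/row_matrixP => k; rewrite !rowE; apply: (bij_inj b0).
  by rewrite -(nbhs_singleton hP) -h.
have Uu : U \in unitmx.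
  have [z [h1 [[h2 h3] h4]] hz] := above_near th (nearI fgn (nearI sn hU)).
  rewrite sx.1 in hz; have hz' : 0 < hgt (z - w i) by rewrite hgtB subr_gt0.
  have [k1 _ pz] := sl1_pos sx h2 h3.
  by apply: (unit1 U z pz); [exact: h1|exact: k1|move=> y ey; exact: h4].
have Lu : L \in unitmx.
  have [z [h1 [[h2 h3] h4]] hz] := below_near th (nearI fgn (nearI sn hL)).
  rewrite sx.1 in hz; have hz' : hgt (z - w i) < 0 by rewrite hgtB subr_lt0.
  have [_ k1 pz] := sl1_pos sx h2 h3.
  by apply: (unit1 L z pz); [exact: h1|exact: k1|move=> y ey; exact: h4].
exists (frame_mul g (invmx U), invmx U *m L); split=> /=.
- by apply: framed_mul => //; rewrite unitmx_inv.
- by rewrite unitmx_mul unitmx_inv Uu.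
have := pt_near (nearI hU hL); apply: filterS => y [h1 h2] v; split=> h.
  by rewrite /frame_mul /= (h1 _ _ erefl) ?mulmxKV// hgtB subr_gt0.
by rewrite /frame_mul /= (h2 _ _ erefl) ?mulmxA// hgtB subr_lt0.
Qed.

Lemma across_uniq i x gM gM' : sl1 i (set_val x) -> across i x gM -> across i x gM' ->
  gM.2 = gM'.2 /\ forall v, gM.1 x v = gM'.1 x v.
Proof.
move=> sx [fg Mu hg] [fg' Mu' hg'].
have sn := sl1_near hinj sx.
have at_x v : gM.1 x v = gM'.1 x v.
  apply: contrapT => ne; have [_ s1] := framed_at fg; have [_ s2] := framed_at fg'.
  have nn := near_pt (nearI (framed_neq fg (s1 v) (s2 v) ne) (nearI hg hg')).
  have [z [h1 [h2 h3]]] := above_near th (nearI nn sn); rewrite sx.1 => hz.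
  have [_ _ pz] := sl1_pos sx h2 h3; pose y : punctured w := exist _ z pz.
  have [k1 [k2 k3]] := h1 y erefl; apply: k1.
  by rewrite (k2 v).1// (k3 v).1.
split=> //.
have e1 : \forall y \near x, forall v, gM.1 y v = gM'.1 y (v *m 1%:M).
  by apply: frame_eq_near => // v; rewrite mulmx1.
have nn := near_pt (nearI e1 (nearI hg hg')).
have [z [h1 [h2 h3]]] := below_near th (nearI nn sn); rewrite sx.1 => hz.
have [_ k pz] := sl1_pos sx h2 h3; pose y : punctured w := exist _ z pz.
have [k1 [k2 k3]] := h1 y erefl.
have oz : om1 z by apply: k; rewrite hgtB subr_lt0.
have [b0 _] := framed_at (fg0 (x := y) oz).
apply/row_matrixP => l; rewrite !rowE; apply: (bij_inj b0).
by rewrite -(k2 _).2// -(k3 _).2// k1 mulmx1.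
Qed.

Lemma across_near i x gM : sl1 i (set_val x) -> across i x gM ->
  \forall y \near x, sl1 i (set_val y) -> across i y gM.
Proof.
move=> sx [fg Mu hg]; apply: filterS2 (framed_open fg) (near_join hg) => y h1 h2 sy.
by split.
Qed.

(** By uniqueness the jump is locally constant along the slit, and the open half-line is
    connected. *)
Let slit_const i : exists2 B, B \in unitmx & forall x, sl1 i (set_val x) -> exists g, across i x (g, B).
Proof.
pose z t := pt th t (hgt (w i)).
have sz t : rho (w i) < t -> sl1 i (z t) by move=> h; split; rewrite /z ?hgt_pt ?rho_pt.
pose mk t (h : rho (w i) < t) : punctured w := exist _ (z t) (sl1_punctured hinj (sz t h)).
have h1 : rho (w i) < rho (w i) + 1 by lra.
have [[g B] hB] := across_ex (x := mk _ h1) (sz _ h1); have [_ Bu _] := hB.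
exists B => // x sx.
pose P t := forall y : punctured w, set_val y = z t -> exists g, across i y (g, B).
have loc t : rho (w i) < t -> \forall t' \near t, rho (w i) < t' -> P t' <-> P t.
  move=> ht; have [gM hM] := across_ex (x := mk t ht) (sz t ht).
  have zc : {for t, continuous z}.
    apply: (@cvg_plane R th R (nbhs t) (nbhs_filter t)); rewrite /z.
      by under eq_fun do rewrite rho_pt; rewrite rho_pt; exact: cvg_id.
    by under eq_fun do rewrite hgt_pt; rewrite hgt_pt; exact: cvg_cst.
  have PE t' (ht' : rho (w i) < t') : across i (mk t' ht') gM -> P t' <-> gM.2 = B.
    move=> h; split.
      move=> /(_ (mk t' ht') erefl)[g' hg'].
      by have [] := across_uniq (x := mk t' ht') (sz _ ht') h hg'.
    by move=> e y ey; exists gM.1; rewrite -e; have -> : y = mk t' ht' by [apply: val_inj; rewrite /= -ey]; case: (gM) h.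
  have nz : \forall t' \near t, forall y, set_val y = z t' -> sl1 i (set_val y) -> across i y gM.
    exact: (zc _ (near_pt (across_near (x := mk t ht) (sz t ht) hM))).
  apply: filterS nz => t' h ht'; rewrite (PE t ht hM) (PE t' ht') //.
  exact: (h (mk t' ht') erefl (sz t' ht')).
have key a b : a <= b -> rho (w i) < a -> P a <-> P b.
  move=> ab ha; apply: (segment_const (P := fun t => P a <-> P t) ab) => // t /andP[at_ tb].
  have ht : rho (w i) < t by exact: lt_le_trans ha at_.
  apply: filterS (loc t ht) => t' h /andP[at' _]; rewrite h//; exact: lt_le_trans ha at'.
have P1 : P (rho (w i) + 1).
  by move=> y ey; exists g; have -> : y = mk _ h1 by [apply: val_inj; rewrite /= -ey].
have xE : set_val x = z (rho (set_val x)) by rewrite /z -sx.1 pt_rho_hgt.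
suff : P (rho (set_val x)) by apply.
by have [/key|/ltW/key] := leP (rho (w i) + 1) (rho (set_val x)); move=> h; apply/h => //; exact: sx.2.
Qed.

Lemma slit_extend : exists (phi : frame F n) (B : 'I_r -> 'M[K]_n),
  [/\ forall x, bijective (phi x), forall i, B i \in unitmx & forall x, exists g, [/\ framed g x,
    om1 (set_val x) -> \forall y \near x, forall v, g y v = phi y v &
    forall i, sl1 i (set_val x) -> \forall y \near x, forall v,
      g y v = phi y (if hgt (set_val y) < hgt (w i) then v *m B i else v)]].
Proof.
have [B hB] := choice (fun i => let: ex_intro2 B h1 h2 := slit_const i in ex_intro _ B (conj h1 h2)).
have sl_uniq i j z : sl1 i z -> sl1 j z -> i = j by move=> [h _] [h' _]; apply: hinj; rewrite -h.
have sl_om i z : sl1 i z -> ~ om1 z by move=> [h1 h2] /(_ i h1); lra.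
have ex x : exists h : frame F n, (om1 (set_val x) -> h = g0) /\ forall i, sl1 i (set_val x) -> across i x (h, B i).
  have [ox|[i sx]] := om1_or_sl1 th x.
    by exists g0; split=> // i /sl_om.
  have [g hg] := (hB i).2 x sx; exists g; split=> [/(sl_om _ _ sx)//|j sj].
  by rewrite -(sl_uniq _ _ _ sx sj).
have [h hh] := choice ex; pose phi : frame F n := fun x => h x x.
have hfr x : framed (h x) x.
  have [ox|[i sx]] := om1_or_sl1 th x; first by rewrite (hh x).1//; exact: fg0.
  by have [] := (hh x).2 i sx.
exists phi, B; split=> [x|i|x].
- by have [] := framed_at (hfr x).
- exact: (hB i).1.
exists (h x); split=> // [ox|i sx].
  have := pt_near (om1_near ox); apply: filterS => y oy v.
  by rewrite /phi (hh x).1// (hh y).1.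
have ax := (hh x).2 i sx; have [_ _ hg] := ax.
apply: filterS3 (across_near sx ax) hg (pt_near (sl1_near hinj sx)) => y h1 h2 [h3 h4] v.
have [k1 k2] := sl1_off h3 h4.
rewrite /phi; case: (ltgtP (hgt (set_val y)) (hgt (w i))) => e.
- by rewrite (hh y).1 ?(h2 v).2//; apply: k2; rewrite lt_eqF.
- by rewrite (hh y).1 ?(h2 v).1//; apply: k2; rewrite gt_eqF.
- have sy := k1 e; have [_] := across_uniq sy (h1 sy) ((hh y).2 i sy); exact.
Qed.

End SlitFrame2.

Section SlitFrame3.
Variables (R : realType) (K : fieldType) (th : R) (r : nat) (w : 'I_r -> Cplx R).
Local Notation C := (Cplx R).

(* A trivialization off the slits [w i + [0, +oo) e^(i th)]: continued from above, [phi] jumps by [B i]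
   across the [i]-th slit. *)
Definition slit_frame (F : sheaf K (punctured w)) n (phi : frame F n) (B : 'I_r -> 'M[K]_n) : Prop :=
  [/\ forall x, bijective (phi x), forall i, B i \in unitmx & forall x, exists g, [/\ framed g x,
    om1 th w (set_val x) -> \forall y \near x, forall v, g y v = phi y v &
    forall i, sl1 th w i (set_val x) -> \forall y \near x, forall v,
      g y v = phi y (if hgt th (set_val y) < hgt th (w i) then v *m B i else v)]].

Theorem slit_frame_ex (F : sheaf K (punctured w)) : local_system F ->
  (forall i j, hgt th (w i) = hgt th (w j) -> i = j) ->
  exists n (phi : frame F n) B, slit_frame phi B.
Proof.
move=> lsF hinj; have [n [g0 fg0]] := omega_frame th lsF.
by exists n; exact: (slit_extend lsF hinj fg0).
Qed.

End SlitFrame3.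

(** * Triviality of transport from winding numbers *)

Section Winding.
Variables (R : realType) (K : fieldType) (th : R).
Local Notation C := (Cplx R).
Local Notation rho := (rho th).
Local Notation hgt := (hgt th).
Local Notation I := (`[0, 1]%classic : set R).

Lemma shift_2pi (N : int) (a : R) : sin (a - N%:~R * (2 * pi)) = sin a /\ cos (a - N%:~R * (2 * pi)) = cos a.
Proof.
have e (n : nat) : n%:R * (2 * pi : R) = (pi *+ 2) *+ n by rewrite mulr_natl -[2]/(2%:R) mulr_natl.
have plus (n : nat) (x : R) : sin (x + n%:R * (2 * pi)) = sin x /\ cos (x + n%:R * (2 * pi)) = cos x.
  rewrite !e; split; first exact: (periodicn (@sinD2pi R)).
  exact: (periodicn (@cosD2pi R)).
case: N => n.
  by have [<- <-] := plus n (a - (Posz n)%:~R * (2 * pi)); rewrite subrK.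
by have := plus n.+1 a; rewrite NegzE mulrNz mulNr opprK.
Qed.

(** The number of full turns counted from the direction [th]: it drops by one when the slit is
    crossed downwards, and on the slit it has its upper value. *)
Definition ang_floor (a : R) : int := Num.floor ((a - th) / (2 * pi)).

Lemma ang_floorP a (N : int) : 0 <= a - th - N%:~R * (2 * pi) < 2 * pi <-> ang_floor a = N.
Proof.
have p0 : 0 < 2 * pi :> R by have := pi_gt0 R; lra.
rewrite /ang_floor; split=> [/andP[h1 h2]|<-].
  apply: floor_def; rewrite ler_pdivlMr// ltr_pdivrMr// intrD; apply/andP; split; lra.
have := floor_le ((a - th) / (2 * pi)); have := floorD1_gt ((a - th) / (2 * pi)).
rewrite ltr_pdivrMr// ler_pdivlMr// intrD mulrDl mul1r; move=> h1 h2; apply/andP; split; lra.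
Qed.

Lemma rho_polar (r a : R) : rho ((r * cos a) +i* (r * sin a))%C = r * cos (a - th).
Proof. by rewrite /rho /= cosB; ring. Qed.
Lemma hgt_polar (r a : R) : hgt ((r * cos a) +i* (r * sin a))%C = r * sin (a - th).
Proof. by rewrite /hgt /= sinB; ring. Qed.

Lemma slit_angle a : sin (a - th) = 0 -> 0 < cos (a - th) -> a - th = (ang_floor a)%:~R * (2 * pi).
Proof.
have /andP[h1 h2] := (ang_floorP a _).2 erefl.
have [<- <-] := shift_2pi (ang_floor a) (a - th); move: h1 h2.
set psi := a - th - _ => h1 h2 s0 c0.
apply/eqP; rewrite -subr_eq0 -/psi; apply/eqP; have p0 := pi_gt0 R.
case: (ltgtP psi 0) => // hp; first lra.
case: (ltgtP psi pi) => hpi.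
- by have := sin_gt0_pi (x := psi); rewrite s0 hp hpi ltxx => /(_ isT).
- have := sinDpi (psi - pi); rewrite subrK s0 => e1.
  have : 0 < sin (psi - pi) by apply: sin_gt0_pi; apply/andP; split; lra.
  by lra.
- by move: c0; rewrite hpi cospi; lra.
Qed.

(** The power of [b] compensates the factor [b] that the coordinate of a lifted path acquires below
    the slit, so that their product is locally constant. Winding number 0 brings the power back to
    its initial value. *)
Lemma floor_count (g : R -> C) (w : C) (b : K) : b != 0 -> winding_number g w 0 ->
  exists m : R -> K, [/\ m 0 = m 1, forall t, m t != 0 & forall t, I t ->
    \forall t' \near within I (nbhs t),
      m t' = if `[< hgt (g t) = hgt w /\ rho w < rho (g t) >] && (hgt (g t') < hgt w) then m t / b else m t].
Proof.
move=> b0 [r [a [_ /subspace_continuousP ca hg e01]]].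
exists (fun t => b ^ ang_floor (a t)); split.
- by congr (b ^ ang_floor _); move: e01; rewrite mul0r => /subr0_eq.
- by move=> t; rewrite expfz_neq0.
move=> t It; have [r0 gt] := hg t It; have p0 := pi_gt0 R.
have sub t' : I t' -> rho (g t') = rho w + r t' * cos (a t' - th) /\ hgt (g t') = hgt w + r t' * sin (a t' - th).
  by move=> It'; have [_ ->] := hg t' It'; rewrite rhoD hgtD rho_polar hgt_polar.
have near_lt c : c < a t -> \forall t' \near within I (nbhs t), c < a t'.
  by move=> h; exact: (ca t It _ (lt_nbhsr h)).
have near_gt c : a t < c -> \forall t' \near within I (nbhs t), a t' < c.
  by move=> h; exact: (ca t It _ (lt_nbhsl h)).
have nI : \forall t' \near within I (nbhs t), I t' by exact: withinT.
have [e1 e2] := sub t It; set N := ang_floor (a t).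
have [[h1 h2]|ns] := asboolP.
  have s0 : sin (a t - th) = 0.
    by move: h1; rewrite e2 => /eqP; rewrite addrC -subr_eq0 addrK mulf_eq0 (gt_eqF r0) => /eqP.
  have c0 : 0 < cos (a t - th) by move: h2; rewrite e1 ltrDl pmulr_rgt0.
  have eN := slit_angle s0 c0; rewrite -/N in eN.
  have n1 := near_lt (a t - pi / 2) ltac:(lra); have n2 := near_gt (a t + pi / 2) ltac:(lra).
  apply: filterS3 nI n1 n2 => t' It' k1 k2.
  have [_ e2'] := sub t' It'; have [r0' _] := hg t' It'; rewrite andTb e2' gtrDl pmulr_rlt0//.
  have [sN _] := shift_2pi N (a t' - th); rewrite -sN -eN.
  have -> : a t' - th - (a t - th) = a t' - a t by lra.
  have [neg|pos] := ltP (a t') (a t).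
    have -> : sin (a t' - a t) < 0.
      by rewrite -oppr_gt0 -sinN; apply: sin_gt0_pi; apply/andP; split; lra.
    have -> : ang_floor (a t') = N - 1.
      by apply/ang_floorP; rewrite intrB mulrBl mul1r -eN; apply/andP; split; lra.
    by rewrite expfzDr// -/N.
  rewrite ltNge sin_ge0_pi /=; last by apply/andP; split; lra.
  by congr (_ ^ _); apply/ang_floorP; rewrite -eN; apply/andP; split; lra.
have /andP[k1 k2] := (ang_floorP (a t) N).2 erefl.
have k0 : a t - th - N%:~R * (2 * pi) != 0.
  apply/eqP => k0; apply: ns; have [sN cN] := shift_2pi N (a t - th).
  by rewrite e1 e2 -sN -cN k0 sin0 cos0 mulr0 mulr1 addr0 ltrDl.
have {k0}k1 : 0 < a t - th - N%:~R * (2 * pi) by rewrite lt_neqAle eq_sym k0.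
have n1 := near_lt (th + N%:~R * (2 * pi)) ltac:(lra); have n2 := near_gt (th + N%:~R * (2 * pi) + 2 * pi) ltac:(lra).
apply: filterS2 n1 n2 => t' l1 l2.
by congr (_ ^ _); apply/ang_floorP; apply/andP; split; lra.
Qed.

End Winding.

Section TransportTrivial.
Variables (R : realType) (K : fieldType) (th : R) (r : nat) (w : 'I_r -> Cplx R).
Local Notation C := (Cplx R).
Local Notation I := (`[0, 1]%classic : set R).
Hypothesis hinj : forall i j, hgt th (w i) = hgt th (w j) -> i = j.

(* With [f] the coordinate of the lift, [f] times the product of the [B j ^ floor (angle j)] is locally constant. *)
Lemma transport_trivial (F : sheaf K (punctured w)) (phi : frame F 1) B x0 g (e e' : F x0) :
  slit_frame th phi B -> loop_at x0 g ->
  (forall j, B j = 1%:M \/ winding_number (set_val \o g) (w j) 0) ->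
  transport g e e' -> e = e'.
Proof.
move=> [bphi Bu hphi] [/subspace_continuousP cg g0 g1] hB [s ls [s0 s1]].
have at_pt t (P : R -> Prop) : I t -> (\forall t' \near within I (nbhs t), P t') -> P t.
  by move=> It /nbhs_singleton; exact.
pose b j := B j 0 0.
have BE j : B j = (b j)%:M by apply/matrixP => k l; rewrite !ord1 mxE eqxx mulr1n.
have b0 j : b j != 0 by have := Bu j; rewrite BE unitmxE det_scalar1 unitfE.
have mex j : exists m : R -> K, [/\ m 0 = m 1, forall t, m t != 0 & forall t, I t ->
    \forall t' \near within I (nbhs t), m t' =
      if `[< sl1 th w j (set_val (g t)) >] && (hgt th (set_val (g t')) < hgt th (w j)) then m t / b j else m t].
  have [B1|wn] := hB j; last exact: floor_count.
  have b1 : b j = 1 by rewrite /b B1 mxE.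
  exists (fun=> 1); split=> [//|t|t It]; first exact: oner_neq0.
  by near=> t'; rewrite b1 divr1; case: ifP.
have [m hm] := choice mex.
have inj2 (x : punctured w) (v v' : F x) : existT (fun x => F x : Type) x v = existT _ x v' -> v = v'.
  by apply: Eqdep_dec.inj_pair2_eq_dec => y z; exact: pselect.
have fex t : exists v, I t -> s t = existT _ (g t) (phi (g t) v).
  have [It|nI] := pselect (I t); last by exists 0.
  have [et [u _ hu]] := ls t It; have [h _ Kh] := bphi (g t).
  exists (h (u (g t))) => _; rewrite Kh; exact: (at_pt _ _ It hu).
have [f hf] := choice fex.
pose T t := f t 0 0 * \prod_j m j t.
have loc t : I t -> \forall t' \near t, I t' -> T t' = T t.
  move=> It; have [_ [u su hu]] := ls t It.
  have [gf [fg h1 h2]] := hphi (g t); have [v hv] := (framed_sect u fg).1 su.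
  have hm' : \forall t' \near within I (nbhs t), forall j, m j t' =
      if `[< sl1 th w j (set_val (g t)) >] && (hgt th (set_val (g t')) < hgt th (w j)) then m j t / b j else m j t.
    rewrite /prop_near1 /within /=; have : \forall t' \near t, forall j, I t' -> m j t' =
      if `[< sl1 th w j (set_val (g t)) >] && (hgt th (set_val (g t')) < hgt th (w j)) then m j t / b j else m j t.
      by apply: near_forall => j; have [_ _] := hm j; apply.
    by apply: filterS => t' h It' j; exact: h.
  have ft v1 : s t = existT _ (g t) (phi (g t) v1) -> f t = v1.
    by rewrite (hf t It) => /inj2 /(bij_inj (bphi _)).
  have [om|[i si]] := om1_or_sl1 th (g t).
    have ns j : `[< sl1 th w j (set_val (g t)) >] = false.
      by apply/asboolP => -[k1 k2]; have := om j k1; lra.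
    have n1 : \forall t' \near within I (nbhs t), u (g t') = phi (g t') v.
      have : \forall y \near g t, u y = phi y v by apply: filterS2 hv (h1 om) => y -> ->.
      exact: (cg t It).
    have e1 : f t = v by apply: ft; rewrite -(at_pt _ _ It n1); exact: (at_pt _ _ It hu).
    have : \forall t' \near within I (nbhs t), I t' -> T t' = T t.
      apply: filterS3 n1 hm' hu => t' k1 k2 k3 It'.
      have ft' : f t' = v by move: k3; rewrite k1 (hf t' It') => /inj2 /(bij_inj (bphi _)).
      by rewrite /T ft' e1; congr (_ * _); apply: eq_bigr => j _; rewrite k2 ns.
    by move=> W; apply: (@filterS _ (nbhs t) _ [set t' | I t' -> (I t' -> T t' = T t)] _ _ W) => t' h It'; exact: h.
  have ns j : `[< sl1 th w j (set_val (g t)) >] = (j == i).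
    by apply/asboolP/eqP => [[k1 _]|->//]; apply: hinj; rewrite -k1 si.1.
  have n1 : \forall t' \near within I (nbhs t), u (g t') =
      phi (g t') (if hgt th (set_val (g t')) < hgt th (w i) then v *m B i else v).
    have : \forall y \near g t, u y = phi y (if hgt th (set_val y) < hgt th (w i) then v *m B i else v).
      by apply: filterS2 hv (h2 i si) => y -> ->.
    exact: (cg t It).
  have e1 : f t = v.
    apply: ft; rewrite (at_pt _ _ It hu) (at_pt _ _ It n1) si.1 ltxx //.
  have : \forall t' \near within I (nbhs t), I t' -> T t' = T t.
    apply: filterS3 n1 hm' hu => t' k1 k2 k3 It'.
    have ft' : f t' = if hgt th (set_val (g t')) < hgt th (w i) then v *m B i else v.
      by move: k3; rewrite k1 (hf t' It') => /inj2 /(bij_inj (bphi _)).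
    rewrite /T ft' e1 (bigD1 i)// [in RHS](bigD1 i)//= k2 ns eqxx /=.
    rewrite (eq_bigr (fun j => m j t)); last by move=> j ji; rewrite k2 ns (negPf ji).
    case: ifP => // _; rewrite BE mul_mx_scalar mxE !mulrA; congr (_ * _).
    by rewrite -!mulrA mulrC -!mulrA mulVf // mulr1.
  by move=> W; apply: (@filterS _ (nbhs t) _ [set t' | I t' -> (I t' -> T t' = T t)] _ _ W) => t' h It'; exact: h.
have T01 : T 0 = T 1.
  apply: (segment_const (P := fun t => T 0 = T t) ler01) => // t /andP[t0 t1].
  have It : I t by rewrite /= in_itv /= t0.
  by apply: filterS (loc t It) => t' h tt; rewrite h//= in_itv.
have I0 : I 0 by rewrite /= in_itv /= lexx ler01.
have I1 : I 1 by rewrite /= in_itv /= lexx ler01.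
have f01 : f 0 = f 1.
  apply/rowP => k; rewrite ord1; move: T01; rewrite /T.
  rewrite (eq_bigr (fun j => m j 1)); last by move=> j _; have [] := hm j.
  by apply: mulIf; apply/prodf_neq0 => j _; have [] := hm j.
have := hf 0 I0; have := hf 1 I1; rewrite s0 s1 f01 g0 g1 => /inj2 -> /inj2 ->.
by [].
Unshelve. all: by end_near. Qed.

End TransportTrivial.

(** * From irreducible local systems to irreducible matrices *)

Lemma framed_local_system (K : fieldType) (X : topologicalType) (F : sheaf K X) :
  (forall x, exists n (g : frame F n), framed g x) -> local_system F.
Proof.
move=> h x; have [n [g fg]] := h x.
move: fg; rewrite /framed /prop_near1 nbhsE => -[U [oU Ux] hU]; exists U; split=> //.
have hs (s : U -> 'rV[K]_n) z : @sect _ _ (constant_sheaf U 'rV[K]_n) s z ->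
    @sect _ _ (pullback (@set_val_cts X U) F) (fun y => g (set_val y) (s y)) z.
  move=> sz; exists (fun y => g y (s z)).
    by have [_] := hU _ (set_valP z); exact.
  by apply: filterS sz => y ->.
exists n, (@SheafHom K U (constant_sheaf U 'rV[K]_n) (pullback (@set_val_cts X U) F) (fun z => g (set_val z)) hs).
split=> z.
  by have [b _] := hU _ (set_valP z); exact: (bij_inj b).
by move=> e; have [[k kK Kk] _] := hU _ (set_valP z); exists (k e); exact: Kk.
Qed.

Lemma linear_dim (K : fieldType) (V : lmodType K) n m (f : {linear 'rV[K]_n -> V}) (g : {linear 'rV[K]_m -> V}) :
  bijective f -> bijective g -> n = m.
Proof.
have key k l (f' : {linear 'rV[K]_k -> V}) (g' : {linear 'rV[K]_l -> V}) :
    bijective f' -> bijective g' -> (k <= l)%N.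
  move=> bf bg; have [P hP] := linear_mx f' bg; have [Q hQ] := linear_mx g' bf.
  have PQ : P *m Q = 1%:M.
    by apply/row_matrixP => i; rewrite !rowE mulmx1 mulmxA; apply: (bij_inj bf); rewrite -hQ -hP.
  by have := mxrankM_maxl P Q; rewrite PQ mxrank1 => /leq_trans; apply; exact: rank_leq_col.
by move=> bf bg; apply/eqP; rewrite eqn_leq (key _ _ _ _ bf bg) (key _ _ _ _ bg bf).
Qed.

(** Among the matrices with rows in [U], one of maximal rank spans [U]: a further vector of [U]
    would raise the rank. *)
Lemma submod_rows (K : fieldType) n (U : set 'rV[K]_n) : submod U ->
  exists m (M : 'M[K]_(m, n)), row_free M /\ forall v, U v <-> exists c, v = c *m M.
Proof.
move=> sU.
have rowsU m (M : 'M[K]_(m, n)) (c : 'rV_m) : (forall i, U (row i M)) -> U (c *m M).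
  move=> hM; rewrite mulmx_sum_row; elim/big_rec: _ => [|i y _ Uy]; first exact: sU.1.
  by apply: sU.2.
pose P k := `[< exists M : 'M[K]_n, (forall i, U (row i M)) /\ \rank M = k >].
have exP : exists k, P k.
  by exists 0%N; apply/asboolP; exists 0; rewrite mxrank0; split=> // i; rewrite row0; exact: sU.1.
have ubP k : P k -> (k <= n)%N by move=> /asboolP[M [_ <-]]; exact: rank_leq_row.
case: (ex_maxnP exP ubP) => k /asboolP[M [hM rM]] maxk.
exists (\rank M), (row_base M); split; first exact: row_base_free.
move=> v; split=> [Uv|[c ->]]; last first.
  have : (c *m row_base M <= M)%MS by rewrite (submx_trans (submxMl _ _)) ?eq_row_base.
  by move=> /submxP[D ->]; exact: rowsU.
suff : (v <= row_base M)%MS by move=> /submxP[D ->]; exists D.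
rewrite eq_row_base; apply: contrapT => /negP nv.
have hr : (\rank M < \rank (M + v)%MS)%N.
  have := mxrank_leqif_sup (addsmxSl M v); move=> /ltn_leqif ->.
  by rewrite addsmx_sub submx_refl /=.
have : P (\rank (M + v)%MS).
  apply/asboolP; exists (M + v)%MS; split=> // i.
  have := row_sub i (M + v)%MS; move=> /sub_addsmxP[[a b] /= ->].
  rewrite -[a *m M]scale1r; apply: sU.2; first exact: rowsU.
  by apply: rowsU => j; have -> : row j v = v by apply/rowP => l; rewrite !mxE ord1.
by move=> /maxk; rewrite -rM leqNgt hr.
Qed.

Section Irreducible.
Variables (R : realType) (K : fieldType) (th : R) (r : nat) (w : 'I_r -> Cplx R).
Local Notation C := (Cplx R).
Variables (F : sheaf K (punctured w)) (n : nat) (phi : frame F n) (B : 'I_r -> 'M[K]_n).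
Hypothesis sf : slit_frame th phi B.

Section Sub.
Variables (m : nat) (M : 'M[K]_(m, n)) (Q : 'I_r -> 'M[K]_m).
Hypothesis Mfree : row_free M.
Hypothesis MQ : forall i, M *m B i = Q i *m M.

Let M_inj : injective (mulmx^~ M : 'rV_m -> 'rV_n).
Proof. exact: row_free_inj. Qed.

Let phi_inj x : injective (phi x). Proof. by case: sf => h _ _; exact: bij_inj. Qed.

(** In the coordinates given by the rows of [M], a section of the future subsheaf jumps by [Q i]
    below the slit [i]; [D] is this jump near a point of the slit, and 1 elsewhere. *)
Let bend x : exists D : forall y : punctured w, 'M[K]_m, [/\ forall y, D y \in unitmx, D x = 1%:M &
  exists2 g : frame F n, framed g x & \forall y \near x, forall v, g y (v *m M) = phi y (v *m D y *m M)].
Proof.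
have [_ Bu /(_ x)[g [fg h1 h2]]] := sf.
have Qu i : Q i \in unitmx.
  rewrite -row_free_unit /row_free -(mxrankMfree _ Mfree) -MQ mxrankMfree; first by move: Mfree.
  by rewrite row_free_unit.
have [ox|[i si]] := om1_or_sl1 th x.
  exists (fun=> 1%:M); split=> [y|//|]; first exact: unitmx1.
  by exists g => //; apply: filterS (h1 ox) => y h v; rewrite h mulmx1.
exists (fun y => if hgt th (set_val y) < hgt th (w i) then Q i else 1%:M); split.
- by move=> y; case: ifP; rewrite ?unitmx1.
- by rewrite si.1 ltxx.
exists g => //; apply: filterS (h2 i si) => y h v; rewrite h; congr (phi y _).
by case: ifP => _; rewrite ?mulmx1// -!mulmxA MQ.
Qed.

(** The subsheaf of [F] spanned by the rows of [M] in the frame [phi]. Taking a full copy of the row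
    space as each stalk makes the inclusion into [F] the map [M] itself. *)
Program Definition row_sheaf : sheaf K (punctured w) :=
  @Sheaf K (punctured w) (fun=> 'rV[K]_m) (fun s x => @sect _ _ F (fun y => phi y (s y *m M)) x) _ _ _ _ _.
Next Obligation. by move=> s t x h e; apply: sect_local h _; apply: filterS e => y ->. Qed.
Next Obligation. by move=> s x h; exact: sect_open h. Qed.
Next Obligation.
move=> x e; have [D [_ D1 [g fg hg]]] := bend x.
exists (fun y => e *m D y); last by rewrite D1 mulmx1.
by have [_ gs] := framed_at fg; apply: sect_local (gs (e *m M)) _; apply: filterS hg => y ->.
Qed.
Next Obligation.
move=> s t x h h' e; have := sect_inj h h' (congr1 (fun v => phi x (v *m M)) e).
by apply: filterS => y /phi_inj /M_inj.
Qed.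
Next Obligation.
move=> a s t x h h'; apply: sect_local (sect_lin a h h') _.
have n1 : \forall y \near x, True by exact: filterT.
by apply: filterS n1 => y _; rewrite mulmxDl linearD -scalemxAl linearZ.
Qed.

Lemma row_sheaf_local : local_system row_sheaf.
Proof.
apply: framed_local_system => x; exists m.
have [D [Du D1 [g fg hg]]] := bend x.
exists (fun y => [the {linear 'rV[K]_m -> 'rV[K]_m} of mulmxr (D y)]).
apply: filterS2 (framed_open fg) (near_join hg) => y h1 h2; split.
  by exists (mulmxr (invmx (D y))) => v /=; rewrite ?mulmxK ?mulmxKV.
move=> v; have [_ gs] := framed_at h1; apply: sect_local (gs (v *m M)) _.
by apply: filterS h2 => z ->.
Qed.

Let row_hom_sect s x : @sect _ _ row_sheaf s x -> @sect _ _ F (fun y => (phi y \o mulmxr M) (s y)) x.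
Proof. by []. Qed.

Definition row_hom : sheaf_hom row_sheaf F :=
  @SheafHom K _ row_sheaf F (fun y => [the {linear 'rV[K]_m -> F y} of phi y \o mulmxr M]) row_hom_sect.

Lemma row_hom_mono : sheaf_mono row_hom.
Proof. by move=> x v v' /phi_inj /M_inj. Qed.

End Sub.

(** A subspace stable under the [B i] spans a subsheaf [row_sheaf] which is a local system, so
    simplicity of [F] decides between zero and everything. *)
Lemma irreducible_frame : irreducible_local_system F -> (forall U : set 'rV[K]_n, submod U ->
  (forall i v, U v -> U (v *m B i)) -> (forall v, U v -> v = 0) \/ (forall v, U v)).
Proof.
move=> [_ [x [e ne]] irr] U sU stU; have [m [M [Mf hM]]] := submod_rows sU.
have ex i : exists Q : 'M[K]_m, M *m B i = Q *m M.
  have hk (k : 'I_m) : exists c : 'rV_m, row k M *m B i = c *m M.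
    by apply/hM; apply: stU; apply/hM; exists (delta_mx 0 k); rewrite rowE.
  have [c hc] := choice hk; exists (\matrix_k c k).
  by apply/row_matrixP => k; rewrite !row_mul hc rowK.
have [Q hQ] := choice ex.
case: (irr _ (row_sheaf_local Mf hQ) (row_hom Mf hQ)) => [|h|[_ epi]].
- exact: row_hom_mono.
- by left=> v /hM[c ->]; rewrite (h x c : c = 0) mul0mx.
- right=> v; have [c hc] := epi x (phi x v); apply/hM; exists c.
  by have [/(_ x)/bij_inj inj _ _] := sf; apply: inj; rewrite -hc.
Qed.

End Irreducible.

(** * The tensor product as a jump system *)

Section TensorLine.
Variables (K : fieldType) (M N : lmodType K) (n : nat).
Variables (f : {linear 'rV[K]_n -> M}) (g : {linear 'rV[K]_1 -> N}).

Definition tline (v : 'rV[K]_n) : tensor M N := tsum [:: (f v, g 1)].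

Lemma tsum_cat (l l' : seq (M * N)) : tsum (l ++ l') = tsum l + tsum l'.
Proof. by rewrite /tsum lclsD. Qed.

Lemma tline_linear : linear tline.
Proof.
move=> a u v; rewrite /tline lclsZ lclsD /= /tsum linearD linearZ.
by apply/lclsP; apply: teq_addl.
Qed.

HB.instance Definition _ := GRing.isLinear.Build K 'rV[K]_n (tensor M N) _ tline tline_linear.

Hypotheses (bf : bijective f) (bg : bijective g).

Lemma tline_bij : bijective tline.
Proof.
have [f' fK Kf] := bf; have [g' gK Kg] := bg.
have f'D a u v : f' (a *: u + v) = a *: f' u + f' v.
  by apply: (can_inj fK); rewrite Kf linearD linearZ !Kf.
have g'D a u v : g' (a *: u + v) = a *: g' u + g' v.
  by apply: (can_inj gK); rewrite Kg linearD linearZ !Kg.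
have f0 : f' 0 = 0 by apply: (can_inj fK); rewrite Kf linear0.
have g0 : g' 0 = 0 by apply: (can_inj gK); rewrite Kg linear0.
(* A candidate inverse, defined on formal sums; its invariance under [teq] yields the injectivity of
   [tline]. *)
pose T (l : seq (M * N)) := \sum_(p <- l) (g' p.2 0 0) *: f' p.1.
have T_eq l l' : teq l l' -> T l = T l'.
  elim=> {l l'} [l|l l' _ -> //|l l' l'' _ -> _ ->//|l1 l1' l2 l2' _ h1 _ h2|l l'|m|m m' k|m k k'|a m k].
  - by [].
  - by rewrite /T !big_cat; congr (_ + _); [exact: h1|exact: h2].
  - by rewrite /T !big_cat /= addrC.
  - by rewrite /T big_seq1 big_nil /= f0 scaler0.
  - by rewrite /T !big_cons !big_nil !addr0 /=; have := f'D 1 m m'; rewrite !scale1r => ->; rewrite scalerDr.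
  - by rewrite /T !big_cons !big_nil !addr0 /=; have := g'D 1 k k'; rewrite !scale1r => ->; rewrite mxE scalerDl.
  - have gZ := g'D a k 0; rewrite g0 !addr0 in gZ.
    have fZ := f'D a m 0; rewrite f0 !addr0 in fZ.
    by rewrite /T !big_seq1 /= gZ fZ mxE !scalerA mulrC.
have inj : injective tline.
  move=> u v /lclsP /T_eq; rewrite /T !big_seq1 /= !fK gK mxE eqxx !scale1r //.
have one m k : tsum [:: (m, k)] = tline (g' k 0 0 *: f' m).
  have ek : k = g' k 0 0 *: g 1.
    by rewrite -linearZ -[LHS]Kg; congr (g _); apply/rowP => i; rewrite !ord1 !mxE eqxx mulr1.
  rewrite /tline linearZ Kf {1}ek; apply/lclsP; apply: teq_sym; exact: teq_scale.
have sur (e : tensor M N) : exists v, tline v = e.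
  have [l ->] := lcls_surj e; change (exists v, tline v = tsum l).
  elim: l => [|[m k] l [v hv]]; first by exists 0; rewrite linear0.
  exists (g' k 0 0 *: f' m + v); rewrite -[(m, k) :: l]cat1s tsum_cat one -hv.
  exact: (linearD [the {linear 'rV[K]_n -> tensor M N} of tline]).
have [h hK] := choice sur.
by exists h => // v; apply: inj.
Qed.

End TensorLine.

Section ConvFrame.
Variables (R : realType) (K : fieldType) (p q n : nat).
Local Notation C := (Cplx R).
Variables (x : 'I_p -> C) (y : 'I_q -> C).
Variables (V1 : sheaf K (punctured x)) (V2 : sheaf K (punctured y)).
Local Notation T := (conv_total x y).

Definition conv_sheaf : sheaf K T := tensor_sheaf (pullback (@pr1_cts R p q x y) V1) (pullback (@dif_cts R p q x y) V2).

Definition tframe (g1 : frame V1 n) (g2 : frame V2 1) : frame conv_sheaf n :=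
  fun z => [the {linear 'rV[K]_n -> conv_sheaf z} of tline (g1 (pr1 z)) (g2 (dif z))].

Lemma tframe_framed g1 g2 z : framed g1 (pr1 z) -> framed g2 (dif z) -> framed (tframe g1 g2) z.
Proof.
move=> /(@pr1_cts R p q x y z) f1 /(@dif_cts R p q x y z) f2.
have n1 : \forall z' \near z, bijective (g1 (pr1 z')) /\ forall v, @sect _ _ V1 (fun w => g1 w v) (pr1 z') by exact: f1.
have n2 : \forall z' \near z, bijective (g2 (dif z')) /\ forall v, @sect _ _ V2 (fun w => g2 w v) (dif z') by exact: f2.
apply: filterS2 n1 n2 => z' [b1 s1] [b2 s2]; split; first exact: tline_bij.
move=> v; exists [:: ((fun z => g1 (pr1 z) v), (fun z => g2 (dif z) 1))]; split; last by near=> w.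
split; [|split=> //].
  by exists (fun w => g1 w v) => //; near=> w.
by exists (fun w => g2 w 1) => //; near=> w.
Unshelve. all: by end_near. Qed.

End ConvFrame.

Section ConvJump.
Variables (R : realType) (K : fieldType) (th : R) (p q n : nat).
Local Notation C := (Cplx R).
Local Notation rho := (rho th).
Local Notation hgt := (hgt th).
Variables (x : 'I_p -> C) (y : 'I_q -> C).
Local Notation I := ('I_p + 'I_q)%type.
Local Notation T := (conv_total x y).
Local Notation S := (conv_base x y).
Hypotheses (hx : injective x) (hy : injective y).
Variables (V1 : sheaf K (punctured x)) (V2 : sheaf K (punctured y)).
Variables (phi1 : frame V1 n) (phi2 : frame V2 1) (Y : 'I_p -> 'M[K]_n) (mu : 'I_q -> K).
Hypothesis sf1 : slit_frame th phi1 Y.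
Hypothesis sf2 : slit_frame (th + pi) phi2 (fun j => (mu j)%:M).

(* In the [x]-plane over [s], the [j]-th puncture of [d^* V2] is [s - y j]. *)
Definition cpa (a : I) : C := match a with inl i => x i | inr j => - y j end.
Definition cea (a : I) : bool := if a is inr _ then true else false.

Local Notation pos := (pos cpa cea).
Local Notation hh := (hh th cpa cea).
Local Notation rr := (rr th cpa cea).
Local Notation omega := (omega th cpa cea).
Local Notation only_slit := (only_slit th cpa cea).
Local Notation B := (braid_mx Y mu).

Definition cphi : frame (conv_sheaf V1 V2) n := tframe phi1 phi2.

Definition csec (c : C * C -> 'rV[K]_n) (u : C * C) : Prop := forall z : T, set_val z = u ->
  @sect _ _ (conv_sheaf V1 V2) (fun z' => cphi z' (c (set_val z'))) z.

Lemma near_ne (z c : C) : z <> c -> \forall z' \near z, z' <> c.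
Proof.
move=> ne; have [e|ne1] := eqVneq (rho z) (rho c); last first.
  have h : 0 < `|rho z - rho c| by rewrite normr_gt0 subr_eq0.
  have cf : continuous (fun z' : C => `|rho z' - rho c|).
    by apply: cts_norm; apply: ctsB; [exact: rho_cts|exact: cts_cst].
  by apply: filterS (cts_pos cf h) => z' h' e; move: h'; rewrite e subrr normr0 ltxx.
have h : 0 < `|hgt z - hgt c|.
  by rewrite normr_gt0 subr_eq0; apply/eqP => e'; apply: ne; exact: plane_eq e e'.
have cf : continuous (fun z' : C => `|hgt z' - hgt c|).
  by apply: cts_norm; apply: ctsB; [exact: hgt_cts|exact: cts_cst].
by apply: filterS (cts_pos cf h) => z' h' e'; move: h'; rewrite e' subrr normr0 ltxx.
Qed.

Lemma conv_baseP s : S s <-> forall i j, s <> x i + y j.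
Proof.
split=> [h i j e|h]; first by apply: h; exists (x i); [by exists i|exists (y j); [by exists j|]].
by move=> [_ [i _ <-] [_ [j _ <-]]] e; exact: h (esym e).
Qed.

Lemma conv_base_near s : S s -> \forall s' \near s, S s'.
Proof.
move=> /conv_baseP h; have : \forall s' \near s, forall i j, s' <> x i + y j.
  by apply: near_forall => i; apply: near_forall => j; exact: near_ne.
by apply: filterS => s' /conv_baseP.
Qed.

Lemma conv_totalP u : T u <-> regular cpa cea S u.
Proof.
split=> [[h1 h2 h3]|[h1 h2]].
  split=> // -[i|j]; rewrite /pos /= ?addr0 => e; first by apply: h1; exists i.
  by apply: h2; exists j => //; rewrite e opprD opprK addrCA subrr addr0.
split=> // -[k _ e].
  by have := h2 (inl k); rewrite /pos /= addr0 e.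
by have := h2 (inr k); rewrite /pos /= e opprB subrK.
Qed.

Lemma regular_near u : regular cpa cea S u -> \forall u' \near u, T u'.
Proof.
move=> [h1 h2]; have n1 : \forall u' \near u, S u'.2 by exact: (@snd_cts R u _ (conv_base_near h1)).
have n2 : \forall u' \near u, forall a, u'.1 <> pos a u'.2.
  apply: near_forall => a; have c : continuous (fun u' : C * C => `|hh a u'| + `|rr a u'|).
    by apply: ctsD; apply: cts_norm; [exact: hh_cts|exact: rr_cts].
  have h : 0 < `|hh a u| + `|rr a u|.
    rewrite lt_neqAle addr_ge0 ?normr_ge0// andbT eq_sym paddr_eq0 ?normr_ge0// !normr_eq0.
    apply/negP => /andP[/eqP e1 /eqP e2]; apply: (h2 a); apply/subr0_eq.
    by apply: (plane_eq (th := th)); rewrite ?rho0 ?hgt0.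
  by apply: filterS (cts_pos c h) => u' h' e; move: h'; rewrite /hh /rr e subrr rho0 hgt0 normr0 addr0 ltxx.
by apply: filterS2 n1 n2 => u' k1 k2; apply/conv_totalP.
Qed.

Let om_x u : omega u -> om1 th x u.1.
Proof. by move=> h i; have := h (inl i); rewrite /hh /rr /pos /= addr0 hgtB rhoB subr_lt0 => k e; apply: k; rewrite e subrr. Qed.

Lemma hgt_opp z : Plane.hgt (th + pi) z = - hgt z.
Proof. by rewrite /Plane.hgt cosDpi sinDpi; ring. Qed.
Lemma rho_opp z : Plane.rho (th + pi) z = - rho z.
Proof. by rewrite /Plane.rho cosDpi sinDpi; ring. Qed.

(** The map sending [x] to [s - x] is a half turn: a slit of direction [th] issuing from [s - y j]
    becomes the slit of direction [th + pi] issuing from [y j], and its upper side stays the upper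
    side. Hence the direction chosen for [phi2]. *)
Let hhr j u : hh (inr j) u = Plane.hgt (th + pi) (u.2 - u.1) - Plane.hgt (th + pi) (y j).
Proof. rewrite /hh /pos /= !hgt_opp !(hgtB, hgtD, hgtN); ring. Qed.
Let rrr j u : rr (inr j) u = Plane.rho (th + pi) (u.2 - u.1) - Plane.rho (th + pi) (y j).
Proof. rewrite /rr /pos /= !rho_opp !(rhoB, rhoD, rhoN); ring. Qed.
Let hhl i u : hh (inl i) u = hgt u.1 - hgt (x i).
Proof. by rewrite /hh /pos /= addr0 hgtB. Qed.
Let rrl i u : rr (inl i) u = rho u.1 - rho (x i).
Proof. by rewrite /rr /pos /= addr0 rhoB. Qed.

Let om_y u : (forall j, hh (inr j) u = 0 -> rr (inr j) u < 0) -> om1 (th + pi) y (u.2 - u.1).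
Proof. by move=> h j; have := h j; rewrite hhr rrr subr_lt0 => k e; apply: k; rewrite e subrr. Qed.

(** Compares [cphi], which jumps, with a true frame near [u]. It is applied with [D] equal to 1 off
    the slits, and to [B a] below the slit of [a]. *)
Lemma csec_near u (D : C * C -> 'M[K]_n) : T u -> D u = 1%:M ->
  (forall z : T, set_val z = u -> exists2 g : frame (conv_sheaf V1 V2) n, framed g z &
    \forall z' \near z, forall v, g z' v = cphi z' (v *m D (set_val z'))) ->
  forall c, csec c u <-> \forall u' \near u, c u' = c u *m D u'.
Proof.
move=> Tu D1 hz c; pose z : T := exist _ u (mem_set Tu).
have [g fg hg] := hz z erefl.
have bphi z' : injective (cphi z').
  have [b1 _ _] := sf1; have [b2 _ _] := sf2; exact: (bij_inj (tline_bij (b1 (pr1 z')) (b2 (dif z')))).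
have nT : \forall u' \near u, T u' by apply: regular_near; apply/conv_totalP.
split.
  move=> /(_ z erefl) /(framed_sect _ fg)[v hv].
  have : \forall z' \near z, c (set_val z') = v *m D (set_val z').
    by apply: filterS2 hg hv => z' h1; rewrite h1 => /bphi.
  move=> h; have := nbhs_singleton h; rewrite /= D1 mulmx1 => ev; rewrite -ev in h.
  move: h => /near_val[W nW hW]; apply: filterS2 nW nT => u' Wu Tu'.
  exact: (hW (exist _ u' (mem_set Tu')) Wu).
move=> h z' ez; have -> : z' = z by exact: val_inj.
apply/(framed_sect _ fg); exists (c u).
have h' : \forall w \near z, c (set_val w) = c u *m D (set_val w).
  by apply/near_val; exists [set u' | c u' = c u *m D u'] => //; exact: h.
by apply: filterS2 hg h' => w -> ->.
Qed.

Let frame_near z D1 D2 (g1 : frame V1 n) (g2 : frame V2 1) : framed g1 (pr1 z) -> framed g2 (dif z) ->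
  (\forall w \near (pr1 z), forall v, g1 w v = phi1 w (v *m D1 (set_val w))) ->
  (\forall w \near (dif z), forall v, g2 w v = phi2 w (v *m (D2 (set_val w))%:M)) ->
  exists2 g : frame (conv_sheaf V1 V2) n, framed g z &
    \forall z' \near z, forall v, g z' v = cphi z' (D2 ((set_val z').2 - (set_val z').1) *: (v *m D1 (set_val z').1)).
Proof.
move=> f1 f2 /(@pr1_cts R p q x y z) h1 /(@dif_cts R p q x y z) h2.
have n1 : \forall z' \near z, forall v, g1 (pr1 z') v = phi1 (pr1 z') (v *m D1 (set_val z').1) by exact: h1.
have n2 : \forall z' \near z, forall v, g2 (dif z') v = phi2 (dif z') (v *m (D2 ((set_val z').2 - (set_val z').1))%:M) by exact: h2.
exists (tframe g1 g2); first exact: tframe_framed.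
apply: filterS2 n1 n2 => z' k1 k2 v; rewrite /cphi /tframe /= /tline k1 k2 mul_mx_scalar !linearZ.
by apply/lclsP; apply: teq_sym; exact: teq_scale.
Qed.

Let base2 (z : T) : om1 (th + pi) y (set_val (dif z)) -> exists2 g2, framed g2 (dif z) &
  \forall w \near (dif z), forall v, g2 w v = phi2 w (v *m (1 : K)%:M).
Proof.
by move=> oz; have [_ _ /(_ (dif z))[g [fg h _]]] := sf2; exists g => //; apply: filterS (h oz) => w k v; rewrite k mulmx1.
Qed.

Let base1 (z : T) : om1 th x (set_val (pr1 z)) -> exists2 g1, framed g1 (pr1 z) &
  \forall w \near (pr1 z), forall v, g1 w v = phi1 w (v *m 1%:M).
Proof.
by move=> oz; have [_ _ /(_ (pr1 z))[g [fg h _]]] := sf1; exists g => //; apply: filterS (h oz) => w k v; rewrite k mulmx1.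
Qed.

Lemma conv_jump_system : jump_system th cpa cea B S csec.
Proof.
have [_ Yu hf1] := sf1; have [_ muu hf2] := sf2.
split.
- exact: conv_base_near.
- move=> s /conv_baseP Ss [i|j] [i'|j']; rewrite /pos /= ?addr0.
  + by move=> /hx ->.
  + by move=> e; exfalso; apply: (Ss i j'); rewrite e addrAC addNr add0r.
  + by move=> e; exfalso; apply: (Ss i' j); rewrite -e addrAC addNr add0r.
  + by move=> /addIr /oppr_inj /hy ->.
- move=> c u Su ou; have Tu : T u by apply/conv_totalP; exact: (regular_omega Su ou).
  have := @csec_near u (fun=> 1%:M) Tu erefl; move=> ->; first by split; apply: filterS => u' ->; rewrite mulmx1.
  move=> z ez; have [g1 f1 h1] : exists2 g1, framed g1 (pr1 z) & \forall w \near (pr1 z), forall v, g1 w v = phi1 w (v *m 1%:M).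
    by apply: base1; rewrite -[set_val (pr1 z)]/((set_val z).1) ez; exact: om_x.
  have [g2 f2 h2] : exists2 g2, framed g2 (dif z) & \forall w \near (dif z), forall v, g2 w v = phi2 w (v *m (1 : K)%:M).
    by apply: base2; rewrite -[set_val (dif z)]/((set_val z).2 - (set_val z).1) ez; apply: om_y => j; exact: ou.
  have [g fg hg] := frame_near (D1 := fun=> 1%:M) (D2 := fun=> 1) f1 f2 h1 h2; exists g => //.
  by apply: filterS hg => w h v; rewrite h scale1r.
- move=> c u a Su ou; have Tu : T u by apply/conv_totalP; exact: (regular_slit Su ou).
  have [h0 hr hb] := ou.
  have := @csec_near u (fun u' => if hh a u' < 0 then B a else 1%:M) Tu; rewrite h0 ltxx => /(_ erefl) ->.
    by split; apply: filterS => u' ->; case: ifP; rewrite ?mulmx1.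
  move=> z ez; case: a h0 hr hb {ou} => [i|j] h0 hr hb.
    have si : sl1 th x i (set_val (pr1 z)).
      by move: h0 hr; rewrite hhl rrl -[set_val (pr1 z)]/((set_val z).1) ez subr_gt0 => /subr0_eq ? ?; split.
    have [g1 [f1 _ /(_ i si) h1]] := hf1 (pr1 z).
    have [g2 f2 h2] : exists2 g2, framed g2 (dif z) & \forall w \near (dif z), forall v, g2 w v = phi2 w (v *m (1 : K)%:M).
      by apply: base2; rewrite -[set_val (dif z)]/((set_val z).2 - (set_val z).1) ez; apply: om_y => j; exact: hb.
    have [|g fg hg] := frame_near (D1 := fun w => if hgt w < hgt (x i) then Y i else 1%:M) (D2 := fun=> 1) f1 f2 _ h2.
      by apply: filterS h1 => w h v; rewrite h; case: ifP => _; rewrite ?mulmx1.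
    by exists g => //; apply: filterS hg => w h v; rewrite h scale1r hhl subr_lt0.
  have sj : sl1 (th + pi) y j (set_val (dif z)).
    by move: h0 hr; rewrite hhr rrr -[set_val (dif z)]/((set_val z).2 - (set_val z).1) ez subr_gt0 => /subr0_eq ? ?; split.
  have [g2 [f2 _ /(_ j sj) h2]] := hf2 (dif z).
  have [g1 f1 h1] : exists2 g1, framed g1 (pr1 z) & \forall w \near (pr1 z), forall v, g1 w v = phi1 w (v *m 1%:M).
    apply: base1; rewrite -[set_val (pr1 z)]/((set_val z).1) ez => i; have := hb (inl i) isT.
    by rewrite hhl rrl subr_lt0 => k e; apply: k; rewrite e subrr.
  have [|g fg hg] := frame_near (D1 := fun=> 1%:M)
    (D2 := fun w => if Plane.hgt (th + pi) w < Plane.hgt (th + pi) (y j) then mu j else 1) f1 f2 h1.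
    by apply: filterS h2 => w h v; rewrite h; case: ifP => _; rewrite ?mulmx1.
  exists g => //; apply: filterS hg => w h v; rewrite h hhr subr_lt0 mulmx1 /=.
  by case: ifP => _; rewrite ?mul_mx_scalar ?mulmx1 ?scale1r.
- move=> u z ez; apply: sect_local (sect_zero _ _) _.
  by near=> w; rewrite linear0.
- move=> c d u hc hd z ez; apply: sect_local (sect_lin 1 (hc z ez) (hd z ez)) _.
  by near=> w; rewrite scale1r linearD.
- move=> k c u hc z ez; apply: sect_local (sect_lin k (hc z ez) (sect_zero _ _)) _.
  by near=> w; rewrite linearZ addr0.
Unshelve. all: by end_near. Qed.

End ConvJump.

(** * Stalks of the middle convolution *)

Section ProjectiveNbhs.
Variables (R : realType) (th : R) (p q : nat).
Local Notation C := (Cplx R).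
Local Notation rho := (rho th).
Local Notation hgt := (hgt th).
Variables (x : 'I_p -> C) (y : 'I_q -> C).
Local Notation S := (conv_base x y).
Local Notation far := (far th).

Lemma S_near (s : S) : \forall s' \near (set_val s : C), S s'.
Proof. exact: (conv_base_near th (set_valP s)). Qed.

Lemma nearX_some (Q : option C -> C -> Prop) (z : C) (s : S) :
  (\forall w \near ((Some z : P1 R), s), Q w.1 (set_val w.2)) <->
  \forall u \near (z, set_val s : C), Q (Some u.1) u.2.
Proof.
split=> [[[A B] /= [nA nB] h]|[[A B] /= [nA nB] h]].
  have [W nW hW] := (near_val s B).1 nB.
  exists (Some @^-1` A, W `&` S); first by split=> //; exact: filterI nW (S_near s).
  move=> [z' s'] /= [Az' [Ws' Ss']].
  by have := h (Some z', exist _ s' (mem_set Ss')); apply; split=> //=; exact: hW.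
exists (Some @` A, set_val @^-1` B).
  split=> /=; first exact: (@one_point_compactification_some_nbhs C z A nA).
  exact: (@set_val_cts C S s B nB).
by move=> [z' s'] /= [[z'' Az'' <-] Bs']; exact: (h (z'', set_val s')).
Qed.

Lemma disc_compact (b : R) : compact [set z : C | ~ far b z].
Proof.
have c := compact_setX (@segment_compact R (- b) b) (@segment_compact R (- b) b).
have -> : [set z | ~ far b z] = (fun ab : R * R => pt th ab.1 ab.2) @` (`[- b, b]%classic `*` `[- b, b]%classic).
  apply/seteqP; split=> [z /not_orP[/negP h1 /negP h2]|z [[a1 a2] /= [h1 h2] <-]].
    rewrite -!leNgt in h1 h2; exists (rho z, hgt z); last exact: pt_rho_hgt.
    by split; rewrite /= in_itv /= -ler_norml.
  rewrite /Cochains.far rho_pt hgt_pt; move: h1 h2; rewrite !in_itv /= -!ler_norml => h1 h2.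
  by move=> []; rewrite ltNge ?h1 ?h2.
apply: continuous_compact c; apply: continuous_subspaceT; exact: pt_cts2.
Qed.

Lemma compact_near_bound (A : set C) : compact A -> exists b : R, forall z, A z -> ~ far b z.
Proof.
move=> cA; have bnd (f : C -> R) : continuous f -> exists b : R, forall z, A z -> `|f z| <= b.
  move=> cf; have /compact_bounded[b [_ hb]] : compact (f @` A).
    by apply: continuous_compact cA; exact: continuous_subspaceT.
  by exists (b + 1) => z Az; apply: (hb (b + 1)); [rewrite ltrDl|exists z].
have [b1 h1] := bnd _ (@rho_cts R th); have [b2 h2] := bnd _ (@hgt_cts R th).
exists (Num.max b1 b2) => z Az [].
  by rewrite gt_max ltNge h1.
by rewrite gt_max [b2 < _]ltNge h2// andbF.
Qed.

(** Neighbourhoods of infinity are complements of closed compact sets; boxes are compact, and every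
    compact set is contained in one. *)
Lemma nearX_none (Q : option C -> C -> Prop) (s : S) :
  (\forall w \near ((None : P1 R), s), Q w.1 (set_val w.2)) <->
  exists b : R, \forall s' \near (set_val s : C), (forall z, far b z -> Q (Some z) s') /\ Q None s'.
Proof.
split=> [[[A B] /= [[U [cU clU] UA] nB] h]|[b nb]].
  have [b hb] := compact_near_bound cU; exists b.
  have [W nW hW] := (near_val s B).1 nB.
  apply: filterS2 nW (S_near s) => s' Ws' Ss'; pose s1 : S := exist _ s' (mem_set Ss').
  have Bs : B s1 by exact: hW.
  split=> [z fz|].
    apply: (h (Some z, s1)); split=> //=; apply: UA; left; exists z => //.
    by move=> /hb; exact.
  by apply: (h (None, s1)); split=> //=; apply: UA; right.
exists ((Some @` (~` [set z : C | ~ far b z]) `|` [set None]), set_val @^-1` [set s' | (forall z, far b z -> Q (Some z) s') /\ Q None s']).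
  split=> /=; last exact: (@set_val_cts C S s _ nb).
  exists [set z : C | ~ far b z] => //; split; first exact: disc_compact.
  apply: compact_closed; last exact: disc_compact.
  exact: norm_hausdorff.
move=> [z' s'] /= [[[z'' fz <-]|->] [h1 h2]] //.
by apply: h1; apply: contrapT.
Qed.

End ProjectiveNbhs.

Lemma near_open (Z : topologicalType) (z : Z) (P : Z -> Prop) : (\forall z' \near z, P z') ->
  exists V, [/\ open V, V z & forall z', V z' -> P z'].
Proof. by rewrite /prop_near1 nbhsE => -[V [oV Vz] h]; exists V. Qed.

(** * Classes of the middle convolution as cocycles of functions *)

Section Rep.
Variables (R : realType) (K : fieldType) (th : R) (p q n : nat).
Local Notation C := (Cplx R).
Variables (x : 'I_p -> C) (y : 'I_q -> C).
Local Notation T := (conv_total x y).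
Local Notation S := (conv_base x y).
Variables (V1 : sheaf K (punctured x)) (V2 : sheaf K (punctured y)).
Variables (phi1 : frame V1 n) (phi2 : frame V2 1) (Y : 'I_p -> 'M[K]_n) (mu : 'I_q -> K).
Hypothesis sf1 : slit_frame th phi1 Y.
Hypothesis sf2 : slit_frame (th + pi) phi2 (fun j => (mu j)%:M).
Local Notation cphi := (cphi phi1 phi2).
Local Notation csec := (csec phi1 phi2).
Local Notation L := (conv_sheaf V1 V2).
Local Notation X := (P1 R * S)%type.
Local Notation jj := (@incl_j R p q x y).
Local Notation cfun := (C * C -> 'rV[K]_n).
Local Notation near_sec := (near_sec th (cpa x y) (@cea p q) S csec).
Local Notation datum_at := (datum_at th (cpa x y) (@cea p q) S csec).
Local Notation trivial_near := (trivial_near th (cpa x y) (@cea p q) S csec).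

Definition E : sheaf K X := pushforward jj L.
Definition fl (c : cfun) : dprod L := fun z => cphi z (c (set_val z)).

Lemma cphi_bij z : bijective (cphi z).
Proof. by have [b1 _ _] := sf1; have [b2 _ _] := sf2; exact: (tline_bij (b1 (pr1 z)) (b2 (dif z))). Qed.

Lemma fl_surj (m : dprod L) : exists c, fl c = m.
Proof.
have h u : exists v, forall z : T, set_val z = u -> cphi z v = m z.
  have [Tu|nT] := pselect (T u); last by exists 0 => z e; exfalso; apply: nT; rewrite -e; exact: set_valP.
  pose z : T := exist _ u (mem_set Tu); have [k _ Kk] := cphi_bij z.
  by exists (k (m z)) => z' e; have -> : z' = z by [exact: val_inj]; exact: Kk.
have [c hc] := choice h; exists c; apply: functional_extensionality_dep => z.
exact: (hc _ z erefl).
Qed.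

Lemma fl_lin k (c c' : cfun) : fl (k *: c + c') = k *: fl c + fl c'.
Proof. by apply: functional_extensionality_dep => z; exact: linearP. Qed.

Lemma csecE c (z : T) : csec c (set_val z) <-> @sect _ _ L (fl c) z.
Proof. by split=> [|h z' /val_inj ->//]; apply. Qed.

(* Sections of [j_* L] near a point of [P^1 * S], as functions of [(x, s)]. *)
Definition nsec (f : cfun) (w : X) : Prop := \forall w' \near w, forall z : T, jj z = w' -> csec f (set_val z).

Let regT s' z : regular (cpa x y) (@cea p q) S (z, s') -> T (z, s').
Proof. by move=> h; apply/conv_totalP. Qed.

Let T_reg u : T u -> regular (cpa x y) (@cea p q) S u.
Proof. by move=> h; apply/conv_totalP. Qed.

Lemma nsecP f b (s : S) : nsec f ((b : P1 R), s) <-> near_sec f b (set_val s).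
Proof.
pose Q (b : option C) (s' : C) := if b is Some z then regular (cpa x y) (@cea p q) S (z, s') -> csec f (z, s') else True.
have QE : nsec f ((b : P1 R), s) <-> \forall w \near ((b : P1 R), s), Q w.1 (set_val w.2).
  split; apply: filterS => -[[b'|] s'] //= h.
    move=> /regT Tu; pose zz : T := @exist _ (fun u => u \in T) _ (mem_set Tu).
    apply: (h zz); rewrite /incl_j /=; congr pair; exact: val_inj.
  move=> z [e1 e2]; move: h; rewrite -e1 -e2 /= -surjective_pairing; apply; apply: T_reg; exact: set_valP.
apply: iff_trans QE _; case: b => [b|].
  by apply: iff_trans (nearX_some th Q b s) _; split=> h; apply: filterS h => -[u1 u2].
apply: iff_trans (nearX_none th Q s) _.
split=> -[b h]; exists b; apply: filterS h => s'; first by case.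
by move=> h; split.
Qed.

(** The function [f] expresses, in the frame [cphi], a section of the direct image with germ [e] at
    [w]. *)
Definition isg (f : cfun) (w : X) (e : E w) : Prop := @pgerm _ _ (pushforward_pre jj L) w (fl f) e.

Let numP f w : germs (@num _ _ (pushforward_pre jj L)) w (fl f) <-> nsec f w.
Proof.
split; rewrite /nsec /prop_near1 nbhsE.
  by move=> [V [oV Vw h]]; exists V => // w' Vw' z e; apply/csecE; apply: h; rewrite e.
by move=> [V [oV Vw] h]; exists V; split=> // z Vz; apply/csecE; exact: (h _ Vz z).
Qed.

Lemma isg_nsec f w e : @isg f w e -> nsec f w.
Proof. by move=> [g [eg _]]; apply/numP; rewrite -eg; have := set_valP (g : set_type _). Qed.

Lemma isg_ex f w : nsec f w -> exists e, @isg f w e.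
Proof. by move=> /numP h; exact: is_class_ex. Qed.

Lemma isg_surj w (e : E w) : exists f, isg f e.
Proof.
have [m _ hm] := is_class_surj e.
by have [f ef] := fl_surj m; exists f; rewrite /isg ef.
Qed.

Lemma isg_eq f f' w e e' : @isg f w e -> @isg f' w e' ->
  (e = e' <-> \forall w' \near w, forall z : T, jj z = w' -> f (set_val z) = f' (set_val z)).
Proof.
move=> h h'; rewrite (is_class_eq h h').
split; rewrite /prop_near1 nbhsE.
  move=> [V [oV Vw k]]; exists V => // w' Vw' z ez; apply: (bij_inj (cphi_bij z)).
  by apply/subr0_eq; apply: k; rewrite ez.
move=> [V [oV Vw] k]; exists V; split=> // z Vz.
change (fl f z - fl f' z = 0).
by rewrite /fl (k _ Vz z)// subrr.
Qed.

Lemma isg_lin k f f' w e e' : @isg f w e -> @isg f' w e' -> isg (k *: f + f') (k *: e + e').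
Proof. by rewrite /isg fl_lin; exact: is_classD. Qed.

Lemma isg_near f f' w e : @isg f w e -> (\forall w' \near w, forall z : T, jj z = w' -> f (set_val z) = f' (set_val z)) ->
  isg f' e.
Proof.
move=> h ff'; have h' : nsec f' w.
  have := isg_nsec h; rewrite /nsec => h1.
  apply: filterS2 h1 (near_join ff') => w' k1 k2 z ez; apply/csecE.
  apply: sect_local ((csecE f z).1 (k1 z ez)) _.
  have : \forall z' \near z, forall z0 : T, jj z0 = jj z' -> f (set_val z0) = f' (set_val z0).
    rewrite -ez in k2.
    have cj : {for z, continuous jj}.
      move=> A [[A1 A2] /= [nA1 nA2] hA].
      have m1 : \forall z' \near z, A1 (Some (set_val z').1).
        apply: (@continuous_comp T C (P1 R) (fun z => (set_val z).1) Some z) => //.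
        apply: (@continuous_comp _ _ _ set_val fst z); [exact: set_val_cts|exact: fst_cts].
      have m2 : \forall z' \near z, A2 (jj z').2.
        have [W nW hW] := (near_val _ A2).1 nA2.
        have : \forall z' \near z, W (set_val z').2.
          apply: (@continuous_comp _ _ _ set_val snd z) => //; [exact: set_val_cts|exact: snd_cts].
        by apply: filterS => z'; exact: (hW (jj z').2).
      by apply: filterS2 m1 m2 => z' a1 a2; apply: hA.
    exact: (cj _ k2).
  by apply: filterS => z' h2; rewrite /fl (h2 z').
have [e' h2] := isg_ex h'.
by have /(isg_eq h h2) -> := ff'.
Qed.

Lemma isg0 w : isg 0 (0 : E w).
Proof.
have [f hf] := isg_surj (0 : E w).
by have := isg_lin (-1) hf hf; rewrite !scaleN1r !addNr.
Qed.

Lemma E_sect (c : dprod E) w : @sect _ _ E c w <-> exists f, \forall w' \near w, isg f (c w').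
Proof.
split.
  move=> [V [m [oV Vw _ h]]]; have [f ef] := fl_surj m; exists f.
  rewrite /prop_near1 nbhsE; exists V => // w' Vw'; rewrite /isg ef; exact: h.
move=> [f]; rewrite /prop_near1 nbhsE => -[V [oV Vw] h]; exists V, (fl f); split=> //.
move=> z Vz; apply/csecE; have := isg_nsec (h _ Vz).
by move=> /nbhs_singleton; exact.
Qed.

Definition ev (z : T) (e : E (jj z)) : 'rV[K]_n := projT1 (cid (isg_surj e)) (set_val z).

Lemma evE f z (e : E (jj z)) : isg f e -> ev e = f (set_val z).
Proof.
rewrite /ev; case: cid => f' h' /= h.
by have /(isg_eq h' h)/nbhs_singleton := erefl e; exact.
Qed.

Lemma ev_lin k z (e e' : E (jj z)) : ev (k *: e + e') = k *: ev e + ev e'.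
Proof.
have [f hf] := isg_surj e; have [f' hf'] := isg_surj e'.
by rewrite (evE hf) (evE hf') (evE (isg_lin k hf hf')).
Qed.

(** Near [w] a section of the direct image comes from one function, which [ev] reads off at the
    points of the open part; equality of values there is therefore enough. *)
Lemma flat_isg (d : dprod E) f w : @sect _ _ E d w ->
  (\forall w' \near w, forall z, jj z = w' -> ev (d (jj z)) = f (set_val z)) -> \forall w' \near w, isg f (d w').
Proof.
move=> /E_sect[f0 h0] hf; apply: filterS2 h0 (near_join (nearI h0 hf)) => w' h1 h2.
apply: isg_near h1 _; apply: filterS h2 => w'' [k1 k2] z ez.
by rewrite -(k2 z ez) (@evE f0)//; rewrite -ez in k1.
Qed.

Definition GC : sheaf K X := godement_coker E.
Definition cl (c : dprod E) (w : X) (k : GC w) : Prop := @pgerm _ _ (godement_coker_pre E) w c k.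

Lemma cl_ex c w : exists k, @cl c w k.
Proof. exact: godement_class. Qed.

Lemma cl_eq c c' w k k' : @cl c w k -> @cl c' w k' -> (k = k' <-> @sect _ _ E (c - c') w).
Proof.
move=> h h'; rewrite (is_class_eq h h'); split; first by move=> [V [oV Vw]]; exact.
move=> /sect_open; rewrite /prop_near1 nbhsE => -[V [oV Vw] hV]; by exists V; split.
Qed.

Lemma cl_lin a c c' w k k' : @cl c w k -> @cl c' w k' -> cl (a *: c + c') (a *: k + k').
Proof. exact: is_classD. Qed.

Lemma GC_sect (g : dprod GC) w : @sect _ _ GC g w <-> exists c, \forall w' \near w, cl c (g w').
Proof.
split; first by move=> [V [c [oV Vw _ h]]]; exists c; rewrite /prop_near1 nbhsE; exists V.
by move=> [c]; rewrite /prop_near1 nbhsE => -[V [oV Vw] h]; exists V, c.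
Qed.

Definition W : sheaf K S := middle_convolution V1 V2.
Definition wcl (g : dprod GC) (s : S) (e : W s) : Prop := @pgerm _ _ (R1_pre (@pr2bar R p q x y) E) s g e.

Lemma wcl_ex g s : (\forall s' \near s, forall w : X, w.2 = s' -> @sect _ _ GC g w) -> exists e, @wcl g s e.
Proof.
rewrite /prop_near1 nbhsE => -[V [oV Vs] h]; apply: is_class_ex; exists V; split=> // w Vw.
exact: (h _ Vw).
Qed.

Lemma wcl_eq g g' s e e' : @wcl g s e -> @wcl g' s e' -> (e = e' <->
  exists c, \forall s' \near s, forall w : X, w.2 = s' -> cl c ((g - g') w)).
Proof.
move=> h h'; rewrite (is_class_eq h h'); split.
  by move=> [V [oV Vs [c hc]]]; exists c; rewrite /prop_near1 nbhsE; exists V => // s' Vs' w ew; apply: hc; rewrite -ew in Vs'.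
move=> [c]; rewrite /prop_near1 nbhsE => -[V [oV Vs] hc]; exists V; split=> //; exists c => w Vw.
exact: (hc _ Vw).
Qed.

Lemma wcl_lin a g g' s e e' : @wcl g s e -> @wcl g' s e' -> wcl (a *: g + g') (a *: e + e').
Proof. exact: is_classD. Qed.

Lemma W_sect (sg : dprod W) s : @sect _ _ W sg s <-> exists2 g, (\forall s' \near s, wcl g (sg s')) &
  (\forall s' \near s, forall w : X, w.2 = s' -> @sect _ _ GC g w).
Proof.
split.
  move=> [V [g [oV Vs hn h]]]; exists g; rewrite /prop_near1 nbhsE; exists V => // s' Vs'.
  by move=> w ew; apply: hn; rewrite -ew in Vs'.
move=> [g h1 h2]; have := nearI h1 h2; rewrite /prop_near1 nbhsE => -[V [oV Vs] h]; exists V, g; split=> //.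
  by move=> w Vw; exact: (h _ Vw).2.
by move=> s' Vs'; exact: (h _ Vs').1.
Qed.

Let tX (t : option C -> C -> cfun) (w : X) : cfun := t w.1 (set_val w.2).

Lemma datum_X t (s : S) : datum_at t (set_val s) <->
  forall b : P1 R, \forall w \near (b, s), nsec (tX t w - tX t (b, s)) w.
Proof.
pose Q b0 (b : option C) (s' : C) := near_sec (t b s' - t b0 (set_val s)) b s'.
have QE b0 : (\forall w \near (b0 : P1 R, s), nsec (tX t w - tX t (b0, s)) w) <->
    \forall w \near (b0 : P1 R, s), Q b0 w.1 (set_val w.2).
  by split=> h; apply: filterS h => -[b' s'] /nsecP.
split=> [[h1 [b h2]] [b0|]|h].
- by apply/QE/(nearX_some th (Q (Some b0))); exact: h1.
- by apply/QE/(nearX_none th (Q None)); exists b.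
- split=> [z|]; first by have /QE/(nearX_some th (Q (Some z))) := h (Some z).
  by have /QE/(nearX_none th (Q None)) := h None.
Qed.

(** The family of germs [c w] lifts [g] near [w], and its values are those of [t] up to [de]. Only
    differences of lifts matter, so a correction common to all [w] is harmless; it is what allows an
    arbitrary cocycle of functions to be realized by families of germs. *)
Definition link (V : set S) (g : dprod GC) (t : option C -> C -> cfun) (c : X -> dprod E) (de : cfun) : Prop :=
  forall w : X, V w.2 -> \forall w' \near w, cl (c w) (g w') /\
    forall z, jj z = w' -> ev (c w (jj z)) + de (set_val z) = tX t w (set_val z).

Definition Rep t (s : S) (e : W s) : Prop := exists V g, [/\ open V, V s, wcl g e,
  exists c de, link V g t c de & forall s', V s' -> datum_at t (set_val s')].

Let near_V (V : set S) (w : X) : open V -> V w.2 -> \forall w' \near w, V w'.2.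
Proof.
move=> oV Vw; have : {for w, continuous (snd : X -> S)} by exact: cvg_snd.
by apply; exact: open_nbhs_nbhs.
Qed.

Lemma link_diff V g t c de (w : X) : open V -> link V g t c de -> V w.2 ->
  \forall w' \near w, @sect _ _ E (c w' - c w) w' /\
    \forall w'' \near w', isg (tX t w' - tX t w) ((c w' - c w) w'').
Proof.
move=> oV hl Vw; apply: filterS2 (near_V oV Vw) (near_join (hl w Vw)) => w' Vw' h1.
have h2 := hl w' Vw'.
have ss : @sect _ _ E (c w' - c w) w'.
  by have [k1 _] := nbhs_singleton h1; have [k2 _] := nbhs_singleton h2; apply/(cl_eq k2 k1).
split=> //; apply: flat_isg ss _; apply: filterS2 h1 h2 => w'' [_ k1] [_ k2] z ez.
have -> : (c w' - c w) (jj z) = -1 *: c w (jj z) + c w' (jj z) by rewrite scaleN1r addrC.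
rewrite ev_lin scaleN1r !fctE -(k1 z ez) -(k2 z ez).
by rewrite opprD addrACA subrr addr0 addrC.
Qed.

Lemma link_datum V g t c de : open V -> link V g t c de -> forall s, V s -> datum_at t (set_val s).
Proof.
move=> oV hl s Vs; apply/datum_X => b; apply: filterS (link_diff (w := (b, s)) oV hl Vs) => w [_ h].
exact: isg_nsec (nbhs_singleton h).
Qed.

Lemma Rep_datum t s e : @Rep t s e -> \forall s' \near (set_val s : C), datum_at t s'.
Proof.
move=> [V [g [oV Vs _ _ hd]]]; have : \forall s' \near s, V s' by exact: open_nbhs_nbhs.
move=> /near_val[A nA hA]; apply: filterS2 nA (S_near th s) => s' As' Ss'.
by apply: (hd (exist _ s' (mem_set Ss'))); exact: hA.
Qed.

Lemma W_sect_Rep (sg : dprod W) s : @sect _ _ W sg s -> exists t, \forall s' \near s, Rep t (sg s').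
Proof.
move=> /W_sect[g h1 h2]; have [V [oV Vs hV]] := near_open (nearI h1 h2).
have hc (w : X) : exists c, V w.2 -> \forall w' \near w, cl c (g w').
  have [Vw|nV] := pselect (V w.2); last by exists 0.
  by have /GC_sect[c hc] := (hV _ Vw).2 w erefl; exists c.
have [c {}hc] := choice hc.
(* The datum at [w] consists of the values of the lift [c w], extended by 0 where there are none. *)
pose t (b : option C) (s' : C) (u : C * C) : 'rV[K]_n :=
  match pselect (S s'), pselect (T u) with
  | left h, left k => @ev (exist _ u (mem_set k)) (c ((b : P1 R), @exist _ (fun s => s \in S) s' (mem_set h)) (jj (exist _ u (mem_set k))))
  | _, _ => 0
  end.
have tE (w : X) z : tX t w (set_val z) = ev (c w (jj z)).
  rewrite /tX /t; case: pselect => [h|[]]; last exact: set_valP.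
  case: pselect => [k|[]]; last exact: set_valP.
  have -> : (w.1, @exist _ (fun s => s \in S) (set_val w.2) (mem_set h)) = w.
    by rewrite [RHS]surjective_pairing; congr pair; exact: val_inj.
  by have -> : exist _ (set_val z) (mem_set k) = z by exact: val_inj.
have hl : link V g t c 0.
  by move=> w Vw; apply: filterS (hc w Vw) => w' k; split=> // z _; rewrite addr0 tE.
have nV : \forall s' \near s, V s' by exact: open_nbhs_nbhs.
exists t; apply: filterS nV => s' Vs'; exists V, g; split=> //.
- by have [] := hV _ Vs'.
- by exists c, 0.
- exact: link_datum hl.
Qed.

Lemma Rep_ex s (e : W s) : exists t, Rep t e.
Proof.
have [sg ss <-] := sect_ex e; have [t ht] := W_sect_Rep ss.
by exists t; exact: nbhs_singleton ht.
Qed.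

(** The lift at [w] is the family whose germ at [w'] is that of the section [t w - t w']. Its value
    at a point is that of [t w] minus that of the datum attached to the point itself, whence the
    choice of [de]. *)
Lemma Rep_W_sect t s : (\forall s' \near (set_val s : C), datum_at t s') ->
  exists2 sg : dprod W, @sect _ _ W sg s & \forall s' \near s, Rep t (sg s').
Proof.
move=> dt; have : \forall s' \near s, datum_at t (set_val s') by apply/near_val; exists (datum_at t).
move=> /near_open[V [oV Vs hV]].
have cex (w w' : X) : exists e : E w', (exists e, isg (tX t w - tX t w') (e : E w')) -> isg (tX t w - tX t w') e.
  have [[e h]|nh] := pselect (exists e, isg (tX t w - tX t w') (e : E w')); first by exists e.
  by exists 0.
have [c hc] : exists c : X -> dprod E, forall w w', (exists e, isg (tX t w - tX t w') (e : E w')) -> isg (tX t w - tX t w') (c w w').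
  by exists (fun w w' => projT1 (cid (cex w w'))) => w w'; exact: (projT2 (cid (cex w w'))).
pose g : dprod GC := fun w => projT1 (cid (cl_ex (c w) w)).
have gE w : cl (c w) (g w) := projT2 (cid (cl_ex (c w) w)).
pose de (u : C * C) := t (Some u.1) u.2 u.
have near_c w : V w.2 -> \forall w' \near w, isg (tX t w - tX t w') (c w w').
  move=> Vw; have /datum_X/(_ w.1) := hV _ Vw; rewrite -surjective_pairing.
  apply: filterS => w' h; apply: hc; apply: isg_ex.
  have hZ := h; move: hZ => /isg_ex[e he].
  by have := isg_nsec (isg_lin (-1) he (isg0 w')); rewrite addr0 scaleN1r opprB.
have hl : link V g t c de.
  move=> w Vw; apply: filterS2 (near_V oV Vw) (near_join (near_c w Vw)) => w' Vw' h1; split.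
    have [k hk] := cl_ex (c w) w'; suff <- : k = g w' by [].
    apply/(cl_eq hk (gE w')); apply/E_sect; exists (tX t w - tX t w').
    apply: filterS2 h1 (near_c w' Vw') => w'' k1 k2.
    have := isg_lin (-1) k2 k1.
    have -> : -1 *: (tX t w' - tX t w'') + (tX t w - tX t w'') = tX t w - tX t w'.
      by rewrite scaleN1r opprB addrC addrA subrK.
    by have -> : -1 *: c w' w'' + c w w'' = (c w - c w') w'' by rewrite scaleN1r addrC.
  move=> z ez; have := nbhs_singleton h1; rewrite -ez => k1; rewrite (evE k1) /de !fctE.
  exact: subrK.
have sgex s' : exists e : W s', V s' -> wcl g e.
  have [Vs'|nV] := pselect (V s'); last by exists 0.
  have [|e he] := @wcl_ex g s'; last by exists e.
  have nV : \forall s'' \near s', V s'' by exact: open_nbhs_nbhs.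
  apply: filterS nV => s'' Vs'' w ew; apply/GC_sect; exists (c w); rewrite -ew in Vs''.
  by apply: filterS (hl w Vs'') => w' [].
pose sg : dprod W := fun s' => projT1 (cid (sgex s')).
have sgE s' : V s' -> wcl g (sg s') := projT2 (cid (sgex s')).
have nV : \forall s' \near s, V s' by exact: open_nbhs_nbhs.
exists sg.
  apply/W_sect; exists g; first by apply: filterS nV.
  apply: filterS nV => s' Vs' w ew; apply/GC_sect; exists (c w); rewrite -ew in Vs'.
  by apply: filterS (hl w Vs') => w' [].
apply: filterS nV => s' Vs'; exists V, g; split=> //; first exact: sgE.
by exists c, de.
Qed.

Lemma Rep_lin k t t' s e e' : @Rep t s e -> @Rep t' s e' ->
  Rep (fun b s => k *: t b s + t' b s) (k *: e + e').
Proof.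
move=> [V [g [oV Vs hg [c [de hl]] _]]] [V' [g' [oV' Vs' hg' [c' [de' hl']] _]]].
have oVV : open (V `&` V') by exact: openI.
have hl2 : link (V `&` V') (k *: g + g') (fun b s => k *: t b s + t' b s) (fun w => k *: c w + c' w) (k *: de + de').
  move=> w [Vw Vw']; apply: filterS2 (hl w Vw) (hl' w Vw') => w' [h1 h2] [h1' h2']; split.
    exact: cl_lin.
  move=> z ez; have -> : (k *: c w + c' w) (jj z) = k *: c w (jj z) + c' w (jj z) by [].
  rewrite ev_lin /tX !fctE; have := h2 z ez; have := h2' z ez; rewrite /tX => <- <-.
  by rewrite scalerDr addrACA.
exists (V `&` V'), (k *: g + g'); split=> //.
- exact: wcl_lin.
- by exists (fun w => k *: c w + c' w), (k *: de + de').
- exact: link_datum hl2.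
Qed.

(** If the class vanishes, some family of germs [ep] lifts [g] over whole fibres near [s], and its
    values plus [de] form the primitive [mm]. Conversely, adding the germ of [mm - t w] at [w] to
    the diagonal germ of [c w] produces such a family. *)
Lemma Rep_trivial t s e : @Rep t s e -> e = 0 <-> trivial_near t (set_val s).
Proof.
move=> [V [g [oV Vs hg [c [de hl]] _]]].
have wcl0 : wcl (0 : dprod GC) (0 : W s).
  by have := wcl_lin (-1) hg hg; rewrite !scaleN1r !addNr.
have nV : \forall s' \near s, V s' by exact: open_nbhs_nbhs.
split.
  move=> /(wcl_eq hg wcl0)[ep hep].
  pose mm (u : C * C) : 'rV[K]_n := match pselect (T u) with
    | left k => @ev (exist _ u (mem_set k)) (ep (jj (exist _ u (mem_set k)))) + de u | _ => 0 end.
  have mE z : mm (set_val z) = ev (ep (jj z)) + de (set_val z).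
    rewrite /mm; case: pselect => [k|[]]; last exact: set_valP.
    by have -> : exist _ (set_val z) (mem_set k) = z by exact: val_inj.
  exists mm; have nn : \forall s' \near s, forall b, near_sec (mm - t b (set_val s')) b (set_val s').
    apply: filterS2 nV (near_join hep) => s' Vs' h b; apply/nsecP.
    pose w : X := ((b : P1 R), s'); have h2 := hl w Vs'.
    have h3 : \forall w' \near w, cl ep (g w').
      have cs : {for w, continuous (snd : X -> S)} by exact: cvg_snd.
      have : \forall w' \near w, forall v : X, v.2 = w'.2 -> cl ep ((g - 0) v) by exact: (cs _ h).
      by apply: filterS => w' /(_ w' erefl); rewrite subr0.
    have ss : @sect _ _ E (ep - c w) w.
      by have [k1 _] := nbhs_singleton h2; have k2 := nbhs_singleton h3; apply/(cl_eq k2 k1).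
    have := flat_isg ss (f := mm - tX t w); move=> k.
    apply: isg_nsec (nbhs_singleton (k _)); apply: filterS h2 => w' [_ k1] z ez.
    have -> : (ep - c w) (jj z) = -1 *: c w (jj z) + ep (jj z) by rewrite scaleN1r addrC.
    by rewrite ev_lin scaleN1r !fctE mE -(k1 z ez) opprD addrACA subrr addr0 addrC.
  move: nn => /near_val[A nA hA]; apply: filterS2 nA (S_near th s) => s' As' Ss' b.
  exact: (hA (exist _ s' (mem_set Ss')) As' b).
move=> [mm hm]; apply/(wcl_eq hg wcl0).
have nm : \forall s' \near s, forall b, near_sec (mm - t b (set_val s')) b (set_val s').
  by apply/near_val; exists [set s' | forall b, near_sec (mm - t b s') b s'].
have [V' [oV' Vs' hV']] := near_open (nearI nV nm).
have eex (w : X) : exists e0 : E w, V' w.2 -> isg (mm - tX t w) e0.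
  have [Vw|nVw] := pselect (V' w.2); last by exists 0.
  have [|e0 h0] := @isg_ex (mm - tX t w) w; last by exists e0.
  by rewrite [w in nsec _ w]surjective_pairing; apply/nsecP; have [_] := hV' _ Vw; exact.
pose e0 w := projT1 (cid (eex w)).
have e0E w : V' w.2 -> isg (mm - tX t w) (e0 w) := projT2 (cid (eex w)).
pose ep : dprod E := fun w => c w w + e0 w.
have nV' : \forall s' \near s, V' s' by exact: open_nbhs_nbhs.
exists ep; apply: filterS nV' => s' Vs'' w ew; rewrite subr0; rewrite -ew in Vs''.
have [Vw _] := hV' _ Vs''.
have [k hk] := cl_ex ep w; suff <- : k = g w by [].
have [k1 _] := nbhs_singleton (hl w Vw).
apply/(cl_eq hk k1); apply/E_sect; exists (mm - tX t w).
apply: filterS2 (near_V oV' Vs'') (link_diff oV hl Vw) => w' Vw' [_ h].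
have := isg_lin 1 (nbhs_singleton h) (e0E _ Vw'); rewrite !scale1r.
have -> : (c w' - c w) w' + e0 w' = (ep - c w) w' by rewrite [RHS]addrAC.
by rewrite addrC addrA subrK.
Qed.

End Rep.

(** * Choice of a direction, and the matrices of the slits *)

Lemma generic_dir (R : realType) (I : finType) (d : I -> Cplx R) :
  exists th, forall i, d i <> 0 -> hgt th (d i) <> 0.
Proof.
(* The slope [t] exceeds the slopes of all the [d i]; the purely imaginary ones, for which the
   quotient is 0, are treated apart. *)
pose t : R := 1 + \sum_i `|complex.Im (d i) / complex.Re (d i)|.
have ti i : `|complex.Im (d i) / complex.Re (d i)| < t.
  rewrite /t (bigD1 i)//=.
  have : 0 <= \sum_(j | j != i) `|complex.Im (d j) / complex.Re (d j)| by apply: sumr_ge0.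
  by lra.
have c0 : 0 < cos (atan t) by apply: cos_gt0_pihalf; rewrite atan_gtNpi2 atan_ltpi2.
have st : sin (atan t) = t * cos (atan t).
  by rewrite -{2}[t]atanK /tan mulfVK// gt_eqF.
exists (atan t) => i ne; rewrite /hgt st.
have -> : complex.Im (d i) * cos (atan t) - complex.Re (d i) * (t * cos (atan t)) =
  cos (atan t) * (complex.Im (d i) - t * complex.Re (d i)) by ring.
apply/eqP; rewrite mulf_eq0 (gt_eqF c0) /=; apply/eqP => e.
have [r0|r0] := eqVneq (complex.Re (d i)) 0.
  apply: ne; move: r0 e; case: (d i) => a b /= -> e; congr (_ +i* _)%C.
  by move: e; rewrite mulr0 subr0.
have := ti i; move/subr0_eq: e => ->; rewrite mulfK// => h.
by have := ler_norm t; lra.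
Qed.

Section Frames.
Variables (R : realType) (K : fieldType) (p q : nat).
Local Notation C := (Cplx R).
Variables (x : 'I_p -> C) (y : 'I_q -> C) (x0 : punctured x) (alpha : 'I_p.+1 -> R -> punctured x).
Variables (y0 : punctured y) (beta : 'I_q.+1 -> R -> punctured y) (th : R).
Hypothesis xh : forall i i', hgt th (x i) = hgt th (x i') -> i = i'.
Hypothesis yh : forall j j', hgt th (y j) = hgt th (y j') -> j = j'.
Hypotheses (halpha : standard_generators x0 alpha) (hbeta : standard_generators y0 beta).

(** Were [mu j] equal to 1, the loop [beta] around [y j], which does not wind around the other
    punctures, would act trivially by [transport_trivial], against [lambda j <> 1]. *)
Lemma line_monodromy (V2 : sheaf K (punctured y)) (lambda : 'I_q.+1 -> K) : local_system V2 ->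
  monodromy_tuple V2 y0 beta (fun i => (lambda i)%:M : 'M[K]_1) -> (forall i, lambda (fin_idx i) <> 1) ->
  exists (phi2 : frame V2 1) (mu : 'I_q -> K), [/\ slit_frame (th + pi) phi2 (fun j => (mu j)%:M),
    forall j, mu j != 0 & forall j, mu j != 1].
Proof.
move=> ls [_ [b [bb tr]]] l1.
have yh' j j' : hgt (th + pi) (y j) = hgt (th + pi) (y j') -> j = j'.
  by rewrite !hgt_opp => /oppr_inj /yh.
have [n [phi2 [B sf]]] := slit_frame_ex ls yh'.
have [bphi Bu _] := sf; have n1 := linear_dim (bphi y0) bb; subst n.
have BE j : B j = (B j 0 0)%:M by exact: mx11_scalar.
exists phi2, (fun j => B j 0 0); split.
- by have -> : (fun j => (B j 0 0)%:M) = B by apply/funext => j; rewrite -BE.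
- by move=> j; have := Bu j; rewrite BE unitmxE det_scalar1 unitfE mxE eqxx mulr1n.
move=> j; apply/eqP => e1; apply: (l1 j).
have := tr (fin_idx j) 1; move=> /(transport_trivial yh' sf (gen_loop hbeta (fin_idx j))) h.
have : (1 : 'rV[K]_1) = 1 *m (lambda (fin_idx j))%:M.
  apply: (bij_inj bb); apply: h => l; have [->|lj] := eqVneq l j; first by left; rewrite BE e1.
  by right; have := gen_around hbeta j l; rewrite eq_sym (negPf lj).
by rewrite mul_mx_scalar => /matrixP/(_ 0 0); rewrite !mxE eqxx mulr1 => <-.
Qed.

(** In rank one with at most one nontrivial slit, the loops around the other punctures act trivially
    by [transport_trivial]; two nontrivial [A i] exclude this. If all slits were trivial,
    irreducibility would force rank one and lead to the same case. *)
Lemma irreducible_monodromy (V1 : sheaf K (punctured x)) m (A : 'I_p.+1 -> 'M[K]_m) :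
  monodromy_tuple V1 x0 alpha A -> in_T V1 A ->
  exists n (phi1 : frame V1 n) (Y : 'I_p -> 'M[K]_n), [/\ slit_frame th phi1 Y, irreducible_mx Y,
    exists i, Y i != 1%:M & ~ (n = 1%N /\ exists i0, forall k, k != i0 -> Y k = 1%:M)].
Proof.
move=> [_ [b [bb tr]]] [irr [i1 [i2 [i12 A1 A2]]]].
have [ls [z [e ne]] _] := irr.
have [n [phi1 [Y sf]]] := slit_frame_ex ls xh.
exists n, phi1, Y; have [bphi _ _] := sf.
have irrY : irreducible_mx Y by exact: irreducible_frame sf irr.
have no1 : ~ (n = 1%N /\ exists i0, forall k, k != i0 -> Y k = 1%:M).
  move=> [n1 [i0 hi0]]; subst n.
  have [i [ii0 Ai]] : exists i, i != i0 /\ A (fin_idx i) <> 1%:M.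
    have [e1|ne1] := eqVneq i1 i0; last by exists i1.
    by exists i2; split=> //; rewrite -e1 eq_sym.
  apply: Ai; apply/row_matrixP => k; rewrite !rowE mulmx1; apply: (bij_inj bb).
  apply/esym; apply: (transport_trivial xh sf (gen_loop halpha (fin_idx i)) _ (tr _ _)) => l.
  have [->|li] := eqVneq l i0; last by left; exact: hi0.
  by right; have := gen_around halpha i i0; rewrite (negPf ii0).
split=> //; apply: contrapT => hn.
have Y1 i : Y i = 1%:M by apply/eqP; apply: contraT => h; exfalso; apply: hn; exists i.
apply: no1; split; last by exists i1 => k _.
have n0 : (0 < n)%N.
  rewrite lt0n; apply/eqP => n0; subst n; apply: ne.
  by have [k kK Kk] := bphi z; rewrite -(Kk e) -(Kk 0); congr (phi1 z _); apply/rowP => -[].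
pose d : 'rV[K]_n := delta_mx 0 (Ordinal n0).
have all v : exists k : K, v = k *: d.
  have [||h|h] := irrY [set v : 'rV[K]_n | exists k : K, v = k *: d].
  - split; first by exists 0; rewrite scale0r.
    by move=> k _ _ [a ->] [c ->]; exists (k * a + c); rewrite scalerDl scalerA.
  - by move=> k u; rewrite Y1 mulmx1.
  - have /rowP/(_ (Ordinal n0)) : d = 0 by apply: h; exists 1; rewrite scale1r.
    by rewrite !mxE !eqxx => /eqP; rewrite oner_eq0.
  - exact: h.
have le1 : (1%:M <= d)%MS.
  by apply/row_subP => k; have [a ->] := all (row k 1%:M); exact: scalemx_sub.
have := mxrankS le1; rewrite mxrank1 => /leq_trans/(_ (rank_leq_row _)).
move: (n0); clear; by case: n => [|[]].
Qed.

End Frames.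

(** The rows of [D] form a basis of [G] modulo its intersection with [U], which serves as a model
    for a quotient stalk. *)
Lemma submod_complement (K : fieldType) N (G U : set 'rV[K]_N) : submod G -> submod U ->
  exists d (D : 'M[K]_(d, N)), [/\ forall c, G (c *m D), forall c, U (c *m D) -> c = 0 &
    forall v, G v -> exists c, U (v - c *m D)].
Proof.
move=> /submod_rows[k [A [_ hA]]] /submod_rows[l [B [_ hB]]].
exists (\rank (A :\: B)%MS), (row_base (A :\: B)%MS); split.
- move=> c; apply/hA; apply/submxP; apply: submx_trans (submxMl _ _) _.
  by rewrite eq_row_base diffmxSl.
- move=> c /hB[b eb]; apply: (row_free_inj (row_base_free (A :\: B)%MS)); rewrite mul0mx.
  apply/eqP; rewrite -submx0 -(capmx_diff A B) sub_capmx.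
  rewrite (submx_trans (submxMl _ _)) ?eq_row_base//=.
  by rewrite eb submxMl.
move=> v /hA[a ->]; have : (a *m A <= A :\: B + A :&: B)%MS by rewrite addsmx_diff_cap_eq submxMl.
move=> /sub_addsmxP[[u1 u2] /= ->].
have /submxP[c ->] : (u1 *m (A :\: B)%MS <= row_base (A :\: B)%MS)%MS.
  by rewrite eq_row_base submxMl.
exists c; rewrite addrAC subrr add0r; apply/hB; apply/submxP.
by apply: submx_trans (submxMl _ _) _; exact: capmxSr.
Qed.

(** * Frames of the middle convolution *)

Section LocalSystem.
Variables (R : realType) (K : fieldType) (th : R) (p q n : nat).
Local Notation C := (Cplx R).
Variables (x : 'I_p -> C) (y : 'I_q -> C).
Local Notation I := ('I_p + 'I_q)%type.
Local Notation T := (conv_total x y).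
Local Notation S := (conv_base x y).
Local Notation vec := (option I -> 'rV[K]_n).
Variables (V1 : sheaf K (punctured x)) (V2 : sheaf K (punctured y)).
Variables (phi1 : frame V1 n) (phi2 : frame V2 1) (Y : 'I_p -> 'M[K]_n) (mu : 'I_q -> K).
Hypothesis sf1 : slit_frame th phi1 Y.
Hypothesis sf2 : slit_frame (th + pi) phi2 (fun j => (mu j)%:M).
Hypotheses (hx : injective x) (hy : injective y).
Local Notation csec := (csec phi1 phi2).
Local Notation B := (braid_mx Y mu).
Local Notation J := (conv_jump_system hx hy sf1 sf2).
Local Notation datum := (option C -> C -> C * C -> 'rV[K]_n).
Local Notation pos := (pos (cpa x y) (@cea p q)).
Local Notation off := (off th (cpa x y) (@cea p q)).
Local Notation datum_at := (datum_at th (cpa x y) (@cea p q) S csec).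
Local Notation trivial_near := (trivial_near th (cpa x y) (@cea p q) S csec).
Local Notation coord := (coord th (cpa x y) (@cea p q) S csec).
Local Notation parabolic := (parabolic th (cpa x y) (@cea p q) B).
Local Notation descending := (descending th (cpa x y) (@cea p q)).
Local Notation W := (W V1 V2).
Local Notation Rep := (Rep sf1 sf2).
Local Notation triv := (trivial_vec Y mu).

Definition vlin (k : K) (v v' : vec) : vec := fun o => k *: v o + v' o.

Lemma triv_lin k v v' : triv v -> triv v' -> triv (vlin k v v').
Proof.
move=> [w hw] [w' hw']; exists (k *: w + w') => a.
by rewrite /vlin opprD addrACA -scalerBr mulmxDl -scalemxAl hw hw'.
Qed.

Lemma triv0 : triv (fun=> 0).
Proof. by exists 0 => a; rewrite subrr mul0mx. Qed.

Lemma parabolic_lin k v v' s : parabolic v s -> parabolic v' s -> parabolic (vlin k v v') s.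
Proof.
rewrite /Parabolic.parabolic => h h'; rewrite /vlin -{2}h -{2}h'.
elim: (descending s) (v None) (v' None) {h h'} => //= a l IH z z'; rewrite -IH; congr foldl.
rewrite /afix scalerDr [RHS]addrACA; congr (_ + _).
by rewrite scalemxAl -mulmxDl; congr (_ *m _); rewrite scalerBr opprD addrACA.
Qed.

Lemma parabolic0 s : parabolic (fun=> 0) s.
Proof. by rewrite /Parabolic.parabolic; elim: (descending s) => //= a l IH; rewrite /afix subrr mul0mx addr0. Qed.

Lemma descending_near s0 : off s0 -> \forall s \near s0, descending s = descending s0.
Proof.
move=> os; have : \forall s \near s0, forall a b, (hgt th (pos b s) <= hgt th (pos a s)) = (hgt th (pos b s0) <= hgt th (pos a s0)).
  apply: near_forall => a; apply: near_forall => b.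
  have [->|ab] := eqVneq a b; first by near=> s; rewrite !lexx.
  have cf : continuous (fun s => hgt th (pos a s) - hgt th (pos b s)).
    by apply: ctsB; (apply: cts_comp; [exact: pos_cts|exact: hgt_cts]).
  case: (ltgtP (hgt th (pos b s0)) (hgt th (pos a s0))) => h.
  - have h' : 0 < hgt th (pos a s0) - hgt th (pos b s0) by rewrite subr_gt0.
    by apply: filterS (cts_pos cf h') => s; rewrite subr_gt0 => /ltW.
  - have h' : hgt th (pos a s0) - hgt th (pos b s0) < 0 by rewrite subr_lt0.
    by apply: filterS (cts_neg cf h') => s; rewrite subr_lt0 leNgt => ->.
  - by have := os _ _ (esym h) => e; rewrite e eqxx in ab.
apply: filterS => s h; rewrite /Parabolic.descending; congr (sort _ _).
by apply/funext => a; apply/funext => b.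
Unshelve. all: by end_near. Qed.

Lemma model_ex s0 v : S s0 -> off s0 -> parabolic v s0 ->
  exists2 t : datum, (\forall s \near s0, datum_at t s) & coord t s0 v.
Proof. by move=> Ss os pv; have [h1 h2] := coord_model J Ss os pv; exists (model_datum th (cpa x y) (@cea p q) B v s0). Qed.

Lemma coord0 s0 : S s0 -> off s0 -> coord (fun _ _ => 0) s0 (fun=> 0).
Proof.
move=> Ss os; have [t _ ct] := model_ex Ss os (parabolic0 s0).
have := coord_lin J (-1) ct ct; congr (Cochains.coord _ _ _ _ _ _ _ _).
  by apply/funext => b; apply/funext => s; rewrite scaleN1r addNr.
by apply/funext => o; rewrite scaler0 addr0.
Qed.

Lemma coord_sum m (c : 'I_m -> K) (t : 'I_m -> datum) (v : 'I_m -> vec) s0 : S s0 -> off s0 ->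
  (forall k, coord (t k) s0 (v k)) ->
  coord (fun b s => \sum_k c k *: t k b s) s0 (fun o => \sum_k c k *: v k o).
Proof.
move=> Ss os h; elim: (index_enum _) => [|a l IH].
  have := coord0 Ss os; congr (Cochains.coord _ _ _ _ _ _ _ _).
    by apply/funext => b; apply/funext => s; rewrite big_nil.
  by apply/funext => o; rewrite big_nil.
have := coord_lin J (c a) (h a) IH; congr (Cochains.coord _ _ _ _ _ _ _ _).
  by apply/funext => b; apply/funext => s; rewrite big_cons.
by apply/funext => o; rewrite big_cons.
Qed.

Lemma Rep_ext (t t' : datum) s (e : W s) : (forall b s, t b s = t' b s) -> Rep t e -> Rep t' e.
Proof. by move=> h; have -> : t = t' by apply/funext => b; apply/funext => s'. Qed.

Lemma Rep0 s : Rep (fun _ _ => 0) (0 : W s).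
Proof.
have [t ht] := Rep_ex sf1 sf2 (0 : W s).
have := Rep_lin (-1) ht ht; rewrite scaler0 addr0; apply: Rep_ext => b s'.
by rewrite scaleN1r addNr.
Qed.

Lemma Rep_sum m (c : 'I_m -> K) (t : 'I_m -> datum) s (e : 'I_m -> W s) :
  (forall k, Rep (t k) (e k)) -> Rep (fun b s => \sum_k c k *: t k b s) (\sum_k c k *: e k).
Proof.
move=> h; elim: (index_enum _) => [|a l IH].
  by rewrite big_nil; apply: Rep_ext (Rep0 s) => b s'; rewrite big_nil.
by rewrite big_cons; apply: Rep_ext (Rep_lin (c a) (h a) IH) => b s'; rewrite big_cons.
Qed.

Lemma Rep_coord t (s : S) (e : W s) : off (set_val s) -> Rep t e ->
  exists2 v, coord t (set_val s) v & parabolic v (set_val s).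
Proof.
move=> os ht; have [v cv] := coord_ex J (set_valP s) os (Rep_datum ht).
exists v => //; have := coord_parabolic J os cv. exact.
Qed.

Lemma Rep_coord_triv t (s : S) (e : W s) v : off (set_val s) -> Rep t e -> coord t (set_val s) v ->
  e = 0 <-> triv v.
Proof.
move=> os ht cv; rewrite (Rep_trivial ht); split; first by move=> /(coord_trivial J os cv).
by move=> [w hw]; have := coord_trivialP J os cv hw.
Qed.

Local Notation N := #|{: option I}|.
(** Coordinate vectors are flattened to row vectors so that [submod_complement] applies to them. *)
Let dec (r : 'rV[K]_(N * n)) : vec := fun o => row (enum_rank o) (vec_mx r).
Let enc (v : vec) : 'rV[K]_(N * n) := mxvec (\matrix_k v (enum_val k)).

Let encK v : dec (enc v) = v.
Proof. by apply/funext => o; rewrite /dec /enc mxvecK rowK enum_rankK. Qed.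

Let dec_lin k r r' : dec (k *: r + r') = vlin k (dec r) (dec r').
Proof. by apply/funext => o; rewrite /dec /vlin !linearP. Qed.

Let dec0 : dec 0 = fun=> 0.
Proof. by apply/funext => o; rewrite /dec !linear0. Qed.

(** Coordinates identify a stalk with the parabolic vectors modulo the trivial ones. A basis of this
    quotient at [s0] is realized by model data. For nearby [s] their coordinates are the same, and
    so is the parabolic relation, because the order of the slits persists. *)
Lemma W_framed s0 : off (set_val s0) -> exists m (g : frame W m), framed g s0.
Proof.
move=> os.
have sG : submod [set r | parabolic (dec r) (set_val s0)].
  by split=> [|k u v hu hv] /=; [rewrite dec0; exact: parabolic0|rewrite dec_lin; exact: parabolic_lin].
have sU : submod [set r | triv (dec r)].
  by split=> [|k u v hu hv] /=; [rewrite dec0; exact: triv0|rewrite dec_lin; exact: triv_lin].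
have [d [D [hG hU hGU]]] := submod_complement sG sU.
exists d; pose vk (k : 'I_d) := dec (row k D).
have /choice[t ht] k : exists t : datum, (\forall s \near (set_val s0 : C), datum_at t s) /\ coord t (set_val s0) (vk k).
  have pk : parabolic (vk k) (set_val s0) by have := hG (delta_mx 0 k); rewrite /= -rowE.
  by have [t h1 h2] := model_ex (set_valP s0) os pk; exists t.
have hsg k : exists sg : dprod W, @sect _ _ W sg s0 /\ \forall s' \near s0, Rep (t k) (sg s').
  by have [sg h1 h2] := Rep_W_sect sf1 sf2 (ht k).1; exists sg.
have [sg {}hsg] := choice hsg.
have vsum (c : 'rV_d) : (fun o => \sum_k c 0 k *: vk k o) = dec (c *m D).
  apply/funext => o; rewrite /dec mulmx_sum_row linear_sum linear_sum; apply: eq_bigr => k _.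
  by rewrite !linearZ.
pose gf s (c : 'rV[K]_d) : W s := \sum_k c 0 k *: sg k s.
have gfl s : linear (gf s).
  move=> a c c'; rewrite /gf scaler_sumr -big_split; apply: eq_bigr => k _.
  by rewrite !mxE scalerDl scalerA.
pose g : frame W d := fun s => HB.pack (gf s) (GRing.isLinear.Build _ _ _ _ (gf s) (gfl s)).
have gE s c : g s c = gf s c by [].
exists g.
have nA : \forall s \near s0, forall k, Rep (t k) (sg k s) by apply: near_forall => k; exact: (hsg k).2.
have nB : \forall s \near s0, forall k, @sect _ _ W (sg k) s.
  by apply: near_forall => k; exact: (sect_open (hsg k).1).
have nC : \forall s \near s0, forall k, coord (t k) (set_val s) (vk k).
  apply: near_forall => k; apply/near_val; exists [set s | coord (t k) s (vk k)] => //.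
  exact: (coord_near J (ht k).2).
have nD : \forall s \near s0, off (set_val s) /\ descending (set_val s) = descending (set_val s0).
  apply/near_val; exists [set s | off s /\ descending s = descending (set_val s0)] => //.
  exact: (nearI (off_near os) (descending_near os)).
apply: filterS2 (nearI nA nB) (nearI nC nD) => s [hA hB] [hC [os' ds]].
have rg (c : 'rV[K]_d) : Rep (fun b s => \sum_k c 0 k *: t k b s) (g s c) by exact: Rep_sum.
have cg (c : 'rV[K]_d) : coord (fun b s => \sum_k c 0 k *: t k b s) (set_val s) (dec (c *m D)).
  by rewrite -vsum; apply: coord_sum => //; exact: set_valP.
split.
  have inj : injective (g s).
    move=> c c' e; apply/subr0_eq; apply: hU; rewrite /=.
    by apply/(Rep_coord_triv os' (rg _) (cg _)); rewrite linearB e subrr.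
  have sur e : exists c, g s c = e.
    have [te hte] := Rep_ex sf1 sf2 e; have [v cv pv] := Rep_coord os' hte.
    have [|c hc] := hGU (enc v).
      by rewrite /= encK /Parabolic.parabolic -ds.
    exists c; apply/esym/subr0_eq.
    have h1 := Rep_lin (-1) (rg c) hte; have h2 := coord_lin J (-1) (cg c) cv.
    have -> : e - g s c = -1 *: g s c + e by rewrite scaleN1r addrC.
    apply/(Rep_coord_triv os' h1 h2).
    have <- : dec (enc v - c *m D) = (fun a => -1 *: dec (c *m D) a + v a).
      by rewrite addrC -scaleN1r dec_lin encK.
    exact: hc.
  by have [h hK] := choice sur; exists h => // c; apply: inj.
move=> c; suff hs (l : seq 'I_d) : @sect _ _ W (fun z => \sum_(k <- l) c 0 k *: sg k z) s by exact: hs.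
elim: l => [|a l IH].
  by apply: sect_local (sect_zero _ _) _; near=> z; rewrite big_nil.
by apply: sect_local (sect_lin (c 0 a) (hB a) IH) _; near=> z; rewrite big_cons.
Unshelve. all: by end_near. Qed.

End LocalSystem.

(** * Images of subsheaves across the strips *)

Section Image.
Variables (R : realType) (K : fieldType) (th : R) (p q n : nat).
Local Notation C := (Cplx R).
Variables (x : 'I_p -> C) (y : 'I_q -> C).
Local Notation I := ('I_p + 'I_q)%type.
Local Notation S := (conv_base x y).
Local Notation vec := (option I -> 'rV[K]_n).
Variables (V1 : sheaf K (punctured x)) (V2 : sheaf K (punctured y)).
Variables (phi1 : frame V1 n) (phi2 : frame V2 1) (Y : 'I_p -> 'M[K]_n) (mu : 'I_q -> K).
Hypothesis sf1 : slit_frame th phi1 Y.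
Hypothesis sf2 : slit_frame (th + pi) phi2 (fun j => (mu j)%:M).
Hypotheses (hx : injective x) (hy : injective y).
Hypothesis xh : forall i i', hgt th (x i) = hgt th (x i') -> i = i'.
Hypothesis yh : forall j j', hgt th (y j) = hgt th (y j') -> j = j'.
Local Notation hgt := (hgt th).
Local Notation rho := (rho th).
Local Notation csec := (csec phi1 phi2).
Local Notation B := (braid_mx Y mu).
Local Notation J := (conv_jump_system hx hy sf1 sf2).
Local Notation datum := (option C -> C -> C * C -> 'rV[K]_n).
Local Notation pos := (pos (cpa x y) (@cea p q)).
Local Notation off := (off th (cpa x y) (@cea p q)).
Local Notation datum_at := (datum_at th (cpa x y) (@cea p q) S csec).
Local Notation coord := (coord th (cpa x y) (@cea p q) S csec).
Local Notation parabolic := (parabolic th (cpa x y) (@cea p q) B).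
Local Notation descending := (descending th (cpa x y) (@cea p q)).
Local Notation W := (W V1 V2).
Local Notation Rep := (Rep sf1 sf2).
Local Notation triv := (trivial_vec Y mu).

Definition crossing (i : 'I_p) (j : 'I_q) : R := hgt (x i + y j).

Lemma pos_l i s : hgt (pos (inl i) s) = hgt (x i).
Proof. by rewrite /pos /= addr0. Qed.
Lemma pos_r j s : hgt (pos (inr j) s) = hgt s - hgt (y j).
Proof. by rewrite /pos /= hgtD hgtN addrC. Qed.

Lemma off_offh s : off s <-> offh crossing (hgt s).
Proof.
split=> [os i j|oh [i|j] [i'|j']].
- apply/eqP => e; have := os (inl i) (inr j).
  by rewrite pos_l pos_r -e /crossing hgtD addrK => /(_ erefl).
- by rewrite !pos_l => /xh ->.
- by rewrite pos_l pos_r => e; have := oh i j'; rewrite /crossing hgtD e subrK eqxx.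
- by rewrite pos_l pos_r => e; have := oh i' j; rewrite /crossing hgtD -e subrK eqxx.
- by rewrite !pos_r => /addrI/oppr_inj/yh ->.
Qed.

Lemma offh_S s : offh crossing (hgt s) -> S s.
Proof. by move=> oh; apply/conv_baseP => i j e; have := oh i j; rewrite /crossing e eqxx. Qed.

Definition getl (a : I) : option 'I_p := if a is inl i then Some i else None.
Definition scal (a : I) : K := if a is inr j then mu j else 1.

Lemma foldl_scale k z l : foldl (fun (z : 'rV[K]_n) i => z *m Y i) (k *: z) l = k *: foldl (fun (z : 'rV[K]_n) i => z *m Y i) z l.
Proof. by elim: l z => //= i l IH z; rewrite -scalemxAl IH. Qed.

Lemma foldl_braid z (l : seq I) : foldl (fun (z : 'rV[K]_n) a => z *m B a) z l =
  (\prod_(a <- l) scal a) *: foldl (fun (z : 'rV[K]_n) i => z *m Y i) z (pmap getl l).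
Proof.
elim: l z => [|[i|j] l IH] z /=; first by rewrite big_nil scale1r.
  by rewrite IH big_cons /= mul1r.
by rewrite IH big_cons /= mul_mx_scalar foldl_scale scalerA mulrC.
Qed.

(** The factors of [V2] are scalars and the [x i] do not move with [s], so the way in which the two
    families of slits interleave does not affect the product. *)
Lemma fold_indep s s' z : off s -> off s' ->
  foldl (fun (z : 'rV[K]_n) a => z *m B a) z (descending s) = foldl (fun (z : 'rV[K]_n) a => z *m B a) z (descending s').
Proof.
move=> os os'; rewrite !foldl_braid.
have -> : \prod_(a <- descending s) scal a = \prod_(a <- descending s') scal a.
  by apply: perm_big; rewrite /Parabolic.descending perm_sort perm_sym perm_sort.
suff -> : pmap getl (descending s) = pmap getl (descending s') by [].
have key s0 : off s0 -> sorted (fun i i' => hgt (x i') < hgt (x i)) (pmap getl (descending s0)).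
  move=> os0; have := descending_sorted os0; rewrite !sorted_pairwise; last 2 first.
  - by move=> a b c h1 h2; exact: lt_trans h2 h1.
  - by move=> a b c h1 h2; exact: lt_trans h2 h1.
  elim: (descending s0) => //= -[i|j] l IH /= /andP[h1 h2]; last exact: IH.
  rewrite IH// andbT; move: h1; elim: l {IH h2} => //= -[i'|j'] l IH /= /andP[h1 h2]; last exact: IH.
  by rewrite IH// andbT; move: h1; rewrite !pos_l.
apply: (irr_sorted_eq _ _ (key _ os) (key _ os')).
- by move=> a b c h1 h2; exact: lt_trans h2 h1.
- by move=> a; rewrite ltxx.
have mem s0 i : i \in pmap getl (descending s0).
  by rewrite mem_pmap; apply/mapP; exists (inl i) => //; exact: mem_descending.
by move=> i; rewrite !mem.
Qed.

Definition trv (w : 'rV[K]_n) (r : vec) := forall a, (r (Some a) - w) *m B a = r (Some a) - w.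

Lemma trv_parabolic w r s : trv w r -> parabolic r s <->
  foldl (fun (z : 'rV[K]_n) a => z *m B a) (r None - w) (descending s) = r None - w.
Proof.
move=> h; rewrite /Parabolic.parabolic.
have -> : foldl (fun z a => afix B r a z) (r None) (descending s) =
    w + foldl (fun (z : 'rV[K]_n) a => z *m B a) (r None - w) (descending s).
  rewrite -{1}[r None](subrK w) addrC; elim: (descending s) (r None - w) => //= a l IH z.
  rewrite -IH; congr foldl; rewrite /afix.
  have -> : w + z - r (Some a) = z - (r (Some a) - w) by rewrite opprB addrCA addrA.
  by rewrite mulmxBl h addrA addrAC opprB addrA [r _ + _]addrC addrK addrC.
by split=> e; [apply: (addrI w); rewrite e|rewrite e]; rewrite addrC subrK.
Qed.

(** After subtraction of [w], the affine maps act on a trivial vector as their linear parts, and by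
    [fold_indep] the relation at infinity is the same for every [s]. This is how the trivial part of
    a vector passes across a line in [In_cross]. *)
Lemma parabolic_triv r r' w s s' : trv w r -> trv w r' -> r None = r' None -> off s -> off s' ->
  parabolic r s -> parabolic r' s'.
Proof.
move=> h h' e os os' /(trv_parabolic _ h) k; apply/(trv_parabolic _ h').
by rewrite -e (fold_indep _ os' os).
Qed.

Variables (N : sheaf K S) (f : sheaf_hom N W).
Hypothesis lsN : local_system N.

Definition In (s : S) (v : vec) : Prop := exists t e, [/\ coord t (set_val s) v, Rep t e & exists e0, f s e0 = e].

Lemma In_lin k (s : S) v v' : In s v -> In s v' -> In s (vlin k v v').
Proof.
move=> [t [e [ct rt [e0 he]]]] [t' [e' [ct' rt' [e0' he']]]].
exists (fun b s => k *: t b s + t' b s), (k *: e + e'); split.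
- exact: (coord_lin J k ct ct').
- exact: Rep_lin.
- by exists (k *: e0 + e0'); rewrite linearP he he'.
Qed.

Lemma In_parabolic (s : S) v : off (set_val s) -> In s v -> parabolic v (set_val s).
Proof. by move=> os [t [e [ct _ _]]]; have := coord_parabolic J os ct. Qed.

Lemma In_triv (s : S) v : off (set_val s) -> triv v -> parabolic v (set_val s) -> In s v.
Proof.
move=> os tv pv; have [t dt ct] := model_ex sf1 sf2 hx hy (set_valP s) os pv.
have [sg _ /nbhs_singleton ht] := Rep_W_sect sf1 sf2 dt.
exists t, (sg s); split=> //; exists 0; rewrite linear0.
by apply/esym/(Rep_coord_triv hx hy os ht ct).
Qed.

Lemma image_span (s0 : S) : exists m (t : 'I_m -> datum) (ek : 'I_m -> dprod W),
  (forall k, \forall s \near (set_val s0 : C), datum_at (t k) s) /\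
  \forall s \near s0, (forall k, Rep (t k) (ek k s)) /\
    forall e : W s, (exists e0, f s e0 = e) <-> exists c : 'rV[K]_m, e = \sum_k c 0 k *: ek k s.
Proof.
have [m [g fg]] := local_system_frame s0 lsN; exists m.
have [_ gs] := framed_at fg.
pose ek k : dprod W := fun s => f s (g s (delta_mx 0 k)).
have /choice[t ht] k : exists t : datum, \forall s \near s0, Rep t (ek k s).
  by apply: W_sect_Rep; exact: (hom_sect f (gs (delta_mx 0 k))).
exists t, ek; split; first by move=> k; exact: (Rep_datum (nbhs_singleton (ht k))).
have hA : \forall s \near s0, forall k, Rep (t k) (ek k s) by apply: near_forall.
apply: filterS2 fg hA => s [[h hK Kh] _] hr; split=> // e.
have gE (c : 'rV_m) : f s (g s c) = \sum_k c 0 k *: ek k s.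
  by rewrite {1}[c]row_sum_delta !linear_sum; apply: eq_bigr => k _; rewrite !linearZ.
split=> [[e0 <-]|[c ->]]; first by exists (h e0); rewrite -gE Kh.
by exists (g s c).
Qed.

Let lincomb m (c : 'rV[K]_m) (vk : 'I_m -> vec) : vec := fun o => \sum_k c 0 k *: vk k o.

(** Coordinates of one class are determined only up to trivial vectors. Hence the image consists of
    the parabolic vectors that differ from a combination of the [vk] by a trivial one. *)
Lemma In_span m (t : 'I_m -> datum) (ek : 'I_m -> dprod W) (s : S) (vk : 'I_m -> vec) : off (set_val s) ->
  (forall k, Rep (t k) (ek k s)) ->
  (forall e : W s, (exists e0, f s e0 = e) <-> exists c : 'rV[K]_m, e = \sum_k c 0 k *: ek k s) ->
  (forall k, coord (t k) (set_val s) (vk k)) ->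
  forall v, In s v <-> parabolic v (set_val s) /\ exists c : 'rV_m, triv (vlin (-1) (lincomb c vk) v).
Proof.
move=> os hr he hc v.
have cl (c : 'rV_m) : coord (fun b s => \sum_k c 0 k *: t k b s) (set_val s) (lincomb c vk).
  exact: (coord_sum sf1 sf2 hx hy (fun k => c 0 k) (set_valP s) os hc).
have rl (c : 'rV_m) : Rep (fun b s => \sum_k c 0 k *: t k b s) (\sum_k c 0 k *: ek k s) by exact: Rep_sum.
split.
  move=> iv; split; first exact: In_parabolic iv.
  have [t' [e [ct rt /he[c ec]]]] := iv; exists c.
  apply/(Rep_coord_triv hx hy os (Rep_lin (-1) (rl c) rt) (coord_lin J (-1) (cl c) ct)).
  by rewrite ec scaleN1r addNr.
move=> [pv [c tv]]; have icl : In s (lincomb c vk).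
  by exists (fun b s => \sum_k c 0 k *: t k b s), (\sum_k c 0 k *: ek k s); split=> //; apply/he; exists c.
have -> : v = vlin 1 (lincomb c vk) (vlin (-1) (lincomb c vk) v).
  by apply/funext => o; rewrite /vlin scale1r scaleN1r addrA subrr add0r.
apply: In_lin => //; apply: In_triv => //; apply: parabolic_lin => //.
exact: In_parabolic.
Qed.

Lemma In_loc (s0 : S) : off (set_val s0) -> \forall s \near s0, forall v, In s v <-> In s0 v.
Proof.
move=> os; have [m [t [ek [dt hs]]]] := image_span s0.
have [hr0 he0] := nbhs_singleton hs.
have /choice[vk hvk] k : exists v, coord (t k) (set_val s0) v by have := coord_ex J (set_valP s0) os (dt k).
have nC : \forall s \near s0, forall k, coord (t k) (set_val s) (vk k).
  apply: near_forall => k; apply/near_val; exists [set s | coord (t k) s (vk k)] => //.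
  exact: (coord_near J (hvk k)).
have nD : \forall s \near s0, off (set_val s) /\ descending (set_val s) = descending (set_val s0).
  apply/near_val; exists [set s | off s /\ descending s = descending (set_val s0)] => //.
  exact: (nearI (off_near os) (descending_near os)).
apply: filterS3 hs nC nD => s [hr he] hc [os' ds] v.
by rewrite (In_span os' hr he hc) (In_span os hr0 he0 hvk) /Parabolic.parabolic ds.
Qed.

Let slide_lin (D : 'M[K]_n) (a b : I) k (v v' : vec) : slide (vlin k v v') a b D = vlin k (slide v a b D) (slide v' a b D).
Proof.
apply/funext => o; rewrite /slide /upd /vlin; case: ifP => // _.
rewrite scalerDr [RHS]addrACA; congr (_ + _); rewrite scalemxAl -mulmxDl; congr (_ *m _).
by rewrite scalerBr opprD addrACA.
Qed.

Let slide_lincomb (D : 'M[K]_n) (a b : I) m (c : 'rV_m) vk :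
  slide (lincomb c vk) a b D = lincomb c (fun k => slide (vk k) a b D).
Proof.
apply/funext => o; rewrite /slide /upd /lincomb; case: ifP => // _.
rewrite -sumrB mulmx_suml -big_split /=; apply: eq_bigr => k _.
by rewrite -scalerBr -scalemxAl -scalerDr.
Qed.

Let slide_trv (D : 'M[K]_n) (a b : I) w (r : vec) : a != b -> D \in unitmx -> (forall z : 'rV[K]_n, z *m B a = z -> z *m D = z) ->
  comm_mx D (B b) -> trv w r -> trv w (slide r a b D).
Proof.
move=> ab Du hD cD h c; rewrite /slide /upd; case: eqP => [[->]|_]; last exact: h.
have e : r (Some a) + (r (Some b) - r (Some a)) *m D - w = (r (Some b) - w) *m D.
  have -> : r (Some b) - r (Some a) = (r (Some b) - w) - (r (Some a) - w) by rewrite opprB addrA subrK.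
  by rewrite mulmxBl (hD _ (h a)) addrAC addrC subrK.
by rewrite e -mulmxA cD mulmxA h.
Qed.

Let slide_cancel (D : 'M[K]_n) (a b : I) (v : vec) : a != b -> D \in unitmx -> slide (slide v a b D) a b (invmx D) = v.
Proof.
move=> ab Du; apply/funext => o; rewrite /slide /upd !eqxx.
have -> : (Some a == Some b) = false by apply/eqP => -[e]; rewrite e eqxx in ab.
case: eqP => // ->.
by rewrite [X in X *m invmx D]addrC addKr mulmxK// addrC subrK.
Qed.

Let vlin_sub (v : vec) : vlin (-1) v v = fun=> 0.
Proof. by apply/funext => o; rewrite /vlin scaleN1r addNr. Qed.

(** Over [s0] two heights coincide, but the image of [f] is still spanned by finitely many data
    around [s0]. By [coord_cross] their coordinates on the two sides are related by [slide], and the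
    trivial remainder of a vector is moved by [parabolic_triv]. *)
Lemma In_cross (s0 : S) a b : a != b -> B a \in unitmx -> comm_mx (B a) (B b) ->
  hgt (pos a (set_val s0)) = hgt (pos b (set_val s0)) -> rho (pos a (set_val s0)) < rho (pos b (set_val s0)) ->
  (forall c d, c != d -> hgt (pos c (set_val s0)) = hgt (pos d (set_val s0)) -> c = a /\ d = b \/ c = b /\ d = a) ->
  exists2 U, nbhs s0 U & forall s1 s2 : S, U s1 -> U s2 -> off (set_val s1) -> off (set_val s2) ->
    hgt (pos a (set_val s1)) < hgt (pos b (set_val s1)) -> hgt (pos b (set_val s2)) < hgt (pos a (set_val s2)) ->
    (forall v, In s1 v -> In s2 (slide v a b (B a))) /\
    (forall v, In s2 v -> In s1 (slide v a b (invmx (B a)))).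
Proof.
move=> ab Bu cB hab rab only.
have [m [t [ek [dt hs]]]] := image_span s0.
have hcr k : exists v, \forall s \near (set_val s0 : C),
    (hgt (pos a s) < hgt (pos b s) -> coord (t k) s v) /\
    (hgt (pos b s) < hgt (pos a s) -> coord (t k) s (slide v a b (B a))).
  exact: (coord_cross J (set_valP s0) (dt k) hab rab only).
have [vk hvk] := choice hcr.
have nC : \forall s \near s0, forall k,
    (hgt (pos a (set_val s)) < hgt (pos b (set_val s)) -> coord (t k) (set_val s) (vk k)) /\
    (hgt (pos b (set_val s)) < hgt (pos a (set_val s)) -> coord (t k) (set_val s) (slide (vk k) a b (B a))).
  apply: near_forall => k; apply/near_val.
  by exists [set s | (hgt (pos a s) < hgt (pos b s) -> coord (t k) s (vk k)) /\
    (hgt (pos b s) < hgt (pos a s) -> coord (t k) s (slide (vk k) a b (B a)))]; [exact: (hvk k)|].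
have [U [oU Us hU]] := near_open (nearI hs nC); exists U; first exact: open_nbhs_nbhs.
move=> s1 s2 /hU[[hr1 he1] hc1] /hU[[hr2 he2] hc2] o1 o2 l1 l2.
have e1 := In_span o1 hr1 he1 (fun k => (hc1 k).1 l1).
have e2 := In_span o2 hr2 he2 (fun k => (hc2 k).2 l2).
have Bi (z : 'rV[K]_n) : z *m B a = z -> z *m invmx (B a) = z by move=> h; rewrite -{1}h mulmxK.
have cBi : comm_mx (invmx (B a)) (B b).
  rewrite /comm_mx -[LHS]mulmx1 -(mulmxV Bu) mulmxA; congr (_ *m _).
  by rewrite -mulmxA -[B b *m B a]cB mulKmx.
have icl1 (c : 'rV[K]_m) : In s1 (lincomb c vk) by apply/e1; split;
  [apply: In_parabolic => //; exists (fun b s => \sum_k c 0 k *: t k b s), (\sum_k c 0 k *: ek k s1); split;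
    [exact: (coord_sum sf1 sf2 hx hy (fun k => c 0 k) (set_valP s1) o1 (fun k => (hc1 k).1 l1))|exact: Rep_sum|apply/he1; exists c]
  |exists c; rewrite vlin_sub; exact: triv0].
have icl2 (c : 'rV[K]_m) : In s2 (lincomb c (fun k => slide (vk k) a b (B a))) by apply/e2; split;
  [apply: In_parabolic => //; exists (fun b s => \sum_k c 0 k *: t k b s), (\sum_k c 0 k *: ek k s2); split;
    [exact: (coord_sum sf1 sf2 hx hy (fun k => c 0 k) (set_valP s2) o2 (fun k => (hc2 k).2 l2))|exact: Rep_sum|apply/he2; exists c]
  |exists c; rewrite vlin_sub; exact: triv0].
split=> v.
  move=> iv; have [pv [c [w hw]]] := (e1 v).1 iv.
  have pr : parabolic (vlin (-1) (lincomb c vk) v) (set_val s1).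
    by apply: parabolic_lin => //; exact: In_parabolic (icl1 c).
  have tr : trv w (slide (vlin (-1) (lincomb c vk) v) a b (B a)) by apply: slide_trv.
  have pr2 := parabolic_triv hw tr (erefl _) o1 o2 pr.
  have -> : slide v a b (B a) = vlin 1 (lincomb c (fun k => slide (vk k) a b (B a)))
      (slide (vlin (-1) (lincomb c vk) v) a b (B a)).
    by rewrite -slide_lincomb -slide_lin; congr slide; apply/funext => o; rewrite /vlin scale1r scaleN1r addrA subrr add0r.
  by apply: In_lin (icl2 c) _; apply: In_triv => //; exists w.
move=> iv; have [pv [c [w hw]]] := (e2 v).1 iv.
set r := vlin _ _ _ in hw.
have pr : parabolic r (set_val s2) by apply: parabolic_lin => //; exact: In_parabolic (icl2 c).
have tr : trv w (slide r a b (invmx (B a))) by apply: slide_trv => //; rewrite unitmx_inv.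
have pr2 := parabolic_triv hw tr (erefl _) o2 o1 pr.
have -> : slide v a b (invmx (B a)) = vlin 1 (lincomb c vk) (slide r a b (invmx (B a))).
  rewrite -[lincomb c vk](slide_cancel _ ab Bu) slide_lincomb -slide_lin; congr slide.
  by apply/funext => o; rewrite /r /vlin scale1r scaleN1r addrA subrr add0r.
by apply: In_lin (icl1 c) _; apply: In_triv => //; exists w.
Qed.

End Image.

(** * Paths in the base and strips *)

Section Lines.
Variables (R : realType) (K : fieldType) (th : R) (p q : nat).
Local Notation C := (Cplx R).
Variables (x : 'I_p -> C) (y : 'I_q -> C).
Local Notation S := (conv_base x y).
Hypothesis xh : forall i i', hgt th (x i) = hgt th (x i') -> i = i'.
Hypothesis yh : forall j j', hgt th (y j) = hgt th (y j') -> j = j'.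
Local Notation hgt := (hgt th).
Local Notation rho := (rho th).
Local Notation H := (crossing th x y).
Hypothesis Hinj : forall i j i' j', H i j = H i' j' -> i = i' /\ j = j'.

Lemma pt_line_cts (a b c d : R) : continuous (fun t : R => pt th (a + t * b) (c + t * d)).
Proof.
apply: (@cts_plane R _ th).
  rewrite (_ : (fun t : R => _) = fun t : R => a + t * b); last by apply/funext => t; rewrite rho_pt.
  by apply: ctsD; [exact: cts_cst|apply: ctsM; [move=> t; exact: cvg_id|exact: cts_cst]].
rewrite (_ : (fun t : R => _) = fun t : R => c + t * d); last by apply/funext => t; rewrite hgt_pt.
by apply: ctsD; [exact: cts_cst|apply: ctsM; [move=> t; exact: cvg_id|exact: cts_cst]].
Qed.

Lemma segment_in_S (a b c d : R) (P : S -> Prop) (D : S -> Prop) :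
  (forall t, 0 <= t <= 1 -> exists2 s : S, set_val s = pt th (a + t * b) (c + t * d) & D s) ->
  (forall s, D s -> \forall s' \near s, P s' <-> P s) ->
  forall s s' : S, set_val s = pt th a c -> set_val s' = pt th (a + b) (c + d) -> P s -> P s'.
Proof.
move=> hD hP s s' es es' Ps.
pose Q t := forall s1 : S, set_val s1 = pt th (a + t * b) (c + t * d) -> P s1.
suff : Q 1 by apply; rewrite !mul1r.
apply: (segment_const (P := Q) (@ler01 R)); last by move=> s1; rewrite !mul0r !addr0 -es => /val_inj ->.
move=> t t01; have [st et Dt] := hD t t01.
have QE t' (s1 : S) : set_val s1 = pt th (a + t' * b) (c + t' * d) -> Q t' <-> P s1.
  by move=> e; split=> [h|Ps1 s2]; [exact: h|rewrite -e => /val_inj ->].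
have /near_val[A nA hA] := hP st Dt.
have nt : \forall t' \near t, A (pt th (a + t' * b) (c + t' * d)).
  by rewrite et in nA; exact: (pt_line_cts nA).
apply: filterS nt => t' At' t01'; have [s1 e1 _] := hD t' t01'.
by rewrite (QE t' s1 e1) (QE t st et); apply: hA; rewrite e1.
Qed.

(** Two points with the same heights [H i j] below them are joined by a segment that avoids all
    these heights, hence stays in [S]. *)
Lemma same_strip_const (P : S -> Prop) :
  (forall s : S, offh H (hgt (set_val s)) -> \forall s' \near s, P s' <-> P s) ->
  forall s s' : S, offh H (hgt (set_val s)) -> offh H (hgt (set_val s')) ->
    same_strip H (hgt (set_val s)) (hgt (set_val s')) -> P s -> P s'.
Proof.
move=> hP s s' os os' ss.
apply: (segment_in_S (a := rho (set_val s)) (b := rho (set_val s') - rho (set_val s))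
   (c := hgt (set_val s)) (d := hgt (set_val s') - hgt (set_val s)) (D := fun s => offh H (hgt (set_val s)))) => //.
- move=> t t01; set z := pt _ _ _.
  have oz : offh H (hgt z).
    move=> i j; rewrite hgt_pt; have := ss i j; have := os i j; have := os' i j.
    case: (ltgtP (H i j) (hgt (set_val s))) => // h1; case: (ltgtP (H i j) (hgt (set_val s'))) => // h2 _ _ _.
      have := half_pos (x := hgt (set_val s) - H i j) (y := hgt (set_val s') - H i j) (t := t).
      rewrite !subr_gt0 => /(_ h1 h2 t01) k; rewrite lt_eqF//; lra.
    have := half_pos (x := H i j - hgt (set_val s)) (y := H i j - hgt (set_val s')) (t := t).
    rewrite !subr_gt0 => /(_ h1 h2 t01) k; rewrite gt_eqF//; lra.
  by exists (@exist _ (fun s => s \in S) z (mem_set (offh_S oz))).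
- by rewrite pt_rho_hgt.
- have e (u v : R) : u + (v - u) = v by rewrite addrC subrK.
  by rewrite !e pt_rho_hgt.
Qed.

Lemma line_sides (s0 : S) i j U : hgt (set_val s0) = H i j -> nbhs s0 U ->
  exists s1 s2 : S, [/\ U s1 /\ U s2, offh H (hgt (set_val s1)) /\ offh H (hgt (set_val s2)),
    H i j < hgt (set_val s1) /\ hgt (set_val s2) < H i j &
    forall z z', only_between H z i j z' ->
      same_strip H (hgt (set_val s1)) z' /\ same_strip H (hgt (set_val s2)) z].
Proof.
move=> h0 /near_val[A nA hA]; have [e e0 he] := isolated H (H i j).
have nB : \forall s \near (set_val s0 : C), `|hgt s - H i j| < e.
  have cf : continuous (fun s : C => e - `|hgt s - H i j|).
    by apply: ctsB; [exact: cts_cst|apply: cts_norm; apply: ctsB; [exact: hgt_cts|exact: cts_cst]].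
  have := cts_pos (x := set_val s0 : C) cf; rewrite h0 subrr normr0 subr0 => /(_ e0).
  by apply: filterS => s; rewrite subr_gt0.
have ne i' j' : (i', j') != (i, j) -> H i' j' != H i j.
  by move=> h; apply: contra h => /eqP /Hinj[-> ->].
have offz z : `|hgt z - H i j| < e -> hgt z != H i j -> offh H (hgt z).
  move=> hz hz0 i' j'; have [[-> ->]|/ne h] := eqVneq (i', j') (i, j); first by rewrite eq_sym.
  by have [] := he _ hz _ _ h.
have [z1 [Az1 Bz1]] := above_near th (nearI nA nB); rewrite h0 => l1.
have [z2 [Az2 Bz2]] := below_near th (nearI nA nB); rewrite h0 => l2.
have o1 : offh H (hgt z1) by apply: offz => //; rewrite gt_eqF.
have o2 : offh H (hgt z2) by apply: offz => //; rewrite lt_eqF.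
exists (@exist _ (fun s => s \in S) z1 (mem_set (offh_S o1))), (@exist _ (fun s => s \in S) z2 (mem_set (offh_S o2))).
split=> //; first by split; exact: hA.
move=> z z' [/andP[zh hz'] ob].
have key i' j' : (i', j') != (i, j) -> (H i' j' < z) = (H i' j' < H i j).
  by move=> h; apply/idP/idP => k; [lra|rewrite ob//; lra].
split=> i' j' /=; have [[-> ->]|h] := eqVneq (i', j') (i, j).
- by rewrite l1 hz'.
- by rewrite (he _ Bz1 _ _ (ne _ _ h)).1 -ob// key.
- by rewrite !ltNge !ltW.
- by rewrite (he _ Bz2 _ _ (ne _ _ h)).1 key.
Qed.

(* Vertical lines through none of the [x i + y j] stay in [S]. *)
Lemma bottom_path (P : S -> Prop) (sb : S) : (forall i j, hgt (set_val sb) < H i j) ->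
  (forall s : S, \forall s' \near s, P s' <-> P s) -> P sb -> forall s, P s.
Proof.
move=> hb hP Pb s; have ob : offh H (hgt (set_val sb)) by move=> i j; rewrite gt_eqF.
have /near_val[A nA hA] := hP s.
have [e1 e10 h1] := isolated (fun i j => rho (x i + y j)) (rho (set_val s)).
move: nA => /(nbhs_box th)[e2 e20 h2].
pose r := rho (set_val s) + Num.min e1 e2 / 2.
have m0 : 0 < Num.min e1 e2 by rewrite lt_min e10.
have m1 : Num.min e1 e2 <= e1 by rewrite ge_min lexx.
have m2 : Num.min e1 e2 <= e2 by rewrite ge_min lexx orbT.
have rr : `|r - rho (set_val s)| = Num.min e1 e2 / 2 by rewrite /r addrC addKr gtr0_norm ?divr_gt0.
have hr i j : rho (x i + y j) != r.
  have [e|ne] := eqVneq (rho (x i + y j)) (rho (set_val s)).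
    by rewrite e lt_eqF// /r ltrDl divr_gt0.
  by have [|_] := h1 r _ i j ne; first by rewrite rr; lra.
have rS h : S (pt th r h).
  by apply/conv_baseP => i j e; have := hr i j; rewrite -e rho_pt eqxx.
pose mk h : S := @exist _ (fun s => s \in S) (pt th r h) (mem_set (rS h)).
have P1 : P (mk (hgt (set_val sb))).
  have fl : forall s : S, offh H (hgt (set_val s)) -> \forall s' \near s, P s' <-> P s by move=> ? _; exact: hP.
  by apply: (same_strip_const fl ob _ _ Pb); rewrite /= hgt_pt// => i j.
have P2 : P (mk (hgt (set_val s))).
  apply: (segment_in_S (a := r) (b := 0) (c := hgt (set_val sb)) (d := hgt (set_val s) - hgt (set_val sb))
     (D := fun=> True) _ _ _ _ P1) => //.
  - by move=> t _; exists (mk (hgt (set_val sb) + t * (hgt (set_val s) - hgt (set_val sb)))); rewrite //= mulr0 addr0.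
  - by rewrite /= addr0 addrC subrK.
apply/(hA (mk (hgt (set_val s)))) => //; apply: h2; split; rewrite /= ?rho_pt ?hgt_pt.
  by rewrite rr; lra.
by rewrite subrr normr0.
Qed.

End Lines.

(** In local frames [f] is given by a constant matrix, so its surjectivity on stalks is locally
    constant. *)
Lemma epi_near (K : fieldType) (X : topologicalType) (F G : sheaf K X) (f : sheaf_hom F G) x :
  local_system F -> local_system G ->
  \forall y \near x, (forall e, exists e', f y e' = e) <-> (forall e, exists e', f x e' = e).
Proof.
move=> lsF lsG; have [m [g fg]] := local_system_frame x lsF; have [d [k fk]] := local_system_frame x lsG.
have [_ gs] := framed_at fg.
have hv (l : 'I_m) : exists v, \forall y \near x, f y (g y (delta_mx 0 l)) = k y v.
  exact: ((framed_sect _ fk).1 (hom_sect f (gs (delta_mx 0 l)))).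
have [v {}hv] := choice hv; pose M := \matrix_l v l.
have hM : \forall y \near x, forall c, f y (g y c) = k y (c *m M).
  have : \forall y \near x, forall l, f y (g y (delta_mx 0 l)) = k y (v l) by apply: near_forall.
  apply: filterS => y h c; rewrite {1}[c]row_sum_delta mulmx_sum_row !linear_sum; apply: eq_bigr => l _.
  by rewrite !linearZ rowK h.
have hE : \forall y \near x, (forall e, exists e', f y e' = e) <-> (forall u : 'rV[K]_d, exists c : 'rV[K]_m, u = c *m M).
  have fg' : \forall y \near x, bijective (g y) by apply: filterS fg => y [].
  have fk' : \forall y \near x, bijective (k y) by apply: filterS fk => y [].
  apply: filterS3 hM fg' fk' => y h [gi gK Kg] [ki kK Kk]; split=> hh.
    move=> u; have [e' he'] := hh (k y u); exists (gi e'); apply: (can_inj kK).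
    by rewrite -h Kg he'.
  by move=> e; have [c hc] := hh (ki e); exists (g y c); rewrite h -hc Kk.
have h0 := nbhs_singleton hE.
by apply: filterS hE => y ->; rewrite h0.
Qed.

(** * Irreducibility *)

Section Final.
Variables (R : realType) (K : fieldType) (th : R) (p q n : nat).
Local Notation C := (Cplx R).
Variables (x : 'I_p -> C) (y : 'I_q -> C).
Local Notation I := ('I_p + 'I_q)%type.
Local Notation S := (conv_base x y).
Local Notation vec := (option I -> 'rV[K]_n).
Variables (V1 : sheaf K (punctured x)) (V2 : sheaf K (punctured y)).
Variables (phi1 : frame V1 n) (phi2 : frame V2 1) (Y : 'I_p -> 'M[K]_n) (mu : 'I_q -> K).
Hypothesis sf1 : slit_frame th phi1 Y.
Hypothesis sf2 : slit_frame (th + pi) phi2 (fun j => (mu j)%:M).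
Hypotheses (hx : injective x) (hy : injective y).
Hypothesis xh : forall i i', hgt th (x i) = hgt th (x i') -> i = i'.
Hypothesis yh : forall j j', hgt th (y j) = hgt th (y j') -> j = j'.
Local Notation H := (crossing th x y).
Hypothesis Hinj : forall i j i' j', H i j = H i' j' -> i = i' /\ j = j'.
Hypothesis mu0 : forall j, mu j != 0.
Hypothesis mu1 : forall j, mu j != 1.
Hypothesis irr : irreducible_mx Y.
Hypothesis nontriv : exists i, Y i != 1%:M.
Hypothesis q_gt0 : (0 < q)%N.
Hypothesis rank2 : ~ (n = 1%N /\ exists i0, forall k, k != i0 -> Y k = 1%:M).
Local Notation hgt := (hgt th).
Local Notation rho := (rho th).
Local Notation B := (braid_mx Y mu).
Local Notation J := (conv_jump_system hx hy sf1 sf2).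
Local Notation pos := (pos (cpa x y) (@cea p q)).
Local Notation off := (off th (cpa x y) (@cea p q)).
Local Notation parabolic := (parabolic th (cpa x y) (@cea p q) B).
Local Notation descending := (descending th (cpa x y) (@cea p q)).
Local Notation W := (W V1 V2).
Local Notation Rep := (Rep sf1 sf2).
Local Notation triv := (trivial_vec Y mu).

Definition getr (a : I) : option 'I_q := if a is inr j then Some j else None.

Lemma split_lr (l : seq I) (r : rel I) : pairwise r l -> (forall i j, ~~ r (inr j) (inl i)) ->
  l = [seq inl i | i <- pmap (@getl p q) l] ++ [seq inr j | j <- pmap getr l].
Proof.
move=> h hr; elim: l h => //= -[i|j] l IH /andP[h1 h2] /=; first by rewrite -IH.
have e : pmap (@getl p q) l = [::].
  by elim: l h1 {IH h2} => //= -[i'|j'] l IH /andP[h1 h2] //=; [rewrite (negPf (hr i' j)) in h1|exact: IH].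
by rewrite e /=; congr cons; rewrite {1}(IH h2) e.
Qed.

Lemma bottom_point : exists s : S, forall i j, hgt (set_val s) < H i j.
Proof.
pose h : R := - (1 + \sum_(ij : 'I_p * 'I_q) `|H ij.1 ij.2|).
have hb i j : h < H i j.
  have : `|H i j| <= \sum_(ij : 'I_p * 'I_q) `|H ij.1 ij.2|.
    by rewrite (bigD1 (i, j))//= lerDl; apply: sumr_ge0.
  by have := ler_norm (- H i j); rewrite normrN /h; lra.
have oh : offh H (hgt (pt th 0 h)) by move=> i j; rewrite hgt_pt gt_eqF.
by exists (@exist _ (fun s => s \in S) _ (mem_set (offh_S oh))) => i j; rewrite /= hgt_pt.
Qed.

Section Bottom.
Variable sb : S.
Hypothesis hb : forall i j, hgt (set_val sb) < H i j.
Let lx := pmap (@getl p q) (descending (set_val sb)).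
Let lz := pmap getr (descending (set_val sb)).

Lemma bottom_offh : offh H (hgt (set_val sb)).
Proof. by move=> i j; rewrite gt_eqF. Qed.

Lemma bottom_off : off (set_val sb).
Proof. by apply/(off_offh xh yh); exact: bottom_offh. Qed.

Lemma lx_perm : perm_eq lx (enum 'I_p).
Proof.
apply: uniq_perm; [apply: (pmap_uniq (g := inl)); [by case|by rewrite sort_uniq enum_uniq]|exact: enum_uniq|].
move=> i; rewrite mem_enum mem_pmap; apply/mapP; exists (inl i) => //; exact: mem_descending.
Qed.

Lemma lz_perm : perm_eq lz (enum 'I_q).
Proof.
apply: uniq_perm; [apply: (pmap_uniq (g := inr)); [by case|by rewrite sort_uniq enum_uniq]|exact: enum_uniq|].
move=> i; rewrite mem_enum mem_pmap; apply/mapP; exists (inr i) => //; exact: mem_descending.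
Qed.

Lemma holonomy_parabolic v : holonomy Y mu lx lz v (v None) = v None <-> parabolic v (set_val sb).
Proof.
have fm (A : Type) (h : A -> I) z l : foldl (fun z a => afix B v a z) z (map h l) = foldl (fun z a => afix B v (h a) z) z l.
  by elim: l z => //= a l IH z; rewrite IH.
rewrite /Parabolic.parabolic; have so := descending_sorted bottom_off.
rewrite sorted_pairwise in so; last by move=> a b c h1 h2; exact: lt_trans h2 h1.
rewrite (split_lr so) ?foldl_cat ?fm// => i j.
rewrite -leNgt pos_l pos_r; have := hb i j; rewrite /crossing hgtD; lra.
Qed.

(** If every parabolic vector of the lowest strip were trivial, [holonomy_trivial] would give the
    rank one situation excluded by [rank2]. A nontrivial one is realized by a datum, whose class is
    nonzero. *)
Lemma W_nonzero : exists e : W sb, e <> 0.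
Proof.
have [v [hv nv]] : exists v, holonomy Y mu lx lz v (v None) = v None /\ ~ triv v.
  apply: contrapT => hn; apply: rank2.
  have [_ Yu _] := sf1; apply: (holonomy_trivial Yu mu0 mu1 irr nontriv q_gt0 lx_perm lz_perm) => v hv.
  by apply: contrapT => nv; apply: hn; exists v.
have pv := (holonomy_parabolic v).1 hv.
have [t dt ct] := model_ex sf1 sf2 hx hy (set_valP sb) bottom_off pv.
have [sg _ /nbhs_singleton ht] := Rep_W_sect sf1 sf2 dt.
exists (sg sb) => e0; apply: nv.
exact: ((Rep_coord_triv hx hy bottom_off ht ct).1 e0).
Qed.

Variables (N : sheaf K S) (f : sheaf_hom N W).
Hypotheses (lsN : local_system N) (lsW : local_system W) (mono : sheaf_mono f).
Local Notation In := (In sf1 sf2 f).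

Let Ny (z : R) (v : vec) : Prop := exists s : S, hgt (set_val s) = z /\ In s v.

Let In_same (s s' : S) v : offh H (hgt (set_val s)) -> offh H (hgt (set_val s')) ->
  same_strip H (hgt (set_val s)) (hgt (set_val s')) -> In s v -> In s' v.
Proof.
move=> os os' ss; apply: (same_strip_const (th := th) (P := fun s => In s v)) => // s1 o1.
have /(off_offh xh yh) o1' := o1.
by apply: filterS (In_loc sf1 sf2 hx hy f lsN o1') => s2; exact.
Qed.

Let Ny_In z v (s : S) : offh H z -> offh H (hgt (set_val s)) -> same_strip H z (hgt (set_val s)) -> Ny z v -> In s v.
Proof. by move=> oz os ss [s' [e iv]]; apply: In_same iv; rewrite ?e. Qed.

Let pt_S z : offh H z -> exists s : S, hgt (set_val s) = z.
Proof.
move=> oz; have oz' : offh H (hgt (pt th 0 z)) by rewrite hgt_pt.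
by exists (@exist _ (fun s => s \in S) _ (mem_set (offh_S oz'))); rewrite /= hgt_pt.
Qed.

(** The heights of the sums are distinct, so on this line only [x i] and [s - y j] come to the same
    height. The sign of [d] chooses the side of [x i + y j]. *)
Let on_line i j (d : R) : d != 0 -> exists s0 : S, [/\ hgt (set_val s0) = H i j,
  rho (set_val s0) = rho (x i + y j) + d & forall c e, c != e ->
    hgt (pos c (set_val s0)) = hgt (pos e (set_val s0)) -> c = inl i /\ e = inr j \/ c = inr j /\ e = inl i].
Proof.
move=> d0; pose z := pt th (rho (x i + y j) + d) (H i j).
have Sz : S z.
  apply/conv_baseP => i' j' e; have := congr1 hgt e; rewrite hgt_pt => /Hinj[e1 e2].
  have := congr1 rho e; rewrite rho_pt -e1 -e2 => /eqP.
  by rewrite -subr_eq0 addrC addKr (negPf d0).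
exists (@exist _ (fun s => s \in S) z (mem_set Sz)); rewrite /= hgt_pt rho_pt; split=> //.
move=> [i1|j1] [i2|j2] ne.
- by rewrite !pos_l => /xh e; rewrite e eqxx in ne.
- rewrite pos_l pos_r hgt_pt => e; left.
  by have [-> ->] : i = i1 /\ j = j2 by apply: Hinj; rewrite [RHS]/crossing hgtD e subrK.
- rewrite pos_l pos_r hgt_pt => e; right.
  by have [-> ->] : i = i2 /\ j = j1 by apply: Hinj; rewrite [RHS]/crossing hgtD -e subrK.
- by rewrite !pos_r => /addrI/oppr_inj/yh e; rewrite e eqxx in ne.
Qed.

(** On the right of [x i + y j], the puncture [s - y j] is to the right of [x i] and crosses its
    slit, from above to below when [s] goes down. *)
Let N_right z i j z' : offh H z -> offh H z' -> only_between H z i j z' ->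
  (forall v, Ny z' v -> Ny z (slide v (inl i) (inr j) (Y i))) /\
  (forall v, Ny z v -> Ny z' (slide v (inl i) (inr j) (invmx (Y i)))).
Proof.
move=> oz oz' ob; have [s0 [h0 r0 only]] := on_line i j (oner_neq0 R).
have [_ Yu _] := sf1.
have [] := @In_cross _ _ _ _ _ _ _ _ _ _ _ _ _ _ sf1 sf2 hx hy _ f lsN s0 (inl i) (inr j) isT (Yu i).
- by rewrite /comm_mx /= mul_mx_scalar mul_scalar_mx.
- by rewrite pos_l pos_r h0 /crossing hgtD addrK.
- by rewrite /Slits.pos /= addr0 rhoD rhoN r0 rhoD; lra.
- exact: only.
move=> U nU hU; have [s1 [s2 [[U1 U2] [q1 q2] [l1 l2] hs]]] := line_sides Hinj h0 nU.
have [ss1 ss2] := hs _ _ ob.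
have [||||c1 c2] := hU s1 s2 U1 U2; try exact/(off_offh xh yh).
- by rewrite pos_l pos_r; move: l1; rewrite /crossing hgtD; lra.
- by rewrite pos_l pos_r; move: l2; rewrite /crossing hgtD; lra.
have sym a b : same_strip H a b -> same_strip H b a by move=> h i' j'; rewrite h.
have [t et] := pt_S oz; have [t' et'] := pt_S oz'.
split=> v nv.
  exists t; split=> //; apply: (In_same (s := s2)); rewrite ?et//.
  by apply: c1; apply: Ny_In nv => //; exact: sym.
exists t'; split=> //; apply: (In_same (s := s1)); rewrite ?et'//.
by apply: c2; apply: Ny_In nv => //; exact: sym.
Qed.

(** On the left, [x i] is to the right of [s - y j] and crosses its slit, from above to below when
    [s] goes up. *)
Let N_left z i j z' : offh H z -> offh H z' -> only_between H z i j z' ->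
  (forall v, Ny z v -> Ny z' (slide v (inr j) (inl i) (mu j)%:M)) /\
  (forall v, Ny z' v -> Ny z (slide v (inr j) (inl i) (mu j)^-1%:M)).
Proof.
move=> oz oz' ob; have d0 : -1 != 0 :> R by rewrite oppr_eq0 oner_neq0.
have [s0 [h0 r0 only]] := on_line i j d0.
have mu_unit : B (inr j) \in unitmx by rewrite unitmxE det_scalar unitfE expf_neq0.
have [] := @In_cross _ _ _ _ _ _ _ _ _ _ _ _ _ _ sf1 sf2 hx hy _ f lsN s0 (inr j) (inl i) isT mu_unit.
- by rewrite /comm_mx /= mul_mx_scalar mul_scalar_mx.
- by rewrite pos_l pos_r h0 /crossing hgtD addrK.
- by rewrite /Slits.pos /= addr0 rhoD rhoN r0 rhoD; lra.
- by move=> c e ne h; have [[-> ->]|[-> ->]] := only c e ne h; [right|left].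
move=> U nU hU; have [s1 [s2 [[U1 U2] [q1 q2] [l1 l2] hs]]] := line_sides Hinj h0 nU.
have [ss1 ss2] := hs _ _ ob.
have [||||c1 c2] := hU s2 s1 U2 U1; try exact/(off_offh xh yh).
- by rewrite pos_l pos_r; move: l2; rewrite /crossing hgtD; lra.
- by rewrite pos_l pos_r; move: l1; rewrite /crossing hgtD; lra.
have sym a b : same_strip H a b -> same_strip H b a by move=> h i' j'; rewrite h.
have [t et] := pt_S oz; have [t' et'] := pt_S oz'.
split=> v nv.
  exists t'; split=> //; apply: (In_same (s := s1)); rewrite ?et'//.
  by apply: c1; apply: Ny_In nv => //; exact: sym.
exists t; split=> //; apply: (In_same (s := s2)); rewrite ?et//.
by rewrite -invmx_scalar; apply: c2; apply: Ny_In nv => //; exact: sym.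
Qed.

Let near_off (s : S) (P : S -> Prop) : (\forall s' \near s, P s') -> exists2 s', P s' & off (set_val s').
Proof.
move=> /near_val[A nA hA]; have [e e0 he] := isolated H (hgt (set_val s)).
have nB : \forall z \near (set_val s : C), `|hgt z - hgt (set_val s)| < e.
  have := box_nbhs th (set_val s : C) e0; apply: filterS => z []; by [].
have [z [Az Bz] lz'] := above_near th (nearI nA nB).
have oz : offh H (hgt z).
  move=> i j; have [h|h] := eqVneq (H i j) (hgt (set_val s)); first by rewrite h lt_eqF.
  by have [] := he _ Bz _ _ h.
exists (@exist _ (fun s => s \in S) z (mem_set (offh_S oz))); first exact: hA.
exact/(off_offh xh yh).
Qed.

(** If all coordinate vectors of the image are trivial, [N] vanishes wherever the heights are
    distinct, hence everywhere, since its rank is locally constant. Otherwise [braid_irreducible]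
    puts every parabolic vector of the lowest strip into the image, and surjectivity spreads from
    there to all of [S]. *)
Theorem W_simple : (forall s (e : N s), e = 0) \/ sheaf_iso f.
Proof.
have [hT|] := pselect (forall (s : S) v, off (set_val s) -> In s v -> triv v).
  have z0 (s : S) : off (set_val s) -> forall e : N s, e = 0.
    move=> os e; apply: mono; rewrite linear0.
    have [t ht] := Rep_ex sf1 sf2 (f s e); have [v cv _] := Rep_coord hx hy os ht.
    by apply/(Rep_coord_triv hx hy os ht cv)/(hT s) => //; exists t, (f s e); split=> //; exists e.
  left=> s e; have [m [g fg]] := local_system_frame s lsN.
  have [[h hK Kh] _] := framed_at fg.
  have [s' [[h' hK' Kh'] _] os'] := near_off fg.
  rewrite -(Kh e); have -> : h e = 0 by rewrite -(hK' (h e)) (z0 _ os' (g s' (h e))) -(z0 _ os' (g s' 0)) hK'.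
  by rewrite linear0.
move=> /existsNP[s /existsNP[v /not_implyP[os /not_implyP[iv nv]]]]; right.
split=> //; have ob := bottom_offh.
have oh : offh H (hgt (set_val s)) by apply/(off_offh xh yh).
have all u : holonomy Y mu lx lz u (u None) = u None -> In sb u.
  move=> hu; apply: (Ny_In ob ob) => //.
  have Nyv : Ny (hgt (set_val s)) v by exists s.
  apply: (braid_irreducible mu0 mu1 irr Hinj (N := Ny) _ _ _ N_right N_left nontriv q_gt0 lx_perm lz_perm oh ob Nyv nv _ hu).
  - move=> z oz k w w' nw nw'; have [t et] := pt_S oz; exists t; split=> //.
    by apply: (In_lin hx hy); [apply: (Ny_In oz _ _ nw)|apply: (Ny_In oz _ _ nw')]; rewrite et.
  - move=> z oz w; have [t et] := pt_S oz; exists t; split=> //.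
    have ot : off (set_val t) by apply/(off_offh xh yh); rewrite et.
    apply: (In_triv sf1 sf2 hx hy f ot); first by exists w => a; rewrite subrr mul0mx.
    by rewrite /Parabolic.parabolic; elim: (descending _) => //= a l IH; rewrite /afix subrr mul0mx addr0.
  - move=> z z' oz oz' ss w nw; have [t et] := pt_S oz'; exists t; split=> //.
    by apply: (Ny_In oz _ _ nw); rewrite et.

  - move=> w nw; apply/holonomy_parabolic.
    have iw : In sb w := Ny_In ob ob (fun i j => erefl) nw.
    exact: (In_parabolic hx hy bottom_off iw).
have epi_b : forall e, exists e', f sb e' = e.
  move=> e; have [t ht] := Rep_ex sf1 sf2 e; have [u cu pu] := Rep_coord hx hy bottom_off ht.
  have [t' [e1 [ct rt [e0 he0]]]] := all u ((holonomy_parabolic u).2 pu).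
  exists e0; rewrite he0; apply/esym/subr0_eq.
  have h1 := Rep_lin (-1) rt ht; have h2 := coord_lin J (-1) ct cu.
  have -> : e - e1 = -1 *: e1 + e by rewrite scaleN1r addrC.
  apply/(Rep_coord_triv hx hy bottom_off h1 h2).
  by exists 0 => a; rewrite scaleN1r addNr subrr mul0mx.
have fl (s1 : S) : \forall s' \near s1, (forall e, exists e', f s' e' = e) <-> (forall e, exists e', f s1 e' = e).
  exact: epi_near.
move=> s1 e; exact: (bottom_path (P := fun s => forall e, exists e', f s e' = e) hb fl epi_b s1 e).
Qed.

End Bottom.
End Final.

From mathcomp Require Import finmap.

(** * Genericity and conclusion *)

(** The set of sums is enumerated by a list of length [p * q]; having as many elements, it leaves no
    room for a repetition. *)
Lemma generic_inj (R : realType) (p q : nat) (x : 'I_p -> Cplx R) (y : 'I_q -> Cplx R) : generic_conv x y ->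
  injective (fun ij : 'I_p * 'I_q => x ij.1 + y ij.2).
Proof.
set g := fun ij => _; move=> gen; pose l := [seq g t | t <- enum {: 'I_p * 'I_q}].
have el : conv_points x y = [set` [fset z in l]%fset].
  apply/seteqP; split=> z /=.
    move=> [_ [i _ <-] [_ [j _ <-]]] <-; rewrite inE; apply/mapP; exists (i, j) => //; exact: mem_enum.
  rewrite inE => /mapP[[i j] _ ->]; exists (x i); [by exists i|exists (y j); [by exists j|by []]].
move: gen; rewrite /generic_conv el => /card_eq_fsetP; rewrite card_fseq => sz.
apply/injectiveP; rewrite /injectiveb /dinjectiveb; apply: contraT; rewrite -ltn_size_undup.
by rewrite sz size_map -cardE card_prod !card_ord ltnn.
Qed.

Section Assembly.
Variables (R : realType) (K : fieldType) (p q : nat).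
Hypothesis hq : (0 < q)%N.
Variables (x : 'I_p -> Cplx R) (y : 'I_q -> Cplx R).
Hypotheses (hx : injective x) (hy : injective y) (hgen : generic_conv x y).
Variables (x0 : punctured x) (alpha : 'I_p.+1 -> R -> punctured x).
Hypothesis halpha : standard_generators x0 alpha.
Variables (y0 : punctured y) (beta : 'I_q.+1 -> R -> punctured y).
Hypothesis hbeta : standard_generators y0 beta.
Variables (V1 : sheaf K (punctured x)) (m : nat) (A : 'I_p.+1 -> 'M[K]_m).
Hypotheses (hA : monodromy_tuple V1 x0 alpha A) (hV1 : in_T V1 A).
Variables (V2 : sheaf K (punctured y)) (lambda : 'I_q.+1 -> K).
Hypotheses (hV2 : local_system V2)
  (hlambda : monodromy_tuple V2 y0 beta (fun i => (lambda i)%:M : 'M[K]_1))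
  (hlambda1 : forall i : 'I_q, lambda (fin_idx i) <> 1).

Lemma generic_heights (I : finType) (d : I -> Cplx R) : injective d ->
  exists th, forall a b, hgt th (d a) = hgt th (d b) -> a = b.
Proof.
move=> dinj; have [th h] := @generic_dir R (I * I)%type (fun ab => d ab.1 - d ab.2).
exists th => a b e; apply/eqP; apply: contraT => /eqP ne; exfalso.
by apply: (h (a, b)) => /= [/subr0_eq /dinj //|]; rewrite hgtB e subrr.
Qed.

(** The condition is local, so a direction is chosen anew for each [s0], such that no two punctures
    over [s0] have the same height. No single direction would do for all [s0] at once. *)
Lemma conv_local_system : local_system (W V1 V2).
Proof.
apply: framed_local_system => s0.
have pinj : injective (fun a => pos (cpa x y) (@cea p q) a (set_val s0)).
  have /conv_baseP Ss := set_valP s0 => -[i|j] [i'|j']; rewrite /pos /= ?addr0.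
  - by move=> /hx ->.
  - by move=> e; exfalso; apply: (Ss i j'); rewrite e addrAC addNr add0r.
  - by move=> e; exfalso; apply: (Ss i' j); rewrite -e addrAC addNr add0r.
  - by move=> /addIr/oppr_inj/hy ->.
have [th os] := generic_heights pinj.
have xh i i' : hgt th (x i) = hgt th (x i') -> i = i'.
  by move=> e; have := os (inl i) (inl i'); rewrite !pos_l => /(_ e)[].
have yh j j' : hgt th (y j) = hgt th (y j') -> j = j'.
  by move=> e; have := os (inr j) (inr j'); rewrite !pos_r e => /(_ erefl)[].
have [phi2 [mu [sf2 _ _]]] := line_monodromy yh hbeta hV2 hlambda hlambda1.
have [n [phi1 [Y [sf1 _ _ _]]]] := irreducible_monodromy xh halpha hA hV1.
exact: (W_framed sf1 sf2 hx hy os).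
Qed.

(** One direction that separates the heights of all the [x i + y j] also separates those of the
    [x i] and those of the [y j], by fixing the other index at [j0] or [i0]. *)
Lemma conv_irreducible : irreducible_local_system (W V1 V2).
Proof.
have [_ [i0 _]] := hV1.
have [th hth] := generic_heights (generic_inj hgen).
have j0 := Ordinal hq.
have xh i i' : hgt th (x i) = hgt th (x i') -> i = i'.
  by move=> e; have := hth (i, j0) (i', j0); rewrite /= !hgtD e => /(_ erefl)[].
have yh j j' : hgt th (y j) = hgt th (y j') -> j = j'.
  by move=> e; have := hth (i0, j) (i0, j'); rewrite /= !hgtD e => /(_ erefl)[].
have Hinj i j i' j' : crossing th x y i j = crossing th x y i' j' -> i = i' /\ j = j'.
  by move=> e; have [] := hth (i, j) (i', j') e.
have [phi2 [mu [sf2 mu0 mu1]]] := line_monodromy yh hbeta hV2 hlambda hlambda1.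
have [n [phi1 [Y [sf1 irr nontriv rank2]]]] := irreducible_monodromy xh halpha hA hV1.
have [sb hb] := bottom_point th x y.
split; first exact: conv_local_system.
  by exists sb; exact: (W_nonzero sf1 sf2 hx hy xh yh mu0 mu1 irr nontriv hq rank2 hb).
move=> N lsN f mono.
exact: (W_simple sf1 sf2 hx hy xh yh Hinj mu0 mu1 irr nontriv hq hb lsN conv_local_system mono).
Qed.

End Assembly.

Unset Implicit Arguments.
Set Strict Implicit.

Theorem theorem1p7p1 (R : realType) (K : fieldType) (p q : nat)
  (hq : (0 < q)%N)
  (x : 'I_p -> Cplx R) (y : 'I_q -> Cplx R)
  (hx : injective x) (hy : injective y) (hgen : generic_conv x y)
  (x0 : punctured x) (alpha : 'I_p.+1 -> R -> punctured x)
  (halpha : standard_generators x0 alpha)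
  (y0 : punctured y) (beta : 'I_q.+1 -> R -> punctured y)
  (hbeta : standard_generators y0 beta)
  (V1 : sheaf K (punctured x)) (n : nat) (A : 'I_p.+1 -> 'M[K]_n)
  (hA : monodromy_tuple V1 x0 alpha A) (hV1 : in_T V1 A)
  (V2 : sheaf K (punctured y)) (hV2 : local_system V2)
  (lambda : 'I_q.+1 -> K)
  (hlambda : monodromy_tuple V2 y0 beta (fun i => (lambda i)%:M : 'M[K]_1))
  (hlambda1 : forall i : 'I_q, lambda (fin_idx i) <> 1) :
  0 < (p%:Z - 2) * n%:Z
      - \sum_(i < p) (\rank (kermx (A (fin_idx i) - 1%:M)))%:Z ->
  irreducible_local_system (middle_convolution V1 V2).
Proof. by move=> _; exact: (conv_irreducible hq hx hy hgen halpha hbeta hA hV1 hV2 hlambda hlambda1). Qed.
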